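(* Let $q>p\geq 1$ be integers and let $G/K$ be one of the symmetric spaces $\mathbf{SO}_0(p,q)/\mathbf{SO}(p)\times\mathbf{SO}(q)$, $\mathbf{SU}(p,q)/\mathbf{S}(\mathbf{U}(p)\times\mathbf{U}(q))$ or $\mathbf{Sp}(p,q)/\mathbf{Sp}(p)\times\mathbf{Sp}(q)$. Let $X,Y\in\mathfrak{a}$ have configurations $[\mathbf{s};u]$ and $[\mathbf{t};v]$ respectively. Then the measure $\delta_{e^X}^\natural\star\delta_{e^Y}^\natural$ on $G$ is absolutely continuous with respect to the Haar measure of $G$ if and only if $X$ and $Y$ are eligible, i.e. if and only if $$\max(\mathbf{s},2u)+\max(\mathbf{t},2v)\leq 2p.$$
   Context: Let $I_{p,q}=\mathrm{diag}(-I_p,I_q)$. $\mathbf{SO}_0(p,q)$ is the identity component of $\mathbf{SO}(p,q)=\{g\in\mathbf{SL}(p+q,\mathbf{R}): g^TI_{p,q}g=I_{p,q}\}$; $\mathbf{SU}(p,q)=\{g\in\mathbf{SL}(p+q,\mathbf{C}): g^*I_{p,q}g=I_{p,q}\}$; $\mathbf{Sp}(p,q)$ is the group of quaternionic $(p+q)\times(p+q)$ matrices $g$ with $g^*I_{p,q}g=I_{p,q}$. The maximal compact subgroup $K$ is the subgroup of block-diagonal matrices with blocks of size $p\times p$ and $q\times q$ in $\mathbf{SO}(p)\times\mathbf{SO}(q)$, $\mathbf{S}(\mathbf{U}(p)\times\mathbf{U}(q))$, $\mathbf{Sp}(p)\times\mathbf{Sp}(q)$ respectively. In all cases, $\mathfrak{a}$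 is the real vector space of matrices $$H=\begin{pmatrix}0_{p\times p}&\mathcal{D}_H&0\\ \mathcal{D}_H&0_{p\times p}&0\\0&0&0_{(q-p)\times(q-p)}\end{pmatrix},\quad \mathcal{D}_H=\mathrm{diag}[H_1,\dots,H_p],\ H_i\in\mathbf{R}.$$ Let $m_K$ be the normalized Haar measure of $K$, viewed as a measure on $G$. For $X\in\mathfrak{a}$, $\delta_{e^X}^\natural=m_K\star\delta_{e^X}\star m_K$, where $\star$ is convolution of measures on $G$. Configuration: for $X\in\mathfrak{a}$, list the absolute values of the diagonal entries of $\mathcal{D}_X$ in decreasing order as $x_1$ repeated $s_1$ times, ..., $x_r$ repeated $s_r$ times, and $0$ repeated $u\ge0$ times, where $x_1>\dots>x_r>0$, $s_i\geq1$, and $\sum s_i+u=p$. Then $[\mathbf{s};u]=[s_1,\dots,s_r;u]$ is the configuration of $X$ (for $X=0$ it is $[0;p]$). For an integer $m$, $\max(\mathbf{s},m)=\max(\max_i s_i,m)$. *)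

(* Defs.v *)
From HB Require Import structures.
From mathcomp Require Import all_boot all_order all_algebra.
From mathcomp Require Import ring complex.
From mathcomp Require Import all_classical all_reals all_analysis.

Set Implicit Arguments.
Unset Strict Implicit.
Unset Printing Implicit Defensive.

Import Order.TTheory GRing.Theory Num.Theory.
Import numFieldNormedType.Exports.

Local Open Scope classical_set_scope.
Local Open Scope ring_scope.

(* Declared as a numClosedFieldType so that R[i] gets the topology that the
   library attaches to numeric fields. *)
Definition cplx (R : realType) : numClosedFieldType := R[i].

(* (a, b, c, d) stands for a + b i + c j + d k; the topology is that of R^4. *)
Definition quat (R : realType) : Type := (R * R * R * R)%type.

Section Quaternions.
Variable R : realType.
Implicit Types x y z : quat R.

HB.instance Definition _ := Pointed.copy (quat R) (R * R * R * R)%type.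
HB.instance Definition _ := PseudoMetric.copy (quat R) (R * R * R * R)%type.
HB.instance Definition _ := GRing.Zmodule.copy (quat R) (R * R * R * R)%type.

Definition quat1 : quat R := (1, 0, 0, 0).

Definition quat_mul x y : quat R :=
  let: (a, b, c, d) := x in let: (a', b', c', d') := y in
  (a * a' - b * b' - c * c' - d * d',
   a * b' + b * a' + c * d' - d * c',
   a * c' - b * d' + c * a' + d * b',
   a * d' + b * c' - c * b' + d * a').

Let quat_mulA : associative quat_mul.
Proof.
by move=> [[[? ?] ?] ?] [[[? ?] ?] ?] [[[? ?] ?] ?]; congr (_, _, _, _); ring.
Qed.

Let quat_mul1l : left_id quat1 quat_mul.
Proof.
by move=> [[[? ?] ?] ?]; congr (_, _, _, _); ring.
Qed.

Let quat_mul1r : right_id quat1 quat_mul.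
Proof.
by move=> [[[? ?] ?] ?]; congr (_, _, _, _); ring.
Qed.

Let quat_mulDl : left_distributive quat_mul +%R.
Proof.
by move=> [[[? ?] ?] ?] [[[? ?] ?] ?] [[[? ?] ?] ?]; congr (_, _, _, _) => /=; ring.
Qed.

Let quat_mulDr : right_distributive quat_mul +%R.
Proof.
by move=> [[[? ?] ?] ?] [[[? ?] ?] ?] [[[? ?] ?] ?]; congr (_, _, _, _) => /=; ring.
Qed.

Let quat1_neq0 : quat1 != 0.
Proof. by apply/eqP => -[/eqP]; rewrite oner_eq0. Qed.

HB.instance Definition _ := GRing.Zmodule_isNzRing.Build (quat R)
  quat_mulA quat_mul1l quat_mul1r quat_mulDl quat_mulDr quat1_neq0.

Definition quat_conj x : quat R :=
  let: (a, b, c, d) := x in (a, - b, - c, - d).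

Definition quat_of_real (a : R) : quat R := (a, 0, 0, 0).

End Quaternions.

Section Matrices.
Variables (F : nzRingType) (n : nat).
Implicit Types (A J : 'M[F]_n) (star : 'M[F]_n -> 'M[F]_n).

Definition adjoint (conj : F -> F) A := (map_mx conj A)^T.

Definition preserves star J : set 'M[F]_n := [set g | star g *m J *m g = J].

End Matrices.

Section Groups.
Local Unset Implicit Arguments.
Variable R : realType.

Definition Ipq (F : nzRingType) (p q : nat) : 'M[F]_(p + q) :=
  block_mx (- 1%:M) 0 0 1%:M.

Definition block_diag (F : nzRingType) (p q : nat) (A : set 'M[F]_p)
    (B : set 'M[F]_q) : set 'M[F]_(p + q) :=
  [set block_mx ab.1 0 0 ab.2 | ab in A `*` B].

Definition cadj n : 'M[cplx R]_n -> 'M[cplx R]_n := adjoint (@conjc R).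
Definition qadj n : 'M[quat R]_n -> 'M[quat R]_n := adjoint (@quat_conj R).

Definition SOn n : set 'M[R]_n := preserves trmx 1%:M `&` [set g | \det g = 1].
Definition Un n : set 'M[cplx R]_n := preserves (cadj n) 1%:M.
Definition Spn n : set 'M[quat R]_n := preserves (qadj n) 1%:M.

Definition SOpq p q : set 'M[R]_(p + q) :=
  preserves trmx (Ipq R p q) `&` [set g | \det g = 1].
Definition SO0pq p q : set 'M[R]_(p + q) :=
  connected_component (SOpq p q) 1%:M.
Definition SUpq p q : set 'M[cplx R]_(p + q) :=
  preserves (cadj _) (Ipq _ p q) `&` [set g | \det g = 1].
Definition Sppq p q : set 'M[quat R]_(p + q) :=
  preserves (qadj _) (Ipq _ p q).

(* A closed matrix group [grp] with a subgroup [cpt]: the groups are subsets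
   of the topological monoid [ambient] of all matrices over the relevant
   scalars, into which real matrices are sent by [of_real]. *)
Record matrix_pair (n : nat) := MatrixPair {
  ambient :> ptopologicalType;
  amul : ambient -> ambient -> ambient;
  of_real : 'M[R]_n -> ambient;
  grp : set ambient;
  cpt : set ambient }.

Variant symmetric_family := RealCase | ComplexCase | QuaternionicCase.

Definition symmetric_pair (k : symmetric_family) (p q : nat) :
    matrix_pair (p + q) :=
  match k with
  | RealCase =>
      MatrixPair (p + q) 'M[R]_(p + q) mulmx id
        (SO0pq p q) (block_diag R p q (SOn p) (SOn q))
  | ComplexCase =>
      MatrixPair (p + q) 'M[cplx R]_(p + q) mulmx
        (map_mx (fun a : R => (a%:C)%C : cplx R))
        (SUpq p q) (block_diag _ p q (Un p) (Un q) `&` [set g | \det g = 1])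
  | QuaternionicCase =>
      MatrixPair (p + q) 'M[quat R]_(p + q) mulmx
        (map_mx (@quat_of_real R))
        (Sppq p q) (block_diag _ p q (Spn p) (Spn q))
  end.

End Groups.

Arguments amul {R n m}.
Arguments of_real {R n m}.
Arguments grp {R n}.
Arguments cpt {R n}.

(* A Borel measure on a closed subgroup is represented by a Borel measure on
   the ambient space of matrices that vanishes off the subgroup; products,
   convolution and absolute continuity are the same on both sides. *)
Notation borel T := (g_sigma_algebraType (@open T)).

Section Measures.
Variables (R : realType) (n : nat) (M : matrix_pair R n).
Local Open Scope ereal_scope.

(* The groups considered are second countable, so that a Borel measure that is
   finite on compact sets is Radon; [mu (amul g @^-1` A)] is the measure of
   g^-1 A. *)
Definition is_haar (H : set M) (mu : set (borel M) -> \bar R) : Prop :=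
  [/\ mu (~` H) = 0,
      forall g, H g -> forall A : set (borel M), measurable A ->
        mu (amul g @^-1` A) = mu A,
      forall C, compact C -> C `<=` H -> mu C < +oo
    & mu H != 0].

Definition convolution (mu nu : set (borel M) -> \bar R) :
    set (borel M) -> \bar R :=
  pushforward (mu \x nu)
    (fun xy : borel M * borel M => amul xy.1 xy.2 : borel M).

Definition natural (mK : set (borel M) -> \bar R) (g : borel M) :
    set (borel M) -> \bar R :=
  convolution (convolution mK \d_g) mK.

End Measures.

Section Cartan.
Variable R : realType.

Definition expmx n (A : 'M[R]_n) : 'M[R]_n :=
  limn (series (fun k => k`!%:R^-1 *: A ^+ k)).

(* The p x q matrix (D_H 0). *)
Definition rect_diag p q (H : 'rV[R]_p) : 'M[R]_(p, q) :=
  \matrix_(i, j) (H ord0 i *+ (i == j :> nat)).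

Definition cartan_mx p q (H : 'rV[R]_p) : 'M[R]_(p + q) :=
  block_mx 0 (rect_diag q H) (rect_diag q H)^T 0.

(* [s; u] is the configuration of the matrix with diagonal D_H. *)
Definition configuration p (H : 'rV[R]_p) (s : seq nat) (u : nat) : Prop :=
  exists x : seq R,
    [/\ size x = size s, sorted >%R x, all (fun a => 0 < a) x,
        all (fun m => 0 < m)%N s
      & sort >=%R [seq `|H ord0 i| | i <- enum 'I_p] =
        flatten [seq nseq c.1 c.2 | c <- zip s x] ++ nseq u 0].

End Cartan.

Definition max_config (s : seq nat) (m : nat) : nat :=
  maxn (\max_(i <- s) i) m.

(* Main.v *)
(* Identify matrices over C and over the quaternions with real matrices that
   commute with right multiplications, so that all three groups consist of real
   matrices preserving J = diag(-1, 1) (x) 1.  The measure in question is the law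
   of k1 e^X l e^Y k2, where k1, l, k2 are independent Haar elements of K.

   If (X, Y) is not eligible, then a fixed number is an eigenvalue of A A^T or of
   A^T A, where A is the upper left block of k1 e^X l e^Y k2, for all k1, l, k2:
   by dimension count, an eigenspace of cosh X has a vector that the factor e^Y
   does not affect.  This confines the law to the zero set of a polynomial, which
   is null for the Haar measure of G because the polynomial does not vanish
   identically along the left translates by a suitable one-parameter group.

   If (X, Y) is eligible, then for almost all l in K no nonzero matrix
   anticommuting with J commutes both with sinh 2X and with l sinh 2Y l^T; for
   one explicit l this is a chase along the coordinates, and it propagates to
   almost all l because the exceptional set is algebraic.  By duality for the
   trace form, the Lie algebra of G is then k + Ad(e^X) k + Ad(e^X l e^Y) k, so
   that (k1, k2, k3) |-> k1 e^X k2 l e^Y k3 is a submersion at the identity.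
   Translating by a grid of Cayley transforms near the identity preserves the
   law, and few points of the translated grid fall in a given small ball; this
   bounds the law of a set by the Haar measure of its neighbourhoods. *)

Require Import Defs.
From HB Require Import structures.
From mathcomp Require Import all_boot all_order all_algebra.
From mathcomp Require Import fingroup perm finmap complex mxtens ring lra zify.
From mathcomp Require Import all_classical all_reals all_analysis measurable_realfun.

Set Implicit Arguments.
Unset Strict Implicit.
Unset Printing Implicit Defensive.

Import Order.TTheory GRing.Theory Num.Theory.
Import numFieldNormedType.Exports.

Local Open Scope classical_set_scope.
Local Open Scope ring_scope.

(** * Transversal position of two Cartan matrices *)

(** The bound by neighbourhoods rests on a count: a submersion onto an m-dimensional group lets at
    most n^(M - m) of the n^M grid points fall in a given ball of radius of order 1/n, and the Haar
    measure of such a ball is at least of order n^(-m). The ratio is independent of n. Strict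
    derivatives, which compare two points near the identity, give this separation directly.

    Cayley transforms serve as coordinates because they are rational: up to a nonzero factor, the
    exceptional condition is polynomial in their parameters. Their blind spot is the eigenvalue -1,
    the obstacle in joining an arbitrary element of K to the explicit l. Diagonal sign changes
    remove it: they commute with J and only flip signs in a Cartan matrix, so transversality
    survives.

    In the ineligible case the fixed eigenvalue is cosh^2 x, for x = 0 or x an entry of large
    multiplicity. The eigenvector has to satisfy two conditions, each of rank at most the number of
    nonzero entries of the other matrix, whence the factor 2 in 2u; where sinh X vanishes the second
    is void, so that u + v > p suffices. *)

Lemma sqr_row_sum (R : realDomainType) n (v : 'rV[R]_n) :
  (v *m v^T) 0 0 = \sum_i v 0 i ^+ 2.
Proof. by rewrite mxE; apply: eq_bigr => i _; rewrite mxE expr2. Qed.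

Lemma sqr_row_eq0 (R : realDomainType) n (v : 'rV[R]_n) :
  (v *m v^T) 0 0 = 0 -> v = 0.
Proof.
rewrite sqr_row_sum => /eqP; rewrite psumr_eq0 => [/allP h|i _]; last exact: sqr_ge0.
by apply/rowP => i; rewrite mxE; apply/eqP; rewrite -sqrf_eq0; apply: h; rewrite mem_index_enum.
Qed.

Lemma sqr_row_gt0 (R : realDomainType) n (v : 'rV[R]_n) :
  v != 0 -> 0 < (v *m v^T) 0 0.
Proof.
move=> v0; rewrite lt_neqAle; apply/andP; split.
  by apply: contraNneq v0 => h; apply/eqP/sqr_row_eq0.
by rewrite sqr_row_sum sumr_ge0// => i _; exact: sqr_ge0.
Qed.

(** Zeroing the rows outside [S] makes the matrix singular, so some unit vector is orthogonal to all
    rows in [S]; it becomes the row of a missing index, and the complement of [S] shrinks. *)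
Lemma orthonormal_completion (R : rcfType) n (S : {pred 'I_n}) (A : 'M[R]_n) :
  {in S &, forall i j, (row i A *m (row j A)^T) 0 0 = (i == j)%:R} ->
  exists2 B : 'M[R]_n, B *m B^T = 1%:M & {in S, forall i, row i B = row i A}.
Proof.
have [m] := ubnP #|[predC S]|; elim: m S A => // m IH S A; rewrite ltnS => Sm hA.
have [i Si|hS] := pickP [predC S]; last first.
  have inS i : i \in S by have /negbFE := hS i.
  exists A => //; apply/matrixP => i j; rewrite [RHS]mxE -(hA i j)// !mxE.
  by apply: eq_bigr => k _; rewrite !mxE.
pose B : 'M[R]_n := \matrix_(r, c) (if r \in S then A r c else 0).
have : \det B^T == 0.
  rewrite det_tr (expand_det_row _ i) big1// => j _.
  by rewrite mxE (negPf Si) mul0r.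
move=> /det0P[v v0 vB].
pose z := (Num.sqrt ((v *m v^T) 0 0))^-1 *: v.
have zz : (z *m z^T) 0 0 = 1.
  rewrite /z linearZ/= -scalemxAl -scalemxAr scalerA mxE -invfM -expr2.
  by rewrite sqr_sqrtr ?ltW ?mulVf ?gt_eqF ?sqr_row_gt0.
have zA r : r \in S -> (z *m (row r A)^T) 0 0 = 0.
  move=> rS; have : (z *m B^T) 0 r = 0 by rewrite /z -scalemxAl vB scaler0 mxE.
  by rewrite mxE => zB; rewrite mxE -[RHS]zB; apply: eq_bigr => k _; rewrite !mxE rS.
pose A' : 'M[R]_n := \matrix_(r, c) (if r == i then z 0 c else A r c).
have rA' r : row r A' = if r == i then z else row r A.
  by apply/rowP => c; case: ifP => ri; rewrite !mxE ri.
have [||C CC hC] := IH [pred r | (r == i) || (r \in S)] A'.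
- apply: leq_trans Sm; apply: proper_card; apply/properP; split.
    by apply/fintype.subsetP => r; rewrite !inE negb_or => /andP[].
  by exists i => //; rewrite !inE eqxx.
- move=> r r'; rewrite !inE !rA'; have [->|ri] := eqVneq r i.
    have [->|r'i] := eqVneq r' i; first by rewrite zz.
    by move=> _ /= r'S; rewrite zA.
  have [->|r'i] := eqVneq r' i; last exact: hA.
  move=> /= rS _; rewrite (negPf ri) -[RHS](zA r rS) !mxE.
  by apply: eq_bigr => k _; rewrite !mxE mulrC.
exists C => // r rS; rewrite hC ?inE ?rS ?orbT// rA'.
by case: eqVneq => // ri; move: Si; rewrite -ri/= rS.
Qed.

Lemma count_range (T : Type) (x0 : T) (P : pred T) (s : seq T) k l :
  (k <= l)%N -> (l <= size s)%N ->
  (forall i, (k <= i < l)%N -> P (nth x0 s i)) -> (l - k <= count P s)%N.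
Proof.
move=> kl ls hP; rewrite -(cat_take_drop k s) count_cat.
rewrite -(cat_take_drop (l - k) (drop k s)) count_cat addnCA.
have sz : size (take (l - k) (drop k s)) = (l - k)%N.
  by rewrite size_takel// size_drop leq_sub2r.
apply: leq_trans (leq_addr _ _); rewrite -{1}sz -count_predT.
rewrite [X in (_ <= X)%N](_ : _ = count predT (take (l - k) (drop k s)))//.
apply/eqP; rewrite count_predT -all_count; apply/(all_nthP x0) => i; rewrite sz => il.
rewrite nth_take// nth_drop; apply: hP; rewrite leq_addr/=.
by rewrite -ltn_subRL.
Qed.

(** Listed by decreasing [L], the level sets are intervals and the zeros come last. Numbering the
    nonzero positions modulo 2 rho separates each nonzero level set, which has at most 2 rho
    elements; the zeros are numbered afresh from 0. The first rho positions are nonzero because rho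
    + v <= p, and they provide the representatives [r]. *)
Lemma cyclic_classes (R : realDomainType) p (L : 'I_p -> R) rho :
  (forall i, 0 <= L i) -> (0 < rho)%N ->
  (#|[pred i | L i == 0%R]| <= rho)%N -> (rho + #|[pred i | L i == 0%R]| <= p)%N ->
  (forall c, c != 0 -> (#|[pred i | L i == c]| <= 2 * rho)%N) ->
  exists (cl : 'I_p -> nat) (r : nat -> 'I_p),
    [/\ forall i j, cl i = cl j -> L i = L j -> i = j,
        forall a, (a < rho)%N -> cl (r a) = a /\ L (r a) != 0,
        forall i, (cl i < 2 * rho)%N
      & forall i, L i = 0 -> (cl i < rho)%N].
Proof.
move=> L0 rho0; set v := #|_| => vr rvp Lc.
have p0 : (0 < p)%N by apply: leq_trans rvp; rewrite addn_gt0 rho0.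
pose i0 : 'I_p := Ordinal p0.
pose le := [rel i j : 'I_p | L j <= L i].
have le_tr : transitive le by move=> a b c /= ab bc; exact: le_trans bc ab.
have le_tot : total le by move=> a b /=; exact: le_total.
pose sy := sort le (enum 'I_p).
have szy : size sy = p by rewrite size_sort size_enum_ord.
have mem_sy i : i \in sy by rewrite mem_sort mem_enum.
have uniq_sy : uniq sy by rewrite sort_uniq enum_uniq.
have idx_lt i : (index i sy < p)%N by rewrite -{2}szy index_mem.
have idxK i : nth i0 sy (index i sy) = i by exact: nth_index.
have mono k l : (k <= l)%N -> (l < p)%N -> L (nth i0 sy l) <= L (nth i0 sy k).
  move=> kl lp; have := sort_sorted le_tot (enum 'I_p); rewrite -/sy => srt.
  have := @sorted_leq_nth _ le le_tr _ i0 sy srt k l.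
  by rewrite !inE szy; apply=> //; [move=> ? /=|exact: leq_ltn_trans lp].
have cardE (P : pred 'I_p) : #|P| = count P sy.
  rewrite cardE /enum_mem size_filter (seq.permP (permEl (perm_sort _ _))).
  by rewrite enumT; apply: eq_count.
clearbody sy.
have nz i : (index i sy < p - v)%N = (L i != 0).
  have [Li0|Li0] := eqVneq (L i) 0.
    apply/negbTE; rewrite -leqNgt /v cardE.
    have := @count_range _ i0 [pred i | L i == 0] sy (index i sy) p.
    rewrite szy => /(_ (ltnW (idx_lt i)) (leqnn _)) H.
    rewrite leq_subLR addnC -leq_subLR; apply: H => k /andP[ik kp] /=.
    by have := mono _ _ ik kp; rewrite idxK Li0 eq_le L0 andbT.
  have vC : v = (p - #|[pred i | L i != 0%R]|)%N.
    rewrite /v -[X in (X - _)%N](card_ord p) -(cardC [pred i | L i != 0%R]) addKn.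
    by apply: eq_card => j; rewrite !inE negbK.
  have := @count_range _ i0 [pred i | L i != 0] sy 0 (index i sy).+1.
  rewrite szy => /(_ isT (idx_lt i)) H.
  have pvE : (p - v)%N = count [pred i | L i != 0%R] sy.
    by rewrite vC subKn ?cardE//; apply: leq_trans (count_size _ _) _; rewrite szy.
  rewrite pvE -[X in (X <= _)%N]subn0; apply: H => k /andP[_ ki] /=.
  have := mono _ _ (ki : (k <= index i sy)%N) (idx_lt i); rewrite idxK => h.
  by rewrite gt_eqF// (lt_le_trans _ h)// lt_def Li0 L0.
pose cl i := if (index i sy < p - v)%N then (index i sy %% (2 * rho))%N
             else (index i sy - (p - v))%N.
have r2 : (0 < 2 * rho)%N by rewrite muln_gt0.
(* Two distinct congruent positions are at least 2 rho apart, so a common nonzero value would fill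
   the 2 rho + 1 positions between them. *)
have blk i j : L i = L j -> L i != 0 -> (index i sy < index j sy)%N ->
    (index i sy %% (2 * rho) = index j sy %% (2 * rho))%N -> False.
  move=> Lij Li0 ij /eqP; rewrite eq_sym eqn_mod_dvd ?(ltnW ij)// => /dvdn_leq.
  rewrite subn_gt0 => /(_ ij) d.
  have := @count_range _ i0 [pred k | L k == L i] sy (index i sy) (index j sy).+1.
  rewrite szy => /(_ (ltnW (leqW ij)) (idx_lt j)); rewrite -cardE => H.
  have : ((index j sy).+1 - index i sy <= 2 * rho)%N.
    apply: leq_trans (Lc _ Li0); apply: H => k /andP[ik kj] /=.
    have kp : (k < p)%N by have := idx_lt j; lia.
    have := mono _ _ ik kp; have := mono _ _ (kj : (k <= index j sy)%N) (idx_lt j).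
    by rewrite !idxK -Lij eq_le => -> ->.
  by rewrite subSn ?(ltnW ij)//; rewrite leqNgt ltnS d.
exists cl, (nth i0 sy); split.
- move=> i j; rewrite /cl !nz => + Lij; rewrite -Lij; case: ifP => [Li0 m|/negbT Li0 m].
    case: (ltngtP (index i sy) (index j sy)) => h.
    + by case: (blk i j).
    + by case: (blk j i); rewrite -?Lij.
    + by rewrite -(idxK i) h idxK.
  have zi k : L k = 0 -> (p - v <= index k sy)%N.
    by move=> Lk; rewrite leqNgt nz Lk eqxx.
  move: Li0; rewrite negbK => /eqP Li0.
  rewrite -(idxK i) -(idxK j); congr nth.
  by rewrite -(subnK (zi i Li0)) m subnK// zi// -Lij.
- move=> a ar; have apv : (a < p - v)%N by rewrite ltn_subRL addnC (leq_trans _ rvp)// -addSn leq_add2r.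
  have ap : (a < p)%N by exact: leq_trans apv (leq_subr _ _).
  have idxa : index (nth i0 sy a) sy = a by rewrite index_uniq ?szy.
  rewrite -nz /cl idxa apv modn_small//.
  by rewrite mul2n -addnn (leq_trans ar)// leq_addr.
- move=> i; rewrite /cl; case: ifP => [_|/negbT]; first by rewrite ltn_mod.
  rewrite -leqNgt => pvi; apply: (@leq_trans v).
    by rewrite ltn_subLR// subnK// (leq_trans (leq_addl rho v) rvp).
  by rewrite (leq_trans vr)// mul2n -addnn leq_addr.
- move=> i Li0; rewrite /cl nz Li0 eqxx/=; apply: leq_trans vr.
  have : (p - v <= index i sy)%N by rewrite leqNgt nz Li0 eqxx.
  by move=> h; rewrite ltn_subLR// subnK// (leq_trans (leq_addl rho v) rvp).
Qed.

(** Rows supported on disjoint classes are orthogonal whatever the weights [wt], so only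
    normalization and completion remain. The weights are free for later use. *)
Lemma disjoint_frame (R : rcfType) n (S : {pred 'I_n}) (ra k : 'I_n -> nat)
    (wt : 'I_n -> R) :
  {in S &, injective ra} ->
  {in S, forall i, exists2 c, k c = ra i & wt c != 0} ->
  exists (B : 'M[R]_n) (c : 'I_n -> R),
    [/\ B *m B^T = 1%:M,
        {in S, forall i, c i ^+ 2 * (\sum_(j | k j == ra i) wt j ^+ 2) = 1}
      & {in S, forall i j, B i j = c i * wt j *+ (k j == ra i)}].
Proof.
move=> ra_inj hk.
pose nrm i := \sum_(j | k j == ra i) wt j ^+ 2.
have nrm_gt0 i : i \in S -> 0 < nrm i.
  move=> iS; have [c kc wc] := hk i iS.
  rewrite /nrm (bigD1 c) ?kc ?eqxx//= ltr_wpDr ?exprn_even_gt0//.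
  by apply: sumr_ge0 => j _; exact: sqr_ge0.
pose c i := (Num.sqrt (nrm i))^-1.
have c2 i : i \in S -> c i ^+ 2 * nrm i = 1.
  by move=> iS; rewrite exprVn sqr_sqrtr ?ltW ?mulVf ?gt_eqF ?nrm_gt0.
pose A : 'M[R]_n := \matrix_(i, j) (c i * wt j *+ (k j == ra i)).
have [|B BB BA] := @orthonormal_completion R n S A.
  move=> i j iS jS; rewrite mxE.
  have [<-|ij] := eqVneq i j.
    rewrite -(c2 i iS) /nrm mulr_sumr [RHS]big_mkcond/=; apply: eq_bigr => l _.
    by rewrite !mxE; case: eqP => _; rewrite ?mulr1n ?mulr0n ?mul0r// -expr2 exprMn.
  apply: big1 => l _; rewrite !mxE; case: eqP => [kl|_]; last by rewrite mulr0n mul0r.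
  case: eqP => [kl'|_]; last by rewrite mulr0n mulr0.
  by move: ij; rewrite (ra_inj i j) ?eqxx// -kl kl'.
exists B, c; split=> // i iS j.
by have /rowP/(_ j) := BA i iS; rewrite !mxE.
Qed.

Section CartanRows.
Variables (R : realType) (p q : nat) (p_lt_q : (p < q)%N).
Implicit Types H : 'rV[R]_p.

Local Notation wid := (widen_ord (ltnW p_lt_q)).
Local Notation e i := (delta_mx 0 (lshift q i) : 'rV[R]_(p + q)).
Local Notation e' j := (delta_mx 0 (rshift p j) : 'rV[R]_(p + q)).

Lemma row_cartan H i : e i *m cartan_mx q H = H 0 i *: e' (wid i).
Proof.
rewrite -rowE; apply/rowP => k; rewrite [LHS]mxE [RHS]mxE [in RHS]mxE /cartan_mx.
case: (split_ordP k) => j ->; rewrite ?block_mxEul ?block_mxEur mxE.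
  by rewrite eq_lrshift mulr0.
by rewrite eqxx/= eq_rshift -val_eqE/= [RHS]mulrC eq_sym; case: eqP; rewrite ?mul1r ?mul0r.
Qed.

Lemma col_cartan H i : e' (wid i) *m cartan_mx q H = H 0 i *: e i.
Proof.
rewrite -rowE; apply/rowP => k; rewrite [LHS]mxE [RHS]mxE [in RHS]mxE /cartan_mx.
case: (split_ordP k) => j ->; rewrite ?block_mxEdl ?block_mxEdr !mxE.
  by rewrite eqxx/= eq_lshift -!val_eqE/= val_eqE; case: eqP => [->|_]; rewrite ?mulr1 ?mulr0.
by rewrite eq_rlshift mulr0.
Qed.

Lemma col_cartan_ge H (j : 'I_q) : (p <= j)%N -> e' j *m cartan_mx q H = 0.
Proof.
move=> pj; rewrite -rowE; apply/rowP => k; rewrite [LHS]mxE [RHS]mxE /cartan_mx.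
case: (split_ordP k) => i ->; rewrite ?block_mxEdl ?block_mxEdr !mxE//.
by rewrite ltn_eqF// (leq_trans (ltn_ord i)).
Qed.

Definition label H : 'rV[R]_(p + q) :=
  \row_k (match fintype.split k with
          | inl i => H 0 i ^+ 2
          | inr j => if insub (val j) is Some i then H 0 i ^+ 2 else 0 end).

Lemma label_row H i : label H 0 (lshift q i) = H 0 i ^+ 2.
Proof. by rewrite mxE (unsplitK (inl i)). Qed.

Lemma label_col H i : label H 0 (rshift p (wid i)) = H 0 i ^+ 2.
Proof. by rewrite mxE (unsplitK (inr (wid i))) /= valK. Qed.

Lemma label_col_ge H (j : 'I_q) : (p <= j)%N -> label H 0 (rshift p j) = 0.
Proof. by move=> pj; rewrite mxE (unsplitK (inr j)) insubF// ltnNge pj. Qed.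

Lemma wid_case (j : 'I_q) : (p <= j)%N \/ exists i, j = wid i.
Proof.
have [pj|jp] := leqP p j; [by left|right].
by exists (Ordinal jp); apply: val_inj.
Qed.

Lemma cartan_sq H : cartan_mx q H *m cartan_mx q H = diag_mx (label H).
Proof.
apply/row_matrixP => k; rewrite !rowE mulmxA.
have -> : delta_mx 0 k *m diag_mx (label H) = label H 0 k *: delta_mx 0 k :> 'rV_(p + q).
  apply/rowP => l; rewrite -rowE !mxE eqxx/= eq_sym.
  by case: eqP => _; rewrite ?mulr1 ?mulr0 ?mulr1n.
case: (split_ordP k) => j ->.
  by rewrite row_cartan -scalemxAl col_cartan scalerA label_row expr2.
case: (wid_case j) => [pj|[i ->]].
  by rewrite col_cartan_ge// mul0mx label_col_ge// scale0r.
by rewrite col_cartan -scalemxAl row_cartan scalerA label_col expr2.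
Qed.

End CartanRows.

(** Entry (i, j) of such a [W] vanishes unless d_i = d_j, so [W] also commutes with every function
    of the diagonal. With indicator functions this yields the spectral projections. *)
Lemma comm_diag_ind (R : idomainType) n (W : 'M[R]_n) (d : 'rV[R]_n) (P : pred R) :
  W *m diag_mx d = diag_mx d *m W ->
  W *m diag_mx (\row_k (P (d 0 k))%:R) = diag_mx (\row_k (P (d 0 k))%:R) *m W.
Proof.
move=> /matrixP h; apply/matrixP => i j; have := h i j.
rewrite !mul_mx_diag !mul_diag_mx !mxE mulrC => /eqP.
rewrite -subr_eq0 -mulrBl mulf_eq0 subr_eq0 => /orP[/eqP ->|/eqP ->].
  by rewrite mulrC.
by rewrite mulr0 mul0r.
Qed.

Lemma J_odd_block (R : realDomainType) p q (W : 'M[R]_(p + q)) :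
  W *m Ipq R p q = - (Ipq R p q *m W) -> ulsubmx W = 0 /\ drsubmx W = 0.
Proof.
rewrite -{1 2}[W]submxK /Ipq !mulmx_block !mulmx0 !mul0mx !addr0 !add0r.
rewrite !mulmxN !mulNmx !mulmx1 !mul1mx opp_block_mx.
move=> /eq_block_mx[a _ _ d]; split; apply/matrixP => i j.
  by move/matrixP: a => /(_ i j); rewrite !mxE; lra.
by move/matrixP: d => /(_ i j); rewrite !mxE; lra.
Qed.

Section OddCommutant.
Variables (R : realType) (p q : nat) (p_lt_q : (p < q)%N).
Local Notation wid := (widen_ord (ltnW p_lt_q)).
Local Notation e i := (delta_mx 0 (lshift q i) : 'rV[R]_(p + q)).
Local Notation e' j := (delta_mx 0 (rshift p j) : 'rV[R]_(p + q)).

Variables (S : {pred 'I_p}) (rho : nat) (ra cl : 'I_p -> nat) (r : nat -> 'I_p).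
Variable t : 'rV[R]_p.
Hypotheses (rho0 : (0 < rho)%N) (ra_inj : {in S &, injective ra}).
Hypothesis ra_lt : {in S, forall i, (ra i < rho)%N}.
Hypothesis ra_surj : forall a, (a < rho)%N -> exists2 i, i \in S & ra i = a.
Hypothesis cl_inj : forall i j, cl i = cl j -> t 0 i ^+ 2 = t 0 j ^+ 2 -> i = j.
Hypothesis cl_r : forall a, (a < rho)%N -> cl (r a) = a /\ t 0 (r a) != 0.
Hypothesis cl_lt : forall i, (cl i < 2 * rho)%N.
Hypothesis cl_zero : forall i, t 0 i = 0 -> (cl i < rho)%N.

(* The rows of [B] and [C] are supported on the classes of [cl] and
   [col_class]. The latter moves the representatives [r] of the low classes up by
   one and the high classes down by [rho], so that a row killed by [W] in one class
   yields one in the next class. The chain starts at the column [p], which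
   [cartan_mx] kills and which is given weight [q] so as to carry more than half
   of the norm of its row. *)
Definition col_class (c : 'I_q) : nat :=
  if insub (val c) is Some i then
    if (rho <= cl i)%N then (cl i - rho)%N
    else if i == r (cl i) then (cl i).+1 else rho
  else if val c == p then 0%N else rho.

Definition col_weight (c : 'I_q) : R := if val c == p then q%:R else 1.

Let top : 'I_q := Ordinal p_lt_q.

Lemma col_class_top : col_class top = 0%N.
Proof. by rewrite /col_class insubF ?eqxx// /= ltnn. Qed.

Lemma col_class_wid i : col_class (wid i) =
  if (rho <= cl i)%N then (cl i - rho)%N
    else if i == r (cl i) then (cl i).+1 else rho.
Proof. by rewrite /col_class /= valK. Qed.

Lemma col_weight_wid i : col_weight (wid i) = 1.
Proof. by rewrite /col_weight /= ltn_eqF. Qed.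

Lemma col_cases (c : 'I_q) : (col_class c < rho)%N -> c = top \/ exists i, c = wid i.
Proof.
case: (wid_case p_lt_q c) => [pc|]; last by right.
rewrite /col_class insubF; last by rewrite ltnNge pc.
by case: eqP => [cp _|]; [left; apply: val_inj|rewrite ltnn].
Qed.

Variables (B : 'M[R]_p) (b : 'I_p -> R) (C : 'M[R]_q) (c : 'I_q -> R).
Hypothesis BB : B *m B^T = 1%:M.
Hypothesis CC : C *m C^T = 1%:M.
Hypothesis b2 : {in S, forall i, b i ^+ 2 * (\sum_(j | cl j == ra i) 1 ^+ 2) = 1}.
Hypothesis BE : {in S, forall i j, B i j = b i * 1 *+ (cl j == ra i)}.
Hypothesis c2 : {in S, forall i,
  c (wid i) ^+ 2 * (\sum_(j | col_class j == ra i) col_weight j ^+ 2) = 1}.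
Hypothesis CE : {in S, forall i j,
  C (wid i) j = c (wid i) * col_weight j *+ (col_class j == ra i)}.
Variables (s : 'rV[R]_p) (W : 'M[R]_(p + q)).
Hypothesis sS : forall i, (s 0 i != 0) = (i \in S).
Let l := block_mx B 0 0 C.
Hypothesis WJ : W *m Ipq R p q = - (Ipq R p q *m W).
Hypothesis Wt : W *m cartan_mx q t = cartan_mx q t *m W.
Hypothesis Ws : W *m (l^T *m cartan_mx q s *m l) = l^T *m cartan_mx q s *m l *m W.

Let K (z : 'rV[R]_(p + q)) := z *m W = 0.

Let K_comm A z : W *m A = A *m W -> K z -> K (z *m A).
Proof. by move=> WA Kz; rewrite /K -mulmxA -WA mulmxA Kz mul0mx. Qed.

Let K_scale x z : K z -> K (x *: z).
Proof. by move=> Kz; rewrite /K -scalemxAl Kz scaler0. Qed.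

Let K_scaleV x z : x != 0 -> K (x *: z) -> K z.
Proof. by move=> x0 /(K_scale x^-1); rewrite scalerA mulVf// scale1r. Qed.

Let ll : l *m l^T = 1%:M.
Proof.
rewrite /l tr_block_mx !trmx0 mulmx_block !mulmx0 !mul0mx !addr0 !add0r BB CC.
by rewrite -scalar_mx_block.
Qed.

Let ltl : l^T *m l = 1%:M. Proof. exact: mulmx1C. Qed.

(** For the conjugated Cartan matrix, [zeta] and [zeta'] play the role that [e] and [e'] play for
    [cartan_mx q t]. *)
Let zeta i := e i *m l.
Let zeta' j := e' j *m l.

Let zeta_row i : zeta i = row_mx (row i B) 0.
Proof.
apply/rowP => k; rewrite /zeta -rowE mxE /l; case: (split_ordP k) => j ->.
  by rewrite block_mxEul row_mxEl mxE.
by rewrite block_mxEur row_mxEr !mxE.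
Qed.

Let zeta'_row j : zeta' j = row_mx 0 (row j C).
Proof.
apply/rowP => k; rewrite /zeta' -rowE mxE /l; case: (split_ordP k) => i ->.
  by rewrite block_mxEdl row_mxEl !mxE.
by rewrite block_mxEdr row_mxEr mxE.
Qed.

Let zeta_zeta' i : i \in S -> K (zeta i) <-> K (zeta' (wid i)).
Proof.
rewrite -sS => si0; split=> /(K_comm Ws); rewrite /zeta /zeta' !mulmxA.
  rewrite -(mulmxA (e i)) ll mulmx1 row_cartan -scalemxAl.
  exact: K_scaleV.
rewrite -(mulmxA (e' _)) ll mulmx1 col_cartan -scalemxAl.
exact: K_scaleV.
Qed.

Let Q (P : pred R) : 'M[R]_(p + q) :=
  diag_mx (\row_k (P (label q t 0 k))%:R).

Let W_Q P : W *m Q P = Q P *m W.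
Proof.
apply: comm_diag_ind.
by rewrite -(cartan_sq p_lt_q) mulmxA Wt -mulmxA Wt mulmxA.
Qed.

(** The orthogonal projection onto the span of the [zeta i] and [zeta' (wid i)] with i in [S], as a
    spectral projection of the square of the conjugated Cartan matrix. *)
Let Pi : 'M[R]_(p + q) :=
  l^T *m diag_mx (\row_k (label q s 0 k != 0)%:R) *m l.

Let W_Pi : W *m Pi = Pi *m W.
Proof.
have h : (l *m W *m l^T) *m diag_mx (label q s) =
    diag_mx (label q s) *m (l *m W *m l^T).
  have h1 : (l *m W *m l^T) *m cartan_mx q s = cartan_mx q s *m (l *m W *m l^T).
    have := congr1 (fun A => l *m A *m l^T) Ws.
    by rewrite !mulmxA ll mul1mx -!mulmxA ll mulmx1 !mulmxA.
  by rewrite -(cartan_sq p_lt_q) mulmxA h1 -mulmxA h1 mulmxA.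
have := congr1 (fun A => l^T *m A *m l) (comm_diag_ind (fun x => x != 0) h).
by rewrite /Pi !mulmxA ltl mul1mx -!mulmxA ltl mulmx1 !mulmxA.
Qed.

Let Qrow P i : e i *m Q P = (P (t 0 i ^+ 2))%:R *: e i.
Proof.
apply/rowP => k; rewrite -rowE [LHS]mxE [RHS]mxE [in LHS]mxE [in LHS]mxE.
by rewrite [X in _ * X]mxE/= label_row [k == _]eq_sym; case: eqP; rewrite ?mulr1 ?mulr0.
Qed.

Let Qcol P j : e' j *m Q P = (P (label q t 0 (rshift p j)))%:R *: e' j.
Proof.
apply/rowP => k; rewrite -rowE [LHS]mxE [RHS]mxE [in LHS]mxE [in LHS]mxE.
by rewrite [X in _ * X]mxE/= [k == _]eq_sym; case: eqP; rewrite ?mulr1 ?mulr0.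
Qed.

Let zetaE i : i \in S -> zeta i = \sum_(j | cl j == ra i) b i *: e j.
Proof.
move=> iS; rewrite zeta_row; apply/rowP => k; rewrite summxE.
case: (split_ordP k) => j ->; rewrite ?row_mxEl ?row_mxEr.
  rewrite mxE BE// mulr1 big_mkcond (bigD1 j)//= big1 => [|j' j'j].
    by rewrite addr0; case: (_ == ra i); rewrite // !mxE !eqxx mulr1.
  by case: ifP => // _; rewrite !mxE eq_lshift [j == j']eq_sym (negPf j'j) andbF mulr0.
by rewrite mxE big1// => j' _; rewrite !mxE eq_rlshift mulr0.
Qed.

Let zeta'E i : i \in S -> zeta' (wid i) =
  \sum_(j | col_class j == ra i) (c (wid i) * col_weight j) *: e' j.
Proof.
move=> iS; rewrite zeta'_row; apply/rowP => k; rewrite summxE.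
case: (split_ordP k) => j ->; rewrite ?row_mxEl ?row_mxEr.
  by rewrite mxE big1// => j' _; rewrite !mxE eq_lrshift mulr0.
rewrite mxE CE// big_mkcond (bigD1 j)//= big1 => [|j' j'j].
  by rewrite addr0; case: (_ == ra i); rewrite // !mxE !eqxx mulr1.
by case: ifP => // _; rewrite !mxE eq_rshift [j == j']eq_sym (negPf j'j) andbF mulr0.
Qed.

Let b_neq0 i : i \in S -> b i != 0.
Proof.
by move=> /b2; apply: contra_eq_neq => ->; rewrite expr0n mul0r eq_sym oner_eq0.
Qed.

Let c_neq0 i : i \in S -> c (wid i) != 0.
Proof.
by move=> /c2; apply: contra_eq_neq => ->; rewrite expr0n mul0r eq_sym oner_eq0.
Qed.

(** A class contains at most one index of a given label, so the spectral projection cuts a single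
    coordinate out of the row. *)
Let zetaQ i m : i \in S -> cl m = ra i ->
  zeta i *m Q (pred1 (t 0 m ^+ 2)) = b i *: e m.
Proof.
move=> iS cm; rewrite zetaE// mulmx_suml (bigD1 m) ?cm//=.
rewrite -scalemxAl Qrow /= eqxx scale1r big1 ?addr0// => j /andP[/eqP cj jm].
rewrite -scalemxAl Qrow /=; case: eqP => [tj|]; last by rewrite scale0r scaler0.
by move: jm; rewrite (cl_inj _ tj) ?eqxx// cj cm.
Qed.

(** Among the rows spanning the range of [Pi], only the [zeta'] of the class of j has a nonzero
    entry at column j, since the supports are disjoint. *)
Let col_Pi i j : i \in S -> col_class j = ra i ->
  e' j *m Pi = (c (wid i) * col_weight j) *: zeta' (wid i).
Proof.
move=> iS cj; rewrite /Pi !mulmxA.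
have -> : e' j *m l^T *m diag_mx (\row_k (label q s 0 k != 0)%:R) =
    (c (wid i) * col_weight j) *: e' (wid i).
  apply/rowP => k; rewrite mul_mx_diag -rowE [LHS]mxE [RHS]mxE [in LHS]mxE [in LHS]mxE.
  rewrite [X in _ * X = _]mxE [X in _ = _ * X]mxE eqxx/= /l.
  case: (split_ordP k) => i' ->; first by rewrite block_mxEur mxE mul0r eq_lrshift mulr0.
  rewrite block_mxEdr eq_rshift; case: (wid_case p_lt_q i') => [pi'|[i'' ->]].
    rewrite label_col_ge// eqxx mulr0; case: eqP => [i'E|]; last by rewrite mulr0.
    by move: pi'; rewrite i'E/= leqNgt ltn_ord.
  rewrite label_col sqrf_eq0 sS -val_eqE/= val_eqE; have [->|ii'] := eqVneq i'' i.
    by rewrite iS CE// cj eqxx.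
  case: (boolP (i'' \in S)) => [i'S|]; last by rewrite !mulr0.
  rewrite CE// cj mulr1 mulr0; case: eqP => // rr.
  by move: ii'; rewrite (ra_inj _ _ rr) ?eqxx.
by rewrite -scalemxAl.
Qed.

Let W_block : W = block_mx 0 (ursubmx W) (dlsubmx W) 0.
Proof. by have [ul dr] := J_odd_block WJ; rewrite -{1}[W]submxK ul dr. Qed.

Let zeta'_Pi i : i \in S -> zeta' (wid i) *m Pi = zeta' (wid i).
Proof.
move=> iS; rewrite /zeta' /Pi !mulmxA -(mulmxA (e' _)) ll mulmx1; congr (_ *m _).
apply/rowP => k; rewrite mul_mx_diag [LHS]mxE [X in _ * X]mxE mxE.
rewrite eqxx/=; case: eqP => [->|]; last by rewrite mul0r.
by rewrite label_col sqrf_eq0 sS iS mulr1.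
Qed.

Let Pi_sym : Pi^T = Pi.
Proof. by rewrite /Pi !trmx_mul trmxK tr_diag_mx mulmxA. Qed.

(** On the left half, the range of [Pi] is spanned by rows of [B] that are constant on each class of
    [cl]. *)
Let Pi_left (z : 'rV[R]_(p + q)) : exists g : nat -> R, forall m,
  (z *m Pi) 0 (lshift q m) = g (cl m).
Proof.
pose w := z *m l^T *m diag_mx (\row_k (label q s 0 k != 0)%:R).
exists (fun a => \sum_(k in S) (w 0 (lshift q k) * b k) *+ (a == ra k)) => m.
rewrite /Pi !mulmxA -/w mxE big_split_ord/= [X in _ + X]big1 ?addr0 => [|j _]; last first.
  by rewrite /l block_mxEdl [X in _ * X]mxE mulr0.
rewrite [RHS]big_mkcond; apply: eq_bigr => k _; rewrite /l block_mxEul.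
case: ifPn => [kS|]; first by rewrite BE// mulr1 mulrnAr.
rewrite -sS negbK => /eqP sk.
by rewrite /w mul_mx_diag mxE [X in _ * X * _]mxE label_row sk expr0n eqxx mulr0 mul0r.
Qed.

(** Every index with t = 0 has a partner with t nonzero and the same value of [F], namely the
    representative of its class, and distinct such indices have distinct partners. *)
Let sum_zero_le (F : 'I_p -> R) (g : nat -> R) : (forall m, F m = g (cl m)) ->
  (forall m, 0 <= F m) ->
  2 * (\sum_(m | t 0 m == 0) F m) <= \sum_m F m.
Proof.
move=> Fg F0; pose h m := r (cl m).
have hP m : t 0 m = 0 -> cl (h m) = cl m /\ t 0 (h m) != 0.
  by move=> /cl_zero /cl_r.
rewrite mulr_natl mulr2n [leRHS](bigID (fun m => t 0 m == 0))/= lerD2l.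
rewrite (eq_bigr (F \o h)) => [|m /eqP tm]; last by rewrite /= !Fg (hP m tm).1.
rewrite -(@big_imset _ _ _ _ _ h [pred m | t 0 m == 0] F) => [|m m' /=]; last first.
  rewrite !inE => /eqP tm /eqP tm' hh.
  by apply: cl_inj; rewrite ?tm ?tm'// -(hP m tm).1 -(hP m' tm').1 hh.
rewrite [leLHS]big_mkcond [leRHS]big_mkcond/=; apply: ler_sum => n _.
case: imsetP => [[m]|_]; last by case: ifP.
by rewrite inE => /eqP tm ->; rewrite (hP m tm).2.
Qed.

(** The column [top] contributes c^2 q^2 to a total of 1, while the other columns of its class, of
    weight 1, contribute at most c^2 q; and q < q^2. *)
Let kappa i : i \in S -> ra i = 0%N -> 1 < 2 * (c (wid i) * q%:R) ^+ 2.
Proof.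
move=> iS ri; have := c2 iS; rewrite ri (bigD1 top) ?col_class_top//=.
have -> : col_weight top = q%:R by rewrite /col_weight eqxx.
set X := \sum_(_ | _) _ => h.
have q1 : (1 < q)%N by have := ltn_ord (r 0); lia.
have Xq : X <= q%:R.
  apply: (@le_trans _ _ (\sum_(j < q) 1)); last by rewrite sumr_const card_ord.
  rewrite /X [leLHS]big_mkcond; apply: ler_sum => j _; case: ifP => // /andP[_ jt].
  rewrite /col_weight; case: eqP => [jp|_]; last by rewrite expr1n.
  by move: jt; rewrite -val_eqE/= jp eqxx.
have cc : 0 < c (wid i) ^+ 2 by rewrite exprn_even_gt0/= ?c_neq0.
have qq : q%:R < q%:R ^+ 2 :> R.
  by rewrite expr2 -natrM ltr_nat -{1}(muln1 q) ltn_mul2l q1 (ltn_trans _ q1).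
rewrite exprMn -{1}h mulrDr mulr_natl mulr2n ltrD2l ltr_pM2l//.
exact: le_lt_trans Xq qq.
Qed.

(** Put z = [zeta' (wid i) *m W]. Projecting z to label 0 and then by [Pi] multiplies it by kap^2,
    so the part of z on label 0 carries kap^2 > 1/2 of its squared norm. But z lies in the left half
    and is constant on classes, so that this part carries at most one half. Hence z = 0. *)
Let K_start i : i \in S -> ra i = 0%N -> K (zeta' (wid i)).
Proof.
move=> iS ri; pose z := zeta' (wid i) *m W; pose kap := c (wid i) * q%:R.
have zPi : z *m Pi = z by rewrite /z -mulmxA W_Pi mulmxA zeta'_Pi.
have wtop : col_weight top = q%:R by rewrite /col_weight eqxx.
have zQ : zeta' (wid i) *m Q (pred1 0) = kap *: e' top.
  rewrite zeta'E// mulmx_suml (bigD1 top) ?col_class_top ?ri//=.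
  rewrite -scalemxAl Qcol label_col_ge//= eqxx scale1r wtop big1 ?addr0// => j.
  move=> /andP[/eqP cj jt]; rewrite -scalemxAl Qcol.
  case: (@col_cases j) => [|jE|[i' jE]]; [by rewrite cj|by rewrite jE eqxx in jt|].
  (* A column [wid i'] of label 0 has low [cl], so its [col_class] is a successor or [rho], never 0:
     within class 0, only [top] has label 0. *)
  rewrite jE label_col/= sqrf_eq0; case: eqP => [ti'|]; last by rewrite scale0r scaler0.
  have := cl_zero ti'; move: cj; rewrite jE col_class_wid; case: leqP => [?|_]; first by lia.
  by case: eqP => // _ rho_0; move: rho0; rewrite rho_0.
have topPi : e' top *m Pi = kap *: zeta' (wid i).
  by rewrite (@col_Pi i) ?col_class_top// wtop.
have zQPi : z *m Q (pred1 0) *m Pi = kap ^+ 2 *: z.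
  rewrite /z -(mulmxA _ W) W_Q mulmxA zQ -!scalemxAl -mulmxA W_Pi mulmxA topPi.
  by rewrite -scalemxAl scalerA expr2.
have zQz : (z *m Q (pred1 0) *m z^T) 0 0 = kap ^+ 2 * (z *m z^T) 0 0.
  by rewrite -{2}zPi trmx_mul Pi_sym mulmxA zQPi -scalemxAl mxE.
have zr j : z 0 (rshift p j) = 0.
  rewrite /z zeta'_row W_block mul_row_block !mul0mx mulmx0 !add0r.
  by rewrite row_mxEr mxE.
have [g zg] := Pi_left z; rewrite zPi in zg.
have zz : (z *m z^T) 0 0 = \sum_m z 0 (lshift q m) ^+ 2.
  rewrite sqr_row_sum big_split_ord/= [X in _ + X]big1 ?addr0// => j _.
  by rewrite zr expr0n.
have zQz' : (z *m Q (pred1 0) *m z^T) 0 0 = \sum_(m | t 0 m == 0) z 0 (lshift q m) ^+ 2.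
  rewrite mxE big_split_ord/= [X in _ + X]big1 ?addr0 => [|j _]; last by rewrite mxE [_^T _ _]mxE zr mulr0.
  rewrite [RHS]big_mkcond; apply: eq_bigr => m _.
  rewrite /Q mul_mx_diag mxE [_^T _ _]mxE [X in _ * X * _]mxE label_row /= sqrf_eq0.
  by case: eqP => _; rewrite ?mulr1 ?mulr0 ?mul0r// expr2.
have := @sum_zero_le (fun m => z 0 (lshift q m) ^+ 2) (fun a => g a ^+ 2).
rewrite -zz -zQz' zQz => /(_ (fun m => congr1 (fun x => x ^+ 2) (zg m)) (fun m => sqr_ge0 _)).
move=> h; apply: sqr_row_eq0; apply/eqP; rewrite eq_le; apply/andP; split.
  have := kappa iS ri; rewrite -/kap mulrA in h *; rewrite -/z => k1.
  by rewrite -(@pmulr_rle0 _ (2 * kap ^+ 2 - 1)) ?subr_gt0// mulrBl mul1r subr_le0.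
by rewrite sqr_row_sum; apply: sumr_ge0 => k _; exact: sqr_ge0.
Qed.

(** Induction on the class. From class a, the projection [zetaQ] isolates [e (r a)], the first
    Cartan matrix moves it to its column, and [Pi] turns that column, placed by [col_class] in class
    a + 1, into the row of class a + 1. *)
Let K_zeta i : i \in S -> K (zeta i).
Proof.
move=> iS; move: {2}(ra i) (erefl (ra i)) => a; elim: a i iS => [|a IH] i iS ria.
  by apply/zeta_zeta' => //; exact: K_start.
have arho : (a.+1 < rho)%N by rewrite -ria ra_lt.
have [i' i'S ri'] := ra_surj (ltnW arho).
have [cra tra] := cl_r (ltnW arho).
have Km : K (e (r a)).
  apply: (K_scaleV (b_neq0 i'S)); rewrite -(@zetaQ i') ?cra//.
  by apply: K_comm; [exact: W_Q|exact: IH].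
have Km' : K (e' (wid (r a))).
  by apply: (K_scaleV tra); rewrite -row_cartan; exact: K_comm.
apply/zeta_zeta' => //.
apply: (K_scaleV (c_neq0 iS)); rewrite -[c _]mulr1 -(col_weight_wid (r a)).
rewrite -col_Pi; [exact: K_comm|by []|].
by rewrite col_class_wid cra leqNgt (ltnW arho) eqxx ria.
Qed.

Let K_low m : (cl m < rho)%N -> K (e m).
Proof.
move=> cm; have [i iS ri] := ra_surj cm.
apply: (K_scaleV (b_neq0 iS)); rewrite -(@zetaQ i) ?ri//.
by apply: K_comm; [exact: W_Q|exact: K_zeta].
Qed.

Let K_low' m : (cl m < rho)%N -> t 0 m != 0 -> K (e' (wid m)).
Proof.
by move=> cm tm; apply: (K_scaleV tm); rewrite -row_cartan; apply: K_comm => //; exact: K_low.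
Qed.

Let K_row m : K (e m).
Proof.
have [cm|cm] := ltnP (cl m) rho; first exact: K_low.
have tm : t 0 m != 0 by apply: contraTN cm => /eqP /cl_zero; rewrite -ltnNge.
have cmr : (cl m - rho < rho)%N by have := cl_lt m; lia.
have [i iS ri] := ra_surj cmr.
suff : K (e' (wid m)) by move=> /(K_comm Wt); rewrite col_cartan => /(K_scaleV tm).
have : K (zeta' (wid i) *m Q (pred1 (t 0 m ^+ 2))).
  by apply: K_comm; [exact: W_Q|apply/zeta_zeta' => //; exact: K_zeta].
(* Cut down to the label of m, this row retains the column of m and otherwise only columns with low
   [cl], which [K_low'] has already handled: another high one would share both class and label with
   m. *)
have cwm : col_class (wid m) == ra i by rewrite col_class_wid cm ri.
rewrite zeta'E// mulmx_suml (bigD1 (wid m))//= -scalemxAl Qcol label_col/= eqxx scale1r.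
rewrite col_weight_wid mulr1 {1}/K mulmxDl [X in _ + X](_ : _ = 0) ?addr0 => [|].
  exact: (K_scaleV (c_neq0 iS)).
rewrite mulmx_suml big1// => j /andP[/eqP cj jm]; rewrite -scalemxAl; apply: K_scale.
rewrite Qcol; case: (@col_cases j) => [|jE|[i' jE]]; first by rewrite cj ri.
  by rewrite jE label_col_ge//= eq_sym sqrf_eq0 (negPf tm) scale0r /K mul0mx.
rewrite jE label_col/=; case: eqP => [tt|_]; last by rewrite scale0r /K mul0mx.
apply: K_scale; apply: K_low'; last by rewrite -sqrf_eq0 tt sqrf_eq0.
rewrite ltnNge; apply/negP => ci'; move: cj; rewrite jE col_class_wid ci' ri => cc.
have : i' = m by apply: cl_inj => //; lia.
by move=> i'm; rewrite jE i'm eqxx in jm.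
Qed.

Lemma odd_commutant_rows : ursubmx W = 0.
Proof.
apply/matrixP => i j; have := K_row i; rewrite /K -rowE => /rowP/(_ (rshift p j)).
by rewrite !mxE.
Qed.

End OddCommutant.

(* The odd part of e^(2X) is sinh 2X, a Cartan matrix with the same zeros and
   coincidences as X; what follows only depends on this pattern. *)
Definition same_pattern (R : realType) p (X s : 'rV[R]_p) :=
  (forall i, (s 0 i == 0) = (X 0 i == 0)) /\
  (forall i j, s 0 i ^+ 2 = s 0 j ^+ 2 -> X 0 i ^+ 2 = X 0 j ^+ 2).

(** One [k] has to serve all matrices of the given patterns, so that flipping signs of Cartan
    entries is harmless. *)
Definition transverse (R : realType) p q (X Y : 'rV[R]_p) (k : 'M[R]_(p + q)) :=
  forall s t, same_pattern X s -> same_pattern Y t ->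
  forall W, W *m Ipq R p q = - (Ipq R p q *m W) ->
    W *m cartan_mx q s = cartan_mx q s *m W ->
    W *m (k *m cartan_mx q t *m k^T) = k *m cartan_mx q t *m k^T *m W -> W = 0.

Lemma conj_comm (R : comPzRingType) n (k A B : 'M[R]_n) : k *m k^T = 1%:M ->
  A *m B = B *m A ->
  (k *m A *m k^T) *m (k *m B *m k^T) = (k *m B *m k^T) *m (k *m A *m k^T).
Proof.
move=> /mulmx1C kk AB; rewrite !mulmxA -!(mulmxA _ k^T k) kk !mulmx1.
by rewrite -(mulmxA k A B) AB mulmxA.
Qed.

Lemma trmx_cartan (R : realType) p q (H : 'rV[R]_p) : (cartan_mx q H)^T = cartan_mx q H.
Proof. by rewrite /cartan_mx tr_block_mx !trmx0 trmxK. Qed.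

Lemma trmx_Ipq (R : comNzRingType) p q : (Ipq R p q)^T = Ipq R p q.
Proof. by rewrite /Ipq tr_block_mx !trmx0 linearN/= !trmx1. Qed.

Lemma Ipq_sq (R : comNzRingType) p q : Ipq R p q *m Ipq R p q = 1%:M.
Proof.
rewrite /Ipq mulmx_block !mulmx0 !mul0mx !addr0 add0r mulmxN mulNmx opprK !mulmx1.
by rewrite -scalar_mx_block.
Qed.

Lemma conj_odd (R : comPzRingType) n (k J W : 'M[R]_n) :
  k *m J = J *m k -> k^T *m J = J *m k^T -> W *m J = - (J *m W) ->
  (k *m W *m k^T) *m J = - (J *m (k *m W *m k^T)).
Proof.
move=> kJ kJ' WJ; rewrite -!mulmxA kJ' (mulmxA W) WJ mulNmx mulmxN; congr (- _).
by rewrite !mulmxA kJ.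
Qed.

Lemma conj0 (R : comPzRingType) n (k W : 'M[R]_n) : k *m k^T = 1%:M ->
  k *m W *m k^T = 0 -> W = 0.
Proof.
move=> /mulmx1C kk /(congr1 (fun A => k^T *m A *m k)).
by rewrite mulmx0 mul0mx !mulmxA kk mul1mx -mulmxA kk mulmx1.
Qed.

Lemma block_diag_Ipq (R : comNzRingType) p q (B : 'M[R]_p) (C : 'M[R]_q) :
  block_mx B 0 0 C *m Ipq R p q = Ipq R p q *m block_mx B 0 0 C.
Proof.
by rewrite /Ipq !mulmx_block !mulmx0 !mul0mx !addr0 !add0r mulmxN mulNmx !mulmx1 !mul1mx.
Qed.

(** With rho = p - u the number of nonzero entries of [X], the inequalities v <= p - u, v <= u and
    the bound on multiplicities are exactly what [cyclic_classes] asks for. The rows of the frame in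
    the classes below rho are attached to the nonzero entries of [X]. *)
Lemma transversal_ordered (R : realType) p q (X Y : 'rV[R]_p) : (p < q)%N ->
  let u := #|[pred i | X 0%R i == 0%R]| in let v := #|[pred i | Y 0%R i == 0%R]| in
  (u < p)%N -> (v <= u)%N -> (u + v <= p)%N ->
  (forall c, c != 0 -> (#|[pred i | Y 0%R i ^+ 2 == c]| + 2 * u <= 2 * p)%N) ->
  exists k, [/\ k *m k^T = 1%:M, k *m Ipq R p q = Ipq R p q *m k
              & transverse X Y k].
Proof.
move=> pq u v up vu uvp blk; pose rho := (p - u)%N.
have vE : v = #|[pred i | Y 0%R i ^+ 2 == 0%R]|.
  by apply: eq_card => i; rewrite !inE sqrf_eq0.
have [||||cl [r [cl_inj cl_r cl_lt cl_zero]]] :=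
    @cyclic_classes R p (fun i => Y 0 i ^+ 2) rho (fun i => sqr_ge0 _).
- by rewrite /rho; lia.
- by rewrite -vE /rho; lia.
- by rewrite -vE /rho; lia.
- move=> c c0; rewrite /rho mulnBr leq_subRL ?leq_mul2l ?(ltnW up)// addnC; exact: blk.
pose S := [pred i | X 0 i != 0].
have cardS : #|S| = rho.
  have := cardC [pred i | X 0%R i == 0%R]; rewrite card_ord.
  have -> : #|S| = #|predC [pred i | X 0%R i == 0%R]| by apply: eq_card => i; rewrite !inE.
  by rewrite -/u /rho => h; apply/eqP; rewrite eq_sym -(eqn_add2l u) h subnKC// ltnW.
pose ra i := index i (enum S).
have ra_lt : {in S, forall i, (ra i < rho)%N}.
  by move=> i iS; rewrite /ra -cardS cardE index_mem mem_enum.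
have ra_inj : {in S &, injective ra}.
  move=> i j iS jS h; have e k : k \in S -> nth i (enum S) (ra k) = k.
    by move=> kS; rewrite nth_index ?mem_enum.
  by rewrite -(e i iS) h e.
have ra_surj a : (a < rho)%N -> exists2 i, i \in S & ra i = a.
  move=> ar; have rho0 : (0 < rho)%N by lia.
  have p0 : (0 < p)%N by lia.
  have sz : (a < size (enum S))%N by rewrite -cardE cardS.
  exists (nth (Ordinal p0) (enum S) a); first by rewrite -mem_enum mem_nth.
  by rewrite /ra index_uniq// enum_uniq.
have rho0 : (0 < rho)%N by rewrite /rho; lia.
have [|B [b [BB b2 BE]]] := @disjoint_frame R p S ra cl (fun=> 1) ra_inj.
  move=> i iS; exists (r (ra i)); last exact: oner_neq0.
  by have [] := cl_r _ (ra_lt _ iS).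
pose wid := widen_ord (ltnW pq).
pose S' := [pred j : 'I_q | if insub (val j) is Some i then i \in S else false].
pose ra' (j : 'I_q) := if insub (val j) is Some i then ra i else 0%N.
have ra'E i : ra' (wid i) = ra i by rewrite /ra' /= valK.
have S'E i : (wid i \in S') = (i \in S) by rewrite inE /= valK.
have S'_wid j : j \in S' -> exists2 i, i \in S & j = wid i.
  rewrite inE; case: insubP => // i _ ij iS; exists i => //; exact/val_inj.
have [||C [c [CC c2 CE]]] := @disjoint_frame R q S' ra' (col_class rho cl r) (@col_weight R p q).
- move=> j j' /S'_wid[i iS ->] /S'_wid[i' i'S ->]; rewrite !ra'E => /ra_inj -> //.
- move=> j /S'_wid[i iS ->]; rewrite ra'E.
  have q0 : q%:R != 0 :> R by rewrite pnatr_eq0; lia.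
  case: (posnP (ra i)) => [ri|ri].
    exists (Ordinal pq); first by rewrite ri (col_class_top pq).
    by rewrite /col_weight eqxx.
  exists (wid (r (ra i).-1)); last by rewrite (col_weight_wid R pq) oner_neq0.
  have ri' : ((ra i).-1 < rho)%N by have := ra_lt _ iS; lia.
  have [cr _] := cl_r _ ri'.
  by rewrite (col_class_wid pq) cr leqNgt ri' eqxx prednK.
have c2' : {in S, forall i, c (wid i) ^+ 2 *
    (\sum_(j | col_class rho cl r j == ra i) @col_weight R p q j ^+ 2) = 1}.
  by move=> i iS; rewrite -ra'E c2// S'E.
have CE' : {in S, forall i j, C (wid i) j =
    c (wid i) * col_weight R p j *+ (col_class rho cl r j == ra i)}.
  by move=> i iS j; rewrite CE ?S'E// ra'E.
pose k := block_mx B 0 0 C.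
have kk : k *m k^T = 1%:M.
  rewrite /k tr_block_mx !trmx0 mulmx_block !mulmx0 !mul0mx !addr0 !add0r BB CC.
  by rewrite -scalar_mx_block.
have kJ : k *m Ipq R p q = Ipq R p q *m k by exact: block_diag_Ipq.
have kJ' : k^T *m Ipq R p q = Ipq R p q *m k^T.
  by rewrite -[Ipq R p q in LHS]trmx_Ipq -trmx_mul -kJ trmx_mul trmx_Ipq.
exists k; split=> // s t [s0 _] [t0 tY] W WJ Ws Wt.
have kk' : k^T *m k^T^T = 1%:M by rewrite trmxK; exact: mulmx1C.
pose V := k^T *m W *m k.
have VJ : V *m Ipq R p q = - (Ipq R p q *m V).
  by have := conj_odd kJ' _ WJ; rewrite trmxK; exact.
have Vs : V *m (k^T *m cartan_mx q s *m k) = k^T *m cartan_mx q s *m k *m V.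
  by have := conj_comm kk' Ws; rewrite trmxK.
have Vt : V *m cartan_mx q t = cartan_mx q t *m V.
  have e : k^T *m (k *m cartan_mx q t *m k^T) *m k = cartan_mx q t.
    by rewrite !mulmxA (mulmx1C kk) mul1mx -mulmxA (mulmx1C kk) mulmx1.
  by have := conj_comm kk' Wt; rewrite trmxK e.
(* The chain only kills the upper right block. The three conditions are stable under transposition,
   so it also applies to [V^T], whose upper right block is the other block of [V]. *)
have VTJ : V^T *m Ipq R p q = - (Ipq R p q *m V^T).
  rewrite -trmx_Ipq -!trmx_mul -[in RHS]linearN/=; congr trmx.
  by rewrite VJ opprK.
have VTs : V^T *m (k^T *m cartan_mx q s *m k) = k^T *m cartan_mx q s *m k *m V^T.
  have := congr1 trmx Vs; rewrite trmx_mul [in RHS]trmx_mul.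
  by rewrite !(trmx_mul (_ *m _) k) !trmx_mul trmxK trmx_cartan !mulmxA => ->.
have VTt : V^T *m cartan_mx q t = cartan_mx q t *m V^T.
  by rewrite -trmx_cartan -!trmx_mul Vt.
have cl_inj' i j : cl i = cl j -> t 0 i ^+ 2 = t 0 j ^+ 2 -> i = j.
  by move=> cij /tY; exact: cl_inj.
have cl_r' a : (a < rho)%N -> cl (r a) = a /\ t 0 (r a) != 0.
  by move=> /cl_r[cr Yr]; split=> //; rewrite t0 -sqrf_eq0.
have cl_zero' i : t 0 i = 0 -> (cl i < rho)%N.
  by move=> /eqP; rewrite t0 => /eqP Yi; apply: cl_zero; rewrite Yi expr0n.
have sS i : (s 0 i != 0) = (i \in S) by rewrite s0.
have V0 := @odd_commutant_rows R p q pq S rho ra cl r t rho0 ra_inj ra_lt ra_surj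
  cl_inj' cl_r' cl_lt cl_zero' B b C c BB CC b2 BE c2' CE' s V sS VJ Vt Vs.
have VT0 := @odd_commutant_rows R p q pq S rho ra cl r t rho0 ra_inj ra_lt ra_surj
  cl_inj' cl_r' cl_lt cl_zero' B b C c BB CC b2 BE c2' CE' s V^T sS VTJ VTt VTs.
apply: (conj0 kk'); rewrite trmxK -/V -[V]submxK.
have [-> ->] := J_odd_block VJ; rewrite V0.
have -> : dlsubmx V = 0 by apply: trmx_inj; rewrite trmx0 -VT0 trmx_dlsub.
by rewrite block_mx0.
Qed.

Lemma exists_transversal (R : realType) p q (X Y : 'rV[R]_p) : (0 < p < q)%N ->
  let u := #|[pred i | X 0%R i == 0%R]| in let v := #|[pred i | Y 0%R i == 0%R]| in
  (u + v <= p)%N ->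
  (forall c, c != 0 -> (#|[pred i | Y 0%R i ^+ 2 == c]| + 2 * u <= 2 * p)%N) ->
  (forall c, c != 0 -> (#|[pred i | X 0%R i ^+ 2 == c]| + 2 * v <= 2 * p)%N) ->
  exists k, [/\ k *m k^T = 1%:M, k *m Ipq R p q = Ipq R p q *m k
              & transverse X Y k].
Proof.
move=> /andP[p0 pq] u v uvp blkY blkX.
(* If [Z] were 0, then [T] would have no zero entry, and the level set of its first entry would
   violate the bound on multiplicities. *)
have lt_p (Z T : 'rV[R]_p) : (#|[pred i | Z 0%R i == 0%R]| + #|[pred i | T 0%R i == 0%R]| <= p)%N ->
    (forall c, c != 0 -> (#|[pred i | T 0%R i ^+ 2 == c]| + 2 * #|[pred i | Z 0%R i == 0%R]| <= 2 * p)%N) ->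
    (#|[pred i | Z 0%R i == 0%R]| < p)%N.
  move=> ZTp blk; rewrite ltnNge; apply/negP => pZ.
  have T0 : #|[pred i | T 0%R i == 0%R]| = 0%N by lia.
  have Ti : T 0 (Ordinal p0) != 0 by have /card0_eq/(_ (Ordinal p0)) := T0; rewrite !inE => ->.
  have := blk (T 0 (Ordinal p0) ^+ 2); rewrite sqrf_eq0 => /(_ Ti).
  have : (0 < #|[pred i | T 0%R i ^+ 2 == T 0%R (Ordinal p0) ^+ 2]|)%N.
    by apply/card_gt0P; exists (Ordinal p0); rewrite inE.
  by lia.
have [vu|uv] := leqP v u.
  by apply: transversal_ordered => //; exact: (lt_p _ _ uvp blkY).
have vup : (v + u <= p)%N by rewrite addnC.
have [k [kk kJ kT]] := transversal_ordered pq (lt_p _ _ vup blkX) (ltnW uv) vup blkX.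
have kJ' : k^T *m Ipq R p q = Ipq R p q *m k^T.
  by rewrite -[Ipq R p q in LHS]trmx_Ipq -trmx_mul -kJ trmx_mul trmx_Ipq.
exists k^T; split=> //; first by rewrite trmxK; exact: mulmx1C.
move=> s t Xs Yt W WJ Ws; rewrite trmxK => Wt.
apply: (conj0 kk); apply: (kT t s) => //.
- exact: conj_odd.
- have e : k *m (k^T *m cartan_mx q t *m k) *m k^T = cartan_mx q t.
    by rewrite !mulmxA kk mul1mx -mulmxA kk mulmx1.
  by have := conj_comm kk Wt; rewrite e.
- exact: conj_comm.
Qed.

(** * Matrices and Borel measures *)

Lemma mx_entry_continuous (T : topologicalType) m n (i : 'I_m) (j : 'I_n) :
  continuous (fun M : 'M[T]_(m, n) => M i j).
Proof.
move=> M A /= nA; exists (fun i' j' => if (i' == i) && (j' == j) then A else setT).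
  by move=> i' j'; case: ifP => [/andP[/eqP -> /eqP ->]//|_]; exact: filterT.
by move=> N /(_ i j); rewrite !eqxx.
Qed.

Lemma mx_continuous (U T : topologicalType) m n (f : U -> 'M[T]_(m, n)) :
  (forall i j, continuous (fun u => f u i j)) -> continuous f.
Proof.
move=> cf u A [P nP sPA]; rewrite nbhs_filterE/=.
have : \forall v \near u, forall k : 'I_m * 'I_n, P k.1 k.2 (f v k.1 k.2).
  by apply: filter_forall => k; apply: cf; exact: nP.
by apply: filterS => v Pv; apply: sPA => i j; exact: (Pv (i, j)).
Qed.

Section NumFieldMatrixContinuity.
Variables (K : numFieldType) (U : topologicalType).

Lemma continuous_sum (I : Type) (r : seq I) (P : pred I) (f : I -> U -> K) :
  (forall i, P i -> continuous (f i)) -> continuous (fun u => \sum_(i <- r | P i) f i u).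
Proof.
move=> cf u; elim: r => [|i r IH].
  rewrite (_ : (fun _ => _) = fun=> 0); first exact: cst_continuous.
  by apply/funext => v; rewrite big_nil.
rewrite (_ : (fun _ => _) = fun v => (if P i then f i v else 0) + \sum_(i <- r | P i) f i v).
  apply: cvgD => //; case: ifPn => [Pi|_]; [exact: cf|exact: cst_continuous].
by apply/funext => v; rewrite big_cons; case: ifP; rewrite ?add0r.
Qed.

Lemma continuous_prod (I : Type) (r : seq I) (f : I -> U -> K) :
  (forall i, continuous (f i)) -> continuous (fun u => \prod_(i <- r) f i u).
Proof.
move=> cf u; elim: r => [|i r IH].
  rewrite (_ : (fun _ => _) = fun=> 1); first exact: cst_continuous.
  by apply/funext => v; rewrite big_nil.
rewrite (_ : (fun _ => _) = fun v => f i v * \prod_(i <- r) f i v).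
  by apply: cvgM => //; exact: cf.
by apply/funext => v; rewrite big_cons.
Qed.

Lemma continuous_mulmx m n p (f : U -> 'M[K]_(m, n)) (g : U -> 'M[K]_(n, p)) :
  continuous f -> continuous g -> continuous (fun u => f u *m g u).
Proof.
move=> cf cg; apply: mx_continuous => i j.
rewrite (_ : (fun _ => _) = fun u => \sum_k f u i k * g u k j); last first.
  by apply/funext => u; rewrite mxE.
apply: continuous_sum => k _ u; apply: cvgM.
  exact: (continuous_comp (cf u) (@mx_entry_continuous _ _ _ i k _)).
exact: (continuous_comp (cg u) (@mx_entry_continuous _ _ _ k j _)).
Qed.

Lemma continuous_det n (f : U -> 'M[K]_n) : continuous f -> continuous (fun u => \det (f u)).
Proof.
move=> cf; rewrite /determinant; apply: continuous_sum => s _ u.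
apply: cvgM; first exact: cst_continuous.
apply: continuous_prod => i v.
exact: (continuous_comp (cf v) (@mx_entry_continuous _ _ _ _ _ _)).
Qed.

End NumFieldMatrixContinuity.

Lemma continuous_trmx (U T : topologicalType) m n (f : U -> 'M[T]_(m, n)) :
  continuous f -> continuous (fun u => (f u)^T).
Proof.
move=> cf; apply: mx_continuous => i j u; rewrite (_ : (fun _ => _) = fun u => f u j i).
  exact: (continuous_comp (cf u) (@mx_entry_continuous _ _ _ _ _ _)).
by apply/funext => v; rewrite mxE.
Qed.

Section MatrixNorm.
Variable R : realType.

Lemma mx_entry_le m n (A : 'M[R]_(m, n)) i j : `|A i j| <= `|A|.
Proof.
rewrite [leRHS]/Num.norm /= mx_normrE.
by apply/bigmax_geP; right => /=; exists (i, j).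
Qed.

Lemma mx_norm_le m n (A : 'M[R]_(m, n)) (c : R) : 0 <= c ->
  (forall i j, `|A i j| <= c) -> `|A| <= c.
Proof.
move=> c0 h; rewrite [leLHS]/Num.norm /= mx_normrE.
by apply/bigmax_leP; split => // -[i j] _ /=.
Qed.

Lemma mx_norm_lt m n (A : 'M[R]_(m, n)) (c : R) : 0 < c ->
  (forall i j, `|A i j| < c) <-> `|A| < c.
Proof.
move=> c0; split=> [h|h i j]; last by apply: le_lt_trans h; exact: mx_entry_le.
rewrite [ltLHS]/Num.norm /= mx_normrE.
by apply/bigmax_ltP; split => // -[i j] _ /=.
Qed.

Lemma mx_norm_mul m n p (A : 'M[R]_(m, n)) (B : 'M[R]_(n, p)) :
  `|A *m B| <= n%:R * `|A| * `|B|.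
Proof.
apply: mx_norm_le => [|i j]; first by rewrite !mulr_ge0.
rewrite mxE; apply: le_trans (ler_norm_sum _ _ _) _.
rewrite -mulrA mulr_natl -[X in _ *+ X](card_ord n) -sumr_const.
apply: ler_sum => k _; rewrite normrM.
by apply: ler_pM => //; exact: mx_entry_le.
Qed.

Lemma mx_norm_tr m n (A : 'M[R]_(m, n)) : `|A^T| = `|A|.
Proof.
apply/eqP; rewrite eq_le; apply/andP; split; apply: mx_norm_le => // i j.
  by rewrite mxE mx_entry_le.
by have := mx_entry_le A^T j i; rewrite mxE.
Qed.

Lemma orth_norm n (k : 'M[R]_n) : k^T *m k = 1%:M -> `|k| <= 1.
Proof.
move=> kk; apply: mx_norm_le => // i j.
have : (k^T *m k) j j = 1 by rewrite kk mxE eqxx.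
rewrite mxE => h; rewrite -ler_sqr ?nnegrE// expr1n -h real_normK ?num_real//.
rewrite (bigD1 i)//= mxE -expr2 lerDl sumr_ge0// => l _.
by rewrite mxE -expr2 sqr_ge0.
Qed.

Lemma mx_bounded_closed_compact m n (A : set 'M[R]_(m, n)) (c : R) :
  closed A -> (forall x, A x -> `|x| <= c) -> compact A.
Proof.
move=> Acl Ab; pose B := [set v : 'rV[R]_(m * n) | A (vec_mx v)].
have cvec : continuous (vec_mx : 'rV[R]_(m * n) -> 'M[R]_(m, n)).
  apply: mx_continuous => i j u.
  rewrite (_ : (fun _ => _) = fun v : 'rV[R]_(m * n) => v 0 (mxvec_index i j)).
    exact: mx_entry_continuous.
  by apply/funext => v; rewrite mxE.
have cB : compact B.
  apply: bounded_closed_compact.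
    exists (Num.max c 0); split => [|M cM v /Ab vc]; first exact: num_real.
    have M0 : 0 <= M by apply: le_trans (ltW cM); rewrite le_max lexx orbT.
    apply: mx_norm_le => // i j; rewrite (ord1 i); case/mxvec_indexP: j => k l.

    have -> : v 0 (mxvec_index k l) = vec_mx v k l by rewrite mxE.
    apply: le_trans (mx_entry_le _ _ _) _; apply: le_trans vc _.
    by apply: le_trans (ltW cM); rewrite le_max lexx.
  exact: (@closed_comp _ _ vec_mx A (fun x _ => cvec x)).
have -> : A = vec_mx @` B.
  apply/seteqP; split => [x Ax|x [v Bv <-]//].
  by exists (mxvec x); rewrite /B/= ?mxvecK.
by apply: continuous_compact => //; exact: continuous_subspaceT.
Qed.

End MatrixNorm.

Definition mk_mfun d1 d2 (T1 : measurableType d1) (T2 : measurableType d2)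
  (f : T1 -> T2) (mf : measurable_fun setT f) : {mfun T1 >-> T2} :=
  HB.pack f (isMeasurableFun.Build _ _ _ _ f mf).

Section BorelMeasurability.

Lemma borel_open (T : ptopologicalType) (A : set (borel T)) : @open T A -> measurable A.
Proof. exact: sub_sigma_algebra. Qed.

Lemma borel_closed (T : ptopologicalType) (A : set (borel T)) : @closed T A -> measurable A.
Proof. by move=> cA; rewrite -[A]setCK; apply: measurableC; apply: borel_open; exact: closed_openC. Qed.

Lemma borel_fun d (S : measurableType d) (T : ptopologicalType) (f : S -> borel T) :
  (forall A : set T, open A -> measurable (f @^-1` A)) -> measurable_fun setT f.
Proof.
move=> h; apply: (@measurability _ _ S (borel T) setT f (@open T) erefl).
by move=> _ [A oA <-]; rewrite setTI; exact: h.
Qed.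

Lemma borel_continuous (S T : ptopologicalType) (f : S -> T) :
  continuous f -> measurable_fun setT (f : borel S -> borel T).
Proof.
move=> cf; apply: borel_fun => A oA; apply: borel_open.
by apply: open_comp => // x _; exact: cf.
Qed.

Lemma borel_real_continuous (R : realType) (S : ptopologicalType) (f : S -> R) :
  continuous f -> measurable_fun setT (f : borel S -> R).
Proof.
move=> cf; apply: (measurability _ (RGenOpens.measurableE R)).
move=> _ [_ [a [b ->] <-]]; rewrite setTI; apply: borel_open.
by apply: open_comp; [move=> x _; exact: cf|exact: interval_open].
Qed.

(** An open set is the union of the countably many boxes with rational centre and radius 1/(n + 1)
    that it contains, and each box is a finite intersection of conditions on entries. *)
Lemma borel_mx (R : realType) d (S : measurableType d) m n (f : S -> borel 'M[R]_(m, n)) :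
  (forall i j, measurable_fun setT (fun t => (f t : 'M[R]_(m, n)) i j)) ->
  measurable_fun setT f.
Proof.
move=> mf; apply: borel_fun => A oA.
pose Idx := ('M[rat]_(m, n) * nat)%type.
pose ctr (k : Idx) : 'M[R]_(m, n) := map_mx ratr k.1.
pose box (k : Idx) : set 'M[R]_(m, n) := [set x | forall i j, `|x i j - ctr k i j| < k.2.+1%:R^-1].
have -> : f @^-1` A = \bigcup_(k in [set k : Idx | box k `<=` A]) (f @^-1` box k).
  apply/seteqP; split => [t /= At|t [k bA] /= /bA //].
  have /nbhs_ballP[e /= e0 eA] : nbhs (f t : 'M[R]_(m, n)) A by exact: open_nbhs_nbhs.
  have [N _ Ne] := near_infty_natSinv_lt (PosNum (divr_gt0 e0 (ltr0Sn R 1))).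
  have {}Ne := Ne N (leqnn N).
  have N0 : 0 < N.+1%:R^-1 :> R by rewrite invr_gt0.
  pose x : 'M[R]_(m, n) := f t.
  have hr i j : exists r : rat, `|x i j - ratr r| < N.+1%:R^-1.
    have [|r] := @rat_in_itvoo R (x i j) (x i j + N.+1%:R^-1); first by rewrite ltrDl.
    rewrite in_itv/= => /andP[h1 h2]; exists r.
    by rewrite distrC ger0_norm ?subr_ge0 ?(ltW h1)// ltrBlDl.
  pose q : 'M[rat]_(m, n) := \matrix_(i, j) projT1 (cid (hr i j)).
  exists (q, N) => /=; last first.
    by move=> i j; rewrite /ctr !mxE; case: cid.
  move=> y by_; apply: eA; rewrite -ball_normE /=.
  apply/mx_norm_lt => // i j; rewrite !mxE.
  have := by_ i j; rewrite /ctr/= !mxE; case: cid => r /= xr yr.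
  rewrite -/x in xr *; move: Ne; rewrite /= => Ne.
  rewrite (le_lt_trans (ler_distD (ratr r) _ _))// [ltRHS](splitr e).
  by rewrite ltrD ?(lt_trans _ Ne)// distrC.
rewrite bigcup_mkcond; apply: countable_bigcupT_measurable => [|k]; first exact: countableP.
case: ifP => _; last exact: measurable0.
have -> : f @^-1` box k = \bigcap_(ij in setT)
    ((fun t => (f t : 'M[R]_(m, n)) ij.1 ij.2) @^-1` [set r : R | `|r - ctr k ij.1 ij.2| < k.2.+1%:R^-1]).
  by apply/seteqP; split => [t h [i j] _ /=|t h i j]; [exact: h|exact: (h (i, j) I)].
apply: fin_bigcap_measurable => [|[i j] _]; first exact: finite_finset.
rewrite -[X in measurable X]setTI; apply: mf => //.
rewrite (_ : [set _ | _] = ball (ctr k i j) k.2.+1%:R^-1); last first.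
  by apply/seteqP; split => r /=; rewrite -ball_normE /= distrC.
exact: measurable_ball.
Qed.

Lemma borel_entry (R : realType) m n i j :
  measurable_fun setT (fun x : borel 'M[R]_(m, n) => (x : 'M[R]_(m, n)) i j).
Proof. by apply: borel_real_continuous; exact: mx_entry_continuous. Qed.

Lemma borel_entry_comp (R : realType) d (S : measurableType d) m n (f : S -> borel 'M[R]_(m, n)) i j :
  measurable_fun setT f -> measurable_fun setT (fun t => (f t : 'M[R]_(m, n)) i j).
Proof. by move=> mf; exact: (measurableT_comp (@borel_entry R m n i j) mf). Qed.

Lemma borel_mulmx (R : realType) d (S : measurableType d) m n p
    (f : S -> borel 'M[R]_(m, n)) (g : S -> borel 'M[R]_(n, p)) :
  measurable_fun setT f -> measurable_fun setT g ->
  measurable_fun setT (fun t => (f t : 'M[R]_(m, n)) *m (g t : 'M[R]_(n, p)) : borel 'M[R]_(m, p)).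
Proof.
move=> mf mg; apply: borel_mx => i j.
rewrite (_ : (fun _ => _) = fun t => \sum_k (f t : 'M[R]_(m, n)) i k * (g t : 'M[R]_(n, p)) k j); last first.
  by apply/funext => t; rewrite mxE.
apply: measurable_sum => k; apply: measurable_funM; exact: borel_entry_comp.
Qed.

Lemma borel_trmx (R : realType) d (S : measurableType d) m n (f : S -> borel 'M[R]_(m, n)) :
  measurable_fun setT f -> measurable_fun setT (fun t => (f t : 'M[R]_(m, n))^T : borel 'M[R]_(n, m)).
Proof.
move=> mf; apply: borel_mx => i j.
rewrite (_ : (fun _ => _) = fun t => (f t : 'M[R]_(m, n)) j i); last first.
  by apply/funext => t; rewrite mxE.
exact: borel_entry_comp.
Qed.

Lemma nonincreasing_mu_le (R : realType) d (T : measurableType d)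
    (mu : {finite_measure set T -> \bar R}) (E : (set T)^nat) (r : R) :
  (forall n, measurable (E n)) -> (forall m n, (m <= n)%N -> E n `<=` E m) -> 0 < r ->
  exists N, (mu (E N) <= mu (\bigcap_n E n) + r%:E)%E.
Proof.
move=> mE ndE r0; have mI : measurable (\bigcap_n E n) by exact: bigcapT_measurable.
have : (fun N => mu (E N)) @ \oo --> mu (\bigcap_n E n).
  apply: nonincreasing_cvg_mu => //.
  - by rewrite ltey_eq fin_num_measure.
  - by move=> m n mn; apply/subsetPset; exact: ndE.
have fI : mu (\bigcap_n E n) \is a fin_num by exact: fin_num_measure.
rewrite -(fineK fI) => /fine_cvgP[_ /cvgrPdist_lt /(_ r r0)][N _ /(_ N (leqnn N))] /= hN.
have fN : mu (E N) \is a fin_num by exact: fin_num_measure.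
exists N; rewrite -(fineK fN) -EFinD lee_fin.
by move: hN; rewrite ltr_norml => /andP[h _]; lra.
Qed.

(* Outer regularity: the sets that are sandwiched between a closed and an open
   set up to measure e form a sigma-algebra containing the open sets. *)
Lemma borel_outer_regular (R : realType) (V : normedModType R)
    (mu : {finite_measure set (borel V) -> \bar R}) (A : set (borel V)) (e : R) :
  measurable A -> 0 < e ->
  exists U : set (borel V), [/\ @open V U, A `<=` U & (mu (U `\` A) <= e%:E)%E].
Proof.
pose good := [set B : set (borel V) | forall e : R, 0 < e -> exists F U : set (borel V),
  [/\ @closed V F, @open V U, F `<=` B, B `<=` U & (mu (U `\` F) <= e%:E)%E]].
move=> mA e0.
suff : good A.
  move=> /(_ e e0)[F [U [cF oU FA AU h]]]; exists U; split => //.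
  apply: le_trans h; apply: le_measure; rewrite ?inE.
  - by apply: measurableD => //; exact: borel_open.
  - by apply: measurableD; [exact: borel_open|exact: borel_closed].
  - exact: setDS.
have sig : sigma_algebra setT good.
  split.
  - move=> r r0; exists set0, set0; split => //; rewrite ?setD0 ?measure0 ?lee_fin ?ltW//.
    + exact: closed0.
    + exact: open0.
  - move=> B gB r r0; have [F [U [cF oU FB BU h]]] := gB r r0.
    exists (~` U), (~` F); split; rewrite ?setTD; [exact: open_closedC|exact: closed_openC|exact: subsetC|exact: subsetC|].
    by rewrite setDE setCK setIC -setDE.
  - move=> B gB r r0.
    have h n : exists FU : set (borel V) * set (borel V), [/\ @closed V FU.1, @open V FU.2,
        FU.1 `<=` B n, B n `<=` FU.2 & (mu (FU.2 `\` FU.1) <= (r / 2 / (2 ^ n.+1)%:R)%:E)%E].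
      have rn : 0 < r / 2 / (2 ^ n.+1)%:R by rewrite !divr_gt0// ltr0n expn_gt0.
      by have [F [U hFU]] := gB n _ rn; exists (F, U).
    have [FU hFU] := choice h.
    pose U := \bigcup_n (FU n).2; pose F := \bigcup_n (FU n).1.
    pose FN N := \big[setU/set0]_(i < N) (FU i).1.
    have FNE N : FN N = \bigcup_(i in [set k | (k < N)%N]) (FU i).1.
      rewrite /FN; elim: N => [|N IH]; first by rewrite big_ord0; apply/seteqP; split => // x [].
      rewrite big_ord_recr/= IH; apply/seteqP; split => x.
        by case=> [[i /= iN Fx]|Fx]; [exists i => //=; exact: ltnW|exists N => /=].
      case=> i /=; rewrite ltnS leq_eqVlt => /orP[/eqP -> Fx|iN Fx]; first by right.
      by left; exists i.
    have mF n : measurable (FU n).1 by apply: borel_closed; case: (hFU n).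
    have mU n : measurable (FU n).2 by apply: borel_open; case: (hFU n).
    have mUF : (mu (U `\` F) <= (r / 2)%:E)%E.
      apply: (@le_trans _ _ (\sum_(n <oo) mu ((FU n).2 `\` (FU n).1))%E).
        apply: (@measure_sigma_subadditive _ _ _ mu _ (fun n => (FU n).2 `\` (FU n).1)).
        - move=> n; exact: measurableD.
        - by apply: measurableD; exact: bigcupT_measurable.
        - move=> x [[n _ Ux] nF]; exists n => //; split => // Fx; apply: nF; by exists n.
      apply: (@le_trans _ _ (\sum_(n <oo) (r / 2 / (2 ^ n.+1)%:R)%:E)%E).
        by apply: lee_nneseries => // n _; case: (hFU n).
      apply: epsilon_trick0; exact/ltW/divr_gt0.
    have mFN N : measurable (FN N) by exact: bigsetU_measurable.
    have mUU : measurable U by exact: bigcupT_measurable.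
    (* The union of all the closed sets need not be closed, but finitely many of them already
       exhaust it up to r / 2. *)
    have [|||N] := @nonincreasing_mu_le R _ _ mu (fun N => U `\` FN N) (r / 2) _ _ _.
    - by move=> n; exact: measurableD.
    - move=> m n mn; apply: setDS => x.
      by rewrite !FNE => -[i /= im Fx]; exists i => //=; exact: leq_trans im mn.
    - exact: divr_gt0.
    have -> : \bigcap_N (U `\` FN N) = U `\` F.
      apply/seteqP; split => [x h1|x [Ux nFx] N' _].
        split; first by case: (h1 0%N I).
        move=> [n _ Fx]; case: (h1 n.+1 I) => _; apply.
        by rewrite FNE; exists n => /=.
      split => //; rewrite FNE => -[i _ Fx]; apply: nFx; by exists i.
    move=> hN.
    exists (FN N), U; split.
    + rewrite /FN; elim/big_ind : _ => //; [exact: closed0|by move=> ? ?; exact: closedU|].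
      by move=> i _; case: (hFU i).
    + by apply: bigcup_open => n _; case: (hFU n).
    + by move=> x; rewrite FNE => -[i _ Fx]; exists i => //; case: (hFU i) => _ _ + _ _; exact.
    + by move=> x [n _ Bx]; exists n => //; case: (hFU n) => _ _ _ + _; exact.
    + by apply: (le_trans hN); rewrite [in leRHS](splitr r) EFinD leeD2r.
have goodopen : @open V `<=` good.
  move=> B0 oB r r0; pose B : set (borel V) := B0.
  have {}oB : @open V B := oB.
  (* An open set is exhausted by the closed sets of points at distance at least 1/(n + 1) from its
     complement. *)
  pose Fn n : set (borel V) := ~` \bigcup_(y in ~` B) (ball (y : V) n.+1%:R^-1 : set V).
  have cFn n : @closed V (Fn n).
    by apply: open_closedC; apply: bigcup_open => y _; exact: ball_open.
  have mB : measurable B by exact: borel_open.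
  have mFn n : measurable (Fn n) by exact: borel_closed.
  have [||N] := @nonincreasing_mu_le R _ _ mu (fun N => B `\` Fn N) r _ _ r0.
  - by move=> n; exact: measurableD.
  - move=> m n mn; apply: setDS; apply: subsetC => x [y By xy].
    exists y => //; apply: le_ball xy.
    by rewrite lef_pV2 ?posrE ?ltr0n// ler_nat ltnS.
  have -> : \bigcap_N (B `\` Fn N) = set0.
    apply/seteqP; split => // x h; have [Bx _] := h 0%N I.
    have /nbhs_ballP[d /= d0 dB] : nbhs (x : V) B by exact: open_nbhs_nbhs.
    have [N' _ Ne] := near_infty_natSinv_lt (PosNum d0).
    have [_ /=] := h N' I; apply => -[y nBy xy]; apply: nBy; apply: dB.
    by apply: ball_sym; apply: le_ball xy; apply: ltW; exact: Ne (leqnn N').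
  rewrite measure0 add0e => hN; exists (Fn N), B; split => //.
  by move=> x /=; apply: contra_notP => nBx; exists x => //; apply: ballxx; rewrite invr_gt0.
have : <<s @open V >> `<=` good by apply: smallest_sub.
exact.
Qed.

End BorelMeasurability.

Section MeasureLemmas.
Context d (T : measurableType d) (R : realType).

(** The tails, the unions of the [A n] over n >= N, decrease to the limsup and each has measure at
    least r; finiteness of [mu] allows passing to the limit. *)
Lemma limsup_mu_ge (mu : {finite_measure set T -> \bar R}) (A : (set T)^nat) (r : R) :
  (forall n, measurable (A n)) -> (forall n, (r%:E <= mu (A n))%E) ->
  (r%:E <= mu (\bigcap_N \bigcup_(n in [set n | (N <= n)%N]) A n))%E.
Proof.
move=> mA rA; pose E N := \bigcup_(n in [set n | (N <= n)%N]) A n.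
have mE N : measurable (E N) by apply: bigcup_measurable => n _; exact: mA.
rewrite leNgt; apply/negP => lt.
have mI : measurable (\bigcap_n E n) by exact: bigcapT_measurable.
have fI : mu (\bigcap_n E n) \is a fin_num by exact: fin_num_measure.
move: lt; rewrite -/E -(fineK fI) lte_fin => lt.
have e0 : 0 < (r - fine (mu (\bigcap_n E n))) / 2 by rewrite divr_gt0// subr_gt0.
have [|N] := @nonincreasing_mu_le R _ _ mu E _ mE _ e0.
  by move=> m n mn x [k /= nk Ak]; exists k => //=; exact: leq_trans nk.
rewrite -(fineK fI) -EFinD => h.
have : (r%:E <= mu (E N))%E.
  by apply: le_trans (rA N) _; apply: le_measure; rewrite ?inE// => x Ax; exists N => /=.
move=> /le_trans /(_ h); rewrite lee_fin; lra.
Qed.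

(* Stands in for Fubini along a curve on which a polynomial has finitely many
   zeros. *)
Lemma null_of_finitely_often (mu : {finite_measure set T -> \bar R}) (A : (set T)^nat) (r : \bar R) :
  (forall n, measurable (A n)) -> (forall n, mu (A n) = r) ->
  (forall x, exists N, forall n, (N <= n)%N -> ~ A n x) -> r = 0%E.
Proof.
move=> mA Ar fA.
have fr : r \is a fin_num by rewrite -(Ar 0%N) fin_num_measure.
have := @limsup_mu_ge mu A (fine r) mA; rewrite fineK// => /(_ (fun n => eq_ind_r (fun x => (r <= x)%E) (lexx _) (Ar n))).
rewrite (_ : \bigcap_N _ = set0) ?measure0 => [r0|]; last first.
  apply/seteqP; split => // x h; have [N hN] := fA x.
  by have [n /= Nn Ax] := h N I; exact: (hN n Nn).
by apply/eqP; rewrite eq_le r0/= -(Ar 0%N) measure_ge0.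
Qed.

(** The sum of the probabilities is the expected number of events that occur. *)
Lemma sum_prob_le (P : probability T R) (W : finType) (E : W -> set T) (c : R) :
  (forall w, measurable (E w)) -> (forall x, \sum_w \1_(E w) x <= c) ->
  (\sum_w P (E w) <= c%:E)%E.
Proof.
move=> mE h.
have -> : (\sum_w P (E w) = \int[P]_x \sum_w (\1_(E w) x)%:E)%E.
  rewrite ge0_integral_sum//; last first.
    by move=> w; apply/measurable_EFinP; exact: measurable_indic.
  by apply: eq_bigr => w _; rewrite integral_indic// setIT.
apply: (@le_trans _ _ (\int[P]_x c%:E)%E); last first.
  have h1 : P [set: T] = 1%E by exact: probability_setT.
  by rewrite [leLHS](integral_cst P measurableT c%:E) [X in (_ * X <= _)%E]h1 mule1.
apply: ge0_le_integral => //.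
- by move=> x _; apply: sume_ge0 => w _; rewrite lee_fin.
- by apply: emeasurable_sum => w; apply/measurable_EFinP; exact: measurable_indic.
- by move=> x _; rewrite sumEFin lee_fin.
Qed.

Lemma measure_le_sum (mu : {measure set T -> \bar R}) (W : Type) (s : seq W) (E : W -> set T) A :
  (forall w, measurable (E w)) -> measurable A ->
  A `<=` \big[setU/set0]_(w <- s) E w -> (mu A <= \sum_(w <- s) mu (E w))%E.
Proof.
move=> mE; elim: s A => [|w s IH] A mA; rewrite !(big_nil, big_cons).
  by rewrite subset0 => ->; rewrite measure0.
move=> AE; apply: (@le_trans _ _ (mu (E w `|` (A `\` E w)))).
  apply: le_measure; rewrite ?inE//; first by apply: measurableU => //; exact: measurableD.
  by move=> x Ax; have [|] := pselect (E w x); [left|right].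
apply: le_trans (measureU2 _ _ _) _ => //; first exact: measurableD.
apply: leeD => //; apply: IH; first exact: measurableD.
by move=> x [/AE []].
Qed.

End MeasureLemmas.

Lemma product_swap d1 d2 (T1 : measurableType d1) (T2 : measurableType d2) (R : realType)
  (m1 : {sigma_finite_measure set T1 -> \bar R})
  (m2 : {sigma_finite_measure set T2 -> \bar R}) (A : set (T1 * T2)) : measurable A ->
  (\int[m1]_x m2 (xsection A x) = \int[m2]_y m1 (ysection A y))%E.
Proof.
move=> mA; have := @product_measure_unique _ _ _ _ _ m1 m2 (m1 \x^ m2)%E.
by apply => // *; exact: product_measure2E.
Qed.

Lemma borel_norm (R : realType) d (S : measurableType d) m n (f : S -> borel 'M[R]_(m, n)) (r : R) :
  measurable_fun setT f -> measurable [set t | `|(f t : 'M[R]_(m, n))| < r].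
Proof.
move=> mf; rewrite (_ : [set _ | _] = f @^-1` ball (0 : 'M[R]_(m, n)) r); last first.
  by apply/seteqP; split => t /=; rewrite -ball_normE /= sub0r normrN.
rewrite -[X in measurable X]setTI; apply: mf => //.
by apply: borel_open; exact: ball_open.
Qed.

Lemma continuous_affine (R : realType) m n p (A : 'M[R]_(m, n)) (B : 'M[R]_(m, p)) :
  continuous (fun h => A *m h - B).
Proof.
apply: mx_continuous => i j x.
rewrite (_ : (fun _ => _) = fun h : 'M[R]_(n, p) => (\sum_k A i k * h k j) - B i j); last first.
  by apply/funext => h; rewrite !mxE.
apply: continuousB; last exact: cst_continuous.
apply: (continuous_sum (f := fun k (h : 'M[R]_(n, p)) => A i k * h k j)) => k _ u.
by apply: (@continuousM _ _ (fun=> A i k)); [exact: cst_continuous|exact: mx_entry_continuous].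
Qed.

(** * Haar measure of small balls, and a spreading criterion for absolute continuity *)

Section HaarRegularity.
Variables (R : realType) (N : nat) (J : 'M[R]_N) (G : set 'M[R]_N).
Hypotheses (JT : J^T = J) (JJ : J *m J = 1%:M).
Hypotheses (G1 : G 1%:M) (GM : forall g h, G g -> G h -> G (g *m h)).
(** On [G], the relation g^T J g = J together with J^2 = 1 makes this the inverse of g, by a formula
    that is continuous on all matrices. *)
Definition jinv (g : 'M[R]_N) := J *m g^T *m J.
Hypotheses (Ginv : forall g, G g -> G (jinv g)).
Hypotheses (GJ : forall g, G g -> g^T *m J *m g = J).
Hypothesis Gcl : closed G.
Variable mG : {measure set (borel 'M[R]_N) -> \bar R}.
Hypothesis mGC : mG (~` G) = 0%E.
Hypothesis mGinv : forall g, G g -> forall A : set (borel 'M[R]_N), measurable A ->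
  mG (mulmx g @^-1` A) = mG A.
Hypothesis mGfin : forall C : set 'M[R]_N, compact C -> C `<=` G -> (mG C < +oo)%E.
Hypothesis mG0 : mG G != 0%E.

Lemma jinvK g : G g -> jinv g *m g = 1%:M.
Proof. by move=> /GJ h; rewrite /jinv -!mulmxA (mulmxA g^T) h JJ. Qed.

Lemma mul_jinv g : G g -> g *m jinv g = 1%:M.
Proof. by move=> /jinvK /mulmx1C. Qed.

Lemma mG_measurable_G : measurable (G : set (borel 'M[R]_N)).
Proof. exact: borel_closed. Qed.

Lemma mG_bounded (c : R) : (mG [set x : 'M[R]_N | (`|x| < c)%R] < +oo)%E.
Proof.
pose C : set (borel 'M[R]_N) := [set x : 'M[R]_N | G x /\ `|x| <= c].
have cC : @closed 'M[R]_N C.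
  rewrite (_ : C = G `&` (fun x : 'M[R]_N => `|x|) @^-1` [set r | r <= c]); last by [].
  apply: closedI => //; apply: closed_comp; last exact: closed_le.
  by move=> x _; exact: norm_continuous.
have mU : measurable ([set x : 'M[R]_N | `|x| < c] : set (borel 'M[R]_N)).
  exact: (@borel_norm R _ (borel 'M[R]_N) N N id).
apply: (@le_lt_trans _ _ (mG (C `|` ~` G))).
  apply: le_measure; rewrite ?inE//.
    apply: measurableU; [exact: borel_closed|apply: measurableC; exact: mG_measurable_G].
  move=> x /= xc; have [Gx|] := pselect (G x); [by left; split => //; exact: ltW|by right].
apply: le_lt_trans (measureU2 _ _ _) _; first exact: borel_closed.
  by apply: measurableC; exact: mG_measurable_G.
have h0 : mG (~` (G : set (borel 'M[R]_N))) = 0%E by exact: mGC.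
rewrite [X in (_ + X < _)%E]h0 adde0; apply: mGfin; last by move=> x [].
by apply: (@mx_bounded_closed_compact R N N C c) => // x [].
Qed.

Definition Bnear (r : R) : set (borel 'M[R]_N) := [set g : 'M[R]_N | `|g - 1%:M| < r].

Lemma Bnear_measurable r : measurable (Bnear r).
Proof.
apply: (@borel_norm R _ (borel 'M[R]_N) N N (fun x => (x : 'M[R]_N) - 1%:M)).
apply: borel_continuous; have := @continuous_affine R N N N 1%:M 1%:M.
by under eq_fun do rewrite mul1mx.
Qed.

Lemma mG_translate_near g r : G g ->
  mG [set h : 'M[R]_N | `|jinv g *m h - 1%:M| < r] = mG (Bnear r).
Proof. by move=> Gg; rewrite -(mGinv (Ginv Gg) (Bnear_measurable r)). Qed.

(** If the ball were null, so would be all its translates, hence every compact subset of [G],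
    covered by finitely many of them, and finally [G], a countable union of compact sets. *)
Lemma mG_near_gt0 r : 0 < r -> (0 < mG (Bnear r))%E.
Proof.
move=> r0; rewrite lt0e measure_ge0 andbT; apply/negP => /eqP B0; move/eqP: mG0; apply.
pose O (g : 'M[R]_N) : set 'M[R]_N := [set h : 'M[R]_N | `|jinv g *m h - 1%:M| < r].
have oO g : open (O g).
  rewrite (_ : O g = (fun h => jinv g *m h - 1%:M) @^-1` ball 0 r); last first.
    by apply/seteqP; split => h /=; rewrite -ball_normE /= sub0r normrN.
  by apply: open_comp; [move=> x _; exact: continuous_affine|exact: ball_open].
pose C n : set 'M[R]_N := [set x | G x /\ `|x| <= n%:R].
have cC n : compact (C n).
  apply: (@mx_bounded_closed_compact R N N _ n%:R) => [|x []//].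
  rewrite (_ : C n = G `&` (fun x : 'M[R]_N => `|x|) @^-1` [set r | r <= n%:R]); last by [].
  apply: closedI => //; apply: closed_comp; last exact: closed_le.
  by move=> x _; exact: norm_continuous.
have mC n : measurable (C n : set (borel 'M[R]_N)).
  by apply: borel_closed; apply: compact_closed => //; exact: norm_hausdorff.
have C0 n : mG (C n) = 0%E.
  have := cC n; rewrite compact_cover => /(_ 'M[R]_N G O) [].
  - by move=> g _; exact: oO.
  - move=> x [Gx _]; exists x => //; rewrite /O /= jinvK// subrr normr0//.
  move=> D DG CD.
  have mO g : measurable (O g : set (borel 'M[R]_N)) by apply: borel_open; exact: oO.
  apply/eqP; rewrite eq_le measure_ge0 andbT.
  have le1 : (mG (C n) <= mG (\bigcup_(g in [set` D]) (O g : set (borel 'M[R]_N))))%E.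
    by apply: le_measure; rewrite ?inE//; apply: fin_bigcup_measurable => //; exact: finite_fset.
  apply: (le_trans le1).
  apply: (@le_trans _ _ (\sum_(g \in [set` D]) mG (O g))%E).
    apply: (@content_sub_fsum _ _ _ mG _ [set` D] _ (fun g : 'M[R]_N => O g : set (borel 'M[R]_N))) => //.
    by apply: fin_bigcup_measurable => //; exact: finite_fset.
  rewrite fsbig1// => g /= gD; rewrite mG_translate_near// ?B0//.
  by have := DG g gD; rewrite inE.
have -> : G = \bigcup_n C n.
  apply/seteqP; split => [x Gx|x [n _ []]//].
  have := archi_boundP (normr_ge0 x); set n := Num.bound _ => xn.
  by exists n => //; split => //; exact: ltW.
apply/eqP; rewrite eq_le measure_ge0 andbT.
apply: (@le_trans _ _ (\sum_(n <oo) mG (C n))%E).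
  by apply: generalized_Boole_inequality => //; exact: bigcupT_measurable.
by rewrite eseries0.
Qed.

Lemma mG_capG (A : set (borel 'M[R]_N)) : measurable A -> (mG A <= mG (A `&` G))%E.
Proof.
move=> mA; have mGG := mG_measurable_G; apply: (@le_trans _ _ (mG ((A `&` G) `|` ~` G))).
  apply: le_measure; rewrite ?inE//.
    by apply: measurableU; [exact: measurableI|exact: measurableC].
  by move=> x Ax; have [|] := pselect (G x); [left|right].
apply: le_trans (measureU2 _ _ _) _; [exact: measurableI|exact: measurableC|].
have h0 : mG (~` (G : set (borel 'M[R]_N))) = 0%E by exact: mGC.
by rewrite [X in (_ + X)%E]h0 adde0.
Qed.

Lemma Bnear_fin r : (mG (Bnear r) < +oo)%E.
Proof.
apply: (@le_lt_trans _ _ (mG [set x : 'M[R]_N | (`|x| < r + `|1%:M : 'M[R]_N|)%R])).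
  apply: le_measure; rewrite ?inE; [exact: Bnear_measurable|exact: (@borel_norm R _ (borel 'M[R]_N) N N id)|].
  move=> x /= xr; rewrite -(subrK 1%:M x); apply: le_lt_trans (ler_normD _ _) _.
  by rewrite ltrD2r.
exact: mG_bounded.
Qed.

(* Cut a chart of dimension [m] at the identity into [n ^ m] cells: each of
   them lies in a translate of [Bnear (C / n)]. *)
Lemma mG_near_ge (m : nat) (phi : 'I_m -> 'M[R]_N -> R) (delta A c : R) :
  0 < delta -> 0 < A -> 0 < c ->
  (forall i g, G g -> `|g - 1%:M| < delta -> `|phi i g| < A) ->
  (forall g g' (t : R), G g -> G g' -> `|g - 1%:M| < delta -> `|g' - 1%:M| < delta ->
     0 <= t -> (forall i, `|phi i g - phi i g'| <= t) -> `|g - g'| <= c * t) ->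
  exists2 C : R, 0 < C & forall n : nat, (0 < n)%N ->
    1 <= C * n%:R ^+ m * fine (mG (Bnear (C / n%:R))).
Proof.
move=> delta0 A0 c0 hA hc.
have f0 : 0 < fine (mG (Bnear delta)) by rewrite fine_gt0// mG_near_gt0//= Bnear_fin.
set f := fine _ in f0.
pose B := N%:R * (N%:R * (N%:R * `|J| * (delta + `|1%:M : 'M[R]_N|)) * `|J|).
have B0 : 0 <= B by rewrite !mulr_ge0// addr_ge0// ltW.
(* The first summand bounds n times the distance from 1 of g^-1 g' for g, g' in one cell of side 2A
   / n; the second gives C * f >= 1 in the final comparison. *)
pose C := B * (c * (2 * A)) + f^-1 + 1.
have C1 : 0 <= B * (c * (2 * A)) by rewrite mulr_ge0// mulr_ge0 ?(ltW c0)// mulr_ge0 ?(ltW A0).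
have f1 : 0 < f^-1 by rewrite invr_gt0.
have C0 : 0 < C by rewrite /C; lra.
exists C => // n n0; have nR : 0 < n%:R :> R by rewrite ltr0n.
have r0 : 0 < C / n%:R by rewrite divr_gt0.
set r := C / n%:R in r0 *.
pose cell (a : {ffun 'I_m -> 'I_n}) : set 'M[R]_N := [set g | G g /\ `|g - 1%:M| < delta /\
  forall i, (a i)%:R <= (phi i g + A) / (2 * A) * n%:R < (a i).+1%:R].
have cellP a : exists T : set (borel 'M[R]_N),
    [/\ measurable T, cell a `<=` T & (mG T <= mG (Bnear r))%E].
  have [[g [Gg [gd ga]]]|nc] := pselect (exists g, cell a g); last first.
    exists set0; split => //; last by rewrite measure0.
    by move=> g cg; case: nc; exists g.
  exists [set h : 'M[R]_N | `|jinv g *m h - 1%:M| < r]; split.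
  - apply: (@borel_norm R _ (borel 'M[R]_N) N N (fun x => jinv g *m (x : 'M[R]_N) - 1%:M)).
    by apply: borel_continuous; exact: continuous_affine.
  - move=> g' [Gg' [gd' ga']] /=; rewrite -(jinvK Gg) -mulmxBr.
    have gg : `|g' - g| <= c * (2 * A / n%:R).
      apply: hc => // [|i]; first by rewrite !mulr_ge0 ?invr_ge0 ?(ltW nR) ?(ltW A0).
      move: (ga i) (ga' i) => /andP[h1 h2] /andP[h3 h4].
      have q : `|(phi i g' + A) / (2 * A) * n%:R - (phi i g + A) / (2 * A) * n%:R| <= 1.
        move: h1 h2 h3 h4; rewrite -[(a i).+1%:R]natr1 ler_norml.
        move: (_ * n%:R) (_ * n%:R) (nat_of_ord _)%:R => P Q k *; apply/andP; split; lra.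
      have A2 : 0 < 2 * A by lra.
      have -> : phi i g' - phi i g = ((phi i g' + A) / (2 * A) * n%:R - (phi i g + A) / (2 * A) * n%:R) * (2 * A / n%:R).
        by field; rewrite !gt_eqF.
      rewrite normrM (@ger0_norm _ (2 * A / n%:R)) ?divr_ge0 ?(ltW A2) ?(ltW nR)//.
      by rewrite ler_piMl// divr_ge0 ?(ltW A2) ?(ltW nR).
    have g1 : `|g| <= delta + `|1%:M : 'M[R]_N|.
      rewrite -(subrK 1%:M g); apply: le_trans (ler_normD _ _) _.
      by rewrite lerD2r ltW.
    have jg : `|jinv g| <= N%:R * (N%:R * `|J| * (delta + `|1%:M : 'M[R]_N|)) * `|J|.
      apply: le_trans (mx_norm_mul _ _) _; rewrite ler_wpM2r// ler_wpM2l//.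
      apply: le_trans (mx_norm_mul _ _) _; rewrite mx_norm_tr ler_wpM2l// mulr_ge0//.
    apply: (@le_lt_trans _ _ (B * (c * (2 * A / n%:R)))).
      apply: le_trans (mx_norm_mul _ _) _; rewrite /B.
      by apply: ler_pM => //; rewrite ler_wpM2l.
    by rewrite !mulrA /r ltr_pM2r ?invr_gt0// /C -!mulrA; lra.
  - by rewrite mG_translate_near.
have /choice[T hT] := cellP.
have mT a : measurable (T a) by case: (hT a).
have : (mG (Bnear delta) <= \sum_(a : {ffun 'I_m -> 'I_n}) mG (Bnear r))%E.
  apply: le_trans (mG_capG (Bnear_measurable _)) _.
  apply: (@le_trans _ _ (\sum_(a : {ffun 'I_m -> 'I_n}) mG (T a))%E); last first.
    by apply: lee_sum => a _; case: (hT a).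
  apply: measure_le_sum => //.
    by apply: measurableI; [exact: Bnear_measurable|exact: mG_measurable_G].
  move=> g [gd Gg].
  have hk i : (Num.truncn ((phi i g + A) / (2 * A) * n%:R) < n)%N /\
     (Num.truncn ((phi i g + A) / (2 * A) * n%:R))%:R <=
     (phi i g + A) / (2 * A) * n%:R < (Num.truncn ((phi i g + A) / (2 * A) * n%:R)).+1%:R.
    have := hA i g Gg gd; rewrite ltr_norml => /andP[h1 h2].
    have p0 : 0 <= (phi i g + A) / (2 * A) by rewrite divr_ge0//; lra.
    have h3 := truncn_itv (mulr_ge0 p0 (ltW nR)); split => //.
    rewrite -(ltr_nat R); case/andP: h3 => h3 _; apply: (le_lt_trans h3).
    rewrite -[ltRHS]mul1r ltr_pM2r// ltr_pdivrMr; lra.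
  pose a := [ffun i => Ordinal (proj1 (hk i))].
  have Ta : T a g.
    case: (hT a) => _ + _; apply; split => //; split => // i.
    by rewrite ffunE; exact: (proj2 (hk i)).
  by rewrite (bigD1 a)//=; left.
have rfin : mG (Bnear r) \is a fin_num by rewrite ge0_fin_numE// Bnear_fin.
rewrite -(fineK rfin) sumEFin sumr_const card_ffun !card_ord.
have dfin : mG (Bnear delta) \is a fin_num by rewrite ge0_fin_numE// Bnear_fin.
rewrite -(fineK dfin) lee_fin -/f -(mulr_natl _ (n ^ m)) natrX => h.
rewrite -mulrA; apply: (@le_trans _ _ (f^-1 * f)); first by rewrite mulVf// gt_eqF.
apply: ler_pM => //; rewrite ?ltW// /C; lra.
Qed.

Section Spread.
Context d (Om : measurableType d) (P : probability Om R).
Variables (mu : probability (borel 'M[R]_N) R) (c0 : R).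
(** The [h w] are resamplings of one random matrix of law [mu]. Outside an event of probability eta,
    the empirical measure of the points [h w om] has density at most C relative to [mG] at scale r.
    What matters is that C is fixed before delta, hence independent of the scale. *)
Hypothesis spread : forall eta : R, 0 < eta ->
  exists (Q : set Om) (C : R), [/\ measurable Q, (P (~` Q) <= eta%:E)%E, 0 <= C &
    forall delta : R, 0 < delta ->
    exists (r : R) (W : finType) (h : W -> Om -> borel 'M[R]_N),
      [/\ 0 < r <= delta, (0 < #|W|)%N,
          forall w, measurable_fun setT (h w) /\
            (forall A : set (borel 'M[R]_N), measurable A -> mu A = P (h w @^-1` A)),
          forall w om, Q om -> G (h w om) /\ `|h w om : 'M[R]_N| < c0
        & forall om g, Q om -> G g ->
          #|[pred w | `|jinv (h w om) *m g - 1%:M| < r]|%:R <=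
            C * #|W|%:R * fine (mG (Bnear r))]].

Lemma near_subset (x g : 'M[R]_N) r e : G x -> `|x| < c0 -> 0 < r ->
  N%:R * c0 * r <= e -> `|jinv x *m g - 1%:M| < r -> `|g - x| < e \/ g = x.
Proof.
move=> Gx xc r0 h hr; have [->|gx] := eqVneq g x; [by right|left].
have -> : g - x = x *m (jinv x *m g - 1%:M) by rewrite mulmxBr mulmxA mul_jinv// mul1mx mulmx1.
apply: le_lt_trans (mx_norm_mul _ _) _; apply: lt_le_trans h.
have N0 : (0 < N)%N.
  rewrite lt0n; apply: contra_neqN gx => /eqP N0; apply/matrixP => i.
  by have := ltn_ord i; rewrite {2}N0.
have c00 : 0 < c0 by apply: le_lt_trans xc.
rewrite -!mulrA ltr_pM2l ?ltr0n//; apply: (@le_lt_trans _ _ (c0 * `|jinv x *m g - 1%:M|)).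
  by rewrite ler_wpM2r// ltW.
by rewrite ltr_pM2l.
Qed.

(* Average over [w]: mu A is the mean of the P (h w \in A), and for each [om]
   few [h w om] fall in a given small ball. *)
Lemma ac_of_spread (A : set (borel 'M[R]_N)) : measurable A -> mG A = 0%E -> mu A = 0%E.
Proof.
move=> mA A0; apply/eqP; rewrite eq_le measure_ge0 andbT.
apply/lee_addgt0Pr => eps eps0; rewrite add0e.
pose eta := eps / 4; have eta0 : 0 < eta by rewrite divr_gt0.
have [Q [C [mQ PQ C0 hC]]] := spread eta0.
(* Outer regularity is for finite measures, so [mG] is restricted to a ball with room for the points
   [h w om], of norm below c0, and their neighbourhoods of radius at most 1. *)
pose U0 : set (borel 'M[R]_N) := [set x : 'M[R]_N | `|x| < c0 + 1].
have mU0 : measurable U0 by exact: (@borel_norm R _ (borel 'M[R]_N) N N id).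
have U0fin : (mG U0 < +oo)%E by exact: mG_bounded.
pose mG0' := mfrestr mU0 U0fin.
have e0 : 0 < eta / (C + 1) by rewrite divr_gt0// ltr_wpDl.
have [V [oV AV hV]] := @borel_outer_regular R 'M[R]_N mG0' A _ mA e0.
have mV : measurable V by exact: borel_open.
pose V' := V `&` U0; have mV' : measurable V' by exact: measurableI.
have mGV : (mG V' <= (eta / (C + 1))%:E)%E.
  have -> : V' = (V' `&` A) `|` ((V `\` A) `&` U0).
    apply/seteqP; split => [x [Vx Ux]|x [[[]]//|[[Vx _] Ux]]//].
    by have [Ax|nAx] := pselect (A x); [left|right].
  have A0' : mG (V' `&` A) = 0%E.
    apply/eqP; rewrite eq_le measure_ge0 andbT -A0.
    by apply: le_measure; rewrite ?inE//; exact: measurableI.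
  apply: le_trans (measureU2 _ _ _) _.
  - exact: measurableI.
  - by apply: measurableI => //; exact: measurableD.
  - by rewrite [X in (X + _)%E]A0' add0e.
have mGVfin : (mG V' < +oo)%E by apply: le_lt_trans mGV _; rewrite ltry.
pose mGV' := mfrestr mV' mGVfin.
pose Vn n : set (borel 'M[R]_N) := ~` \bigcup_(y in ~` V) (ball (y : 'M[R]_N) n.+1%:R^-1 : set 'M[R]_N).
have mVn n : measurable (Vn n).
  by apply: borel_closed; apply: open_closedC; apply: bigcup_open => y _; exact: ball_open.
have [||n hn] := @nonincreasing_mu_le R _ _ mu (fun n => V `\` Vn n) eta _ _ eta0.
- by move=> n; exact: measurableD.
- move=> m n mn; apply: setDS; apply: subsetC => x [y By xy].
  exists y => //; apply: le_ball xy.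
  by rewrite lef_pV2 ?posrE ?ltr0n// ler_nat ltnS.
have : \bigcap_n (V `\` Vn n) = set0.
  apply/seteqP; split => // x h; have [Bx _] := h 0%N I.
  have /nbhs_ballP[d' /= d0 dB] : nbhs (x : 'M[R]_N) V by exact: open_nbhs_nbhs.
  have [N' _ Ne] := near_infty_natSinv_lt (PosNum d0).
  have [_ /=] := h N' I; apply => -[y nBy xy]; apply: nBy; apply: dB.
  by apply: ball_sym; apply: le_ball xy; apply: ltW; exact: Ne (leqnn N').
move=> cap0; move: hn; rewrite cap0 measure0 add0e => hn.
(* For r <= delta, the translated ball of radius r about a point of [G] that lies in [Vn n] and has
   norm below c0 stays within distance 1/(n + 1), hence in [V]. *)
pose delta := (n.+1%:R^-1 / (N%:R * `|c0| + 1)) : R.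
have delta0 : 0 < delta by rewrite divr_gt0// ?invr_gt0// ltr_wpDl// mulr_ge0.
have [r [W [h [/andP[r0 rd] W0 hW hQ cnt]]]] := hC _ delta0.
have w0 : W by move: W0 => /card_gt0P/sigW[].
have v0 := mG_near_gt0 r0.
have vfin : mG (Bnear r) \is a fin_num by rewrite ge0_fin_numE// Bnear_fin.
pose v := fine (mG (Bnear r)).
have v0' : 0 < v by rewrite -lte_fin fineK.
pose E w : set (Om * borel 'M[R]_N) :=
  [set z | Q z.1 /\ G (z.2) /\ `|jinv (h w z.1) *m (z.2 : 'M[R]_N) - 1%:M| < r].
have mE w : measurable (E w).
  have -> : E w = fst @^-1` Q `&` (snd @^-1` (G : set (borel 'M[R]_N)) `&`
     [set z | `|jinv (h w z.1) *m (z.2 : 'M[R]_N) - 1%:M| < r]) by [].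
  apply: measurableI; first by rewrite -[X in measurable X]setTI; exact: measurable_fst.
  apply: measurableI.
    rewrite -[X in measurable X]setTI; apply: measurable_snd => //; exact: borel_closed.
  apply: (@borel_norm R _ _ N N (fun z : Om * borel 'M[R]_N => jinv (h w z.1) *m (z.2 : 'M[R]_N) - 1%:M)).
  apply: (@measurableT_comp _ _ _ _ _ _ (fun x : borel 'M[R]_N => (x : 'M[R]_N) - 1%:M : borel 'M[R]_N)).
    by apply: borel_continuous; have := @continuous_affine R N N N 1%:M 1%:M; under eq_fun do rewrite mul1mx.
  apply: (@borel_mulmx R _ _ N N N (fun z : Om * borel 'M[R]_N => jinv (h w z.1))); last exact: measurable_snd.
  apply: (@borel_mulmx R _ _ N N N (fun z : Om * borel 'M[R]_N => J *m (h w z.1 : 'M[R]_N)^T) (fun=> J)) => //.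
  apply: (@borel_mulmx R _ _ N N N (fun=> J)) => //; apply: borel_trmx.
  by apply: measurableT_comp; [case: (hW w)|exact: measurable_fst].
have sub om w : Q om -> Vn n (h w om) -> (v%:E <= mGV' (xsection (E w) om))%E.
  move=> Qom Vh; have [Gh hc] := hQ w om Qom.
  rewrite fineK// -(mG_translate_near r Gh).
  have mX : measurable (xsection (E w) om `&` V') by apply: measurableI => //; exact: measurable_xsection.
  have mD : measurable ([set g : 'M[R]_N | `|jinv (h w om) *m g - 1%:M| < r] : set (borel 'M[R]_N)).
    apply: (@borel_norm R _ (borel 'M[R]_N) N N (fun x => jinv (h w om) *m (x : 'M[R]_N) - 1%:M)).
    by apply: borel_continuous; exact: continuous_affine.
  have mC : measurable (~` G : set (borel 'M[R]_N)) by apply: measurableC; exact: mG_measurable_G.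
  apply: (@le_trans _ _ (mG ((xsection (E w) om `&` V') `|` ~` G))).
    apply: le_measure; rewrite ?inE//; first exact: measurableU.
    move=> g /= gD; have [Gg|] := pselect (G g); [left|by right].
    have N0 : 0 < N%:R * `|c0| + 1 by rewrite ltr_wpDl// mulr_ge0.
    have gh : `|g - h w om| < n.+1%:R^-1.
      suff hr : N%:R * c0 * r <= n.+1%:R^-1.
        have [//|->] := @near_subset (h w om) g r (n.+1%:R^-1) Gh hc r0 hr gD.
        by rewrite subrr normr0 invr_gt0.
      apply: (@le_trans _ _ ((N%:R * `|c0| + 1) * r)).
        rewrite ler_pM2r//; apply: ler_wpDr => //.
        by rewrite ler_wpM2l// ler_norm.
      by rewrite mulrC -ler_pdivlMr.
    split; first by apply/xsectionP; split.
    split.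
      apply: contrapT => nV; apply: Vh; exists g => //.
      by rewrite -ball_normE.
    rewrite /U0 /= -(subrK (h w om : 'M[R]_N) g) addrC.
    apply: le_lt_trans (ler_normD _ _) _; apply: ltr_leD => //.
    by apply: le_trans (ltW gh) _; rewrite invf_le1// ler1n.
  apply: le_trans (measureU2 _ _ _) _ => //.
  have h0 : mG (~` (G : set (borel 'M[R]_N))) = 0%E by exact: mGC.
  by rewrite [X in (_ + X)%E]h0 adde0.
have mhV w : measurable (h w @^-1` Vn n).
  by rewrite -[X in measurable X]setTI; apply: (proj1 (hW w)) => //; exact: mVn.
have PE w : (v%:E * P (Q `&` h w @^-1` Vn n) <= \int[mGV']_g P (ysection (E w) g))%E.
  rewrite -(product_swap P mGV' (mE w)).
  have mQh : measurable (Q `&` h w @^-1` Vn n) by exact: measurableI.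
  have -> : (v%:E * P (Q `&` h w @^-1` Vn n) =
      \int[P]_om (v%:E * (\1_(Q `&` h w @^-1` Vn n) om)%:E))%E.
    rewrite ge0_integralZl//; last 2 first.
    - by apply/measurable_EFinP; exact: measurable_indic.
    - by rewrite lee_fin ltW.
    by rewrite integral_indic// setIT.
  apply: ge0_le_integral => //.
  - by move=> om _; rewrite -EFinM lee_fin mulr_ge0// ltW.
  - apply: measurable_funeM; apply/measurable_EFinP; exact: measurable_indic.
  - exact: measurable_fun_xsection.
  - move=> om _; rewrite indicE; case: (boolP (om \in _)) => [|_]; rewrite ?mule0 ?measure_ge0//.
    by rewrite inE mule1 => -[Qom Vh]; exact: sub.
have nW0 : 0 < #|W|%:R :> R by rewrite ltr0n.
have sumE : (\sum_w \int[mGV']_g P (ysection (E w) g) <= (C * #|W|%:R * v)%:E * mG V')%E.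
  rewrite -ge0_integral_sum//; last by move=> w; exact: measurable_fun_ysection.
  have -> : mG V' = mGV' setT by rewrite /mGV' /mfrestr /mrestr /= setTI.
  rewrite -integral_cst//; apply: ge0_le_integral => //.
  - by move=> g _; apply: sume_ge0.
  - by apply: emeasurable_sum => w; exact: measurable_fun_ysection.
  - move=> g _; apply: sum_prob_le => [w|om]; first exact: measurable_ysection.
    have [Qom|nQ] := pselect (Q om); last first.
      rewrite big1; first by rewrite !mulr_ge0// ltW.
      by move=> w _; rewrite indicE memNset// => /ysectionP[].
    have [Gg|nG] := pselect (G g); last first.
      rewrite big1; first by rewrite !mulr_ge0// ltW.
      by move=> w _; rewrite indicE memNset// => /ysectionP[_ []].
    apply: le_trans (cnt om g Qom Gg); rewrite -sum1_card natr_sum [leRHS]big_mkcond/=.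
    apply: ler_sum => w _; rewrite indicE; case: (boolP (om \in _)) => [|_]; last by case: ifP.
    by rewrite inE => /ysectionP [_ [_ hh]]; rewrite inE [X in if X then _ else _]hh.
have muV w : (mu (Vn n) <= P (Q `&` h w @^-1` Vn n) + eta%:E)%E.
  rewrite (proj2 (hW w) _ (mVn n)).
  apply: (@le_trans _ _ (P ((Q `&` h w @^-1` Vn n) `|` ~` Q))).
    apply: le_measure; rewrite ?inE//.
      by apply: measurableU; [exact: measurableI|exact: measurableC].
    by move=> om Vom; have [Qom|] := pselect (Q om); [left|right].
  apply: le_trans (measureU2 _ _ _) _; [exact: measurableI|exact: measurableC|].
  exact: leeD.
have fmuV : mu (Vn n) \is a fin_num by exact: fin_num_measure.
(* Adding over w and dividing by #|W| * v gives mu (Vn n) <= C * mG V' + eta, and mG V' <= eta / (C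
   + 1). *)
have muVn : (mu (Vn n) <= (2 * eta)%:E)%E.
  have h1 : (\sum_(w : W) (v%:E * mu (Vn n)) <= \sum_(w : W) (\int[mGV']_g P (ysection (E w) g) + (v * eta)%:E))%E.
    apply: lee_sum => w _; apply: (@le_trans _ _ (v%:E * (P (Q `&` h w @^-1` Vn n) + eta%:E))%E).
      by rewrite lee_pmul2l// ?lte_fin.
    rewrite ge0_muleDr ?measure_ge0 ?lee_fin ?(ltW eta0)//.
    by rewrite -EFinM leeD2r.
  move: h1; rewrite big_split/=.
  rewrite -(fineK fmuV) -EFinM !sumEFin !sumr_const.
  move=> /le_trans /(_ (leeD sumE (lexx _))).
  move=> /le_trans; have fV : mG V' \is a fin_num by rewrite ge0_fin_numE.
  move: mGV; rewrite -(fineK fV) !lee_fin ler_pdivlMr ?ltr_wpDl// => mGV.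
  rewrite -EFinM -EFinD => /(_ _ (lexx _)); rewrite !lee_fin.
  rewrite -(mulr_natr (v * _)) -(mulr_natr (v * eta)) => h1; set a := fine (mG V') in mGV h1.
  have a0 : 0 <= a by rewrite fine_ge0.
  have : #|W|%:R * v * fine (mu (Vn n)) <= #|W|%:R * v * (C * a + eta) by lra.
  rewrite ler_pM2l ?mulr_gt0//; lra.
apply: (@le_trans _ _ (mu ((V `\` Vn n) `|` Vn n))).
  apply: le_measure; rewrite ?inE//; first by apply: measurableU => //; exact: measurableD.
  by move=> x /AV Vx; have [|] := pselect (Vn n x); [right|left].
apply: le_trans (measureU2 _ _ _) _ => //; first exact: measurableD.
apply: le_trans (leeD hn muVn) _; rewrite -EFinD lee_fin /eta; lra.
Qed.

End Spread.

End HaarRegularity.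

(** * Cayley transforms and strict derivatives *)

Section Cayley.
Variables (R : realFieldType) (n : nat).
Implicit Types x h s : 'M[R]_n.

(** If v x = v with x skew, then v v^T = v x v^T = - v v^T, so v = 0. *)
Lemma skew_unit x : x^T = - x -> 1%:M - x \in unitmx.
Proof.
move=> xT; rewrite -row_free_unit -kermx_eq0; apply/eqP/row_matrixP => i; rewrite row0.
set v := row i _; have : v *m (1%:M - x) = 0 by rewrite -row_mul mulmx_ker row0.
rewrite mulmxBr mulmx1 => /eqP; rewrite subr_eq0 => /eqP vx.
have xv : x *m v^T = - v^T by rewrite {2}vx trmx_mul xT mulNmx opprK.
have : v *m v^T = - (v *m v^T) by rewrite {1}vx -mulmxA xv mulmxN.
move=> /matrixP/(_ 0 0); rewrite [in RHS]mxE => h; apply: sqr_row_eq0; lra.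
Qed.

Definition cay x := invmx (1%:M - x) *m (1%:M + x).

Lemma mul_cay x : x^T = - x -> (1%:M - x) *m cay x = 1%:M + x.
Proof. by move=> xT; rewrite /cay mulmxA mulmxV ?mul1mx// skew_unit. Qed.

Lemma cay_comm x s : x^T = - x -> x *m s = s *m x -> cay x *m s = s *m cay x.
Proof.
move=> xT xs; have u := skew_unit xT.
have h : (1%:M - x) *m s = s *m (1%:M - x) by rewrite mulmxBl mulmxBr mul1mx mulmx1 xs.
rewrite /cay -mulmxA mulmxDl mul1mx xs -{1}(mulmx1 s) -mulmxDr.
apply: (can_inj (mulKmx u)); rewrite mulKVmx// mulmxA h -mulmxA.
by rewrite (mulmxA (1%:M - x)) mulmxV// mul1mx.
Qed.

Lemma cay_orth x : x^T = - x -> (cay x)^T *m cay x = 1%:M.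
Proof.
move=> xT; have u := skew_unit xT; have m := mul_cay xT.
have m' : cay x *m (1%:M - x) = 1%:M + x.
  by rewrite cay_comm // mulmxBl mulmxBr mul1mx mulmx1.
have : (cay x)^T *m (1%:M + x) = 1%:M - x.
  move/(congr1 trmx): m; rewrite trmx_mul linearB (linearD _ 1%:M x) /= !trmx1 xT opprK //.
rewrite -{1}m' mulmxA => /(congr1 (fun A => A *m invmx (1%:M - x))); by rewrite mulmxK// mulmxV.
Qed.

Lemma cayE x : x^T = - x -> cay x = 1%:M + x *m (1%:M + cay x).
Proof.
move=> /mul_cay; rewrite mulmxBl mul1mx => /eqP; rewrite subr_eq => /eqP {1}->.
by rewrite mulmxDr mulmx1 addrA.
Qed.

Lemma cay0 : cay 0 = 1%:M.
Proof. by rewrite cayE ?mul0mx ?addr0// trmx0 oppr0. Qed.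

(** The inverse transform is x = (h - 1)(1 + h)^-1, available exactly when -1 is not an eigenvalue
    of h. As a rational function of h it commutes with whatever h commutes with. *)
Lemma cay_surj h : h *m h^T = 1%:M -> 1%:M + h \in unitmx ->
  exists x, [/\ x^T = - x, cay x = h & forall s, h *m s = s *m h -> x *m s = s *m x].
Proof.
move=> hh u; have hth := mulmx1C hh.
pose x := (h - 1%:M) *m invmx (1%:M + h).
have xh : x *m (1%:M + h) = h - 1%:M by rewrite mulmxKV.
have cm : (1%:M + h) *m (h - 1%:M) = (h - 1%:M) *m (1%:M + h).
  rewrite (mulmxDl _ _ (h - 1%:M)) (mulmxBl _ _ (1%:M + h)) !mulmxBr !mulmxDr !mul1mx !mulmx1.
  by apply/matrixP => i j; rewrite !mxE; ring.
have hx : (1%:M + h) *m x = h - 1%:M by rewrite mulmxA cm mulmxK.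
have uT : 1%:M + h^T \in unitmx by rewrite -(trmx1 R n) -linearD unitmx_tr.
have xT : x^T = - x.
  apply: (can_inj (mulKmx uT)).
  have -> : (1%:M + h^T) *m x^T = h^T - 1%:M.
    by move/(congr1 trmx): xh; rewrite trmx_mul linearD linearB /= trmx1.
  have -> : 1%:M + h^T = h^T *m (1%:M + h) by rewrite mulmxDr mulmx1 hth addrC.
  by rewrite mulmxN -mulmxA hx mulmxBr mulmx1 hth opprB.
exists x; split => //.
  apply: (can_inj (mulKmx (skew_unit xT))); rewrite mul_cay//.
  apply: (can_inj (mulmxK u)); rewrite mulmxDl xh mul1mx -mulmxA.
  have -> : h *m (1%:M + h) = (1%:M + h) *m h by rewrite mulmxDl mulmxDr mul1mx mulmx1.
  rewrite mulmxA mulmxBl xh mul1mx (_ : _ - (h - 1%:M) = 1%:M + 1%:M); last first.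
    by apply/matrixP => i j; rewrite !mxE; ring.
  by rewrite mulmxDl mul1mx; apply/matrixP => i j; rewrite !mxE; ring.
move=> s hs; apply: (can_inj (mulmxK u)).
have us : (1%:M + h) *m s = s *m (1%:M + h) by rewrite mulmxDl mulmxDr mul1mx mulmx1 hs.
rewrite -mulmxA -us mulmxA xh -mulmxA xh.
by rewrite mulmxBl mulmxBr mul1mx mulmx1 hs.
Qed.

End Cayley.

Section CayleyAnalysis.
Variables (R : realType) (n : nat) (E : 'M[R]_n).
Hypothesis ET : E^T = - E.

Let sT (t : R) : (t *: E)^T = - (t *: E).
Proof. by rewrite linearZ /= ET scalerN. Qed.

Let C (t : R) := cay (t *: E).
Let a := n%:R * `|E|.
Let a0 : 0 <= a. Proof. by rewrite mulr_ge0. Qed.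

Let C1 t : `|1%:M + C t| <= 2.
Proof.
apply: le_trans (ler_normD _ _) _; rewrite [leRHS](_ : 2 = 1 + 1)//.
by apply: lerD; apply: orth_norm; rewrite ?trmx1 ?mul1mx//; exact: cay_orth.
Qed.

(** The difference of the equations C = 1 + t E (1 + C) at t and s. Solved for C t - C s it gives
    continuity; for small s its last term is an error of second order. *)
Let C_sub t s : C t - C s = (t - s) *: (E *m (1%:M + C t)) + s *: (E *m (C t - C s)).
Proof.
rewrite {1}/C cayE// -/(C t) [X in _ - X]/C cayE// -/(C s).
rewrite -!scalemxAl !mulmxDr mulmxN !mulmx1 !scalerDr !scalerBl scalerN.
move: (t *: E) (t *: (E *m C t)) (s *: E) (s *: (E *m C t)) (s *: (E *m C s)) => x y z u v.
by rewrite opprD; apply/matrixP => i j; rewrite !mxE; ring.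
Qed.

Lemma cay_continuous : continuous (fun t : R => cay (t *: E)).
Proof.
move=> s; have key t : C t - C s = (t - s) *: (invmx (1%:M - s *: E) *m (E *m (1%:M + C t))).
  apply: (can_inj (mulKmx (skew_unit (sT s)))).
  rewrite -scalemxAr mulmxA mulmxV ?skew_unit// mul1mx mulmxBl mul1mx -scalemxAl.
  by rewrite {1}C_sub addrK.
apply/cvgrPdist_lt => e e0; near=> t.
rewrite distrC [X in `|X|]key normrZ.
pose b := n%:R * `|invmx (1%:M - s *: E)| * (a * 2) + 1.
have b0 : 0 < b by rewrite ltr_wpDl// !mulr_ge0.
apply: (@le_lt_trans _ _ (`|t - s| * b)).
  rewrite ler_wpM2l//; apply: le_trans (mx_norm_mul _ _) _; apply: ler_wpDr => //.
  rewrite ler_wpM2l ?mulr_ge0//; apply: le_trans (mx_norm_mul _ _) _.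
  by rewrite ler_wpM2l.
rewrite -ltr_pdivlMr// distrC; near: t; exists (e / b) => //=.
by rewrite divr_gt0// ltr_wpDl// !mulr_ge0.
Unshelve. all: by end_near. Qed.

Lemma cay_strict (eta : R) : 0 < eta -> exists2 delta : R, 0 < delta &
  forall t s, `|t| < delta -> `|s| < delta ->
  `|cay (t *: E) - cay (s *: E) - (2 * (t - s)) *: E| <= eta * `|t - s|.
Proof.
move=> eta0; pose d1 := (2 * (a + 1))^-1; pose d2 := eta / (6 * a ^+ 2 + 1).
have a1 : 0 < 2 * (a + 1) by rewrite mulr_gt0// ltr_wpDl.
have a2 : 0 < 6 * a ^+ 2 + 1 by rewrite ltr_wpDl// mulr_ge0// sqr_ge0.
have d10 : 0 < d1 by rewrite invr_gt0.
have d20 : 0 < d2 by rewrite divr_gt0.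
exists (Num.min d1 d2); first by rewrite lt_min d10.
move=> t s; rewrite !lt_min => /andP[_ t2] /andP[s1 s2].
have as1 : a * `|s| <= 1 / 2.
  move: s1; rewrite /d1 -[X in _ < X]div1r ltr_pdivlMr// => h; have := normr_ge0 s.
  by move=> s0; nra.
have EC t' : `|E *m (1%:M + C t')| <= a * 2.
  by apply: le_trans (mx_norm_mul _ _) _; rewrite ler_wpM2l.
have Cs : `|C t - C s| <= 4 * a * `|t - s|.
  have : `|C t - C s| <= `|t - s| * (a * 2) + `|s| * (a * `|C t - C s|).
    rewrite {1}C_sub; apply: le_trans (ler_normD _ _) _; rewrite !normrZ; apply: lerD.
      by rewrite ler_wpM2l.
    by rewrite ler_wpM2l// ; exact: mx_norm_mul.
  have := normr_ge0 (C t - C s); have := normr_ge0 (t - s) => h1 h2 h3.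
  have : a * `|s| * `|C t - C s| <= 1 / 2 * `|C t - C s| by rewrite ler_wpM2r.
  nra.
have Ct1 : `|C t - 1%:M| <= `|t| * (a * 2).
  by rewrite {1}/C (cayE (sT t)) addrAC subrr add0r -scalemxAl normrZ ler_wpM2l// -/(C t).
have -> : cay (t *: E) - cay (s *: E) - (2 * (t - s)) *: E =
    (t - s) *: (E *m (C t - 1%:M)) + s *: (E *m (C t - C s)).
  rewrite -/(C t) -/(C s) {1}C_sub addrAC; congr (_ + _).
  rewrite mulrC -scalerA -scalerBr; congr (_ *: _).
  by rewrite mulmxDr mulmxBr mulmx1; apply/matrixP => i j; rewrite !mxE; ring.
apply: (@le_trans _ _ (`|t - s| * (a * (`|t| * (a * 2))) + `|s| * (a * (4 * a * `|t - s|)))).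
  apply: le_trans (ler_normD _ _) _; rewrite !normrZ; apply: lerD.
    by rewrite ler_wpM2l//; apply: le_trans (mx_norm_mul _ _) _; rewrite ler_wpM2l.
  by rewrite ler_wpM2l//; apply: le_trans (mx_norm_mul _ _) _; rewrite ler_wpM2l.
rewrite (_ : _ + _ = (2 * a ^+ 2 * `|t| + 4 * a ^+ 2 * `|s|) * `|t - s|); last by ring.
rewrite ler_wpM2r//.
have d2a : d2 * (6 * a ^+ 2 + 1) = eta by rewrite divfK// gt_eqF.
have a3 : 0 <= a ^+ 2 by exact: sqr_ge0.
have : a ^+ 2 * `|t| <= a ^+ 2 * d2 by rewrite ler_wpM2l// ltW.
have : a ^+ 2 * `|s| <= a ^+ 2 * d2 by rewrite ler_wpM2l// ltW.
nra.
Qed.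

End CayleyAnalysis.

Section StrictDerivative.
Variables (R : realType) (M : nat).
Implicit Types w : 'rV[R]_M.

(** Strict differentiability at 0, with partial derivatives [D]. Since two arbitrary points near 0
    are compared, independent derivatives yield a lower bound for |F w - F w'|. *)
Definition strict m n (F : 'rV[R]_M -> 'M[R]_(m, n)) (D : 'I_M -> 'M[R]_(m, n)) :=
  forall eta : R, 0 < eta -> exists2 delta : R, 0 < delta &
  forall w w', `|w| < delta -> `|w'| < delta ->
    `|F w - F w' - \sum_b (w 0 b - w' 0 b) *: D b| <= eta * `|w - w'|.

Lemma strict_cst m n (A : 'M[R]_(m, n)) : strict (fun=> A) (fun=> 0).
Proof.
move=> eta eta0; exists 1 => // w w' _ _.
by rewrite big1 ?subr0 ?subrr ?normr0 ?mulr_ge0 ?(ltW eta0)// => b _; rewrite scaler0.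
Qed.

Lemma strict_cay n (E : 'M[R]_n) (c : 'I_M) : E^T = - E ->
  strict (fun w => cay (w 0 c *: E)) (fun b => (2 *+ (b == c)) *: E).
Proof.
move=> ET eta eta0; have [delta d0 h] := cay_strict ET eta0.
exists delta => // w w' wd wd'.
rewrite (bigD1 c)//= big1 ?addr0 => [|b /negPf ->]; last by rewrite scale0r scaler0.
rewrite eqxx scalerA mulrC; apply: (le_trans (h _ _ _ _)).
- by apply: le_lt_trans wd; exact: mx_entry_le.
- by apply: le_lt_trans wd'; exact: mx_entry_le.
rewrite ler_wpM2l ?(ltW eta0)//.
by have := mx_entry_le (w - w') 0 c; rewrite !mxE.
Qed.

Lemma strict_lip m n (F : 'rV[R]_M -> 'M[R]_(m, n)) D : strict F D ->
  exists2 c : R, 0 < c & exists2 delta : R, 0 < delta &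
  forall w w', `|w| < delta -> `|w'| < delta -> `|F w - F w'| <= c * `|w - w'|.
Proof.
move=> /(_ 1 ltr01)[delta d0 h]; exists (1 + \sum_b `|D b|).
  by rewrite ltr_pwDl// sumr_ge0.
exists delta => // w w' wd wd'; have := h _ _ wd wd'; set S := \sum_b _ => hS.
rewrite -(subrK S (F w - F w')); apply: le_trans (ler_normD _ _) _.
rewrite mulrDl; apply: lerD => //; apply: le_trans (ler_norm_sum _ _ _) _.
rewrite mulr_suml; apply: ler_sum => b _; rewrite normrZ mulrC ler_wpM2l//.
by have := mx_entry_le (w - w') 0 b; rewrite !mxE.
Qed.

Lemma strict_mul m n p (F : 'rV[R]_M -> 'M[R]_(m, n)) (G : 'rV[R]_M -> 'M[R]_(n, p)) D D' :
  strict F D -> strict G D' ->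
  strict (fun w => F w *m G w) (fun b => D b *m G 0 + F 0 *m D' b).
Proof.
move=> sF sG eta eta0.
have [cF cF0 [dF dF0 lF]] := strict_lip sF.
have [cG cG0 [dG dG0 lG]] := strict_lip sG.
pose sD := \sum_b `|D b|; pose sD' := \sum_b `|D' b|.
pose B := n%:R + cF + cG + `|F 0| + `|G 0| + sD + sD' + 1.
have [n0 sD0 sD0'] : [/\ 0 <= n%:R :> R, 0 <= sD & 0 <= sD'] by split; rewrite ?sumr_ge0.
have [F00 G00] := (normr_ge0 (F 0), normr_ge0 (G 0)).
have B0 : 0 < B by rewrite /B; lra.
(* The error of the product splits into four terms, each at most e B^3 |w - w'| = (eta / 8) |w -
   w'|. *)
have e0 : 0 < eta / (8 * B ^+ 3) by rewrite divr_gt0// !mulr_gt0// exprn_gt0.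
set e := eta / (8 * B ^+ 3) in e0; have eB : e * B ^+ 3 * 8 = eta.
  by rewrite /e -mulrA [_ * 8]mulrC divfK// gt_eqF// mulr_gt0// exprn_gt0.
have [d1 d10 h1] := sF _ e0; have [d2 d20 h2] := sG _ e0.
exists (Num.min d1 (Num.min d2 (Num.min dF (Num.min dG (Num.min e B^-1))))).
  by rewrite !lt_min d10 d20 dF0 dG0 e0 invr_gt0 B0.
move=> w w'; rewrite !lt_min => /and5P[w1 w2 wF wG /andP[we wB]].
move=> /and5P[w1' w2' wF' wG' /andP[we' wB']].
have [z1 zG] : `|0 : 'rV[R]_M| < dF /\ `|0 : 'rV[R]_M| < dG by rewrite normr0.
have mul_le a b c (A : 'M[R]_(m, n)) (A' : 'M[R]_(n, p)) : 0 <= a -> 0 <= b ->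
    `|A| <= a -> `|A'| <= b -> B * (a * b) <= c -> `|A *m A'| <= c.
  move=> a0 b0 Aa Ab; apply: le_trans; apply: le_trans (mx_norm_mul _ _) _.
  by rewrite -mulrA; apply: ler_pM => //; rewrite ?mulr_ge0//; [rewrite /B; lra|apply: ler_pM].
have lin k l (Q : 'I_M -> 'M[R]_(k, l)) : \sum_b `|Q b| <= B ->
    `|\sum_b (w 0 b - w' 0 b) *: Q b| <= B * `|w - w'|.
  move=> QB; apply: le_trans (ler_norm_sum _ _ _) _.
  apply: (@le_trans _ _ (\sum_b `|Q b| * `|w - w'|)); last by rewrite -mulr_suml ler_wpM2r.
  apply: ler_sum => b _; rewrite normrZ mulrC ler_wpM2l//.
  by have := mx_entry_le (w - w') 0 b; rewrite !mxE.
set h := `|w - w'| in lin *; have h0 : 0 <= h by exact: normr_ge0.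
set LF := \sum_b (w 0 b - w' 0 b) *: D b; set LG := \sum_b (w 0 b - w' 0 b) *: D' b.
have -> : F w *m G w - F w' *m G w' - \sum_b (w 0 b - w' 0 b) *: (D b *m G 0 + F 0 *m D' b) =
    (F w - F w' - LF) *m G w + LF *m (G w - G 0) + F w' *m (G w - G w' - LG)
    + (F w' - F 0) *m LG.
  have -> : \sum_b (w 0 b - w' 0 b) *: (D b *m G 0 + F 0 *m D' b) = LF *m G 0 + F 0 *m LG.
    rewrite mulmx_suml mulmx_sumr -big_split; apply: eq_bigr => b _.
    by rewrite scalerDr scalemxAl scalemxAr.
  rewrite !(mulmxBl, mulmxBr).
  by apply/matrixP => i j; rewrite !mxE; ring.
have Gw : `|G w| <= B.
  rewrite -(subrK (G 0) (G w)); apply: le_trans (ler_normD _ _) _.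
  have : `|G w - G 0| <= cG * B^-1.
    apply: le_trans (lG _ _ wG zG) _; rewrite subr0 ler_wpM2l ?ltW//.
  have : cG * B^-1 <= 1 by rewrite ler_pdivrMr// mul1r /B; lra.
  rewrite /B; lra.
have Fw : `|F w'| <= B.
  rewrite -(subrK (F 0) (F w')); apply: le_trans (ler_normD _ _) _.
  have : `|F w' - F 0| <= cF * B^-1.
    apply: le_trans (lF _ _ wF' z1) _; rewrite subr0 ler_wpM2l ?ltW//.
  have : cF * B^-1 <= 1 by rewrite ler_pdivrMr// mul1r /B; lra.
  rewrite /B; lra.
have Gw0 : `|G w - G 0| <= B * e.
  apply: le_trans (lG _ _ wG zG) _; rewrite subr0; apply: ler_pM => //; rewrite ?ltW//.
  rewrite /B; lra.
have Fw0 : `|F w' - F 0| <= B * e.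
  apply: le_trans (lF _ _ wF' z1) _; rewrite subr0; apply: ler_pM => //; rewrite ?ltW//.
  rewrite /B; lra.
have LFh : `|LF| <= B * h by apply: lin; rewrite -/sD /B; lra.
have LGh : `|LG| <= B * h by apply: lin; rewrite -/sD' /B; lra.
have Bh : 0 <= B * h by rewrite mulr_ge0// ltW.
have Be : 0 <= B * e by rewrite mulr_ge0// ltW.
have eh : 0 <= e * h by rewrite mulr_ge0// ltW.
have B1 : 1 <= B by rewrite /B; lra.
have q0 : e * B ^+ 3 * h * 8 = eta * h by rewrite -eB; ring.
have q1 : B * (e * h * B) <= e * B ^+ 3 * h.
  rewrite (_ : e * B ^+ 3 * h = B * (B * (e * h * B))); last by ring.
  by rewrite ler_peMl// mulr_ge0 ?(ltW B0)// mulr_ge0 ?(ltW B0).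
have t1 := mul_le _ _ _ _ _ eh (ltW B0) (h1 _ _ w1 w1') Gw q1.
have q2 : B * (B * h * (B * e)) <= e * B ^+ 3 * h by rewrite le_eqVlt; apply/orP; left; apply/eqP; ring.
have t2 := mul_le _ _ _ _ _ Bh Be LFh Gw0 q2.
have q3 : B * (B * (e * h)) <= e * B ^+ 3 * h by rewrite [B * (e * h)]mulrC.
have t3 := mul_le _ _ _ _ _ (ltW B0) eh Fw (h2 _ _ w2 w2') q3.
have q4 : B * (B * e * (B * h)) <= e * B ^+ 3 * h by rewrite [B * e * _]mulrC.
have t4 := mul_le _ _ _ _ _ Be Bh Fw0 LGh q4.
apply: le_trans (ler_normD _ _) _; have := ler_normD ((F w - F w' - LF) *m G w + LF *m (G w - G 0)) (F w' *m (G w - G w' - LG)).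
have := ler_normD ((F w - F w' - LF) *m G w) (LF *m (G w - G 0)).
have : 0 <= e * B ^+ 3 * h by rewrite mulr_ge0// mulr_ge0 ?exprn_ge0 ?ltW.
rewrite -q0; lra.
Qed.

Lemma strict_bigmul n (I : Type) (r : seq I) (F : I -> 'rV[R]_M -> 'M[R]_n)
    (D : I -> 'I_M -> 'M[R]_n) :
  (forall i, strict (F i) (D i)) -> (forall i, F i 0 = 1%:M) ->
  strict (fun w => \big[mulmx/1%:M]_(i <- r) F i w) (fun b => \sum_(i <- r) D i b).
Proof.
move=> sF F0; elim: r => [|i r IH].
  have -> : (fun w => \big[mulmx/1%:M]_(i <- [::]) F i w) = fun=> 1%:M.
    by apply/funext => w; rewrite big_nil.
  have -> : (fun b => \sum_(i <- [::]) D i b) = fun=> 0.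
    by apply/funext => b; rewrite big_nil.
  exact: strict_cst.
have := strict_mul (sF i) IH; congr strict; apply/funext => w; rewrite big_cons//.
rewrite F0 mul1mx (eq_bigr (fun=> 1%:M))//.
rewrite (_ : \big[mulmx/1%:M]_(_ <- r) 1%:M = 1%:M) ?mulmx1//.
by elim: r {IH} => [|? ? IH']; rewrite ?big_nil ?big_cons ?mul1mx.
Qed.

End StrictDerivative.

(** A free sequence in [V] of maximal length works, since a vector of [V] outside its span would
    extend it. *)
Lemma exists_free_seq (F : fieldType) (vT : vectType F) (V : set vT) :
  exists X : seq vT, [/\ free X, forall x, x \in X -> V x & forall v, V v -> v \in <<X>>%VS].
Proof.
pose P k := `[< exists X : seq vT, [/\ free X, forall x, x \in X -> V x & size X = k] >].
have P0 : exists k, P k by exists 0%N; apply/asboolP; exists [::]; rewrite nil_free.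
have Pub k : P k -> (k <= \dim {:vT})%N.
  by move=> /asboolP [X [fX _ <-]]; rewrite -(eqnP fX) dimvS// subvf.
case: (ex_maxnP P0 Pub) => k /asboolP [X [fX XV sX]] kmax.
exists X; split => // v Vv; apply: contraT => nv.
have /kmax : P (size (v :: X)).
  apply/asboolP; exists (v :: X); split => //; first by rewrite free_cons nv.
  by move=> x; rewrite inE => /orP[/eqP ->|/XV].
by rewrite /= sX ltnn.
Qed.

Lemma linear_form_bound (R : realType) m n (f : {linear 'M[R]_(m, n) -> R^o}) :
  exists2 C : R, 0 < C & forall v, `|f v| <= C * `|v|.
Proof.
exists (\sum_i \sum_j `|f (delta_mx i j)| + 1).
  by rewrite ltr_wpDl// sumr_ge0// => i _; exact: sumr_ge0.
move=> v; rewrite {1}(matrix_sum_delta v) linear_sum.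
apply: (@le_trans _ _ ((\sum_i \sum_j `|f (delta_mx i j)|) * `|v|)); last first.
  by rewrite ler_wpM2r// ler_wpDr.
rewrite mulr_suml; apply: le_trans (ler_norm_sum _ _ _) _; apply: ler_sum => i _.
rewrite linear_sum mulr_suml; apply: le_trans (ler_norm_sum _ _ _) _; apply: ler_sum => j _.
by rewrite linearZ normrM mulrC ler_wpM2l// mx_entry_le.
Qed.

(** Overwriting the coordinates in the range of [c] by an arbitrary k-tuple is injective on pairs:
    the tuple is read off on that range, and the element of [S] is determined by the remaining
    coordinates. *)
Lemma card_separated_fibres (M n k : nat) (c : 'I_k -> 'I_M) (S : pred {ffun 'I_M -> 'I_n}) :
  injective c ->
  (forall w w', S w -> S w' -> (forall b, b \notin codom c -> w b = w' b) -> w = w') ->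
  (#|S| * n ^ k <= n ^ M)%N.
Proof.
move=> ci hS.
pose phi (z : {ffun 'I_M -> 'I_n} * {ffun 'I_k -> 'I_n}) : {ffun 'I_M -> 'I_n} :=
  [ffun b => if [pick j | c j == b] is Some j then z.2 j else z.1 b].
have phic z j : phi z (c j) = z.2 j.
  by rewrite ffunE; case: pickP => [j' /eqP /ci ->//|/(_ j)]; rewrite eqxx.
have phin z b : b \notin codom c -> phi z b = z.1 b.
  move=> nb; rewrite ffunE; case: pickP => // j /eqP cj.
  by case/negP: nb; rewrite -cj codom_f.
have <- : #|[predX S & {ffun 'I_k -> 'I_n}]| = (#|S| * n ^ k)%N.
  by rewrite cardX card_ffun !card_ord.
have <- : #|{ffun 'I_M -> 'I_n}| = (n ^ M)%N by rewrite card_ffun !card_ord.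
rewrite -(@card_in_image _ _ phi) ?max_card// => -[w a] [w' a'] /andP[/= Sw _] /andP[/= Sw' _] e.
have ea : a = a' by apply/ffunP => j; rewrite -(phic (w, a)) e phic.
by congr (_, _) => //; apply: hS => // b nb; rewrite -(phin (w, a))// e phin.
Qed.

(** When only the coordinates [c j] vary, the linear part is a combination of free vectors, so dual
    coordinates bound |w - w'| by C |L|; the strict error absorbs half of this. A single integer
    serves as constant and as inverse radius, so that countably many cases exhaust all F. *)
Lemma strict_lower (R : realType) M m n (F : 'rV[R]_M -> 'M[R]_(m, n)) D
    k (Y : k.-tuple 'M[R]_(m, n)) (c : 'I_k -> 'I_M) :
  strict F D -> free Y -> injective c -> (forall j, D (c j) = Y`_j) ->
  exists2 j0 : nat, (0 < j0)%N & forall w w' : 'rV[R]_M,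
    `|w| <= j0%:R^-1 -> `|w'| <= j0%:R^-1 -> (forall b, b \notin codom c -> w 0 b = w' 0 b) -> `|w - w'| <= j0%:R * `|F w - F w'|.
Proof.
move=> sF fY ci cY.
have [C C0 hC] : exists2 C : R, 0 < C & forall j v, `|coord Y j v| <= C * `|v|.
  have /choice[Cf hCf] : forall j : 'I_k, exists C : R, 0 < C /\ forall v, `|coord Y j v| <= C * `|v|.
    by move=> j; have [C ? ?] := linear_form_bound (coord Y j); exists C.
  exists (\sum_j Cf j + 1); first by rewrite ltr_wpDl// sumr_ge0// => j _; apply: ltW; case: (hCf j).
  move=> j v; apply: le_trans (proj2 (hCf j) v) _; rewrite ler_wpM2r//.
  rewrite (bigD1 j)//= -addrA ler_wpDr// ?addr_ge0// sumr_ge0// => i _; apply: ltW; case: (hCf i) => //.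
have e0 : 0 < (2 * C)^-1 by rewrite invr_gt0 mulr_gt0.
have [delta d0 h] := sF _ e0.
pose j0 := (Num.truncn (2 * C) + Num.truncn delta^-1).+1.
have j01 : 2 * C <= j0%:R.
  have := truncn_itv (ltW (mulr_gt0 (ltr0n R 2) C0)) => /andP[_ /ltW q].
  by apply: le_trans q _; rewrite ler_nat /j0 ltnS leq_addr.
have j02 : j0%:R^-1 < delta.
  have di : 0 < delta^-1 by rewrite invr_gt0.
  rewrite invf_plt ?posrE ?ltr0n//; have := truncn_itv (ltW di) => /andP[_ q].
  by apply: lt_le_trans q _; rewrite ler_nat /j0 ltnS leq_addl.
exists j0 => // w w' wd wd' ww.
have := h w w' (le_lt_trans wd j02) (le_lt_trans wd' j02); set L := \sum_b _ => hL.
have LE : L = \sum_j (w 0 (c j) - w' 0 (c j)) *: Y`_j.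
  rewrite /L (bigID (fun b => b \in codom c))/= addrC big1 ?add0r; last first.
    by move=> b nb; rewrite ww// subrr scale0r.
  rewrite (eq_bigl [in c @: 'I_k]) ?big_imset => [|i j _ _ /ci//|b].
    by apply: eq_bigr => j _; rewrite cY.
  by apply/idP/imsetP => [/codomP[j ->]|[j _ ->]]; [exists j|exact: codom_f].
have hw : `|w - w'| <= C * `|L|.
  apply: mx_norm_le => [|i b]; first by rewrite mulr_ge0// ltW.
  rewrite !mxE (ord1 i); have [/codomP[j ->]|nb] := boolP (b \in codom c); last first.
    by rewrite ww// subrr normr0 mulr_ge0// ltW.
  by rewrite -(coord_sum_free (fun j => w 0 (c j) - w' 0 (c j)) j fY) -LE.
have : `|L| <= `|F w - F w'| + (2 * C)^-1 * `|w - w'|.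
  rewrite -[L](subKr (F w - F w')); apply: le_trans (ler_normB _ _) _; exact: lerD.
move=> /(ler_wpM2l (ltW C0)); rewrite mulrDr mulrA invfM mulrCA mulfV ?gt_eqF// mulr1 => hL'.
have : 2 * C * `|F w - F w'| <= j0%:R * `|F w - F w'| by rewrite ler_wpM2r.
have := le_trans hw hL'; lra.
Qed.

Lemma eq_integral_off_null d (T : measurableType d) (R : realType) (m : {measure set T -> \bar R})
    (Z : set T) (f g : T -> \bar R) :
  measurable Z -> m (~` Z) = 0%E -> measurable_fun setT f -> measurable_fun setT g ->
  (forall x, (0 <= f x)%E) -> (forall x, (0 <= g x)%E) ->
  (forall x, Z x -> f x = g x) -> (\int[m]_x f x = \int[m]_x g x)%E.
Proof.
move=> mZ m0 mf mg f0 g0 fg; apply: ge0_ae_eq_integral => //.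
exists (~` Z); split => //; first exact: measurableC.
by move=> x /= nfg Zx; apply: nfg => _; exact: fg.
Qed.

Lemma product_invariant d1 d2 (T1 : measurableType d1) (T2 : measurableType d2) (R : realType)
  (m1 : probability T1 R) (m2 : probability T2 R) (f1 : T1 -> T1) (f2 : T2 -> T2) :
  measurable_fun setT f1 -> measurable_fun setT f2 ->
  (forall A, measurable A -> m1 (f1 @^-1` A) = m1 A) ->
  (forall A, measurable A -> m2 (f2 @^-1` A) = m2 A) ->
  forall X, measurable X -> (m1 \x m2)%E ((fun z => (f1 z.1, f2 z.2)) @^-1` X) = (m1 \x m2)%E X.
Proof.
move=> mf1 mf2 i1 i2 X mX.
have mf : measurable_fun setT (fun z : T1 * T2 => (f1 z.1, f2 z.2)).
  apply/measurable_fun_pairP; split.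
    exact: (measurableT_comp mf1 measurable_fst).
  exact: (measurableT_comp mf2 measurable_snd).
have := @product_measure_unique _ _ _ _ _ m1 m2 (pushforward (m1 \x m2)%E (mk_mfun mf)).
move=> h; apply/esym; apply: (h mf) => // A B mA mB; rewrite /pushforward.
change ((m1 \x m2)%E ((f1 @^-1` A) `*` (f2 @^-1` B)) = (m1 A * m2 B)%E).
rewrite product_measure1E; last 2 first.
- by rewrite -[X in measurable X]setTI; exact: mf1.
- by rewrite -[X in measurable X]setTI; exact: mf2.
by congr (_ * _)%E; [exact: i1|exact: i2].
Qed.

(** * Inversion and right translation for the Haar measure of K *)

Section CompactHaar.
Variables (R : realType) (N : nat) (K : set 'M[R]_N).
Hypothesis Kcl : closed K.
Hypothesis Korth : forall k, K k -> k^T *m k = 1%:M.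
Hypothesis Ktr : forall k, K k -> K k^T.
Variable mK : probability (borel 'M[R]_N) R.
Hypothesis mKC : mK (~` K) = 0%E.
Hypothesis mKinv : forall g, K g -> forall A : set (borel 'M[R]_N), measurable A ->
  mK (mulmx g @^-1` A) = mK A.

Let mK_K : measurable (K : set (borel 'M[R]_N)). Proof. exact: borel_closed. Qed.

Lemma measurable_mull (A : 'M[R]_N) :
  measurable_fun setT (fun x : borel 'M[R]_N => A *m (x : 'M[R]_N) : borel 'M[R]_N).
Proof. by apply: (@borel_mulmx _ _ _ _ _ _ (fun=> A) id). Qed.

Lemma measurable_mulr (A : 'M[R]_N) :
  measurable_fun setT (fun x : borel 'M[R]_N => (x : 'M[R]_N) *m A : borel 'M[R]_N).
Proof. by apply: (@borel_mulmx _ _ _ _ _ _ id (fun=> A)). Qed.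

Let pre (f : borel 'M[R]_N -> borel 'M[R]_N) (A : set (borel 'M[R]_N)) :
  measurable_fun setT f -> measurable A -> measurable (f @^-1` A).
Proof. by move=> mf mA; rewrite -[X in measurable X]setTI; exact: mf. Qed.

(** On [K], transposition is inversion. The set of pairs (k, k') with k^-1 k' in [A] is measured in
    both orders: its sections at k are translates of [A], those at k' are translates of the inverse
    of [A]. *)
Lemma haar_trmx (A : set (borel 'M[R]_N)) : measurable A ->
  mK ((fun x : borel 'M[R]_N => (x : 'M[R]_N)^T) @^-1` A) = mK A.
Proof.
move=> mA.
have mtr : measurable_fun setT (fun x : borel 'M[R]_N => (x : 'M[R]_N)^T : borel 'M[R]_N).
  exact: (@borel_trmx _ _ _ _ _ id).
pose D : set (borel 'M[R]_N * borel 'M[R]_N) :=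
  (fun z => (z.1 : 'M[R]_N)^T *m (z.2 : 'M[R]_N) : borel 'M[R]_N) @^-1` A.
have mD : measurable D.
  rewrite -[D]setTI; apply: (_ : measurable_fun setT _) => //.
  apply: (@borel_mulmx _ _ _ _ _ _ (fun z : borel 'M[R]_N * borel 'M[R]_N => (z.1 : 'M[R]_N)^T)) => //.
  by apply: borel_trmx; exact: measurable_fst.
have := product_swap mK mK mD.
have -> : (\int[mK]_x mK (xsection D x) = \int[mK]_x (cst (mK A) x))%E.
  apply: (eq_integral_off_null mK_K mKC) => //; first exact: measurable_fun_xsection.
  move=> k Kk; rewrite -(mKinv (Ktr Kk) mA); congr (mK _).
  by apply/seteqP; split => y; [move=> /xsectionP|move=> h; apply/xsectionP].
have -> : (\int[mK]_y mK (ysection D y) = \int[mK]_y (cst (mK ((fun x : borel 'M[R]_N => (x : 'M[R]_N)^T) @^-1` A)) y))%E.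
  apply: (eq_integral_off_null mK_K mKC) => //; first exact: measurable_fun_ysection.
  move=> k Kk; rewrite -(mKinv (Ktr Kk) (pre mtr mA)); congr (mK _).
  apply/seteqP; split => y /=; rewrite trmx_mul trmxK; first by move=> /ysectionP.
  by move=> h; apply/ysectionP.
have icst (c : \bar R) : (\int[mK]_x (cst c x) = c)%E.
  have h1 : mK [set: borel 'M[R]_N] = 1%E by exact: probability_setT.
  have := integral_cst mK measurableT c; rewrite [X in _ = (_ * X)%E -> _]h1 mule1 => h.
  exact: h.
by rewrite !icst => ->.
Qed.

Lemma haar_mulr g (A : set (borel 'M[R]_N)) : K g -> measurable A ->
  mK ((fun x : borel 'M[R]_N => (x : 'M[R]_N) *m g) @^-1` A) = mK A.
Proof.
move=> Kg mA.
have mtr : measurable_fun setT (fun x : borel 'M[R]_N => (x : 'M[R]_N)^T : borel 'M[R]_N).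
  exact: (@borel_trmx _ _ _ _ _ id).
rewrite -(haar_trmx mA) -(mKinv (Ktr Kg) (pre mtr mA)).
rewrite -(haar_trmx (pre (measurable_mull _) (pre mtr mA))); congr (mK _).
by apply/seteqP; split => y /=; rewrite trmx_mul !trmxK.
Qed.

End CompactHaar.

Lemma measurable_word (R : realType) n (x y : 'M[R]_n) :
  measurable_fun setT (fun om : borel 'M[R]_n * borel 'M[R]_n * borel 'M[R]_n =>
    om.1.1 *m x *m om.1.2 *m y *m om.2 : borel 'M[R]_n).
Proof.
set Om := (_ * _ * _)%type.
apply: (@borel_mulmx _ _ _ _ _ _ (fun om : Om => om.1.1 *m x *m om.1.2 *m y)); last exact: measurable_snd.
apply: (@borel_mulmx _ _ _ _ _ _ (fun om : Om => om.1.1 *m x *m om.1.2) (fun=> y)) => //.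
have m12 : measurable_fun setT (fun om : Om => om.1.2) by apply: measurableT_comp.
apply: (@borel_mulmx _ _ _ _ _ _ (fun om : Om => om.1.1 *m x) (fun om : Om => om.1.2)) => //.
apply: (@borel_mulmx _ _ _ _ _ _ (fun om : Om => om.1.1) (fun=> x)) => //.
by apply: measurableT_comp.
Qed.

(** * Absolute continuity of random words from a submersion *)

Section AbsoluteContinuity.
Variables (R : realType) (N : nat) (J : 'M[R]_N) (G : set 'M[R]_N).
Hypotheses (JT : J^T = J) (JJ : J *m J = 1%:M).
Hypotheses (G1 : G 1%:M) (GM : forall g h, G g -> G h -> G (g *m h)).
Hypotheses (Ginv : forall g, G g -> G (jinv J g)).
Hypotheses (GJ : forall g, G g -> g^T *m J *m g = J).
Hypothesis Gcl : closed G.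
Variable mG : {measure set (borel 'M[R]_N) -> \bar R}.
Hypothesis mGC : mG (~` G) = 0%E.
Hypothesis mGinv : forall g, G g -> forall A : set (borel 'M[R]_N), measurable A ->
  mG (mulmx g @^-1` A) = mG A.
Hypothesis mGfin : forall C : set 'M[R]_N, compact C -> C `<=` G -> (mG C < +oo)%E.
Hypothesis mG0 : mG G != 0%E.
Variable K : set 'M[R]_N.
Hypotheses (Kcl : closed K) (KG : K `<=` G).
Hypothesis Korth : forall k, K k -> k^T *m k = 1%:M.
Hypothesis Ktr : forall k, K k -> K k^T.
Hypotheses (K1 : K 1%:M) (KM : forall g h, K g -> K h -> K (g *m h)).
Variable mK : probability (borel 'M[R]_N) R.
Hypothesis mKC : mK (~` K) = 0%E.
Hypothesis mKinv : forall g, K g -> forall A : set (borel 'M[R]_N), measurable A ->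
  mK (mulmx g @^-1` A) = mK A.
Variables (x y : 'M[R]_N).
Hypotheses (Gx : G x) (Gy : G y).
Variables (m0 : nat) (E : 'I_m0 -> 'M[R]_N).
Hypotheses (ET : forall b, (E b)^T = - E b) (KE : forall b t, K (cay (t *: E b))).
Variables (m : nat) (X : m.-tuple 'M[R]_N).
Hypothesis fX : free X.
(** [X] stands for a basis of the Lie algebra of [G]: near the identity, the coordinates dual to it
    control the distance in [G]. *)
Hypothesis chart : exists delta c : R, [/\ 0 < delta, 0 < c &
  forall g g' (t : R), G g -> G g' -> `|g - 1%:M| < delta -> `|g' - 1%:M| < delta ->
    0 <= t -> (forall i, `|coord X i (g - g')| <= t) -> `|g - g'| <= c * t].
Variable bad : set (borel 'M[R]_N).
Hypotheses (mbad : measurable bad) (bad0 : mK bad = 0%E).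
(** The dual form of surjectivity of the differential: no nonzero Z in the span of [X] is
    trace-orthogonal to the [E b], to their conjugates by x and to those by x l y. *)
Hypothesis nbad : forall l, K l -> ~ bad l -> forall Z, Z \in <<X>>%VS ->
  (forall b, [/\ \tr (Z *m E b) = 0, \tr (jinv J x *m Z *m x *m E b) = 0 &
     \tr (jinv J (x *m l *m y) *m Z *m (x *m l *m y) *m E b) = 0]) -> Z = 0.

Let M := (m0 + (m0 + m0))%N.
Let i1 (b : 'I_m0) : 'I_M := lshift _ b.
Let i2 (b : 'I_m0) : 'I_M := rshift _ (lshift _ b).
Let i3 (b : 'I_m0) : 'I_M := rshift _ (rshift _ b).
(** A product of Cayley factors, one for each generator; [s] selects which of the three groups of m0
    coordinates drives it. *)
Let kap (s : 'I_m0 -> 'I_M) (w : 'rV[R]_M) :=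
  \big[mulmx/1%:M]_(b <- index_enum 'I_m0) cay (w 0 (s b) *: E b).
Let F l w := kap i1 w *m x *m kap i2 w *m l *m y *m kap i3 w.
Let dkap (s : 'I_m0 -> 'I_M) (c : 'I_M) := \sum_(b <- index_enum 'I_m0) (2 *+ (c == s b)) *: E b.
Let D l c := dkap i1 c *m (x *m l *m y) + x *m dkap i2 c *m (l *m y) + x *m l *m y *m dkap i3 c.

Let kap0 s : kap s 0 = 1%:M.
Proof.
rewrite /kap; elim: (index_enum _) => [|b r IH]; rewrite ?big_nil// big_cons IH.
by rewrite mulmx1 mxE scale0r cay0.
Qed.

Let kapK s w : K (kap s w).
Proof.
rewrite /kap; elim: (index_enum _) => [|b r IH]; rewrite ?big_nil// big_cons.
exact: KM.
Qed.

Let strict_kap s : strict (kap s) (dkap s).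
Proof.
apply: strict_bigmul => b; first by apply: strict_cay.
by rewrite mxE scale0r cay0.
Qed.

Let strictF l : strict (F l) (D l).
Proof.
have s1 := strict_mul (strict_kap i1) (strict_cst M x).
have s2 := strict_mul s1 (strict_kap i2).
have s3 := strict_mul s2 (strict_cst M l).
have s4 := strict_mul s3 (strict_cst M y).
have := strict_mul s4 (strict_kap i3); congr strict; apply/funext => c.
rewrite !kap0 !(mulmx0, mul1mx, mulmx1, addr0) !mulmxDl.
by rewrite /D !mulmxA.
Qed.

Let dkapE s b : injective s -> dkap s (s b) = 2 *: E b.
Proof.
move=> si; rewrite /dkap (bigD1 b)//= eqxx big1 ?addr0// => b' nb.
by rewrite (inj_eq si) eq_sym (negPf nb) scale0r.
Qed.

Let dkap_off s c : (forall b, c != s b) -> dkap s c = 0.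
Proof. by move=> h; rewrite /dkap big1// => b _; rewrite (negPf (h b)) scale0r. Qed.

Let i1_inj : injective i1. Proof. exact: lshift_inj. Qed.
Let i2_inj : injective i2. Proof. by move=> b b' /rshift_inj/lshift_inj. Qed.
Let i3_inj : injective i3. Proof. by move=> b b' /rshift_inj/rshift_inj. Qed.

Let D1 l b : D l (i1 b) = 2 *: (E b *m (x *m l *m y)).
Proof.
rewrite /D (dkapE _ i1_inj) !dkap_off ?mulmx0 ?mul0mx ?addr0 -?scalemxAl// => b'; first by rewrite eq_lrshift.
by rewrite eq_lrshift.
Qed.

Let D2 l b : D l (i2 b) = 2 *: (x *m E b *m (l *m y)).
Proof.
rewrite /D (dkapE _ i2_inj) !dkap_off ?mulmx0 ?mul0mx ?addr0 ?add0r -?scalemxAr -?scalemxAl// => b'.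
  by rewrite (inj_eq (@rshift_inj _ _)) eq_lrshift.
by rewrite eq_rlshift.
Qed.

Let D3 l b : D l (i3 b) = 2 *: (x *m l *m y *m E b).
Proof.
rewrite /D (dkapE _ i3_inj) !dkap_off ?mulmx0 ?mul0mx ?addr0 ?add0r -?scalemxAr// => b'.
  by rewrite (inj_eq (@rshift_inj _ _)) eq_rlshift.
by rewrite eq_rlshift.
Qed.

(** Take a maximal free family [Y] of derivatives and pair it with [X] by tr (g^-1 X_i Y_j), g = x l
    y. A row relation of this matrix gives a Z orthogonal to all derivatives; dividing them by g
    turns this into the three conditions of [nbad]. So the rank is m, and [Y] has at least m
    members. *)
Let frame l : K l -> ~ bad l ->
  exists (Y : m.-tuple 'M[R]_N) (c : 'I_m -> 'I_M),
    [/\ free Y, injective c & forall j, D l (c j) = Y`_j].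
Proof.
move=> Kl nl; have [Y [fY YD Yspan]] := exists_free_seq (range (D l)).
pose g := x *m l *m y; have Gg : G g by apply: GM => //; apply: GM => //; exact: KG.
have gj := jinvK JJ GJ Gg; have jg := mul_jinv JJ GJ Gg.
have xj := jinvK JJ GJ Gx; have jx := mul_jinv JJ GJ Gx.
have mY : (m <= size Y)%N.
  pose A := \matrix_(i < m, j < size Y) \tr (jinv J g *m X`_i *m Y`_j).
  suff /eqP <- : row_free A by exact: rank_leq_col.
  rewrite -kermx_eq0; apply/eqP/row_matrixP => i; rewrite row0; set v := row i _.
  have vA : v *m A = 0 by rewrite -row_mul mulmx_ker row0.
  pose Z := \sum_(i < m) v 0 i *: X`_i.
  have ZY W : W \in <<Y>>%VS -> \tr (jinv J g *m Z *m W) = 0.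
    move=> /(coord_span (X := in_tuple Y)) ->; rewrite mulmx_sumr linear_sum big1// => j _.
    rewrite -scalemxAr linearZ /= -mulmxA mulmx_suml mulmx_sumr linear_sum /=.
    have /matrixP/(_ 0 j) := vA; rewrite !mxE => vj.
    set S := \sum_(_ < m) _; suff -> : S = 0 by rewrite mulr0.
    rewrite -[RHS]vj; apply: eq_bigr => k _.
    by rewrite [A k j]mxE -scalemxAl -scalemxAr linearZ /= mulmxA.
  have ZD c : \tr (jinv J g *m Z *m D l c) = 0 by apply: ZY; apply: Yspan; exists c.
  have Z0 : Z = 0.
    apply: (nbad Kl nl) => [|b].
      by apply: memv_suml => k _; apply: memvZ; rewrite memv_span// mem_nth// size_tuple.
    have t1 A' : \tr (jinv J g *m Z *m (A' *m g)) = \tr (Z *m A').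
      by rewrite mxtrace_mulC -mulmxA (mulmxA g) jg mul1mx mxtrace_mulC.
    have n2 : (2 : R) != 0 by rewrite pnatr_eq0.
    split.
    - have := ZD (i1 b); rewrite D1 -scalemxAr linearZ /= => /eqP.
      by rewrite mulf_eq0 (negPf n2)/= => /eqP; rewrite t1.
    - have := ZD (i2 b); rewrite D2 -scalemxAr linearZ /= => /eqP.
      rewrite mulf_eq0 (negPf n2)/= => /eqP.
      have -> : x *m E b *m (l *m y) = x *m E b *m jinv J x *m g.
        rewrite -[RHS]mulmxA; congr (_ *m _).
        by rewrite /g -(mulmxA x) mulmxA xj mul1mx.
      rewrite t1; move: (jinv J x) => j h.
      have : \tr (j *m (Z *m (x *m E b))) = 0 by rewrite mxtrace_mulC -h -!mulmxA.
      by rewrite !mulmxA.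
    - have := ZD (i3 b); rewrite D3 -scalemxAr linearZ /= => /eqP.
      by rewrite mulf_eq0 (negPf n2)/= -/g !mulmxA => /eqP.
  have h := elimT freeP fX (fun k => v 0 k) Z0.
  by apply/rowP => k; rewrite [RHS]mxE h.
have sY : size (take m Y) == m by rewrite size_takel.
have /choice[c hc] : forall j : 'I_m, exists c, D l c = (take m Y)`_j.
  by move=> j; have [|c _ <-] := YD ((take m Y)`_j); [rewrite (mem_take (n0 := m))// mem_nth// (eqP sY)|exists c].
exists (Tuple sY), c; split => //=.
- by apply: (@catl_free _ _ (drop m Y)); rewrite cat_take_drop.
- move=> i j ij; apply/val_inj/eqP; move: (congr1 (D l) ij); rewrite !hc => /eqP.
  by rewrite nth_uniq ?(eqP sY)// take_uniq// free_uniq.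
Qed.

Let Om : Type := ((borel 'M[R]_N * borel 'M[R]_N) * borel 'M[R]_N)%type.
Let P := ((mK \x mK) \x mK)%E.
Let word (om : Om) : borel 'M[R]_N := om.1.1 *m x *m om.1.2 *m y *m om.2.

Variable mu : probability (borel 'M[R]_N) R.
Hypothesis mu_word : forall A, measurable A -> mu A = P (word @^-1` A).

(** The Cayley factors are absorbed into the Haar elements, on the right of the first and on the
    left of the other two, so that the law of [word] is unchanged. *)
Let ins (w : 'rV[R]_M) (om : Om) : Om :=
  (((om.1.1 : 'M[R]_N) *m kap i1 w, kap i2 w *m (om.1.2 : 'M[R]_N)), kap i3 w *m (om.2 : 'M[R]_N)).

Let measurable_word : measurable_fun setT word := measurable_word x y.

Let mins1 w : measurable_fun setT (fun k : borel 'M[R]_N => (k : 'M[R]_N) *m kap i1 w : borel 'M[R]_N).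
Proof. exact: measurable_mulr. Qed.

Let mins2 s w : measurable_fun setT (fun k : borel 'M[R]_N => kap s w *m (k : 'M[R]_N) : borel 'M[R]_N).
Proof. exact: measurable_mull. Qed.

Let ins_inv w A : measurable A -> P (ins w @^-1` A) = P A.
Proof.
apply: (@product_invariant _ _ _ _ _ (mK \x mK)%E mK
  (fun z : borel 'M[R]_N * borel 'M[R]_N => ((z.1 : 'M[R]_N) *m kap i1 w, kap i2 w *m (z.2 : 'M[R]_N)))
  (fun k : borel 'M[R]_N => kap i3 w *m (k : 'M[R]_N))) => //.
- apply/measurable_fun_pairP; split.
    exact: (measurableT_comp (mins1 w) measurable_fst).
  exact: (measurableT_comp (mins2 i2 w) measurable_snd).
- move=> A' mA'; apply: (@product_invariant _ _ _ _ _ mK mK (fun k : borel 'M[R]_N => (k : 'M[R]_N) *m kap i1 w)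
    (fun k : borel 'M[R]_N => kap i2 w *m (k : 'M[R]_N))) => // B mB; last exact: mKinv.
  exact: (haar_mulr Kcl Ktr mKC mKinv).
- by move=> A' mA'; exact: mKinv.
Qed.

Let word_ins w om : word (ins w om) = om.1.1 *m F (om.1.2) w *m om.2.
Proof. by rewrite /word /ins /F /= !mulmxA. Qed.

Let n3 := N%:R ^+ 3 : R.

(** The l for which [F l] separates points with constant 1/(j + 1), along some m coordinates, in the
    ball of radius 1/(j + 1). For each of the finitely many [c] the condition is closed, whence
    measurability, and the sets increase with j. *)
Let Q (j : nat) : set (borel 'M[R]_N) := [set l | K l /\ exists c : {ffun 'I_m -> 'I_M}, injective c /\
  forall w w' : 'rV[R]_M, `|w| <= j.+1%:R^-1 -> `|w'| <= j.+1%:R^-1 ->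
    (forall b, b \notin codom c -> w 0 b = w' 0 b) -> j.+1%:R^-1 * `|w - w'| <= `|F l w - F l w'| ].

Let F_continuous w : continuous (F ^~ w).
Proof.
move=> l; apply: (@continuous_mulmx _ _ _ _ _ (fun l => kap i1 w *m x *m kap i2 w *m l *m y) (fun=> kap i3 w)) => [{}l|]; last exact: cst_continuous.
apply: (@continuous_mulmx _ _ _ _ _ (fun l => kap i1 w *m x *m kap i2 w *m l) (fun=> y)) => [{}l|]; last exact: cst_continuous.
apply: (@continuous_mulmx _ _ _ _ _ (fun=> kap i1 w *m x *m kap i2 w) id) => ?; [exact: cst_continuous|exact: cvg_id].
Qed.

Let mQ j : measurable (Q j).
Proof.
pose Qc (c : {ffun 'I_m -> 'I_M}) : set (borel 'M[R]_N) :=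
  \bigcap_(z in [set z : 'rV[R]_M * 'rV[R]_M | [/\ injective c, `|z.1| <= j.+1%:R^-1, `|z.2| <= j.+1%:R^-1 &
     forall b, b \notin codom c -> z.1 0 b = z.2 0 b]])
    [set l : 'M[R]_N | j.+1%:R^-1 * `|z.1 - z.2| <= `|F l z.1 - F l z.2| ].
have cQ c : @closed 'M[R]_N (Qc c).
  apply: closed_bigI => z _.
  rewrite (_ : mkset _ = (fun l : 'M[R]_N => `|F l z.1 - F l z.2|) @^-1` [set r | j.+1%:R^-1 * `|z.1 - z.2| <= r])//.
  apply: closed_comp; last exact: closed_ge.
  move=> l _; apply: (@continuous_comp _ _ _ (fun l => F l z.1 - F l z.2) (fun x : 'M[R]_N => `|x|)); last exact: norm_continuous.
  by apply: (@continuousB _ _ _ (F ^~ z.1) (F ^~ z.2)); exact: F_continuous.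
have -> : Q j = (K : set (borel 'M[R]_N)) `&` \bigcup_(c in [set c : {ffun 'I_m -> 'I_M} | injective c]) Qc c.
  apply/seteqP; split => l.
    by move=> [Kl [c [ci h]]]; split => //; exists c => //= z [_ z1 z2 z3]; exact: h.
  by move=> [Kl [c ci h]]; split => //; exists c; split => // w w' z1 z2 z3; exact: (h (w, w')).
apply: measurableI; first exact: borel_closed.
apply: fin_bigcup_measurable => [|c _]; first exact: finite_finset.
exact: borel_closed.
Qed.

Let Q_mono j j' : (j <= j')%N -> Q j `<=` Q j'.
Proof.
move=> jj l [Kl [c [ci h]]]; split => //; exists c; split => // w w' hw hw' ww.
have jR : j'.+1%:R^-1 <= j.+1%:R^-1 :> R by rewrite lef_pV2 ?posrE ?ltr0n// ler_nat ltnS.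
apply: le_trans (h w w' (le_trans hw jR) (le_trans hw' jR) ww).
by rewrite ler_wpM2r.
Qed.

Let Q_full l : K l -> ~ bad l -> exists j, Q j l.
Proof.
move=> Kl nl; have [Y [c [fY ci DY]]] := frame Kl nl.
have [j j0 h] := strict_lower (strictF l) fY ci DY.
exists j.-1; split => //; rewrite prednK//; exists [ffun k => c k]; split.
  by move=> a b; rewrite !ffunE => /ci.
move=> w w' hw hw' ww; rewrite ler_pdivrMl ?ltr0n//; apply: h => // b nb; apply: ww.
by apply: contra nb => /codomP[k ->]; rewrite ffunE codom_f.
Qed.

Let Q_large (eta : R) : 0 < eta -> exists j, (mK (~` Q j) <= eta%:E)%E.
Proof.
move=> eta0.
have [||j hj] := @nonincreasing_mu_le R _ _ mK (fun j => ~` Q j) eta _ _ eta0.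
- by move=> j; apply: measurableC; exact: mQ.
- by move=> j j' jj; apply: subsetC; exact: Q_mono.
exists j; apply: le_trans hj _; rewrite -[leRHS]add0e; apply: leeD2r.
have mKK : measurable (~` K : set (borel 'M[R]_N)) by apply: measurableC; exact: borel_closed.
apply: (@le_trans _ _ (mK (~` K `|` bad))).
  apply: le_measure; rewrite ?inE.
  - by apply: bigcapT_measurable => k; apply: measurableC; exact: mQ.
  - exact: measurableU.
  move=> l h; have [Kl|] := pselect (K l); last by left.
  right; apply: contrapT => nl; have [k Qk] := Q_full Kl nl.
  exact: (h k I).
apply: le_trans (measureU2 _ _ _) _ => //.
have h0 : mK (~` (K : set (borel 'M[R]_N))) = 0%E by exact: mKC.
by rewrite [X in (X + _ <= _)%E]h0 [X in (_ + X <= _)%E]bad0 adde0.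
Qed.

Let mul3_norm (a b c : 'M[R]_N) : `|a| <= 1 -> `|c| <= 1 -> `|a *m b *m c| <= N%:R ^+ 2 * `|b|.
Proof.
move=> a1 c1; apply: le_trans (mx_norm_mul _ _) _.
apply: (@le_trans _ _ (N%:R * (N%:R * 1 * `|b|) * 1)); last by rewrite expr2 !mulr1 mulrA.
apply: ler_pM => //; rewrite ler_wpM2l//; apply: le_trans (mx_norm_mul _ _) _.
by rewrite ler_wpM2r// ler_wpM2l.
Qed.

Let c0 := N%:R ^+ 2 * (N%:R ^+ 2 * `|x| * `|y|) * N%:R + 1.

Let word_bound w om : K om.1.1 -> K om.1.2 -> K om.2 ->
  G (word (ins w om)) /\ `|word (ins w om) : 'M[R]_N| < c0.
Proof.
move=> K1' K2' K3'; have Ka : K (om.1.1 *m kap i1 w) by exact: KM.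
have Kb : K (kap i2 w *m om.1.2) by exact: KM.
have Kc : K (kap i3 w *m om.2) by exact: KM.
rewrite /word /ins /=; split.
  apply: GM; last exact: KG.
  apply: GM => //; apply: GM; last exact: KG.
  by apply: GM => //; exact: KG.
set a := _ *m kap i1 w; set b := kap i2 w *m _; set d := kap i3 w *m _.
have n1 k : K k -> `|k| <= 1 by move=> /Korth; exact: orth_norm.
rewrite /c0; apply: (@le_lt_trans _ _ (N%:R ^+ 2 * (N%:R ^+ 2 * `|x| * `|y|) * N%:R)); last by rewrite ltrDl.
have -> : a *m x *m b *m y *m d = a *m (x *m b *m y) *m d by rewrite !mulmxA.
apply: le_trans (mul3_norm _ (n1 _ Ka) (n1 _ Kc)) _; rewrite -mulrA ler_wpM2l ?exprn_ge0//.
apply: le_trans (mx_norm_mul _ _) _.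
rewrite [leRHS](_ : _ = N%:R * (N%:R ^+ 2 * `|x|) * `|y|); last by ring.
rewrite ler_wpM2r// ler_wpM2l//; apply: le_trans (mx_norm_mul _ _) _.
apply: (@le_trans _ _ (N%:R * `|x| * 1)); first by rewrite ler_wpM2l// ?mulr_ge0// n1.
rewrite mulr1 ler_wpM2r// expr2.
have [->|N0] := posnP N; first by rewrite mulr0.
by rewrite ler_peMl// ler1n.
Qed.

Let chart_lower : exists2 C : R, 0 < C & forall n : nat, (0 < n)%N ->
    1 <= C * n%:R ^+ m * fine (mG (Bnear (C / n%:R))).
Proof.
have [delta0 [c [d00 cpos chart']]] := chart.
have [A A0 hA] : exists2 A : R, 0 < A & forall i v, `|coord X i v| <= A * `|v|.
  have /choice[Cf hCf] : forall i : 'I_m, exists C : R, 0 < C /\ forall v, `|coord X i v| <= C * `|v|.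
    by move=> i; have [C ? ?] := linear_form_bound (coord X i); exists C.
  exists (\sum_i Cf i + 1); first by rewrite ltr_wpDl// sumr_ge0// => i _; apply: ltW; case: (hCf i).
  move=> i v; apply: le_trans (proj2 (hCf i) v) _; rewrite ler_wpM2r//.
  rewrite (bigD1 i)//= -addrA ler_wpDr// ?addr_ge0// sumr_ge0// => i' _; apply: ltW; case: (hCf i') => //.
have Ad : 0 < A * delta0 by rewrite mulr_gt0.
apply: (mG_near_ge (phi := fun i g => coord X i (g - 1%:M)) JJ Ginv GJ Gcl mGC mGinv mGfin mG0 d00 Ad cpos).
- by move=> i g _ gd; apply: le_lt_trans (hA i _) _; rewrite ltr_pM2l.
- move=> g g' t Gg Gg' gd gd' t0 h; apply: chart' => // i.
  have := h i; rewrite -linearB /=; congr (`|coord X i _| <= t).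
  by rewrite opprB addrA subrK.
Qed.

Theorem ac_words A : measurable A -> mG A = 0%E -> mu A = 0%E.
Proof.
apply: (ac_of_spread JJ Ginv GJ Gcl mGC mGinv mGfin mG0 (P := P) (mu := mu) (c0 := c0)).
move=> eta eta0; have [j hj] := Q_large eta0.
have mKK : measurable (K : set (borel 'M[R]_N)) by exact: borel_closed.
pose QQ : set Om := ((K : set (borel 'M[R]_N)) `*` Q j) `*` (K : set (borel 'M[R]_N)).
have mKQ : measurable ((K : set (borel 'M[R]_N)) `*` Q j) by apply: measurableX.
have mQQ : measurable QQ by apply: measurableX.
have [C1 C10 hC1] := chart_lower.
have c00 : 0 < c0 by rewrite /c0 ltr_wpDl// !mulr_ge0.
have n30 : 0 <= n3 by rewrite exprn_ge0.
(* Two words in one ball of radius r come from values of [F] at most 2 n3 c0 r apart, while distinct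
   grid points agreeing off [c] have values at least 1/(n (j + 1)^2) apart. For r = 1 / (B0 n) these
   are incompatible. *)
pose B0 : R := 4 * n3 * c0 * j.+1%:R ^+ 2 + 1.
have B1 : 0 <= 4 * n3 * c0 * j.+1%:R ^+ 2.
  by rewrite mulr_ge0 ?exprn_ge0// mulr_ge0 ?(ltW c00)// mulr_ge0.
have B00 : 0 < B0 by rewrite ltr_wpDl.
pose rho := B0^-1; have rho0 : 0 < rho by rewrite invr_gt0.
(* Applying [chart_lower] with e * n in place of n makes its ball fit into the one of radius rho /
   n, at the price of a factor e ^ m independent of n. *)
pose e := (Num.truncn (C1 * B0)).+1.
have eC : C1 * B0 <= e%:R.
  by have := truncn_itv (ltW (mulr_gt0 C10 B00)) => /andP[_ /ltW].
exists QQ, (C1 * e%:R ^+ m); split => //.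
- have pK : mK (K : set (borel 'M[R]_N)) = 1%E.
    have := @probability_setC _ _ _ mK _ (measurableC mKK); rewrite setCK => pK.
    have h0 : mK (~` (K : set (borel 'M[R]_N))) = 0%E by exact: mKC.
    by rewrite [LHS]pK [X in (1 - X)%E]h0 sube0.
  rewrite probability_setC//; apply: le_trans hj; rewrite probability_setC//.
  suff PQ : P QQ = mK (Q j) by rewrite [X in (1 - X <= _)%E]PQ.
  have q1 := product_measure1E (mK \x mK)%E mK mKQ mKK.
  have q2 := product_measure1E mK mK mKK (mQ j).
  rewrite [LHS]q1 [X in (X * _)%E]q2.
  by rewrite [X in (X * _ * _)%E]pK [X in (_ * X)%E]pK mul1e mule1.
- by rewrite mulr_ge0 ?exprn_ge0 ?(ltW C10).
move=> delta delta0; pose n := (Num.truncn (rho / delta)).+1.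
have nR : 0 < n%:R :> R by rewrite ltr0n.
have JR : 0 < j.+1%:R :> R by rewrite ltr0n.
have rn : rho / n%:R <= delta.
  rewrite ler_pdivrMr// mulrC -ler_pdivrMr//.
  by have := truncn_itv (ltW (divr_gt0 rho0 delta0)) => /andP[_ /ltW].
have r0 : 0 < rho / n%:R by rewrite divr_gt0.
set r := rho / n%:R in rn r0.
pose rv (w : {ffun 'I_M -> 'I_n}) : 'rV[R]_M := \row_b ((w b)%:R / (n%:R * j.+1%:R)).
have rvb w : `|rv w| <= j.+1%:R^-1.
  apply: mx_norm_le => [|i b]; first by rewrite invr_ge0 ltW.
  rewrite mxE ger0_norm; last by rewrite divr_ge0 ?mulr_ge0 ?ler0n.
  rewrite invfM mulrA ler_piMl ?invr_ge0 ?(ltW JR)// ler_pdivrMr// mul1r ler_nat ltnW//.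
exists r, {ffun 'I_M -> 'I_n}, (fun w => word \o ins (rv w)); split.
- by rewrite r0.
- by rewrite card_ffun !card_ord expn_gt0.
- move=> w; have mins : measurable_fun setT (ins (rv w)).
    apply/measurable_fun_pairP; split.
      apply/measurable_fun_pairP; split.
        apply: (measurableT_comp (mins1 (rv w)) (measurableT_comp measurable_fst measurable_fst)).
      exact: (measurableT_comp (mins2 i2 (rv w)) (measurableT_comp measurable_snd measurable_fst)).
    exact: (measurableT_comp (mins2 i3 (rv w)) measurable_snd).
  split=> [|A' mA']; first exact: measurableT_comp.
  rewrite mu_word// -[LHS](ins_inv (rv w))//.
  by rewrite -[X in measurable X]setTI; exact: measurable_word.
- by move=> w om [[K1' [K2' _]] K3']; exact: word_bound.
move=> om g [[K1' [K2' [c [ci hc]]]] K3'] Gg; set S := [pred w | _].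
have hS w w' : S w -> S w' -> (forall b, b \notin codom c -> w b = w' b) -> w = w'.
  move=> Sw Sw' ww; apply/ffunP => b; apply: contrapT => /eqP nb.
  have near w1 : S w1 -> `|g - word (ins (rv w1) om)| <= N%:R * (c0 * r).
    rewrite inE /= => hr; have [Gh hb] := word_bound (rv w1) K1' K2' K3'.
    set h := word _ in hr Gh hb *.
    have -> : g - h = h *m (jinv J h *m g - 1%:M) by rewrite mulmxBr mulmxA (mul_jinv JJ GJ Gh) mul1mx mulmx1.
    apply: le_trans (mx_norm_mul _ _) _; rewrite -mulrA ler_wpM2l//.
    exact: (ler_pM (normr_ge0 _) (normr_ge0 _) (ltW hb) (ltW hr)).
  have hww : `|word (ins (rv w) om) - word (ins (rv w') om)| <= 2 * (N%:R * (c0 * r)).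
    rewrite (_ : _ - _ = (g - word (ins (rv w') om)) - (g - word (ins (rv w) om))); last first.
      by apply/matrixP => i k; rewrite !mxE; ring.
    apply: le_trans (ler_normB _ _) _; rewrite mulr_natl mulr2n.
    by apply: lerD; exact: near.
  have Fww : `|F om.1.2 (rv w) - F om.1.2 (rv w')| <= N%:R ^+ 2 * (2 * (N%:R * (c0 * r))).
    have -> : F om.1.2 (rv w) - F om.1.2 (rv w') =
        om.1.1^T *m (word (ins (rv w) om) - word (ins (rv w') om)) *m om.2^T.
      rewrite !word_ins; move: (F _ (rv w)) (F _ (rv w')) => F1 F2.
      rewrite -mulmxBl -mulmxBr !mulmxA (Korth K1') mul1mx -mulmxA.
      by rewrite (mulmx1C (Korth K3')) mulmx1.
    have n1 k : K k -> `|k| <= 1 by move=> /Korth; exact: orth_norm.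
    apply: le_trans (mul3_norm _ _ _) _; [by rewrite mx_norm_tr n1|by rewrite mx_norm_tr n1|].
    by rewrite ler_wpM2l ?exprn_ge0.
  have := hc (rv w) (rv w') (rvb w) (rvb w') => /(_ _)/le_trans/(_ Fww) hF.
  have {}hF : j.+1%:R^-1 * `|rv w - rv w'| <= N%:R ^+ 2 * (2 * (N%:R * (c0 * r))).
    by apply: hF => b' nb'; rewrite !mxE ww.
  have rw : (n%:R * j.+1%:R)^-1 <= `|rv w - rv w'|.
    apply: le_trans (mx_entry_le _ 0 b); rewrite !mxE -mulrBl normrM.
    have d0 : 0 <= (n%:R * j.+1%:R)^-1 :> R by rewrite invr_ge0 mulr_ge0 ?ler0n.
    rewrite (ger0_norm d0) ler_peMl//.
    have -> : (w b)%:R - (w' b)%:R = ((w b)%:Z - (w' b)%:Z)%:~R :> R by rewrite intrD mulrNz.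
    by rewrite -intr_norm ler1z -gtz0_ge1 normr_gt0 subr_eq0; apply: contra nb => /eqP[] /val_inj ->.
  have : j.+1%:R^-1 * (n%:R * j.+1%:R)^-1 <= N%:R ^+ 2 * (2 * (N%:R * (c0 * r))).
    by apply: le_trans hF; rewrite ler_wpM2l ?invr_ge0 ?ler0n.
  rewrite invfM mulrCA -invfM ler_pdivrMl// /r.
  rewrite (_ : n%:R * _ = 2 * n3 * c0 * rho); last first.
    by rewrite /n3; field; rewrite gt_eqF.
  have q0 : 0 < j.+1%:R * j.+1%:R :> R by rewrite mulr_gt0.
  rewrite -div1r ler_pdivrMr// => h1; have h2 : B0 * rho = 1 by rewrite mulfV// gt_eqF.
  have h3 : B0 * rho = 2 * (2 * n3 * c0 * rho * (j.+1%:R * j.+1%:R)) + rho by rewrite /B0; ring.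
  by move: h1; rewrite leNgt => /negP; apply; lra.
(* So #|S| n^m <= n^M, to be combined with the lower bound of order n^(-m) for the measure of the
   ball. *)
have cS := card_separated_fibres ci hS.
have eR : 0 < e%:R :> R by rewrite ltr0n.
have en : (0 < e * n)%N by rewrite muln_gt0.
have Bfin s : mG (Bnear s) \is a fin_num.
  by rewrite ge0_fin_numE// (Bnear_fin Gcl mGC mGfin).
have f01 : fine (mG (Bnear (C1 / (e * n)%:R))) <= fine (mG (Bnear r)).
  apply: fine_le => //; apply: le_measure; rewrite ?inE; [exact: Bnear_measurable|exact: Bnear_measurable|].
  move=> z /=; rewrite /Bnear /= => /lt_le_trans; apply.
  rewrite natrM invfM mulrA ler_pM2r ?invr_gt0// ler_pdivrMr// /rho.
  by rewrite mulrC -ler_pdivrMr ?invr_gt0// invrK.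
set f := fine (mG (Bnear r)) in f01 *.
have f0 : 0 <= f by rewrite fine_ge0.
have one : 1 <= C1 * e%:R ^+ m * n%:R ^+ m * f.
  apply: le_trans (hC1 _ en) _; move: f01; rewrite natrM => f01; rewrite exprMn mulrA ler_wpM2l//.
  by rewrite !mulr_ge0 ?exprn_ge0 ?(ltW C10).
have cS' : #|S|%:R * n%:R ^+ m <= (n ^ M)%:R :> R by rewrite -natrX -natrM ler_nat.
rewrite card_ffun !card_ord.
apply: (@le_trans _ _ (#|S|%:R * (C1 * e%:R ^+ m * n%:R ^+ m * f))).
  by rewrite ler_peMr.
rewrite (_ : _ * _ = C1 * e%:R ^+ m * f * (#|S|%:R * n%:R ^+ m)); last by ring.
rewrite (_ : C1 * e%:R ^+ m * (n ^ M)%:R * f = C1 * e%:R ^+ m * f * (n ^ M)%:R); last by ring.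
by rewrite ler_wpM2l// !mulr_ge0 ?exprn_ge0 ?(ltW C10).
Qed.

End AbsoluteContinuity.

(** * Generic position *)

Section Tensors.
Variables (R : comNzRingType) (n d : nat).

Lemma sum_tens (V : nmodType) (F : 'I_(n * d) -> V) :
  \sum_k F k = \sum_i \sum_a F (mxtens_index (i, a)).
Proof.
rewrite pair_bigA /= (reindex (@mxtens_index n d)) /=; first by apply: eq_bigr => -[].
exists (@mxtens_unindex n d) => k _; [exact: mxtens_indexK|exact: mxtens_unindexK].
Qed.

Definition unrow (u : 'rV[R]_(n * d)) : 'M[R]_(n, d) :=
  \matrix_(i, a) u 0 (mxtens_index (i, a)).

Lemma unrow_tens u (A : 'M[R]_n) (B : 'M[R]_d) : unrow (u *m (A *t B)) = A^T *m unrow u *m B.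
Proof.
apply/matrixP => i a; rewrite !mxE sum_tens exchange_big; apply: eq_bigr => b _ /=.
rewrite mxE mulr_suml; apply: eq_bigr => j _; rewrite tensmxE !mxE.
by rewrite mulrA [u _ _ * _]mulrC.
Qed.

Lemma unrow_inj : injective unrow.
Proof.
move=> u v /matrixP uv; apply/rowP => k; case: (mxtens_indexP k) => i a.
by have := uv i a; rewrite !mxE.
Qed.

Lemma unrow_dot u v : (u *m v^T) 0 0 = \sum_i (row i (unrow u) *m (row i (unrow v))^T) 0 0.
Proof.
rewrite mxE sum_tens; apply: eq_bigr => i _; rewrite mxE; apply: eq_bigr => a _.
by rewrite !mxE.
Qed.

(** The components of Z along the matrix units of the second factor. A commutation relation with A
    (x) 1 holds for Z if and only if it holds with A for each component, which reduces
    transversality to the case d = 1. *)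
Definition tcomp (a b : 'I_d) (Z : 'M[R]_(n * d)) : 'M[R]_n :=
  \matrix_(i, j) Z (mxtens_index (i, a)) (mxtens_index (j, b)).

Lemma tcomp_mulr a b Z A : tcomp a b (Z *m (A *t 1%:M)) = tcomp a b Z *m A.
Proof.
apply/matrixP => i j; rewrite !mxE sum_tens; apply: eq_bigr => k _.
rewrite (bigD1 b)//= big1 ?addr0 => [|c cb]; rewrite tensmxE mxE ?mxE ?eqxx ?mulr1//.
by rewrite (negPf cb) mulr0 mulr0.
Qed.

Lemma tcomp_mull a b Z A : tcomp a b ((A *t 1%:M) *m Z) = A *m tcomp a b Z.
Proof.
apply/matrixP => i j; rewrite !mxE sum_tens; apply: eq_bigr => k _.
rewrite (bigD1 a)//= big1 ?addr0 => [|c ca]; rewrite tensmxE mxE ?mxE ?eqxx ?mulr1//.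
by rewrite eq_sym (negPf ca) mulr0 mul0r.
Qed.

Lemma tcomp0 Z : (forall a b, tcomp a b Z = 0) -> Z = 0.
Proof.
move=> h; apply/matrixP => k l.
case: (mxtens_indexP k) => i a; case: (mxtens_indexP l) => j b.
by have /matrixP/(_ i j) := h a b; rewrite !mxE.
Qed.

Lemma tcompN a b Z : tcomp a b (- Z) = - tcomp a b Z.
Proof. by apply/matrixP => i j; rewrite !mxE. Qed.

End Tensors.

Section SignLemma.
Variables (R : realFieldType) (n d : nat) (Rs : seq 'M[R]_d).

Definition commutes (g : 'M[R]_(n * d)) :=
  forall rho, rho \in Rs -> g *m (1%:M *t rho) = (1%:M *t rho) *m g.

(** For every nonzero a the vectors a rho already span the space, as they do for the right
    multiplications of a division algebra. *)
Hypothesis irr : forall a b : 'rV[R]_d, a != 0 ->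
  (forall rho, rho \in Rs -> a *m rho *m b^T = 0) -> b = 0.

Definition signs (e : {ffun 'I_n -> bool}) : 'M[R]_n := diag_mx (\row_i (-1) ^+ e i).

Lemma signs_sq e : signs e *m signs e = 1%:M.
Proof.
rewrite /signs mulmx_diag -diag_const_mx; congr diag_mx; apply/rowP => i.
by rewrite !mxE -expr2 sqrr_sign.
Qed.

Lemma signs_tr e : (signs e)^T = signs e. Proof. exact: tr_diag_mx. Qed.

Lemma commutes_tens A : commutes (A *t 1%:M).
Proof. by move=> rho _; rewrite !tensmx_mul !mul1mx !mulmx1. Qed.

(* If [e] minimizes the dimension of the kernel and the kernel is nonzero,
   flipping a sign at a coordinate where a kernel vector is nonzero shrinks it. *)
Lemma orth_add_signs_unit (h : 'M[R]_(n * d)) : h *m h^T = 1%:M -> commutes h ->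
  exists e, h + signs e *t 1%:M \in unitmx.
Proof.
move=> hh hc; pose e0 : {ffun 'I_n -> bool} := [ffun=> false].
case: (@arg_minnP _ e0 xpredT (fun e => \rank (kermx (h + signs e *t 1%:M)))) => // e _ emin.
exists e; rewrite -row_free_unit -kermx_eq0; apply/eqP; set A := h + _ in emin *.
apply/eqP; apply: contraT => kA.
have /rowV0Pn[v /sub_kermxP vA v0] := kA.
have [i0 vi0] : exists i, row i (unrow v) != 0.
  apply: contrapT => /forallNP h0; case/eqP: v0; apply: unrow_inj; apply/row_matrixP => i.
  have /negP := h0 i; rewrite negbK => /eqP ->; apply/rowP => a.
  by rewrite !mxE.
pose e' := [ffun i => if i == i0 then ~~ e i else e i].
have row_signs (f : {ffun 'I_n -> bool}) (u : 'rV[R]_(n * d)) i :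
    row i (unrow (u *m (signs f *t 1%:M))) = (-1) ^+ f i *: row i (unrow u).
  rewrite unrow_tens mulmx1 signs_tr; apply/rowP => a.
  by rewrite !mxE (bigD1 i)//= big1 ?addr0 => [|k /negPf ki]; rewrite !mxE ?eqxx // eq_sym ki mul0r.
(* Since h is orthogonal, u and w have the same inner product as u h and w h, that is, as their
   images under the two sign matrices. These differ only at i0, so the contribution of i0 equals its
   negative. *)
have dotker (u w : 'rV[R]_(n * d)) : u *m A = 0 -> w *m (h + signs e' *t 1%:M) = 0 ->
    row i0 (unrow u) *m (row i0 (unrow w))^T = 0.
  rewrite /A !mulmxDr => /eqP; rewrite addr_eq0 => /eqP uh /eqP.
  rewrite addr_eq0 => /eqP wh.
  have : (u *m w^T) 0 0 = ((u *m (signs e *t 1%:M)) *m (w *m (signs e' *t 1%:M))^T) 0 0.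
    have -> : u *m (signs e *t 1%:M) *m (w *m (signs e' *t 1%:M))^T = (u *m h) *m (w *m h)^T.
      by rewrite uh wh linearN mulNmx mulmxN opprK.
    by rewrite trmx_mul -mulmxA (mulmxA h) hh mul1mx.
  rewrite !unrow_dot (bigD1 i0)//= [in RHS](bigD1 i0)//=.
  rewrite [X in _ = _ + X -> _](eq_bigr (fun i => (row i (unrow u) *m (row i (unrow w))^T) 0 0)); last first.
    move=> i ii0; rewrite !row_signs linearZ /= -scalemxAl -scalemxAr scalerA ffunE (negPf ii0).
    by rewrite -expr2 sqrr_sign scale1r.
  move=> /addIr; rewrite !row_signs linearZ /= -scalemxAl -scalemxAr scalerA ffunE eqxx.
  rewrite -signr_addb addbN addbb /= expr1 scaleN1r [in RHS]mxE => h0.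
  by apply/matrixP => i k; rewrite !ord1 [RHS]mxE; lra.
(* The kernel of [A] is stable under the 1 (x) rho, so row i0 of w is orthogonal to all v_i0 rho,
   hence 0 by irreducibility. *)
have key (w : 'rV[R]_(n * d)) : w *m (h + signs e' *t 1%:M) = 0 -> row i0 (unrow w) = 0.
  move=> hw; apply: (irr vi0) => rho Rrho.
  have vr : v *m (1%:M *t rho) *m A = 0.
    rewrite /A -mulmxA mulmxDr -(hc _ Rrho) -(commutes_tens (signs e) Rrho) -mulmxDl -/A.
    by rewrite mulmxA vA mul0mx.
  have := dotker _ _ vr hw.
  by rewrite unrow_tens trmx1 mul1mx row_mul.
have kk (w : 'rV[R]_(n * d)) : w *m (h + signs e' *t 1%:M) = 0 -> w *m A = 0.
  move=> hw; rewrite -hw /A !mulmxDr; congr (_ + _); apply: unrow_inj; apply/row_matrixP => i.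
  rewrite !row_signs ffunE; have [->|//] := eqVneq i i0.
  by rewrite (key _ hw) !scaler0.
have : (kermx (h + signs e' *t 1%:M) < kermx A)%MS.
  rewrite ltmxE; apply/andP; split.
    by apply/sub_kermxP; apply/row_matrixP => i; rewrite row_mul row0; apply: kk; rewrite -row_mul mulmx_ker row0.
  apply/negP => sub; have : (v <= kermx (h + signs e' *t 1%:M))%MS.
    by apply: submx_trans sub; apply/sub_kermxP.
  by move=> /sub_kermxP /key /eqP; rewrite (negPf vi0).
by move=> /rank_ltmx; rewrite ltnNge emin.
Qed.

End SignLemma.

Section PolynomialMatrices.
Variable R : comNzRingType.

Definition polyfun (f : R -> R) := exists P : {poly R}, forall t, f t = P.[t].
Definition mxpoly m n (M : R -> 'M[R]_(m, n)) := forall i j, polyfun (fun t => M t i j).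

Lemma polyfun_cst c : polyfun (fun=> c).
Proof. by exists c%:P => t; rewrite hornerC. Qed.

Lemma polyfun_add f g : polyfun f -> polyfun g -> polyfun (fun t => f t + g t).
Proof. by move=> [P hP] [Q hQ]; exists (P + Q) => t; rewrite hornerD hP hQ. Qed.

Lemma polyfun_mul f g : polyfun f -> polyfun g -> polyfun (fun t => f t * g t).
Proof. by move=> [P hP] [Q hQ]; exists (P * Q) => t; rewrite hornerM hP hQ. Qed.

Lemma polyfun_sum (I : Type) (r : seq I) (f : I -> R -> R) :
  (forall i, polyfun (f i)) -> polyfun (fun t => \sum_(i <- r) f i t).
Proof.
move=> hf; elim: r => [|i r [P hP]]; first by exists 0 => t; rewrite big_nil horner0.
by have [Q hQ] := hf i; exists (Q + P) => t; rewrite big_cons hornerD hP hQ.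
Qed.

Lemma polyfun_prod (I : Type) (r : seq I) (f : I -> R -> R) :
  (forall i, polyfun (f i)) -> polyfun (fun t => \prod_(i <- r) f i t).
Proof.
move=> hf; elim: r => [|i r [P hP]]; first by exists 1 => t; rewrite big_nil hornerC.
by have [Q hQ] := hf i; exists (Q * P) => t; rewrite big_cons hornerM hP hQ.
Qed.

Lemma polyfun_det n (M : R -> 'M[R]_n) : mxpoly M -> polyfun (fun t => \det (M t)).
Proof.
move=> hM; rewrite /determinant; apply: polyfun_sum => s.
by apply: polyfun_mul; [exact: polyfun_cst|apply: polyfun_prod => i; exact: hM].
Qed.

Lemma mxpoly_cst m n (A : 'M[R]_(m, n)) : mxpoly (fun=> A).
Proof. by move=> i j; exact: polyfun_cst. Qed.

Lemma mxpoly_mul m n p (M : R -> 'M[R]_(m, n)) (M' : R -> 'M[R]_(n, p)) :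
  mxpoly M -> mxpoly M' -> mxpoly (fun t => M t *m M' t).
Proof.
move=> h h' i j; have [P hP] : polyfun (fun t => \sum_k M t i k * M' t k j).
  by apply: polyfun_sum => k; exact: polyfun_mul.
by exists P => t; rewrite -hP mxE.
Qed.

Lemma mxpoly_add m n (M M' : R -> 'M[R]_(m, n)) :
  mxpoly M -> mxpoly M' -> mxpoly (fun t => M t + M' t).
Proof.
move=> h h' i j; have [P hP] := polyfun_add (h i j) (h' i j).
by exists P => t; rewrite -hP mxE.
Qed.

Lemma mxpoly_opp m n (M : R -> 'M[R]_(m, n)) : mxpoly M -> mxpoly (fun t => - M t).
Proof.
by move=> h i j; have [P hP] := h i j; exists (- P) => t; rewrite hornerN -hP mxE.
Qed.

Lemma mxpoly_tr m n (M : R -> 'M[R]_(m, n)) : mxpoly M -> mxpoly (fun t => (M t)^T).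
Proof. by move=> h i j; have [P hP] := h j i; exists P => t; rewrite -hP mxE. Qed.

Lemma mxpoly_row m n p (M : R -> 'M[R]_(m, n)) (M' : R -> 'M[R]_(m, p)) :
  mxpoly M -> mxpoly M' -> mxpoly (fun t => row_mx (M t) (M' t)).
Proof.
move=> h h' i j; case: (split_ordP j) => k ->.
  by have [P hP] := h i k; exists P => t; rewrite row_mxEl.
by have [P hP] := h' i k; exists P => t; rewrite row_mxEr.
Qed.

Lemma mxpoly_adj n (M : R -> 'M[R]_n) : mxpoly M -> mxpoly (fun t => \adj (M t)).
Proof.
move=> h i j; have [P hP] : polyfun (fun t => cofactor (M t) j i).
  apply: polyfun_mul; first exact: polyfun_cst.
  apply: polyfun_det => a b; have [P hP] := h (lift j a) (lift i b).
  by exists P => t; rewrite -hP !mxE.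
by exists P => t; rewrite -hP mxE.
Qed.

End PolynomialMatrices.

Lemma polyfun_zero (R : numDomainType) (f : R -> R) : polyfun f ->
  (forall N, exists2 k, (N <= k)%N & f k%:R = 0) -> forall t, f t = 0.
Proof.
move=> [P hP] h; suff P0 : P = 0 by move=> t; rewrite hP P0 horner0.
have [s [us ss hs]] : exists s : seq nat, [/\ uniq s, size s = size P & forall k, k \in s -> f k%:R = 0].
  elim: (size P) => [|m [s [us ss hs]]]; first by exists [::].
  have [k ks fk] := h (\max_(i <- s) i).+1.
  exists (k :: s); rewrite /= ss us andbT; split => //; last by move=> i; rewrite inE => /orP[/eqP ->|/hs].
  apply: contraTN ks => ks; rewrite -leqNgt.
  exact: (@leq_bigmax_seq _ _ xpredT (fun i => i)).
apply: (@roots_geq_poly_eq0 _ _ [seq k%:R | k <- s]).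
- by apply/allP => _ /mapP[k /hs fk ->]; apply/rootP; rewrite -hP.
- by rewrite map_inj_uniq// => a b /eqP; rewrite eqr_nat => /eqP.
- by rewrite size_map ss.
Qed.

Lemma continuous_mull (K : numFieldType) (U : topologicalType) m n p (A : 'M[K]_(m, n))
    (f : U -> 'M[K]_(n, p)) : continuous f -> continuous (fun u => A *m f u).
Proof. by move=> cf; apply: continuous_mulmx => // u; exact: cst_continuous. Qed.

Lemma continuous_mulr (K : numFieldType) (U : topologicalType) m n p (A : 'M[K]_(n, p))
    (f : U -> 'M[K]_(m, n)) : continuous f -> continuous (fun u => f u *m A).
Proof. by move=> cf; apply: continuous_mulmx => // u; exact: cst_continuous. Qed.

Lemma lin_mulmxE (R : comNzRingType) m n p (A : 'M[R]_(m, n)) i (a : 'I_m) (b : 'I_p) :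
  lin_mulmx A i (mxvec_index a b) = (A *m vec_mx (delta_mx 0 i)) a b.
Proof. by rewrite mxE /= mxvecE. Qed.

Lemma lin_mulmxrE (R : comNzRingType) m n p (A : 'M[R]_(n, p)) i (a : 'I_m) (b : 'I_p) :
  lin_mulmxr A i (mxvec_index a b) = (vec_mx (delta_mx 0 i) *m A) a b.
Proof. by rewrite mxE /= mxvecE. Qed.

(** * The exceptional set and its polynomial equation *)

Section GoodPosition.
Variables (R : realType) (N : nat) (J x2 y2 : 'M[R]_N).
Implicit Types l c : 'M[R]_N.

(** Transversality for one fixed pair; [x2] and [y2] will be the squares of the two Cartan
    exponentials. *)
Definition good l := forall Z, Z *m J = - (J *m Z) -> Z *m x2 = x2 *m Z ->
  Z *m (l *m y2 *m l^T) = (l *m y2 *m l^T) *m Z -> Z = 0.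

Let B l := l *m y2 *m l^T.
Let L l := row_mx (lin_mulmxr J + lin_mulmx J) (row_mx (lin_mulmxr x2 - lin_mulmx x2)
  (lin_mulmxr (B l) - lin_mulmx (B l))) : 'M[R]_(N * N, N * N + (N * N + N * N)).
(* The Gram determinant of the linear system defining [good]. *)
Definition good_det l := \det (L l *m (L l)^T).

Let mulL l Z : mxvec Z *m L l = row_mx (mxvec (Z *m J + J *m Z))
  (row_mx (mxvec (Z *m x2 - x2 *m Z)) (mxvec (Z *m B l - B l *m Z))).
Proof.
rewrite /L !mul_mx_row !(mulmxDr, mulmxN) !mul_vec_lin /=.
by rewrite (linearD (@mxvec R N N)) !(linearB (@mxvec R N N)).
Qed.

Lemma good_detP l : good l <-> good_det l != 0.
Proof.
split=> [gl|dl Z ZJ Zx Zy].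
  apply/det0P => -[v v0 vL]; case/eqP: v0.
  have {}vL : v *m L l = 0.
    by apply: sqr_row_eq0; rewrite trmx_mul mulmxA -[v *m _ *m _]mulmxA vL mul0mx mxE.
  have v0 (W : 'M[R]_N) : mxvec W = 0 -> W = 0 by move=> h; apply: (can_inj mxvecK); rewrite h linear0.
  move: vL; rewrite -[v](vec_mxK v) mulL; set Z := vec_mx v => e.
  have {e} [e1 e] := (congr1 lsubmx e, congr1 rsubmx e); rewrite !linear0 row_mxKl row_mxKr in e1 e.
  have [e2 e3] := (congr1 lsubmx e, congr1 rsubmx e); rewrite !linear0 row_mxKl row_mxKr in e2 e3.
  rewrite (gl Z) ?linear0//.
  - by apply/eqP; rewrite -addr_eq0; apply/eqP; exact: v0.
  - by apply/eqP; rewrite -subr_eq0; apply/eqP; exact: v0.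
  - by apply/eqP; rewrite -subr_eq0; apply/eqP; exact: v0.
apply: (can_inj mxvecK); rewrite linear0.
have : mxvec Z *m (L l *m (L l)^T) = 0.
  by rewrite mulmxA mulL ZJ Zx Zy !subrr addNr !linear0 !row_mx0 mul0mx.
move=> /(congr1 (fun A => A *m invmx (L l *m (L l)^T))); rewrite mul0mx mulmxK//.
by rewrite unitmxE unitfE.
Qed.

(** This permits replacing the inverse in a Cayley transform by the adjugate, and so clearing
    denominators. *)
Lemma good_scale a l : a != 0 -> good (a *: l) -> good l.
Proof.
move=> a0 g Z ZJ Zx Zl; apply: g => //.
by rewrite linearZ /= -!scalemxAl -!scalemxAr -!scalemxAl -?scalemxAr Zl.
Qed.

(** Lets the correcting factor that brings a Cayley transform into the compact group be dropped. *)
Lemma good_mull c l : c^T *m c = 1%:M -> c *m J = J *m c -> c *m x2 = x2 *m c ->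
  good (c *m l) -> good l.
Proof.
move=> cc cJ cx g Z ZJ Zx Zl; have cc' := mulmx1C cc.
have cJ' : c^T *m J = J *m c^T.
  by rewrite -[LHS]mulmx1 -cc' mulmxA -[c^T *m J *m c]mulmxA -cJ mulmxA cc mul1mx.
have cx' : c^T *m x2 = x2 *m c^T.
  by rewrite -[LHS]mulmx1 -cc' mulmxA -[c^T *m x2 *m c]mulmxA -cx mulmxA cc mul1mx.
apply: (conj0 cc'); apply: g.
- exact: conj_odd.
- by rewrite -!mulmxA cx' !mulmxA -[c *m Z *m x2]mulmxA Zx !mulmxA cx.
- rewrite trmx_mul.
  have -> : c *m l *m y2 *m (l^T *m c^T) = c *m (l *m y2 *m l^T) *m c^T by rewrite !mulmxA.
  exact: conj_comm.
Qed.

Let entry_poly (A : R -> 'M[R]_N) : mxpoly A ->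
  mxpoly (fun t => lin_mulmxr (A t) - lin_mulmx (A t) : 'M[R]_(N * N)).
Proof.
move=> hA i j; case/mxvec_indexP: j => a b.
have h1 := mxpoly_mul (mxpoly_cst (vec_mx (delta_mx 0 i))) hA.
have h2 := mxpoly_opp (mxpoly_mul hA (mxpoly_cst (vec_mx (delta_mx 0 i)))).
have [P hP] := mxpoly_add h1 h2 a b.
by exists P => t; rewrite -hP [LHS]mxE lin_mulmxrE [X in _ + X]mxE lin_mulmxE !mxE.
Qed.

Lemma polyfun_good_det (l : R -> 'M[R]_N) : mxpoly l -> polyfun (fun t => good_det (l t)).
Proof.
move=> hl; have hB : mxpoly (fun t => B (l t)).
  apply: mxpoly_mul; last exact: mxpoly_tr.
  by apply: mxpoly_mul => //; exact: mxpoly_cst.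
have hL : mxpoly (fun t => L (l t)).
  apply: mxpoly_row; first exact: mxpoly_cst.
  by apply: mxpoly_row; [exact: mxpoly_cst|exact: entry_poly].
by apply: polyfun_det; apply: mxpoly_mul => //; exact: mxpoly_tr.
Qed.

Lemma continuous_good_det : continuous good_det.
Proof.
have cB : continuous B.
  apply: (@continuous_mulmx _ _ _ _ _ (fun l => l *m y2) trmx); last first.
    by apply: (@continuous_trmx _ _ _ _ id) => ?; exact: cvg_id.
  by apply: (@continuous_mulmx _ _ _ _ _ id (fun=> y2)) => ?; [exact: cvg_id|exact: cst_continuous].
have cL : continuous L.
  apply: mx_continuous => i j; case: (split_ordP j) => k ->.
    rewrite (_ : (fun _ => _) = fun=> (lin_mulmxr J + lin_mulmx J : 'M[R]_(N * N)) i k); last first.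
      by apply/funext => l; rewrite row_mxEl.
    exact: cst_continuous.
  case: (split_ordP k) => k' ->.
    rewrite (_ : (fun _ => _) = fun=> (lin_mulmxr x2 - lin_mulmx x2 : 'M[R]_(N * N)) i k'); last first.
      by apply/funext => l; rewrite row_mxEr row_mxEl.
    exact: cst_continuous.
  case/mxvec_indexP: k' => a b; pose D : 'M[R]_N := vec_mx (delta_mx 0 i).
  rewrite (_ : (fun _ => _) = fun l => (D *m B l) a b - (B l *m D) a b); last first.
    by apply/funext => l; rewrite !row_mxEr [LHS]mxE lin_mulmxrE [X in _ + X]mxE lin_mulmxE.
  have cDB := continuous_mull (A := D) cB; have cBD := continuous_mulr (A := D) cB.
  move=> l; apply: (@continuousB _ _ _ (fun l => (D *m B l) a b) (fun l => (B l *m D) a b)).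
    exact: (continuous_comp (cDB l) (@mx_entry_continuous _ _ _ a b _)).
  exact: (continuous_comp (cBD l) (@mx_entry_continuous _ _ _ a b _)).
by apply: continuous_det; apply: continuous_mulmx => //; exact: continuous_trmx.
Qed.

End GoodPosition.

Section BadNull.
Variables (R : realType) (N : nat) (J x2 y2 : 'M[R]_N) (K : set 'M[R]_N).
Variable mK : probability (borel 'M[R]_N) R.
Hypothesis mKC : mK (~` K) = 0%E.
Hypothesis Kcl : closed K.
Hypothesis mKinv : forall g, K g -> forall A : set (borel 'M[R]_N), measurable A ->
  mK (mulmx g @^-1` A) = mK A.
Variables (a : nat) (e : 'I_a -> 'M[R]_N).
Hypothesis eT : forall b, (e b)^T = - e b.
Let xi (w : 'rV[R]_a) := \sum_b w 0 b *: e b.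
Hypothesis hcK : forall w, exists c,
  [/\ c^T *m c = 1%:M, c *m J = J *m c, c *m x2 = x2 *m c & K (c *m cay (xi w))].
Hypothesis hex : forall k, K k -> exists w, good J x2 y2 (cay (xi w) *m k).

Let gd := good_det J x2 y2.
(** The product of the Cayley transform and k, multiplied by the determinant in its denominator:
    polynomial in w. *)
Let ltil w (k : 'M[R]_N) := \adj (1%:M - xi w) *m (1%:M + xi w) *m k.

Let xiT w : (xi w)^T = - xi w.
Proof.
by rewrite /xi linear_sum -sumrN; apply: eq_bigr => b _; rewrite linearZ /= eT scalerN.
Qed.

Let ltE w k : ltil w k = \det (1%:M - xi w) *: (cay (xi w) *m k).
Proof.
have u := skew_unit (xiT w); have d0 : \det (1%:M - xi w) != 0 by rewrite -unitfE -unitmxE.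
by rewrite /ltil /cay /invmx u -!scalemxAl scalerA mulfV// scale1r.
Qed.

Let good_lt w k : good J x2 y2 (cay (xi w) *m k) <-> gd (ltil w k) != 0.
Proof.
have u := skew_unit (xiT w); have d0 : \det (1%:M - xi w) != 0 by rewrite -unitfE -unitmxE.
rewrite /gd; split => [g|/good_detP].
  apply/good_detP; apply: (@good_scale _ _ _ _ _ (\det (1%:M - xi w))^-1); first by rewrite invr_eq0.
  by rewrite ltE scalerA mulVf// scale1r.
by rewrite ltE; exact: good_scale.
Qed.

Let bad : set (borel 'M[R]_N) := [set l | gd l = 0].

Let mbad : measurable bad.
Proof.
apply: borel_closed; rewrite (_ : bad = gd @^-1` [set 0])//.
by apply: closed_comp => [l _|]; [exact: continuous_good_det|exact: closed_eq].
Qed.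

(** The equation is to hold for all values of the coordinates below i, the others being frozen at
    those of w. This interpolates between a single translate of the bad set, for i = 0 and up to a
    factor that [good] ignores, and vanishing identically in w, for i = a. *)
Let B (i : nat) (w : 'rV[R]_a) : set (borel 'M[R]_N) :=
  [set k | forall w' : 'rV[R]_a, (forall b : 'I_a, (i <= b)%N -> w' 0 b = w 0 b) -> gd (ltil w' k) = 0].

Let mB i w : measurable (B i w).
Proof.
apply: borel_closed.
rewrite (_ : B i w = \bigcap_(w' in [set w' : 'rV[R]_a | forall b : 'I_a, (i <= b)%N -> w' 0 b = w 0 b])
  (fun k => gd (ltil w' k)) @^-1` [set 0]); last first.
  by apply/seteqP; split=> [k h w' hw'|k h w' hw']; exact: h.
apply: closed_bigI => w' _; apply: closed_comp => [l _|]; last exact: closed_eq.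
have cl : continuous (ltil w') by apply: (continuous_mull (f := id)) => ?; exact: cvg_id.
exact: (continuous_comp (cl l) (@continuous_good_det _ _ J x2 y2 _)).
Qed.

Let upd (w : 'rV[R]_a) (i : 'I_a) (t : R) : 'rV[R]_a := \row_b (if b == i then t else w 0 b).

Let poly_lt w i k : polyfun (fun t => gd (ltil (upd w i t) k)).
Proof.
apply: polyfun_good_det.
have hxi : mxpoly (fun t => xi (upd w i t)).
  move=> m n; have [P hP] : polyfun (fun t => \sum_b (upd w i t) 0 b * e b m n).
    apply: polyfun_sum => b; apply: polyfun_mul; last exact: polyfun_cst.
    case: (eqVneq b i) => bi; [exists 'X|exists (w 0 b)%:P] => t; rewrite mxE ?bi ?eqxx ?hornerX ?hornerC//.
    by rewrite (negPf bi).
  by exists P => t; rewrite -hP /xi summxE; apply: eq_bigr => b _; rewrite mxE.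
apply: mxpoly_mul; last exact: mxpoly_cst.
apply: mxpoly_mul; last by apply: mxpoly_add => //; exact: mxpoly_cst.
apply: mxpoly_adj; apply: mxpoly_add; first exact: mxpoly_cst.
exact: mxpoly_opp.
Qed.

Let r := fine (mK bad).
Let rE : mK bad = r%:E. Proof. by rewrite /r fineK// fin_num_measure. Qed.

(** Induction on i. The sets with coordinate i frozen at n = 0, 1, 2, ... have measure at least r,
    hence so has their limsup; and a polynomial in that coordinate with infinitely many zeros
    vanishes. *)
Let B_ge i w : (i <= a)%N -> (r%:E <= mK (B i w))%E.
Proof.
elim: i w => [|i IH] w ia.
  have [c [cc cJ cx Kc]] := hcK w; rewrite -rE -(mKinv Kc mbad).
  apply: le_measure; rewrite ?inE; first by rewrite -[X in measurable X]setTI; apply: measurable_mull.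
    exact: mB.
  move=> k /= bk w' ww; have -> : w' = w by apply/rowP => b; exact: ww.
  apply/eqP; apply: contraTT isT => /good_lt g; move/eqP: bk; rewrite -[_ == _]negbK => /negP[].
  apply/good_detP; apply: (@good_mull _ _ _ _ _ c^T).
  - by rewrite trmxK; exact: mulmx1C.
  - by rewrite -[LHS]mulmx1 -(mulmx1C cc) mulmxA -[c^T *m J *m c]mulmxA -cJ mulmxA cc mul1mx.
  - by rewrite -[LHS]mulmx1 -(mulmx1C cc) mulmxA -[c^T *m x2 *m c]mulmxA -cx mulmxA cc mul1mx.
  - by rewrite !mulmxA cc mul1mx.
pose o := Ordinal ia.
have := @limsup_mu_ge _ _ _ mK (fun n => B i (upd w o n%:R)) r (fun n => mB _ _)
  (fun n => IH _ (ltnW ia)).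
move=> /le_trans; apply; apply: le_measure; rewrite ?inE.
- by apply: bigcapT_measurable => n; apply: bigcup_measurable => m _; exact: mB.
- exact: mB.
move=> k hk w' ww; have := polyfun_zero (poly_lt w' o k) => /(_ _ (w' 0 o)).
rewrite (_ : upd w' o (w' 0 o) = w'); last by apply/rowP => b; rewrite mxE; case: eqP => // ->.
apply=> n; have [m nm Bm] := hk n I; exists m => //.
apply: Bm => b ib; rewrite !mxE; case: ifPn => // bo.
apply: ww; rewrite ltn_neqAle ib andbT eq_sym; apply: contra bo => /eqP bi.
by apply/eqP/val_inj.
Qed.

(* [good_det] is, up to a nonzero factor, polynomial in each coordinate of [w],
   and the coordinates are switched on one at a time. *)
Lemma bad_null : measurable bad /\ mK bad = 0%E.
Proof.
split => //; have : (mK bad <= mK (~` K))%E.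
  rewrite {1}rE; apply: le_trans (B_ge 0 (leqnn a)) _; apply: le_measure; rewrite ?inE.
  - exact: mB.
  - by apply: measurableC; exact: borel_closed.
  move=> k Bk Kk; have [w /good_lt] := hex Kk.
  by rewrite Bk ?eqxx// => b; rewrite leqNgt ltn_ord.
have h0 : mK (~` (K : set (borel 'M[R]_N))) = 0%E by exact: mKC.
by rewrite [X in (_ <= X)%E]h0 => h; apply/eqP; rewrite eq_le h measure_ge0.
Qed.

End BadNull.

Lemma Ipq_diag (R : comNzRingType) p q :
  Ipq R p q = diag_mx (row_mx (const_mx (-1)) (const_mx 1)).
Proof. by rewrite diag_mx_row !diag_const_mx /Ipq raddfN. Qed.

Lemma signs_Ipq (R : realFieldType) p q (e : {ffun 'I_(p + q) -> bool}) :
  signs R e *m Ipq R p q = Ipq R p q *m signs R e.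
Proof. by rewrite Ipq_diag /signs diag_mxC. Qed.

(** Conjugation by signs keeps a Cartan matrix Cartan and preserves the squares of its entries,
    hence its pattern. *)
Lemma signs_cartan (R : realType) p q (pq : (p <= q)%N) (e : {ffun 'I_(p + q) -> bool}) T :
  signs R e *m cartan_mx q T *m signs R e = cartan_mx q
    (\row_i ((-1) ^+ e (lshift q i) * (-1) ^+ e (rshift p (widen_ord pq i)) * T 0 i)).
Proof.
have Eij (A : 'M[R]_(p + q)) i j : (signs R e *m A *m signs R e) i j = (-1) ^+ e i * A i j * (-1) ^+ e j.
  by rewrite /signs mul_mx_diag mul_diag_mx !mxE.
apply/matrixP => i j; rewrite Eij /cartan_mx.
case: (split_ordP i) => i' ->; case: (split_ordP j) => j' ->.
- by rewrite !block_mxEul mxE mulr0 mul0r.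
- rewrite !block_mxEur !mxE; case: (eqVneq (val i') (val j')) => [ij|ij]; last first.
    by rewrite !mulr0n mulr0 mul0r.
  rewrite !mulr1n mulrAC; congr (_ * _ ^+ e (rshift p _) * _).
  by apply/val_inj; rewrite /= ij.
- rewrite !block_mxEdl !mxE; case: (eqVneq (val j') (val i')) => [ij|ij]; last first.
    by rewrite !mulr0n mulr0 mul0r.
  rewrite !mulr1n mulrC mulrA; congr (_ * _ ^+ e (rshift p _) * _).
  by apply/val_inj; rewrite /= ij.
- by rewrite !block_mxEdr mxE mulr0 mul0r.
Qed.

Lemma tens11 (R : comNzRingType) n d : (1%:M : 'M[R]_n) *t (1%:M : 'M[R]_d) = 1%:M.
Proof.
apply/matrixP => i j; case: (mxtens_indexP i) => a b; case: (mxtens_indexP j) => a' b'.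
by rewrite tensmxE !mxE (inj_eq (can_inj (@mxtens_indexK _ _))) xpair_eqE -natrM mulnb.
Qed.

(** For J^2 = 1 this is twice the component of [A] that anticommutes with [J]. *)
Definition odd_part (R : comNzRingType) n (J A : 'M[R]_n) := A - J *m A *m J.

Lemma comm_odd_part (R : comNzRingType) n (J A W : 'M[R]_n) :
  W *m J = - (J *m W) -> W *m A = A *m W -> W *m odd_part J A = odd_part J A *m W.
Proof.
move=> WJ WA; rewrite /odd_part mulmxBr mulmxBl WA; congr (_ - _).
by rewrite !mulmxA WJ !mulNmx -(mulmxA J W) WA -!mulmxA WJ !mulmxN opprK !mulmxA.
Qed.

Lemma comm_sq_of_conj (R : comPzRingType) n (x j W : 'M[R]_n) : x *m j = 1%:M -> j *m x = 1%:M ->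
  j *m W *m x = x *m W *m j -> W *m (x *m x) = x *m x *m W.
Proof.
move=> xj jx /(congr1 (fun M => x *m M *m x)).
by rewrite !mulmxA xj mul1mx -(mulmxA _ j x) jx mulmx1.
Qed.

Section EligiblePairs.
Variables (R : realType) (p q d : nat) (pq : (0 < p < q)%N) (Rs : seq 'M[R]_d).
Hypothesis irr : forall a b : 'rV[R]_d, a != 0 ->
  (forall rho, rho \in Rs -> a *m rho *m b^T = 0) -> b = 0.
Hypothesis RsT : forall rho, rho \in Rs -> rho^T = rho \/ rho^T = - rho.
Local Notation N := ((p + q) * d)%N.
Let J0 := Ipq R p q.
Let J : 'M[R]_N := J0 *t 1%:M.

Lemma tens_J_sym : J^T = J. Proof. by rewrite trmx_tens trmx1 trmx_Ipq. Qed.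

Lemma tens_J_sq : J *m J = 1%:M.
Proof.
by rewrite tensmx_mul Ipq_sq mulmx1 tens11.
Qed.

Lemma commutes_mul (g h : 'M[R]_N) : commutes Rs g -> commutes Rs h -> commutes Rs (g *m h).
Proof. by move=> cg ch rho r; rewrite -mulmxA ch// !mulmxA cg. Qed.

Lemma commutes_tr (g : 'M[R]_N) : commutes Rs g -> commutes Rs g^T.
Proof.
move=> cg rho r; have := congr1 trmx (cg rho r); rewrite !trmx_mul trmx_tens trmx1.
case: (RsT r) => ->; first by [].
have -> : (1%:M *t - rho : 'M[R]_N) = - (1%:M *t rho).
  by apply/matrixP => i j; rewrite !mxE mulrN.
by rewrite mulNmx mulmxN => /oppr_inj.
Qed.

Variables (X Y : 'rV[R]_p) (x0 y0 : 'M[R]_(p + q)) (SX SY : 'rV[R]_p).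
Hypotheses (x0T : x0^T = x0) (y0T : y0^T = y0).
Hypotheses (pX : same_pattern X SX) (pY : same_pattern Y SY).
Hypotheses (oX : odd_part J0 (x0 *m x0) = cartan_mx q SX).
Hypotheses (oY : odd_part J0 (y0 *m y0) = cartan_mx q SY).
Let x : 'M[R]_N := x0 *t 1%:M.
Let y : 'M[R]_N := y0 *t 1%:M.

(** Each component W of Z anticommutes with [J0]; commuting with a matrix, it then commutes with the
    odd part. For the two squares these are Cartan matrices of the patterns of [X] and [Y], the
    second one modified by signs and conjugated by [k0]. *)
Lemma good_signs k0 e : k0 *m k0^T = 1%:M -> k0 *m J0 = J0 *m k0 -> transverse X Y k0 ->
  good J (x *m x) (y *m y) ((k0 *m signs R e) *t 1%:M).
Proof.
move=> kk kJ tk Z ZJ Zx Zy; apply: tcomp0 => a b; set W := tcomp a b Z.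
have WJ : W *m J0 = - (J0 *m W).
  by rewrite /W -tcomp_mulr -tcomp_mull -tcompN -/J ZJ.
have Wx : W *m (x0 *m x0) = x0 *m x0 *m W.
  by rewrite /W -tcomp_mulr -tcomp_mull -[1%:M in LHS]mulmx1 -[1%:M in RHS]mulmx1 -!tensmx_mul Zx.
set M := k0 *m signs R e in Zy.
have Wy : W *m (M *m (y0 *m y0) *m M^T) = M *m (y0 *m y0) *m M^T *m W.
  have e1 : (M *m (y0 *m y0) *m M^T) *t 1%:M = M *t 1%:M *m (y *m y) *m (M *t 1%:M)^T.
    by rewrite trmx_tens trmx1 !tensmx_mul !mulmx1.
  by rewrite /W -tcomp_mulr -tcomp_mull e1 Zy.
have MJ : M *m J0 = J0 *m M.
  rewrite /M -mulmxA signs_Ipq (mulmxA k0) -/J0.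
  by rewrite kJ mulmxA.
have JM : J0 *m M^T = M^T *m J0.
  by have := congr1 trmx MJ; rewrite !trmx_mul /J0 trmx_Ipq.
have pq' : (p <= q)%N by case/andP: pq => _ /ltnW.
pose SY' := \row_i ((-1) ^+ e (lshift q i) * (-1) ^+ e (rshift p (widen_ord pq' i)) * SY 0 i).
apply: (tk SX SY') => //.
- by case: pY => p1 p2; split=> [i|i j]; rewrite !mxE;
    [rewrite -signr_addb mulf_eq0 signr_eq0 p1|rewrite -!signr_addb !exprMn !sqrr_sign !mul1r; exact: p2].
- by rewrite -oX; exact: comm_odd_part.
- have -> : k0 *m cartan_mx q SY' *m k0^T = odd_part J0 (M *m (y0 *m y0) *m M^T).
    have -> : k0 *m cartan_mx q SY' *m k0^T = M *m cartan_mx q SY *m M^T.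
      by rewrite -(signs_cartan pq') /M trmx_mul signs_tr !mulmxA.
    rewrite -oY /odd_part mulmxBr mulmxBl; congr (_ - _).
    by rewrite !mulmxA MJ -!mulmxA JM.
  exact: comm_odd_part.
Qed.

Variables (G K : set 'M[R]_N).
Hypotheses (GM : forall g h, G g -> G h -> G (g *m h)).
Hypotheses (Ginv : forall g, G g -> G (jinv J g)).
Hypotheses (GJ : forall g, G g -> g^T *m J *m g = J).
Hypotheses (GR : forall g, G g -> commutes Rs g).
Hypothesis Gcl : closed G.
Variable mG : {measure set (borel 'M[R]_N) -> \bar R}.
Hypothesis mGC : mG (~` G) = 0%E.
Hypothesis mGinv : forall g, G g -> forall A : set (borel 'M[R]_N), measurable A ->
  mG (mulmx g @^-1` A) = mG A.
Hypothesis mGfin : forall C : set 'M[R]_N, compact C -> C `<=` G -> (mG C < +oo)%E.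
Hypothesis mG0 : mG G != 0%E.
Hypotheses (Kcl : closed K) (KG : K `<=` G).
Hypothesis Korth : forall k, K k -> k^T *m k = 1%:M.
Hypotheses (K1 : K 1%:M) (KM : forall g h, K g -> K h -> K (g *m h)).
Hypothesis Ktr : forall k, K k -> K k^T.
Variable mK : probability (borel 'M[R]_N) R.
Hypothesis mKC : mK (~` K) = 0%E.
Hypothesis mKinv : forall g, K g -> forall A : set (borel 'M[R]_N), measurable A ->
  mK (mulmx g @^-1` A) = mK A.
Hypotheses (Gx : G x) (Gy : G y).
Variable T : 'M[R]_N.
Hypotheses (TT : T^T = - T) (TJ : T *m J = J *m T) (TR : commutes Rs T).
Hypothesis GT : forall g, G g -> g *m T = T *m g.
Hypothesis trT : forall eta : R, 0 < eta -> exists2 delta : R, 0 < delta &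
  forall g g', G g -> G g' -> `|g - 1%:M| < delta -> `|g' - 1%:M| < delta ->
    `|\tr ((g - g') *m T)| <= eta * `|g - g'|.
(** The Lie algebra of [G]; for SU(p, q) the last condition is the vanishing of the complex
    trace. *)
Let gg : set 'M[R]_N := [set a | [/\ commutes Rs a, a^T *m J + J *m a = 0 & \tr (a *m T) = 0]].
Variable gens : set 'M[R]_N.
Hypothesis gensT : forall xi, gens xi -> xi^T = - xi.
Hypothesis gensK : forall xi t, gens xi -> K (cay (t *: xi)).
Hypothesis gens_span : forall Z, commutes Rs Z -> Z *m J = J *m Z -> Z^T = - Z ->
  \tr (Z *m T) = 0 -> (forall xi, gens xi -> \tr (Z *m xi) = 0) -> Z = 0.
Hypothesis Kcay : forall xi, commutes Rs xi -> xi *m J = J *m xi -> xi^T = - xi ->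
  exists c, [/\ c^T *m c = 1%:M, c *m J = J *m c, c *m x = x *m c & K (c *m cay xi)].

Let JT := tens_J_sym.
Let JJ := tens_J_sq.

Let KJ k : K k -> k *m J = J *m k.
Proof.
move=> Kk; have := congr1 (mulmx k) (GJ (KG Kk)).
by rewrite !mulmxA (mulmx1C (Korth Kk)) mul1mx => ->.
Qed.

Let xT : x^T = x. Proof. by rewrite trmx_tens trmx1 x0T. Qed.
Let yT : y^T = y. Proof. by rewrite trmx_tens trmx1 y0T. Qed.

Let commutes_J : commutes Rs J. Proof. exact: commutes_tens. Qed.

Let commutes_lin (a : R) (A B : 'M[R]_N) : commutes Rs A -> commutes Rs B -> commutes Rs (a *: A + B).
Proof.
by move=> cA cB rho r; rewrite mulmxDl mulmxDr -scalemxAl -scalemxAr cA// cB.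
Qed.

Let gg0 : gg 0.
Proof.
split; first by move=> rho _; rewrite mulmx0 mul0mx.
  by rewrite trmx0 mul0mx mulmx0 addr0.
by rewrite mul0mx mxtrace0.
Qed.

Let gg_lin (a : R) (A B : 'M[R]_N) : gg A -> gg B -> gg (a *: A + B).
Proof.
move=> [cA sA tA] [cB sB tB]; split; first exact: commutes_lin.
  rewrite linearP /= mulmxDl mulmxDr -scalemxAl -scalemxAr addrACA -scalerDr sA sB.
  by rewrite scaler0 addr0.
by rewrite mulmxDl -scalemxAl linearP /= tA tB mulr0 addr0.
Qed.

Let gg_span (X' : seq 'M[R]_N) : (forall A, A \in X' -> gg A) -> forall Z, Z \in <<X'>>%VS -> gg Z.
Proof.
move=> hX Z /(coord_span (X := in_tuple X')) ->.
apply: (big_ind gg) => // [A B gA gB|i _]; first by rewrite -[A]scale1r; exact: gg_lin.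
by rewrite -[_ *: _]addr0; apply: gg_lin => //; apply: hX; rewrite mem_nth.
Qed.

Let gg_Ad g Z : G g -> gg Z -> gg (jinv J g *m Z *m g).
Proof.
move=> Gg [cZ sZ tZ]; have gj := jinvK JJ GJ Gg; have jg := mul_jinv JJ GJ Gg; split.
- apply: commutes_mul; last exact: GR.
  by apply: commutes_mul => //; apply: GR; exact: Ginv.
- have jT : (jinv J g)^T = J *m g *m J by rewrite /jinv !trmx_mul trmxK JT mulmxA.
  have Jj : J *m jinv J g = g^T *m J by rewrite /jinv !mulmxA JJ mul1mx.
  move: (jinv J g) jT Jj {gj jg} => j' jT Jj; rewrite !trmx_mul jT.
  rewrite !mulmxA Jj -!(mulmxA _ J J) JJ mulmx1 -!(mulmxA g^T) -mulmxDr.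
  by rewrite -mulmxDl sZ mul0mx mulmx0.
- move: (jinv J g) jg => j' jg.
  rewrite -(mulmxA (j' *m Z) g T) (GT Gg) mulmxA (mxtrace_mulC _ g) !mulmxA.
  by rewrite jg mul1mx tZ.
Qed.

Let trTT : \tr (T *m T) = 0 -> T = 0.
Proof.
move=> t0; have : \tr (T *m T^T) = 0 by rewrite TT mulmxN linearN /= t0 oppr0.
rewrite /mxtrace => /eqP; rewrite psumr_eq0 => [/allP h|i _]; last first.
  by rewrite mxE sumr_ge0// => k _; rewrite mxE -expr2 sqr_ge0.
apply/row_matrixP => i; rewrite row0; apply: sqr_row_eq0; rewrite -(eqP (h i (mem_index_enum i))).
by rewrite !mxE; apply: eq_bigr => k _; rewrite !mxE.
Qed.

(** With D = g - g', the projection a0 = (D - J D^T J) / 2 of D to the J-skew matrices is close to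
    D, because J D^T J = g^-1 - g'^-1 = - g^-1 D g'^-1 is nearly - D close to the identity. A
    multiple of [T], small by [trT], then corrects the trace. *)
Let near_gg (eta : R) : 0 < eta -> exists2 delta : R, 0 < delta &
  forall g g', G g -> G g' -> `|g - 1%:M| < delta -> `|g' - 1%:M| < delta ->
    exists2 a, gg a & `|g - g' - a| <= eta * `|g - g'|.
Proof.
move=> eta0.
have [CT CT0 hCT] : exists2 C : R, 0 < C & forall v, `|\tr (v *m T)| <= C * `|v|.
  exact: (linear_form_bound ((@mxtrace R N) \o mulmxr T)).
pose s := `|(\tr (T *m T))^-1| * `|T|; have s0 : 0 <= s by rewrite mulr_ge0.
pose e1 := eta / (1 + (1 + CT) * s).
have den0 : 0 < 1 + (1 + CT) * s by rewrite ltr_pwDl// mulr_ge0// addr_ge0// ltW.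
have e10 : 0 < e1 by rewrite divr_gt0.
have e1E : e1 * (1 + (1 + CT) * s) = eta by rewrite /e1 divfK// gt_eqF.
have [d1 d10 h1] := trT e10.
pose B := N%:R ^+ 2 * `|J| ^+ 2; have B0 : 0 <= B by rewrite mulr_ge0 ?exprn_ge0.
pose d2 := e1 / ((N%:R + 2 * N%:R ^+ 2) * B + 1).
have n0 : 0 <= N%:R :> R by [].
have den2 : 0 < (N%:R + 2 * N%:R ^+ 2) * B + 1.
  by rewrite ltr_wpDl// mulr_ge0// addr_ge0// mulr_ge0// exprn_ge0.
have d20 : 0 < d2 by rewrite divr_gt0.
have d2E : d2 * ((N%:R + 2 * N%:R ^+ 2) * B + 1) = e1 by rewrite /d2 divfK// gt_eqF.
have B10 : 0 < B + 1 by rewrite ltr_wpDl.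
exists (Num.min d1 (Num.min d2 (B + 1)^-1)); first by rewrite !lt_min d10 d20 invr_gt0.
move=> g g' Gg Gg'; rewrite !lt_min => /and3P[g1 g2 g3] /and3P[g1' g2' g3'].
have jb h : `|1%:M - jinv J h| <= B * `|h - 1%:M|.
  have -> : 1%:M - jinv J h = - (J *m (h - 1%:M)^T *m J).
    by rewrite /jinv linearB /= trmx1 mulmxBr mulmxBl mulmx1 JJ opprB.
  rewrite normrN; apply: le_trans (mx_norm_mul _ _) _.
  have -> : B * `|h - 1%:M| = N%:R * (N%:R * `|J| * `|(h - 1%:M)^T|) * `|J|.
    by rewrite mx_norm_tr /B; ring.
  by rewrite ler_wpM2r// ler_wpM2l//; exact: mx_norm_mul.
set D := g - g'; set a0 := 2^-1 *: (D - J *m D^T *m J).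
have Da0 : `|D - a0| <= e1 * `|D|.
  have -> : D - a0 = 2^-1 *: ((1%:M - jinv J g) *m D + jinv J g *m (D *m (1%:M - jinv J g'))).
    have e2 : J *m D^T *m J = - (jinv J g *m D *m jinv J g').
      have gj := jinvK JJ GJ Gg; have jg := mul_jinv JJ GJ Gg'.
      rewrite /D linearB /= mulmxBr mulmxBl -/(jinv J g) -/(jinv J g').
      by rewrite mulmxBr gj mulmxBl mul1mx -mulmxA jg mulmx1 opprB.
    rewrite /a0 e2 opprK (mulmxBl 1%:M) mul1mx (mulmxBr D) mulmx1 (mulmxBr _ D) (mulmxA (jinv J g) D (jinv J g')).
    move: (jinv J g *m D *m jinv J g') (jinv J g *m D) => u1 u2.
    by apply/matrixP => i k; rewrite !mxE; field.
  have jg2 : `|jinv J g| <= 2.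
    rewrite -[jinv J g](subKr 1%:M); apply: le_trans (ler_normB _ _) _.
    have : `|1%:M : 'M[R]_N| <= 1 by apply: orth_norm; rewrite trmx1 mul1mx.
    have : B * `|g - 1%:M| <= 1.
      apply: (@le_trans _ _ (B * (B + 1)^-1)); first by rewrite ler_wpM2l// ltW.
      by rewrite ler_pdivrMr// mul1r lerDl.
    have := jb g; lra.
  rewrite normrZ ger0_norm ?invr_ge0//.
  have b1 : `|(1%:M - jinv J g) *m D| <= N%:R * (B * d2) * `|D|.
    apply: le_trans (mx_norm_mul _ _) _; rewrite ler_wpM2r// ler_wpM2l//.
    by apply: le_trans (jb g) _; rewrite ler_wpM2l// ltW.
  have b2 : `|jinv J g *m (D *m (1%:M - jinv J g'))| <= N%:R * 2 * (N%:R * `|D| * (B * d2)).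
    apply: le_trans (mx_norm_mul _ _) _; apply: ler_pM => //; rewrite ?mulr_ge0//.
      by rewrite ler_wpM2l.
    apply: le_trans (mx_norm_mul _ _) _; rewrite ler_wpM2l ?mulr_ge0//.
    by apply: le_trans (jb g') _; rewrite ler_wpM2l// ltW.
  have b3 := le_trans (ler_normD _ _) (lerD b1 b2).
  have b4 : N%:R * (B * d2) * `|D| + N%:R * 2 * (N%:R * `|D| * (B * d2)) <= e1 * `|D|.
    rewrite -d2E (_ : _ + _ = d2 * ((N%:R + 2 * N%:R ^+ 2) * B) * `|D|); last by ring.
    by rewrite ler_wpM2r// ler_pM2l// lerDl.
  have b5 := le_trans b3 b4; have := normr_ge0 ((1%:M - jinv J g) *m D + jinv J g *m (D *m (1%:M - jinv J g'))).
  move: b5; set q1 := `|_ + _|; set q2 := e1 * _; lra.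
have ca0 : commutes Rs a0.
  have cD : commutes Rs D by rewrite /D addrC -scaleN1r; apply: commutes_lin; exact: GR.
  rewrite /a0 -[_ *: _]addr0; apply: commutes_lin; last by move=> rho _; rewrite mulmx0 mul0mx.
  rewrite addrC -scaleN1r; apply: commutes_lin => //.
  apply: commutes_mul => //; apply: commutes_mul => //; exact: commutes_tr.
have sa0 : a0^T *m J + J *m a0 = 0.
  rewrite /a0 linearZ /= -scalemxAl -scalemxAr -scalerDr linearB /= !trmx_mul JT trmxK.
  rewrite mulmxBl mulmxBr !mulmxA JJ mul1mx -[_ *m J *m J]mulmxA JJ mulmx1.
  by rewrite addrA subrK subrr scaler0.
pose tau := \tr (a0 *m T) / \tr (T *m T).
exists (- tau *: T + a0).
  split; first exact: commutes_lin.
    rewrite linearP /= mulmxDl mulmxDr -scalemxAl -scalemxAr addrACA sa0 addr0 -scalerDr.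
    by rewrite TT mulNmx TJ addNr scaler0.
  rewrite mulmxDl -scalemxAl linearP /=; have [t0|t0] := eqVneq (\tr (T *m T)) 0.
    by rewrite (trTT t0) !mulmx0 mxtrace0 mulr0 addr0.
  by rewrite /tau mulNr divfK// addNr.
have ta : `|\tr (a0 *m T)| <= e1 * `|D| + CT * (e1 * `|D|).
  have -> : \tr (a0 *m T) = \tr (D *m T) - \tr ((D - a0) *m T) by rewrite -linearB -mulmxBl subKr.
  apply: le_trans (ler_normB _ _) _; apply: lerD; first exact: h1.
  by apply: le_trans (hCT _) _; rewrite ler_pM2l.
rewrite opprD scaleNr opprK addrCA addrC; apply: le_trans (ler_normD _ _) _.
rewrite -e1E mulrDr mulr1 mulrDl; apply: lerD => //.
rewrite normrZ /tau normrM.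
rewrite -[leLHS]mulrA -/s (_ : e1 * ((1 + CT) * s) * `|D| = (e1 * `|D| + CT * (e1 * `|D|)) * s); last by ring.
by rewrite ler_wpM2r.
Qed.

(** g - g' differs from an element of [gg] by at most eta |g - g'|, and that element is controlled
    by its coordinates; eta is so small that the total error is at most half of |g - g'| and can be
    absorbed. *)
Let chart (m : nat) (X' : m.-tuple 'M[R]_N) : (forall Z, gg Z -> Z \in <<X'>>%VS) ->
  exists delta c : R, [/\ 0 < delta, 0 < c &
  forall g g' (t : R), G g -> G g' -> `|g - 1%:M| < delta -> `|g' - 1%:M| < delta ->
    0 <= t -> (forall i, `|coord X' i (g - g')| <= t) -> `|g - g'| <= c * t].
Proof.
move=> hX.
have [A A0 hA] : exists2 A : R, 0 < A & forall i v, `|coord X' i v| <= A * `|v|.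
  have /choice[Cf hCf] : forall i : 'I_m, exists C : R, 0 < C /\ forall v, `|coord X' i v| <= C * `|v|.
    by move=> i; have [C ? ?] := linear_form_bound (coord X' i); exists C.
  exists (\sum_i Cf i + 1); first by rewrite ltr_wpDl// sumr_ge0// => i _; apply: ltW; case: (hCf i).
  move=> i v; apply: le_trans (proj2 (hCf i) v) _; rewrite ler_wpM2r//.
  rewrite (bigD1 i)//= -addrA ler_wpDr// ?addr_ge0// sumr_ge0// => i' _; apply: ltW; case: (hCf i') => //.
pose S := \sum_(i < m) `|X'`_i|; have S0 : 0 <= S by exact: sumr_ge0.
have SA0 : 0 <= S * A by rewrite mulr_ge0// ltW.
pose eta := (2 * (S * A + 1))^-1.
have eta0 : 0 < eta by rewrite invr_gt0 mulr_gt0// ltr_wpDl.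
have etaE : eta * (S * A + 1) = 2^-1.
  by rewrite /eta invfM mulfVK// gt_eqF// ltr_wpDl.
have [delta d0 hd] := near_gg eta0.
exists delta, (2 * S + 1); split => //; first by rewrite ltr_wpDl// mulr_ge0.
move=> g g' t Gg Gg' gd gd' t0 ht; have [a ga ha] := hd _ _ Gg Gg' gd gd'.
have na : `|a| <= S * (t + A * (eta * `|g - g'|)).
  rewrite (coord_span (hX _ ga)) mulr_suml; apply: le_trans (ler_norm_sum _ _ _) _.
  apply: ler_sum => i _; rewrite normrZ mulrC ler_wpM2l//.
  have -> : a = (g - g') - (g - g' - a) by rewrite subKr.
  rewrite linearB; apply: le_trans (ler_normB _ _) _; apply: lerD; first exact: ht.
  by apply: le_trans (hA _ _) _; rewrite ler_pM2l.
have h1 : `|g - g'| <= `|a| + eta * `|g - g'|.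
  rewrite -{1}(subrK a (g - g')) addrC; apply: le_trans (ler_normD _ _) _.
  by rewrite lerD2l.
have h2 : `|g - g'| <= S * t + (eta * (S * A + 1)) * `|g - g'|.
  apply: (le_trans h1); apply: (le_trans (lerD na (lexx _))).
  by rewrite le_eqVlt; apply/orP; left; apply/eqP; ring.
rewrite etaE in h2; have : 0 <= t by []. lra.
Qed.

Hypothesis eligible : exists k0, [/\ k0 *m k0^T = 1%:M, k0 *m J0 = J0 *m k0 & transverse X Y k0].

(** No trace condition is imposed here: for SU(p, q) this is the Lie algebra of U(p) x U(q), so that
    [cay_surj] lands in it. *)
Let kfull : set 'M[R]_N := [set a | [/\ commutes Rs a, a *m J = J *m a & a^T = - a]].

Let kfull_lin (a : R) (A B : 'M[R]_N) : kfull A -> kfull B -> kfull (a *: A + B).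
Proof.
move=> [cA JA TA] [cB JB TB]; split; first exact: commutes_lin.
  by rewrite mulmxDl mulmxDr -scalemxAl -scalemxAr JA JB.
by rewrite linearP /= TA TB opprD scalerN.
Qed.

Let kfull0 : kfull 0.
Proof. by split; [move=> rho _|..]; rewrite ?mulmx0 ?mul0mx ?trmx0 ?oppr0. Qed.

(** To make cay xi * k good, it is steered to k0 s, with k0 transversal and s a sign matrix. Then h
    = k0 s k^T must be a Cayley transform, that is, 1 + h = k0 (k0^T k + s) k^T must be invertible,
    which dictates the choice of s. *)
Let bad_null' : exists bad : set (borel 'M[R]_N), [/\ measurable bad, mK bad = 0%E &
  forall l, K l -> ~ bad l -> good J (x *m x) (y *m y) l].
Proof.
have [Es [fE EsK Espan]] := exists_free_seq kfull.
pose e (b : 'I_(size Es)) := Es`_b.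
have eK b : kfull (e b) by apply: EsK; exact: mem_nth.
have xiK (w : 'rV[R]_(size Es)) : kfull (\sum_b w 0 b *: e b).
  apply: (big_ind kfull) => [//|A B kA kB|b _]; first by rewrite -[A]scale1r; exact: kfull_lin.
  by rewrite -[_ *: _]addr0; apply: kfull_lin.
exists [set l | good_det J (x *m x) (y *m y) l = 0]; have [|||mb b0] := @bad_null R N J (x *m x) (y *m y) K mK mKC Kcl mKinv _ e.
- by move=> b; case: (eK b).
- move=> w; have [c1 c2 c3] := xiK w; have [c [cc cJ cx Kc]] := Kcay c1 c2 c3.
  by exists c; split => //; rewrite mulmxA cx -!mulmxA cx.
- move=> k Kk; have [k0 [kk kJ tk]] := eligible.
  have kt : (k0 *t 1%:M : 'M[R]_N) *m (k0 *t 1%:M)^T = 1%:M.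
    by rewrite trmx_tens trmx1 tensmx_mul kk mulmx1 tens11.
  have kk' := mulmx1C (Korth Kk).
  have [s us] : exists s, (k0 *t 1%:M)^T *m k + signs R s *t 1%:M \in unitmx.
    apply: (orth_add_signs_unit irr).
      by rewrite trmx_mul trmxK mulmxA -[_ *m k *m k^T]mulmxA kk' mulmx1 (mulmx1C kt).
    apply: commutes_mul; last exact: GR (KG Kk).
    by apply: commutes_tr; exact: commutes_tens.
  have cs : commutes Rs (signs R s *t 1%:M : 'M[R]_N) by exact: commutes_tens.
  have ss : (signs R s *t 1%:M : 'M[R]_N) *m (signs R s *t 1%:M)^T = 1%:M.
    by rewrite trmx_tens trmx1 signs_tr tensmx_mul signs_sq mulmx1 tens11.
  pose h := (k0 *t 1%:M) *m (signs R s *t 1%:M) *m k^T.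
  have hh : h *m h^T = 1%:M.
    rewrite /h !trmx_mul trmxK !mulmxA -[_ *m k^T *m k]mulmxA (Korth Kk) mulmx1.
    by rewrite -[_ *m _ *m (signs R s *t 1%:M)^T]mulmxA ss mulmx1 kt.
  have uh : 1%:M + h \in unitmx.
    have -> : 1%:M + h = (k0 *t 1%:M) *m ((k0 *t 1%:M)^T *m k + signs R s *t 1%:M) *m k^T.
      by rewrite mulmxDr mulmxDl !mulmxA kt mul1mx kk'.
    have [u1 _] := mulmx1_unit kt; have [_ u2] := mulmx1_unit kk'.
    by rewrite !unitmx_mul u1 us u2.
  have [xi [xT' cx xc]] := cay_surj hh uh.
  have kxi : kfull xi.
    split => //.
    - move=> rho r; apply: xc; apply: (commutes_mul _ _ r); last by apply: commutes_tr; exact: GR (KG Kk).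
      by apply: commutes_mul => //; exact: commutes_tens.
    - apply: xc; have kJ' : k^T *m J = J *m k^T.
        by have := congr1 trmx (KJ Kk); rewrite !trmx_mul JT.
      rewrite /h -(mulmxA _ k^T J) kJ' !mulmxA /J !tensmx_mul !mulmx1.
      by rewrite -(mulmxA k0) signs_Ipq mulmxA -/J0 kJ.
  exists (\row_b coord (in_tuple Es) b xi).
  rewrite (_ : \sum_b _ = xi); last first.
    rewrite [RHS](coord_span (X := in_tuple Es) (Espan _ kxi)).
    by apply: eq_bigr => b _; rewrite mxE.
  rewrite cx /h -(mulmxA _ k^T k) (Korth Kk) mulmx1 (tensmx_mul k0) mulmx1.
  exact: good_signs.
by split => // l _ nb; apply/good_detP/eqP => h; apply: nb.
Qed.

Variable mu : probability (borel 'M[R]_N) R.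
Hypothesis mu_word : forall A : set (borel 'M[R]_N), measurable A ->
  mu A = ((mK \x mK) \x mK)%E ((fun om : (borel 'M[R]_N * borel 'M[R]_N) * borel 'M[R]_N =>
    om.1.1 *m x *m om.1.2 *m y *m om.2 : borel 'M[R]_N) @^-1` A).

(** An element of [gg] orthogonal to the generators of K is symmetric, as its skew part falls under
    [gens_span]. Thus Z, W = x^-1 Z x and g^-1 Z g, with g = x l y, are all symmetric. As x is
    symmetric, symmetry of W and of x W x^-1 forces W to commute with x^2, and likewise with l y^2
    l^T. A symmetric element of [gg] anticommutes with J, so W = 0 for good l. *)
Theorem ac_eligible (A : set (borel 'M[R]_N)) : measurable A -> mG A = 0%E -> mu A = 0%E.
Proof.
have [X' [fX Xgg Xspan]] := exists_free_seq gg.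
have [Es [fE Egen Espan]] := exists_free_seq gens.
have [bad [mbad bad0 nbad]] := bad_null'.
pose E (b : 'I_(size Es)) := Es`_b.
have Eg b : gens (E b) by apply: Egen; exact: mem_nth.
apply: (@ac_words R N J G JJ GM Ginv GJ Gcl mG mGC mGinv mGfin mG0 K Kcl KG Korth Ktr K1 KM mK mKC mKinv
  x y Gx Gy (size Es) E _ _ (size X') (in_tuple X') fX _ bad mbad bad0 _ mu mu_word).
- by move=> b; exact: gensT.
- by move=> b t; exact: gensK.
- exact: (chart (X' := in_tuple X')).
move=> l Kl nl Z ZX hZ.
have gZ : gg Z by apply: (gg_span Xgg).
have sym W : gg W -> (forall b, \tr (W *m E b) = 0) -> W^T = W.
  move=> [cW JW tW] hW.
  have JW' : W^T *m J = - (J *m W) by apply/eqP; rewrite -addr_eq0 JW.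
  have JWT : J *m W^T = - (W *m J).
    have := congr1 (fun M => J *m M *m J) JW'; rewrite /= mulmxN mulNmx !mulmxA JJ mul1mx.
    by rewrite -!(mulmxA _ J J) JJ mulmx1.
  have tWT : \tr (W^T *m T) = 0 by rewrite -mxtrace_tr trmx_mul trmxK TT mulNmx linearN /= mxtrace_mulC tW oppr0.
  have V0 : W - W^T = 0.
    apply: gens_span.
    - rewrite addrC -scaleN1r; apply: commutes_lin => //; exact: commutes_tr.
    - by rewrite mulmxBl mulmxBr JW' JWT opprK addrC opprK.
    - by rewrite linearB /= trmxK opprB.
    - by rewrite mulmxBl linearB /= tW tWT subr0.
    move=> xi gxi; have : xi \in <<Es>>%VS by exact: Espan.
    move=> /(coord_span (X := in_tuple Es)) ->; rewrite mulmx_sumr linear_sum big1// => b _.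
    rewrite -scalemxAr linearZ /=; set t := \tr _; suff -> : t = 0 by rewrite mulr0.
    rewrite /t mulmxBl linearB /= -/(E b) hW -mxtrace_tr trmx_mul trmxK gensT// mulNmx linearN /=.
    by rewrite mxtrace_mulC hW oppr0 subr0.
  by apply/esym/eqP; rewrite -subr_eq0 V0.
have h1 : Z^T = Z by apply: sym => // b; case: (hZ b).
have Gl := KG Kl.
have Gg : G (x *m l *m y) by apply: GM => //; exact: GM.
pose W := jinv J x *m Z *m x.
have gW : gg W by exact: gg_Ad.
have h2 : W^T = W by apply: sym => // b; case: (hZ b).
have h3 : (jinv J (x *m l *m y) *m Z *m (x *m l *m y))^T = jinv J (x *m l *m y) *m Z *m (x *m l *m y).
  by apply: sym => [|b]; [exact: gg_Ad|case: (hZ b)].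
have xj := jinvK JJ GJ Gx; have jx := mul_jinv JJ GJ Gx.
have yj := jinvK JJ GJ Gy; have jy := mul_jinv JJ GJ Gy.
have jxT : (jinv J x)^T = jinv J x by rewrite /jinv !trmx_mul trmxK JT xT mulmxA.
have jyT : (jinv J y)^T = jinv J y by rewrite /jinv !trmx_mul trmxK JT yT mulmxA.
have jl : jinv J l = l^T.
  have kJ' : l^T *m J = J *m l^T by have := congr1 trmx (KJ Kl); rewrite !trmx_mul JT.
  by rewrite /jinv -mulmxA kJ' mulmxA JJ mul1mx.
have jg : jinv J (x *m l *m y) = jinv J y *m l^T *m jinv J x.
  rewrite -jl /jinv !trmx_mul !mulmxA.
  by rewrite -!(mulmxA _ J J) JJ !mulmx1.
have ZW : Z = x *m W *m jinv J x by rewrite /W; move: (jinv J x) jx => j1 jx'; rewrite !mulmxA jx' mul1mx -mulmxA jx' mulmx1.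
clearbody W.
have Wx : W *m (x *m x) = x *m x *m W.
  apply: (comm_sq_of_conj jx xj); rewrite -ZW -[RHS]h1.
  move: (jinv J x) jxT ZW => j1 jxT' ->.
  by rewrite (trmx_mul (x *m W)) (trmx_mul x W) jxT' h2 xT mulmxA.
have Wy : W *m (l *m (y *m y) *m l^T) = l *m (y *m y) *m l^T *m W.
  pose V := l^T *m W *m l; have VT : V^T = V by rewrite /V !trmx_mul trmxK h2 mulmxA.
  have ll' := mulmx1C (Korth Kl).
  have e1 : jinv J (x *m l *m y) *m Z *m (x *m l *m y) = jinv J y *m V *m y.
    rewrite jg ZW /V; move: (jinv J x) (jinv J y) xj => j1 j2 xj'.
    rewrite !mulmxA -(mulmxA _ j1 x) xj' mulmx1.
    by rewrite -(mulmxA _ j1 x) xj' mulmx1.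
  have e2 : V *m (y *m y) = y *m y *m V.
    apply: (comm_sq_of_conj jy yj); rewrite -[LHS]e1 -h3 e1.
    move: (jinv J y) jyT => j1 jyT'.
    by rewrite (trmx_mul (j1 *m V)) (trmx_mul j1) jyT' VT yT mulmxA.
  have WV : W = l *m V *m l^T by rewrite /V !mulmxA ll' mul1mx -mulmxA ll' mulmx1.
  by rewrite WV; exact: (conj_comm ll').
have W0 : W = 0.
  apply: (nbad l Kl nl) => //; case: gW => _ + _; rewrite h2 => /eqP.
  by rewrite addr_eq0 => /eqP.
by rewrite ZW W0 mulmx0 mul0mx.
Qed.

End EligiblePairs.

(** * Singular words *)

Section SingularSet.
Variables (R : realType) (N : nat) (J : 'M[R]_N).
Hypotheses (JT : J^T = J) (JJ : J *m J = 1%:M).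

(** The projections onto the eigenspaces of [J] for -1 and, for [Pp], for 1: the first p and the
    last q coordinates, tensored with R^d. *)
Definition Pm : 'M[R]_N := 2^-1 *: (1%:M - J).
Definition Pp : 'M[R]_N := 2^-1 *: (1%:M + J).

Lemma Pm_add_Pp : Pm + Pp = 1%:M.
Proof. by apply/matrixP => i j; rewrite !mxE; field. Qed.

Lemma Pm_sq : Pm *m Pm = Pm.
Proof.
rewrite /Pm -scalemxAl -scalemxAr mulmxBl mul1mx mulmxBr JJ mulmx1 scalerA.
by apply/matrixP => i j; rewrite !mxE; field.
Qed.

Lemma Pm_Pp : Pm *m Pp = 0.
Proof. by rewrite -[Pp](addKr Pm) Pm_add_Pp mulmxDr mulmxN Pm_sq mulmx1 addNr. Qed.

Lemma Pp_Pm : Pp *m Pm = 0.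
Proof. by rewrite -[Pp](addKr Pm) Pm_add_Pp mulmxDl mulNmx Pm_sq mul1mx addNr. Qed.

Lemma Pp_sq : Pp *m Pp = Pp.
Proof. by rewrite -{1}[Pp](addKr Pm) Pm_add_Pp mulmxDl mulNmx Pm_Pp oppr0 add0r mul1mx. Qed.

Lemma Pm_tr : Pm^T = Pm. Proof. by rewrite /Pm linearZ linearB /= trmx1 JT. Qed.
Lemma Pp_tr : Pp^T = Pp. Proof. by rewrite /Pp linearZ linearD /= trmx1 JT. Qed.

Lemma Pm_J : Pm *m J = - Pm.
Proof.
rewrite /Pm -scalemxAl mulmxBl mul1mx JJ; apply/matrixP => i j; rewrite !mxE; ring.
Qed.

Lemma Pp_J : Pp *m J = Pp.
Proof. by rewrite /Pp -scalemxAl mulmxDl mul1mx JJ addrC. Qed.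

Lemma PmE : Pm = 2^-1 *: (1%:M - J). Proof. by []. Qed.

Local Opaque Pm Pp.

Lemma Pm_comm k : k *m J = J *m k -> k *m Pm = Pm *m k.
Proof. by move=> kJ; rewrite PmE -scalemxAl -scalemxAr mulmxBr mulmxBl kJ mulmx1 mul1mx. Qed.

(* With respect to the splitting by J this is det (A A^T - kappa), where A is
   the upper left block of g. *)
Definition sing_det (kappa : R) g :=
  \det (Pm *m g *m Pm *m g^T *m Pm - kappa *: Pm + Pp).

Lemma sing_det_eq0 kappa g (v : 'rV[R]_N) : v != 0 -> v *m Pm = v ->
  v *m g *m Pm *m g^T *m Pm = kappa *: v -> sing_det kappa g = 0.
Proof.
move=> v0 vP vg; apply/eqP/det0P; exists v => //.
have e : v *m (Pm *m g *m Pm *m g^T *m Pm) = kappa *: v by rewrite !mulmxA vP.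
rewrite mulmxDr mulmxBr e -scalemxAr vP subrr add0r.
by rewrite -vP -mulmxA Pm_Pp mulmx0.
Qed.

(** The eigenvector is w k1^T. The [Pm] part of w x is c w, and w l is fixed by y; the [Pp] part is
    sent by l y out of the range of [Pm]. So w x l y Pm = c w l, and running back through the
    transposed word gives a second factor c. *)
Lemma sing_det_word kappa c (x l y k1 k4 : 'M[R]_N) (w : 'rV[R]_N) :
  k1 *m k1^T = 1%:M -> k1 *m J = J *m k1 -> k4 *m k4^T = 1%:M -> k4 *m J = J *m k4 ->
  l *m l^T = 1%:M -> l *m J = J *m l -> x^T = x -> y^T = y ->
  w != 0 -> w *m Pm = w -> w *m x *m Pm = c *: w -> w *m l *m y = w *m l ->
  w *m x *m Pp *m l *m y *m Pm = 0 -> kappa = c ^+ 2 ->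
  sing_det kappa (k1 *m x *m l *m y *m k4) = 0.
Proof.
move=> kk1 kJ1 kk4 kJ4 ll lJ xT yT w0 wP wx wl wxl ->.
have kJ1' : k1^T *m J = J *m k1^T by have := congr1 trmx kJ1; rewrite !trmx_mul JT.
have lP := Pm_comm lJ; have kP4 := Pm_comm kJ4; have kP1 := Pm_comm kJ1'.
have kk1' := mulmx1C kk1.
apply: (@sing_det_eq0 _ _ (w *m k1^T)).
- by apply: contraNneq w0 => h; rewrite -[w]mulmx1 -kk1' mulmxA h mul0mx.
- by rewrite -mulmxA kP1 mulmxA wP.
have e1 : w *m x *m l *m y *m Pm = c *: (w *m l).
  rewrite -[X in X *m l](mulmx1) -Pm_add_Pp mulmxDr wx !mulmxDl -!scalemxAl wl wxl addr0.
  by rewrite -mulmxA lP mulmxA wP.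
have -> : w *m k1^T *m (k1 *m x *m l *m y *m k4) *m Pm = w *m x *m l *m y *m Pm *m k4.
  by rewrite !mulmxA -[w *m k1^T *m k1]mulmxA kk1' mulmx1 -mulmxA kP4 mulmxA.
rewrite e1 !trmx_mul xT yT !mulmxA -(mulmxA _ k4 k4^T) kk4 mulmx1 -!scalemxAl wl.
rewrite -(mulmxA w l l^T) ll mulmx1 -(mulmxA _ k1^T Pm) kP1 mulmxA wx.
by rewrite -scalemxAl scalerA expr2.
Qed.

Lemma continuous_sing_det kappa : continuous (sing_det kappa).
Proof.
apply: continuous_det => g.
apply: (@continuousD _ _ _ (fun g => Pm *m g *m Pm *m g^T *m Pm - kappa *: Pm) (fun=> Pp)); last exact: cst_continuous.
apply: (@continuousB _ _ _ (fun g => Pm *m g *m Pm *m g^T *m Pm) (fun=> kappa *: Pm)); last exact: cst_continuous.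
move: g; apply: continuous_mulr; apply: continuous_mulmx.
  by apply: continuous_mulr; apply: (continuous_mull (f := id)) => ?; exact: cvg_id.
by apply: (@continuous_trmx _ _ _ _ id) => ?; exact: cvg_id.
Qed.

Variables (G : set 'M[R]_N).
Hypotheses (GM : forall g h, G g -> G h -> G (g *m h)).
Hypotheses (Ginv : forall g, G g -> G (jinv J g)).
Hypotheses (GJ : forall g, G g -> g^T *m J *m g = J).
Hypothesis Gcl : closed G.
Variable mG : {measure set (borel 'M[R]_N) -> \bar R}.
Hypothesis mGC : mG (~` G) = 0%E.
Hypothesis mGinv : forall g, G g -> forall A : set (borel 'M[R]_N), measurable A ->
  mG (mulmx g @^-1` A) = mG A.
Hypothesis mGfin : forall C : set 'M[R]_N, compact C -> C `<=` G -> (mG C < +oo)%E.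
Variables (H : 'M[R]_N) (h : R -> 'M[R]_N) (ch : R).
Hypotheses (HT : H^T = H) (HJ : H *m J = - (J *m H)) (HH : Pm *m (H *m H) = Pm).
Hypothesis Gh : forall t, G (h t).
Hypothesis hE : forall t, let s := expR t in
  (2 * s) *: (Pm *m h t) = Pm *m ((s ^+ 2 + 1) *: 1%:M + (s ^+ 2 - 1) *: H).
Hypothesis h_bound : forall t, -1 <= t <= 0 -> `|h t| <= ch.

Let gJg g : G g -> g *m J *m g^T = J.
Proof.
move=> Gg; have gj := mul_jinv JJ GJ Gg; have := congr1 (fun A => A *m J) gj.
by rewrite /jinv mul1mx !mulmxA -(mulmxA _ J J) JJ mulmx1.
Qed.

(** By [hE], this is 2 s times the [Pm] block of [h t *m g] at s = e^t; being polynomial in s, it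
    also makes sense at s = 0, the limit t -> -oo. *)
Let B (s : R) g := Pm *m ((s ^+ 2 + 1) *: 1%:M + (s ^+ 2 - 1) *: H) *m g *m Pm.

(** A kernel vector v lies in the range of [Pm]. The row v (1 - H) is isotropic for [J], since H
    anticommutes with [J] and H^2 fixes v; so is its image z under g. As z Pm = 0, z lies in the
    positive definite part, hence z = 0. Then v (1 - H) = 0, whose [Pm] part is v. *)
Let nondegenerate g : G g -> \det (B 0 g + Pp) != 0.
Proof.
move=> Gg; apply/det0P => -[v v0 vB].
have BE : B 0 g = Pm *m (1%:M - H) *m g *m Pm.
  by rewrite /B expr0n /= add0r sub0r scaleN1r scale1r.
have vPp : v *m Pp = 0.
  have := congr1 (mulmx^~ Pp) vB; rewrite /= mul0mx mulmxDr mulmxDl -(mulmxA _ Pp Pp) Pp_sq.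
  by rewrite BE -!mulmxA Pm_Pp !mulmx0 add0r.
have vP : v *m Pm = v.
  by rewrite -[RHS]mulmx1 -Pm_add_Pp mulmxDr vPp addr0.
have vJ : v *m J = - v by rewrite -vP -mulmxA Pm_J mulmxN.
have vH : v *m (H *m H) = v by rewrite -{1}vP -mulmxA HH vP.
pose z := v *m (1%:M - H) *m g.
have zP : z *m Pm = 0.
  by move: vB; rewrite mulmxDr vPp addr0 BE !mulmxA vP.
have zJ : z *m J = z.
  rewrite -[z in RHS]mulmx1 -Pm_add_Pp mulmxDr zP add0r.
  by rewrite -[z in LHS]mulmx1 -Pm_add_Pp mulmxDr zP add0r -mulmxA Pp_J.
have z0 : z = 0.
  apply: sqr_row_eq0; rewrite -{1}zJ /z.
  have -> : v *m (1%:M - H) *m g *m J *m (v *m (1%:M - H) *m g)^T =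
      v *m (1%:M - H) *m (g *m J *m g^T) *m (1%:M - H) *m v^T.
    have hT : (1%:M - H)^T = 1%:M - H by rewrite linearB /= trmx1 HT.
    by rewrite !trmx_mul hT !mulmxA.
  rewrite gJg//.
  have -> : v *m (1%:M - H) *m J *m (1%:M - H) = v *m J *m (1%:M - H *m H).
    have eH : (1%:M - H) *m J *m (1%:M - H) = J *m (1%:M - H *m H).
      rewrite mulmxBl mul1mx HJ opprK -{1}[J]mulmx1 -mulmxDr -mulmxA; congr (_ *m _).
      by rewrite mulmxDl mul1mx mulmxBr mulmx1 addrA subrK.
    by rewrite -(mulmxA v _ J) -(mulmxA v _ (1%:M - H)) eH mulmxA.
  by rewrite vJ mulNmx mulmxBr mulmx1 vH subrr oppr0 mul0mx mxE.
case/eqP: v0; have vH0 : v *m (1%:M - H) = 0.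
  have gj := mul_jinv JJ GJ Gg.
  have z0' : v *m (1%:M - H) *m g = 0 := z0.
  by have := congr1 (mulmx^~ (jinv J g)) z0'; rewrite /= mul0mx -(mulmxA _ g (jinv J g)) gj mulmx1.
have HP : v *m H *m Pm = 0.
  rewrite PmE -scalemxAr mulmxBr mulmx1 -(mulmxA v H J) HJ mulmxN mulmxA vJ mulNmx opprK.
  by rewrite subrr scaler0.
move/(congr1 (mulmx^~ Pm)): vH0; rewrite /= mul0mx mulmxBr mulmx1 mulmxBl HP subr0.
by rewrite vP.
Qed.

Let BB s g : B s g = Pm *m B s g /\ B s g = B s g *m Pm.
Proof. by split; rewrite /B; [rewrite !mulmxA Pm_sq|rewrite -[RHS]mulmxA Pm_sq]. Qed.

(** The singular determinant of [h t *m g], rescaled by (2 s)^2 on the range of [Pm]. At s = 0 the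
    term in kappa disappears, which reduces nonvanishing there to [nondegenerate]. *)
Let poly (left : bool) kappa s g := \det ((if left then B s g *m (B s g)^T else (B s g)^T *m B s g)
   - (kappa * (2 * s) ^+ 2) *: Pm + Pp).

Definition sdet (left : bool) kappa g := if left then sing_det kappa g else sing_det kappa g^T.

Let poly0 left kappa g : G g -> poly left kappa 0 g != 0.
Proof.
move=> Gg; have n0 := nondegenerate Gg; have [B1 B2] := BB 0 g; rewrite /poly.
rewrite mulr0 expr0n /= mulr0 scale0r subr0.
have e1 : (B 0 g)^T = (B 0 g)^T *m Pm by rewrite {1}B1 trmx_mul Pm_tr.
have e2 : (B 0 g)^T = Pm *m (B 0 g)^T by rewrite {1}B2 trmx_mul Pm_tr.
have e3 : B 0 g *m Pp = 0 by rewrite B2 -mulmxA Pm_Pp mulmx0.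
have e4 : Pp *m (B 0 g)^T = 0 by rewrite e2 mulmxA Pp_Pm mul0mx.
have e5 : (B 0 g)^T *m Pp = 0 by rewrite e1 -mulmxA Pm_Pp mulmx0.
have e6 : Pp *m B 0 g = 0 by rewrite B1 mulmxA Pp_Pm mul0mx.
have n1 : \det ((B 0 g)^T + Pp) != 0 by rewrite -Pp_tr -linearD /= det_tr.
case: left.
  have -> : B 0 g *m (B 0 g)^T + Pp = (B 0 g + Pp) *m ((B 0 g)^T + Pp).
    by rewrite mulmxDl !mulmxDr e3 e4 Pp_sq addr0 add0r.
  by rewrite det_mulmx mulf_neq0.
have -> : (B 0 g)^T *m B 0 g + Pp = ((B 0 g)^T + Pp) *m (B 0 g + Pp).
  by rewrite mulmxDl !mulmxDr e5 e6 Pp_sq addr0 add0r.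
by rewrite det_mulmx mulf_neq0.
Qed.

Let poly_fun left kappa g : polyfun (fun s => poly left kappa s g).
Proof.
have hB : mxpoly (fun s => B s g).
  apply: mxpoly_mul; last exact: mxpoly_cst.
  apply: mxpoly_mul; last exact: mxpoly_cst.
  apply: mxpoly_mul; first exact: mxpoly_cst.
  move=> i j; exists (('X ^+ 2 + 1) * ((1%:M : 'M[R]_N) i j)%:P + ('X ^+ 2 - 1) * (H i j)%:P) => s.
  by rewrite !mxE !hornerE.
apply: polyfun_det; apply: mxpoly_add; last exact: mxpoly_cst.
apply: mxpoly_add.
  by case: left; apply: mxpoly_mul => //; exact: mxpoly_tr.
apply: mxpoly_opp => i j; exists ((kappa * 4 * Pm i j)%:P * 'X ^+ 2) => s.
by rewrite mxE !hornerE /=; ring.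
Qed.

Let sdet_poly left kappa t g : sdet left kappa (h t *m g) = 0 -> poly left kappa (expR t) g = 0.
Proof.
set s := expR t; have s0 : s != 0 by rewrite gt_eqF// expR_gt0.
have [B1 B2] := BB s g.
have [A AE] : exists A, Pm *m h t *m g *m Pm = A by exists (Pm *m h t *m g *m Pm).
have BE : B s g = (2 * s) *: A.
  rewrite -AE /B; have /= <- := hE t.
  by rewrite -(scalemxAl _ (Pm *m h t)) -scalemxAl.
have A1 : Pm *m A = A by rewrite -AE !mulmxA Pm_sq.
have A2 : A *m Pm = A by rewrite -AE -mulmxA Pm_sq.
have A1T : A^T *m Pm = A^T by rewrite -{1}Pm_tr -trmx_mul A1.
have A2T : Pm *m A^T = A^T by rewrite -{1}Pm_tr -trmx_mul A2.
pose D := (2 * s) ^+ 2 *: Pm + Pp.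
have key C : Pm *m C = C -> \det (C - kappa *: Pm + Pp) = 0 ->
    \det ((2 * s) ^+ 2 *: C - (kappa * (2 * s) ^+ 2) *: Pm + Pp) = 0.
  move=> CP dC; have -> : (2 * s) ^+ 2 *: C - (kappa * (2 * s) ^+ 2) *: Pm + Pp = D *m (C - kappa *: Pm + Pp).
    have PC : Pp *m C = 0 by rewrite -CP mulmxA Pp_Pm mul0mx.
    move: CP PC Pm_Pp Pp_Pm Pm_sq Pp_sq; rewrite /D; move: ((2 * s) ^+ 2) Pm Pp => b M1 M2 CP PC e1 e2 e3 e4.
    rewrite mulmxDl !mulmxDr !mulmxN -!scalemxAl -!scalemxAr CP PC e1 e2 e3 e4.
    by rewrite !scaler0 oppr0 !addr0 !add0r scalerA [kappa * _]mulrC.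
  by rewrite det_mulmx dC mulr0.
have e1 : B s g *m (B s g)^T = (2 * s) ^+ 2 *: (A *m A^T).
  by rewrite BE linearZ /= -scalemxAl -scalemxAr scalerA -expr2.
have e2 : (B s g)^T *m B s g = (2 * s) ^+ 2 *: (A^T *m A).
  by rewrite BE -scalemxAr linearZ /= -scalemxAl scalerA -expr2.
rewrite /sdet /poly e1 e2; case: left => dA; [apply: (key (A *m A^T))|apply: (key (A^T *m A))].
- by rewrite mulmxA A1.
- rewrite -dA /sing_det; congr (\det (_ - _ + _)).
  rewrite -{1}AE -A1T -AE !trmx_mul Pm_tr !mulmxA.
  by rewrite -!(mulmxA _ Pm Pm) Pm_sq.
- by rewrite mulmxA A2T.
- rewrite -dA /sing_det; congr (\det (_ - _ + _)).
  rewrite -AE !trmx_mul trmxK Pm_tr !mulmxA.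
  by rewrite -!(mulmxA _ Pm Pm) Pm_sq trmxK.
Qed.

Lemma continuous_sdet left kappa : continuous (sdet left kappa).
Proof.
case: left => [|g]; first exact: continuous_sing_det.
have ct : continuous (@trmx R N N) by apply: (@continuous_trmx _ _ _ _ id) => ?; exact: cvg_id.
exact: (continuous_comp (ct g) (@continuous_sing_det kappa _)).
Qed.

(** Truncated to bounded matrices, the zero set has translates by the h(t_i)^-1 of equal measure
    inside a common set of finite measure. A given g lies in finitely many of them: the numbers
    e^(t_i) are distinct, and a nonzero polynomial in s has finitely many zeros. *)
Lemma sing_null left kappa : mG [set g | sdet left kappa g = 0] = 0%E.
Proof.
pose Nk : set (borel 'M[R]_N) := [set g | sdet left kappa g = 0].
have mN : measurable Nk.
  apply: borel_closed; rewrite (_ : Nk = sdet left kappa @^-1` [set 0])//.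
  apply: closed_comp; last exact: closed_eq.
  by move=> g _; exact: continuous_sdet.
pose Nc n : set (borel 'M[R]_N) := Nk `&` [set g : 'M[R]_N | `|g| < n%:R].
have mNc n : measurable (Nc n).
  by apply: measurableI => //; exact: (@borel_norm R _ (borel 'M[R]_N) N N id).
suff Nc0 n : mG (Nc n) = 0%E.
  have NE : Nk = \bigcup_n Nc n.
    apply/seteqP; split=> [g Ng|g [n _ []]//]; exists (Num.truncn `|g|).+1 => //; split => //=.
    by have /andP[] := truncn_itv (normr_ge0 g).
  have : (mG Nk <= \sum_(n <oo) mG (Nc n))%E.
    by rewrite {1}NE; apply: generalized_Boole_inequality => //; exact: bigcupT_measurable.
  rewrite eseries0//; by move=> h0; apply/eqP; rewrite eq_le h0 measure_ge0.
pose ti (i : nat) : R := - i.+1%:R^-1.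
have tib i : -1 <= ti i <= 0.
  by rewrite /ti lerN2 oppr_le0 invr_ge0 ler0n andbT invf_le1// ler1n.
pose c1 := N%:R * (N%:R ^+ 2 * `|J| ^+ 2 * ch) * n%:R + 1.
pose U : set (borel 'M[R]_N) := [set g : 'M[R]_N | `|g| < c1].
have mU : measurable U by exact: (@borel_norm R _ (borel 'M[R]_N) N N id).
have Ufin : (mG U < +oo)%E by exact: (mG_bounded Gcl mGC mGfin).
have mGG : measurable (G : set (borel 'M[R]_N)) by exact: borel_closed.
pose A i : set (borel 'M[R]_N) := (mulmx (h (ti i)) @^-1` Nc n) `&` G.
have mpre i : measurable (mulmx (h (ti i)) @^-1` Nc n : set (borel 'M[R]_N)).
  by rewrite -[X in measurable X]setTI; apply: measurable_mull.
have mA i : measurable (A i) by exact: measurableI.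
have AU i : A i `<=` U.
  move=> g [[_ /= hg] Gg]; rewrite /U /=.
  have jh := jinvK JJ GJ (Gh (ti i)).
  have -> : g = jinv J (h (ti i)) *m (h (ti i) *m g) by rewrite mulmxA jh mul1mx.
  apply: (@le_lt_trans _ _ (N%:R * (N%:R ^+ 2 * `|J| ^+ 2 * ch) * n%:R)); last by rewrite /c1 ltrDl.
  apply: le_trans (mx_norm_mul _ _) _; apply: ler_pM => //; rewrite ?mulr_ge0//; last exact: ltW.
  rewrite ler_wpM2l//; apply: le_trans (mx_norm_mul _ _) _.
  rewrite (_ : _ * ch = N%:R * (N%:R * `|J| * ch) * `|J|); last by ring.
  rewrite ler_wpM2r// ler_wpM2l//; apply: le_trans (mx_norm_mul _ _) _.
  by rewrite mx_norm_tr ler_wpM2l ?mulr_ge0// h_bound.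
have AE i : mG (A i) = mG (Nc n).
  rewrite -(mGinv (Gh (ti i)) (mNc n)); apply/eqP; rewrite eq_le; apply/andP; split.
    by apply: le_measure; rewrite ?inE; [exact: mA|exact: mpre|move=> g []].
  exact: (mG_capG Gcl mGC).
pose m' := mfrestr mU Ufin.
apply: (@null_of_finitely_often _ _ R m' A) => // [i|g].
  change (mG (A i `&` U) = mG (Nc n)).
  by rewrite (setIidl (AU i)) AE.
have [Gg|nG] := pselect (G g); last by exists 0%N => i _ [].
have [P hP] := poly_fun left kappa g.
have P0 : P != 0.
  by apply: contraNneq (poly0 left kappa Gg) => P0; rewrite hP P0 horner0.
apply: contrapT => /forallNP hN.
have {}hN M : exists2 i, (M <= i)%N & P.[expR (ti i)] = 0.
  have := hN M => /existsNP[i /not_implyP[Mi /contrapT [[Ng _] _]]]; exists i => //.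
  by rewrite -hP; exact: sdet_poly.
have [s [us ss hs]] : exists s : seq nat, [/\ uniq s, size s = size P & forall k, k \in s -> P.[expR (ti k)] = 0].
  elim: (size P) => [|k [s [us ss hs]]]; first by exists [::].
  have [i ks fi] := hN (\max_(i <- s) i).+1.
  exists (i :: s); rewrite /= ss us andbT; split => //; last by move=> k'; rewrite inE => /orP[/eqP ->|/hs].
  apply: contraTN ks => ks; rewrite -leqNgt.
  exact: (@leq_bigmax_seq _ _ xpredT (fun i => i)).
case/eqP: P0; apply: (@roots_geq_poly_eq0 _ _ [seq expR (ti k) | k <- s]).
- by apply/allP => _ /mapP[k /hs fk ->]; apply/rootP.
- rewrite map_inj_uniq// => a b /expR_inj /oppr_inj /invr_inj /eqP; rewrite eqr_nat.
  by move=> /eqP [].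
- by rewrite size_map ss.
Qed.

End SingularSet.

(** * The exponential of the Cartan subspace *)

Lemma mx_cvg (U : Type) (T : topologicalType) m n (F : set_system U) (f : U -> 'M[T]_(m, n)) (l : 'M[T]_(m, n)) :
  Filter F -> (forall i j, (fun u => f u i j) @ F --> l i j) -> f @ F --> l.
Proof.
move=> FF cf A [P nP sPA]; rewrite nbhs_filterE/=.
have : \forall v \near F, forall k : 'I_m * 'I_n, P k.1 k.2 (f v k.1 k.2).
  by apply: filter_forall => k; apply: cf; exact: nP.
by apply: filterS => v Pv; apply: sPA => i j; exact: (Pv (i, j)).
Qed.

Section CartanExponential.
Variables (R : realType) (p q : nat) (p_lt_q : (p < q)%N).
Implicit Types (X : 'rV[R]_p) (b : bool).

Local Notation wid := (widen_ord (ltnW p_lt_q)).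
Local Notation e i := (delta_mx 0 (lshift q i) : 'rV[R]_(p + q)).
Local Notation e' j := (delta_mx 0 (rshift p j) : 'rV[R]_(p + q)).
(** Common left eigenvectors of all Cartan matrices, with eigenvalues X_i and -X_i according to b;
    up to sign, J exchanges the two. *)
Definition frame b i := e i + (-1) ^+ b *: e' (wid i).
Local Notation f := frame.

Lemma frame_e i : e i = 2^-1 *: (f false i + f true i).
Proof. by apply/rowP => k; rewrite /frame !mxE; field. Qed.

Lemma frame_e' i : e' (wid i) = 2^-1 *: (f false i - f true i).
Proof. by apply/rowP => k; rewrite /frame !mxE; field. Qed.

Lemma frameE b i : f b i = e i + (-1) ^+ b *: e' (wid i). Proof. by []. Qed.

Local Opaque frame.

Lemma frame_ext (A B : 'M[R]_(p + q)) : (forall b i, f b i *m A = f b i *m B) ->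
  (forall j : 'I_q, (p <= j)%N -> e' j *m A = e' j *m B) -> A = B.
Proof.
move=> hf he; apply/row_matrixP => k; rewrite !rowE; case: (split_ordP k) => j ->.
  by rewrite frame_e -!scalemxAl !(mulmxDl (f false j) (f true j)) !hf.
case: (wid_case p_lt_q j) => [pj|[i ->]]; first exact: he.
by rewrite frame_e' -!scalemxAl !(mulmxBl (f false i) (f true i)) !hf.
Qed.

Lemma frame_cartan b i X : f b i *m cartan_mx q X = ((-1) ^+ b * X 0 i) *: f b i.
Proof.
rewrite frameE mulmxDl -scalemxAl row_cartan col_cartan scalerDr addrC !scalerA; congr (_ + _ *: _).
by rewrite mulrC mulrA -expr2 sqrr_sign mul1r.
Qed.

Lemma row_diag n (k : 'I_n) (D : 'rV[R]_n) : delta_mx 0 k *m diag_mx D = D 0 k *: delta_mx 0 k :> 'rV_n.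
Proof.
apply/rowP => l; rewrite -rowE !mxE eqxx/= eq_sym.
by case: eqP => _; rewrite ?mulr1 ?mulr0 ?mulr1n.
Qed.

Lemma frame_Ipq b i : f b i *m Ipq R p q = - f (~~ b) i.
Proof.
rewrite Ipq_diag frameE mulmxDl -scalemxAl !row_diag row_mxEl row_mxEr !mxE scaleN1r scale1r opprD.
by case: b; rewrite /= ?expr0 ?expr1 ?scaleN1r ?scale1r ?opprK.
Qed.

Lemma e'_Ipq (j : 'I_q) : e' j *m Ipq R p q = e' j.
Proof. by rewrite Ipq_diag row_diag row_mxEr mxE scale1r. Qed.

Definition cosh_mx X : 'M[R]_(p + q) :=
  diag_mx (\row_k (let ch i := (expR (X 0 i) + expR (- X 0 i)) / 2 in
    match fintype.split k with
    | inl i => ch i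
    | inr j => if insub (val j) is Some i then ch i else 1 end)).

Definition cexp X := cosh_mx X + cartan_mx q (\row_i ((expR (X 0 i) - expR (- X 0 i)) / 2)).

Lemma cexp_tr X : (cexp X)^T = cexp X.
Proof. by rewrite /cexp linearD /= tr_diag_mx trmx_cartan. Qed.

Lemma frame_cexp b i X : f b i *m cexp X = expR ((-1) ^+ b * X 0 i) *: f b i.
Proof.
rewrite mulmxDr frame_cartan /cosh_mx; set ch := (expR (X 0 i) + expR (- X 0 i)) / 2.
rewrite [f b i *m diag_mx _](_ : _ = ch *: f b i); last first.
  rewrite frameE mulmxDl -scalemxAl !row_diag mxE (unsplitK (inl i)) mxE.
  by rewrite (unsplitK (inr (wid i))) /= valK scalerDr !scalerA; congr (_ + _ *: _); rewrite mulrC.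
rewrite -scalerDl mxE; congr (_ *: _).
by rewrite /ch; case: b; rewrite ?expr0 ?expr1 ?mulN1r ?mul1r; field.
Qed.

Lemma e'_cexp (j : 'I_q) X : (p <= j)%N -> e' j *m cexp X = e' j.
Proof.
move=> pj; rewrite mulmxDr col_cartan_ge// addr0 row_diag mxE (unsplitK (inr j)) insubF ?scale1r//.
by rewrite ltnNge pj.
Qed.

(** On an eigenvector the partial sums are those of the scalar exponential series. The frame and the
    remaining [e' j], on which the Cartan matrix vanishes, span the space. *)
Lemma expmx_cartan X : expmx (cartan_mx q X) = cexp X.
Proof.
set A := cartan_mx q X; pose S : nat -> 'M[R]_(p + q) := series (fun k => k`!%:R^-1 *: A ^+ k); rewrite /expmx -/S.
have ev (v : 'rV[R]_(p + q)) a n : v *m A = a *: v -> v *m S n = series (exp_coeff a) n *: v.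
  move=> va; rewrite /S /series /= mulmx_sumr scaler_suml; apply: eq_bigr => k _.
  rewrite -scalemxAr /exp_coeff /=; have -> : v *m A ^+ k = a ^+ k *: v.
    elim: k => [|k ih]; first by rewrite !expr0 mulmx1 scale1r.
    by rewrite exprSr mulmxA ih -scalemxAl va scalerA exprSr.
  by rewrite scalerA mulrC.
have cv (v : 'rV[R]_(p + q)) a l : v *m A = a *: v -> v *m cexp X = expR a *: v ->
    (fun n => (v *m S n) 0 l) @ \oo --> (v *m cexp X) 0 l.
  move=> va vE; rewrite vE mxE; under eq_fun do rewrite (ev _ _ _ va) mxE.
  by apply: cvgMl; exact: is_cvg_series_exp_coeff.
suff : S n @[n --> \oo] --> cexp X by move/cvg_lim; apply; exact: norm_hausdorff.
apply: mx_cvg => k l.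
have rE (M : 'M[R]_(p + q)) : M k l = ((delta_mx 0 k : 'rV_(p + q)) *m M) 0 l by rewrite -rowE mxE.
rewrite rE; under eq_fun do rewrite rE.
have cf b i : (fun n => (f b i *m S n) 0 l) @ \oo --> (f b i *m cexp X) 0 l.
  by apply: (cv _ ((-1) ^+ b * X 0 i)); [exact: frame_cartan|exact: frame_cexp].
case: (split_ordP k) => j ->.
  rewrite frame_e -scalemxAl mulmxDl mxE mxE; under eq_fun do rewrite -scalemxAl mulmxDl mxE mxE.
  by apply: cvgMr; apply: cvgD.
case: (wid_case p_lt_q j) => [pj|[i ->]].
  by apply: (cv _ 0); rewrite ?expR0 ?scale1r ?e'_cexp ?scale0r ?col_cartan_ge.
rewrite frame_e' -scalemxAl mulmxBl mxE; under eq_fun do rewrite -scalemxAl mulmxBl mxE.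
by apply: cvgMr; rewrite mxE [X in _ --> _ + X]mxE; under eq_fun do rewrite mxE [X in _ + X]mxE; apply: cvgB.
Qed.

Lemma cexp_Ipq X : cexp X *m Ipq R p q *m cexp X = Ipq R p q.
Proof.
apply: frame_ext => [b i|j pj].
  rewrite mulmxA (mulmxA _ (cexp X)) frame_cexp -!scalemxAl frame_Ipq mulNmx frame_cexp scalerN scalerA -expRD.
  by rewrite signrN mulNr subrr expR0 scale1r.
by rewrite mulmxA (mulmxA _ (cexp X)) e'_cexp// e'_Ipq e'_cexp.
Qed.

Lemma odd_part_cexp X : odd_part (Ipq R p q) (cexp X *m cexp X) =
  cartan_mx q (\row_i (expR (2 * X 0 i) - expR (- (2 * X 0 i)))).
Proof.
apply: frame_ext => [b i|j pj].
  have f2 b' : f b' i *m (cexp X *m cexp X) = expR ((-1) ^+ b' * (2 * X 0 i)) *: f b' i.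
    rewrite mulmxA frame_cexp -scalemxAl frame_cexp scalerA -expRD; congr (expR _ *: _); ring.
  rewrite frame_cartan /odd_part mulmxBr f2 !(mulmxA (f b i)) frame_Ipq !mulNmx.
  rewrite f2 -scalemxAl frame_Ipq negbK scalerN opprK -scalerBl mxE; congr (_ *: _).
  by case: b; rewrite /= ?expr0 ?expr1 ?mulN1r ?mul1r ?opprB.
rewrite col_cartan_ge// /odd_part mulmxBr !mulmxA e'_cexp// e'_cexp// e'_Ipq e'_cexp// e'_cexp//.
by rewrite e'_Ipq subrr.
Qed.

(** The function 2 sinh (2x) is odd and strictly increasing, so it preserves zeros and equality up
    to sign. *)
Lemma same_pattern_sinh X : same_pattern X (\row_i (expR (2 * X 0 i) - expR (- (2 * X 0 i)))).
Proof.
have sh_inj (a b : R) : expR (2 * a) - expR (- (2 * a)) = expR (2 * b) - expR (- (2 * b)) -> a = b.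
  have mono (c d : R) : c < d -> expR (2 * c) - expR (- (2 * c)) < expR (2 * d) - expR (- (2 * d)).
    by move=> cd; rewrite ltrB// ltr_expR; lra.
  by move=> ab; case: (ltgtP a b) => // /mono; rewrite ab ltxx.
split=> [i|i j]; rewrite !mxE.
  apply/eqP/eqP => [h|->]; last by rewrite mulr0 oppr0 subrr.
  by apply: sh_inj; rewrite h mulr0 oppr0 subrr.
move/eqP; rewrite eqf_sqr => /orP[/eqP/sh_inj -> //|/eqP h].
have -> : X 0 i = - X 0 j; last by rewrite sqrrN.
by apply: sh_inj; rewrite h mulrN opprK opprB.
Qed.

Lemma row_cexp X i : e i *m cexp X = ((expR (X 0 i) + expR (- X 0 i)) / 2) *: e i +
  ((expR (X 0 i) - expR (- X 0 i)) / 2) *: e' (wid i).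
Proof.
rewrite {1}frame_e -scalemxAl (mulmxDl (f false i)) !frame_cexp !frameE expr0 expr1 !mulN1r !mul1r.
by apply/rowP => k; rewrite !mxE; field.
Qed.

Lemma col_cexp X i : e' (wid i) *m cexp X = ((expR (X 0 i) - expR (- X 0 i)) / 2) *: e i +
  ((expR (X 0 i) + expR (- X 0 i)) / 2) *: e' (wid i).
Proof.
rewrite {1}frame_e' -scalemxAl (mulmxBl (f false i)) !frame_cexp !frameE expr0 expr1 !mulN1r !mul1r.
by apply/rowP => k; rewrite !mxE; field.
Qed.

End CartanExponential.

Lemma count_blocks (R : realDomainType) (s : seq nat) (x : seq R) y :
  size x = size s -> uniq x ->
  count_mem y (flatten [seq nseq c.1 c.2 | c <- zip s x]) = (if y \in x then nth 0 s (index y x) else 0)%N.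
Proof.
elim: s x => [|m s ih] [|a x] //= [sx] /andP[ax ux].
rewrite count_cat count_nseq ih// in_cons /= (eq_sym y a); case: (eqVneq a y) ax => [-> ax|_ _] /=; last by rewrite mul0n add0n.
by rewrite (negbTE ax) mul1n addn0.
Qed.

(** All that the criterion needs to know of a configuration: the number of zeros and the largest
    multiplicity of a nonzero absolute value. The latter is attained only if positive, since for X =
    0 the list [s] is empty. *)
Lemma configP (R : realType) p (X : 'rV[R]_p) s u : configuration X s u ->
  [/\ #|[pred i | X 0%R i == 0%R]| = u,
      forall c : R, c != 0 -> (#|[pred i | X 0%R i ^+ 2 == c]| <= \max_(m <- s) m)%N
    & (0 < \max_(m <- s) m)%N -> exists2 c : R, c != 0 & #|[pred i | X 0%R i ^+ 2 == c]| = \max_(m <- s) m].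
Proof.
move=> [x [sx xs x0 s0 hX]].
have ux : uniq x by apply: (sorted_uniq _ _ xs) => [a b c ab bc|a]; [exact: lt_trans bc ab|exact: ltxx].
have cnt y : #|[pred i | `|X 0%R i| == y]| =
    ((if y \in x then nth 0 s (index y x) else 0) + (0%R == y) * u)%N.
  rewrite cardE size_filter -enumT -(count_map (fun i => `|X 0 i|) (pred1 y)).
  have /seq.permP <- : perm_eq (sort >=%R [seq `|X 0 i| | i <- enum 'I_p]) [seq `|X 0 i| | i <- enum 'I_p] by rewrite perm_sort.
  by rewrite hX count_cat count_blocks// count_nseq.
have sq y : 0 <= y -> [pred i | X 0 i ^+ 2 == y ^+ 2] =i [pred i | `|X 0 i| == y].
  by move=> y0 i; rewrite !inE -real_normK ?num_real// eqrXn2.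
have x0' y : y \in x -> 0 < y by move/(allP x0).
split.
- have := cnt 0; rewrite eqxx mul1n ifF ?add0n => [<-|]; last first.
    by apply/negP => /x0'; rewrite ltxx.
  by apply: eq_card => i; rewrite !inE normr_eq0.
- move=> c c0; have [/existsP[i /eqP ic]|/existsPn h] := boolP [exists i, X 0 i ^+ 2 == c]; last first.
    by rewrite eq_card0// => i; rewrite inE; apply/negbTE/h.
  rewrite -ic -real_normK ?num_real// (eq_card (sq _ _))// cnt.
  rewrite [0 == _]eq_sym normr_eq0; have [e|_] := eqVneq (X 0 i) 0.
    by move: c0; rewrite -ic e expr0n eqxx.
  rewrite mul0n addn0; case: ifP => // ix; apply: (@leq_bigmax_seq _ _ xpredT (fun m => m)) => //.
  by rewrite mem_nth// -sx index_mem.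
- move=> m0; have [m ms mE] : exists2 m, m \in s & m = \max_(m <- s) m.
    elim: s m0 {sx hX cnt s0} => [|a s ih]; first by rewrite big_nil.
    rewrite big_cons => m0; case: (leqP (\max_(m <- s) m) a) => [h|h].
      by exists a; rewrite ?mem_head.
    have [|m ms mE] := ih; first by apply: leq_ltn_trans h.
    by exists m => //; rewrite in_cons ms orbT.
  have ix : (index m s < size x)%N by rewrite sx index_mem.
  pose y := nth 0 x (index m s); have yx : y \in x by rewrite mem_nth.
  exists (y ^+ 2); first by rewrite sqrf_eq0 gt_eqF// x0'.
  rewrite -mE (eq_card (sq _ _)) ?ltW ?x0'// cnt yx index_uniq// nth_index// lt_eqF ?x0'//.
  by rewrite mul0n addn0.
Qed.

(** * The dimension count for ineligible pairs *)

Lemma rank_rows (F : fieldType) n m (A : 'M[F]_(n, m)) (P : {pred 'I_n}) :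
  (forall k, k \notin P -> row k A = 0) -> (\rank A <= #|P|)%N.
Proof.
move=> h; apply: leq_trans (rank_leq_row (rowsub (@enum_val _ P) A)); apply: mxrankS.
apply/row_subP => k; have [kP|/h ->] := boolP (k \in P); last exact: sub0mx.
by rewrite -[k](enum_rankK_in kP kP) -row_rowsub row_sub.
Qed.

Lemma rank_tens1 (F : fieldType) n d (A : 'M[F]_n) : (\rank (A *t (1%:M : 'M[F]_d)) <= \rank A * d)%N.
Proof.
rewrite -{1}[A]mulmx_base -[1%:M]mulmx1 -tensmx_mul.
by apply: leq_trans (mxrankM_maxl _ _) _; exact: rank_leq_col.
Qed.

(** The rows of [S] span an s-dimensional space, on which [A] and [B] together impose fewer than s
    conditions; the right inverse keeps the solution nonzero. *)
Lemma exists_singular_row (F : fieldType) n s (S : 'M[F]_(s, n)) (S' : 'M[F]_(n, s)) (A B : 'M[F]_n) :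
  S *m S' = 1%:M -> (\rank (S *m A) + \rank (S *m B) < s)%N ->
  exists a : 'rV_s, [/\ a *m S != 0, a *m S *m A = 0 & a *m S *m B = 0].
Proof.
move=> SS rs; pose M := row_mx (S *m A) (S *m B).
have rM : (\rank M < s)%N.
  have -> : M = S *m A *m row_mx 1%:M 0 + S *m B *m row_mx 0 1%:M.
    by rewrite !mul_mx_row !mulmx1 !mulmx0 add_row_mx addr0 add0r.
  apply: leq_ltn_trans rs; apply: leq_trans (mxrank_add _ _) _.
  by apply: leq_add; exact: mxrankM_maxl.
have : kermx M != 0 by rewrite -mxrank_eq0 mxrank_ker subn_eq0 -ltnNge.
move=> /rowV0Pn[a /sub_kermxP aM a0]; exists a.
have : row_mx (a *m (S *m A)) (a *m (S *m B)) = row_mx 0 0 by rewrite -mul_mx_row aM row_mx0.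
move=> /eq_row_mx[e1 e2]; rewrite -!mulmxA e1 e2; split => //.
by apply: contraNneq a0 => h; rewrite -[a]mulmx1 -SS mulmxA h mul0mx.
Qed.

Section SingularWord.
Variables (R : realType) (p q d : nat) (p_lt_q : (p < q)%N) (d_gt0 : (0 < d)%N).
Variables (X Y : 'rV[R]_p).
Local Notation N := ((p + q) * d)%N.
Local Notation wid := (widen_ord (ltnW p_lt_q)).
Local Notation e i := (delta_mx 0 (lshift q i) : 'rV[R]_(p + q)).
Local Notation e' j := (delta_mx 0 (rshift p j) : 'rV[R]_(p + q)).
Local Notation J0 := (Ipq R p q).
Local Notation J := (J0 *t 1%:M : 'M[R]_N).
Local Notation x := (cexp q X *t 1%:M : 'M[R]_N).
Local Notation y := (cexp q Y *t 1%:M : 'M[R]_N).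

Lemma e_Ipq i : e i *m J0 = - e i.
Proof. by rewrite Ipq_diag row_diag row_mxEl mxE scaleN1r. Qed.

Lemma mulJ_Pm n m (A : 'M[R]_(m, n)) (J' : 'M[R]_n) : A *m J' = - A -> A *m Pm J' = A.
Proof.
move=> AJ; rewrite PmE -scalemxAr mulmxBr AJ mulmx1 opprK.
by apply/matrixP => i j; rewrite !mxE; field.
Qed.

Lemma mulJ_Pm0 n m (A : 'M[R]_(m, n)) (J' : 'M[R]_n) : A *m J' = A -> A *m Pm J' = 0.
Proof. by move=> AJ; rewrite PmE -scalemxAr mulmxBr AJ mulmx1 subrr scaler0. Qed.

Lemma mulJ_Pp0 n m (A : 'M[R]_(m, n)) (J' : 'M[R]_n) : A *m J' = - A -> A *m Pp J' = 0.
Proof. by move=> AJ; rewrite /Pp -scalemxAr mulmxDr AJ mulmx1 subrr scaler0. Qed.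

Lemma mulJ_Pp n m (A : 'M[R]_(m, n)) (J' : 'M[R]_n) : A *m J' = A -> A *m Pp J' = A.
Proof.
move=> AJ; rewrite /Pp -scalemxAr mulmxDr AJ mulmx1.
by apply/matrixP => i j; rewrite !mxE; field.
Qed.

Lemma tensD1 m n (A B : 'M[R]_(m, n)) : A *t (1%:M : 'M[R]_d) + B *t 1%:M = (A + B) *t 1%:M.
Proof.
apply/matrixP => i j; case: (mxtens_indexP i) => a b; case: (mxtens_indexP j) => a' b'.
by rewrite [LHS]mxE !tensmxE [in RHS]mxE mulrDl.
Qed.

Lemma tensB1 m n (A B : 'M[R]_(m, n)) : A *t (1%:M : 'M[R]_d) - B *t 1%:M = (A - B) *t 1%:M.
Proof.
apply/matrixP => i j; case: (mxtens_indexP i) => a b; case: (mxtens_indexP j) => a' b'.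
by rewrite [LHS]mxE [X in _ + X]mxE !tensmxE [in RHS]mxE [in RHS]mxE mulrBl.
Qed.

Lemma tensZ1 m n (a : R) (A : 'M[R]_(m, n)) : a *: (A *t (1%:M : 'M[R]_d)) = (a *: A) *t 1%:M.
Proof.
apply/matrixP => i j; case: (mxtens_indexP i) => k b; case: (mxtens_indexP j) => a' b'.
by rewrite [LHS]mxE !tensmxE [in RHS]mxE mulrA.
Qed.

Lemma Pm_tens : Pm J = Pm J0 *t 1%:M.
Proof. by rewrite !PmE -tens11 tensB1 tensZ1. Qed.

Lemma Pp_tens : Pp J = Pp J0 *t 1%:M.
Proof. by rewrite /Pp -tens11 tensD1 tensZ1. Qed.

(** The number of indices at which [cexp q Y] acts nontrivially; it bounds the two ranks below. *)
Let zeros := #|[pred i | Y 0%R i != 0%R]|.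

Lemma rank_cexp_sub1 : (\rank (Pm J0 *m (cexp q Y - 1%:M)) <= zeros)%N.
Proof.
pose P := [pred k | k \in [seq lshift q i | i in [pred i | Y 0%R i != 0%R]]].
have -> : zeros = #|P| by rewrite fintype.card_image//; exact: lshift_inj.
apply: rank_rows => k kP; rewrite rowE mulmxA.
case: (split_ordP k) kP => j -> kP; last first.
  by rewrite mulJ_Pm0 ?mul0mx// e'_Ipq.
rewrite mulJ_Pm ?e_Ipq// mulmxBr (row_cexp p_lt_q) mulmx1.
have -> : Y 0 j = 0.
  by apply: contraNeq kP => Yj; apply/fintype.imageP; exists j.
by rewrite oppr0 expR0 subrr mul0r scale0r addr0 -[1 + 1]/2%:R divff ?pnatr_eq0// scale1r subrr.
Qed.

Lemma rank_cexp_off : (\rank (Pp J0 *m cexp q Y *m Pm J0) <= zeros)%N.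
Proof.
pose P := [pred k | k \in [seq rshift p (wid i) | i in [pred i | Y 0%R i != 0%R]]].
have -> : zeros = #|P|.
  by rewrite fintype.card_image// => i j /rshift_inj /(congr1 val) ij; exact: val_inj.
apply: rank_rows => k kP; rewrite rowE !mulmxA.
case: (split_ordP k) kP => j -> kP; first by rewrite (mulJ_Pp0 (e_Ipq j)) !mul0mx.
rewrite (mulJ_Pp (e'_Ipq _ _ j)); case: (wid_case p_lt_q j) kP => [pj _|[i -> kP]].
  by rewrite e'_cexp// (mulJ_Pm0 (e'_Ipq _ _ j)).
rewrite col_cexp mulmxDl -!scalemxAl (mulJ_Pm0 (A := e' _)) ?e'_Ipq// scaler0 addr0.
have -> : Y 0 i = 0.
  by apply: contraNeq kP => Yj; apply/fintype.imageP; exists i.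
by rewrite oppr0 subrr mul0r scale0r.
Qed.

(** The coordinates in [P0] lie in the eigenspace of cosh X for c. The flag [b] records that sinh X
    vanishes on them, in which case the second condition on the eigenvector costs nothing. *)
Variables (P0 : {pred 'I_p}) (c : R) (b : bool).
Hypothesis P0c : forall i, i \in P0 -> (expR (X 0 i) + expR (- X 0 i)) / 2 = c.
Hypothesis P0b : b -> forall i, i \in P0 -> expR (X 0 i) - expR (- X 0 i) = 0.
Hypothesis P0_card : (zeros + ~~ b * zeros < #|P0|)%N.

Lemma singular_word (k1 l k4 : 'M[R]_N) :
  k1 *m k1^T = 1%:M -> k1 *m J = J *m k1 -> k4 *m k4^T = 1%:M -> k4 *m J = J *m k4 ->
  l *m l^T = 1%:M -> l *m J = J *m l ->
  sing_det J (c ^+ 2) (k1 *m x *m l *m y *m k4) = 0.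
Proof.
move=> kk1 kJ1 kk4 kJ4 ll lJ.
have JT : J^T = J by exact: tens_J_sym.
have JJ : J *m J = 1%:M by exact: tens_J_sq.
pose f (k : 'I_#|P0|) := lshift q (enum_val k).
pose f' (k : 'I_#|P0|) := rshift p (wid (enum_val k)).
pose S0 : 'M[R]_(#|P0|, p + q) := rowsub f 1%:M.
pose S0' : 'M[R]_(#|P0|, p + q) := rowsub f' 1%:M.
pose D : 'M[R]_#|P0| := diag_mx (\row_k ((expR (X 0 (enum_val k)) - expR (- X 0 (enum_val k))) / 2)).
have rS k : row k S0 = e (enum_val k) by rewrite row_rowsub row1.
have rS' k : row k S0' = e' (wid (enum_val k)) by rewrite row_rowsub row1.
pose S : 'M[R]_(#|P0| * d, N) := S0 *t 1%:M; pose S' : 'M[R]_(#|P0| * d, N) := S0' *t 1%:M.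
have SS : S *m (S0^T *t 1%:M) = 1%:M.
  rewrite /S tensmx_mul mulmx1 (_ : S0 *m S0^T = 1%:M) ?tens11//.
  apply/row_matrixP => i; rewrite row_mul rS -rowE row1; apply/rowP => j; rewrite !mxE.
  by rewrite (inj_eq (@lshift_inj _ _)) (inj_eq enum_val_inj) eqxx.
have SJ : S *m J = - S.
  rewrite /S tensmx_mul mulmx1 (_ : S0 *m J0 = - S0).
    by rewrite -(scaleN1r S0) -(scaleN1r (S0 *t 1%:M)) tensZ1.
  by apply/row_matrixP => k; rewrite row_mul linearN /= !rS e_Ipq.
have SJ' : S' *m J = S'.
  rewrite /S' tensmx_mul mulmx1 (_ : S0' *m J0 = S0')//.
  by apply/row_matrixP => k; rewrite row_mul !rS' e'_Ipq.
have Sx : S *m x = c *: S + (D *t 1%:M) *m S'.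
  rewrite /S /S' !tensmx_mul mulmx1 (_ : S0 *m cexp q X = c *: S0 + D *m S0').
    by rewrite -tensD1 -tensZ1.
  apply/row_matrixP => k; have -> : row k (c *: S0 + D *m S0') = c *: row k S0 + row k (D *m S0') by apply/rowP => l'; rewrite !mxE.
  rewrite !row_mul !rS (row_cexp p_lt_q) P0c ?enum_valP//.
  by rewrite rowE row_diag mxE -scalemxAl -rowE rS'.
(* These are the two conditions of [sing_det_word]. Inserting [Pm] is harmless because w l stays in
   its range, and it keeps the rank down to one dimension for each nonzero entry of [Y], where y - 1
   itself has two. *)
pose A := l *m (Pm J *m (y - 1%:M)); pose C := l *m (Pp J *m y *m Pm J); pose B := x *m Pp J *m C.
have rl (M : 'M[R]_N) M0 : M = M0 *t 1%:M -> (\rank M0 <= zeros)%N -> (\rank M <= zeros * d)%N.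
  by move=> -> h; apply: leq_trans (rank_tens1 _ _) _; rewrite leq_pmul2r.
have rA : (\rank (S *m A) <= zeros * d)%N.
  apply: leq_trans (mxrankM_maxr _ _) _; apply: leq_trans (mxrankM_maxr _ _) _.
  apply: rl rank_cexp_sub1; by rewrite Pm_tens -tens11 tensB1 tensmx_mul mulmx1.
have rB : (\rank (S *m B) <= (~~ b * zeros) * d)%N.
  have [bT|bF] := boolP b.
    have Sx0 : S *m x *m Pp J = 0.
      rewrite Sx mulmxDl -scalemxAl mulJ_Pp0// scaler0 add0r (_ : D = 0).
        by rewrite tens0mx !mul0mx.
      by apply/matrixP => i j; rewrite !mxE P0b ?enum_valP// mul0r mul0rn.
    by rewrite /B mulmxA (mulmxA S x) Sx0 mul0mx mxrank0.
  rewrite mul1n; do 3 apply: leq_trans (mxrankM_maxr _ _) _.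
  apply: rl rank_cexp_off; by rewrite Pm_tens Pp_tens !tensmx_mul !mulmx1.
have [|a [w0 wA wB]] := exists_singular_row SS (A := A) (B := B).
  by apply: leq_ltn_trans (leq_add rA rB) _; rewrite -mulnDl ltn_pmul2r.
have lP := Pm_comm lJ.
have lPp : l *m Pp J = Pp J *m l.
  by rewrite /Pp -scalemxAl -scalemxAr mulmxDr mulmxDl lJ mulmx1 mul1mx.
set w := a *m S in w0 wA wB.
have wP : w *m Pm J = w by rewrite /w -mulmxA mulJ_Pm.
apply: (@sing_det_word R N J JT JJ (c ^+ 2) c x l y k1 k4 w) => //.
- by rewrite trmx_tens trmx1 cexp_tr.
- by rewrite trmx_tens trmx1 cexp_tr.
- rewrite /w -(mulmxA a) Sx -mulmxA mulmxDl -scalemxAl mulJ_Pm// -mulmxA mulJ_Pm0// mulmx0 addr0.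
  by rewrite -scalemxAr.
- apply/eqP; rewrite -subr_eq0 -[X in _ - X]mulmx1 -mulmxBr -[w *m l in X in X *m _](_ : w *m l *m Pm J = _).
    by rewrite -wA /A !mulmxA.
  by rewrite -mulmxA lP mulmxA wP.
- have CE : C = Pp J *m (l *m y *m Pm J).
    by rewrite /C -(mulmxA (Pp J)) (mulmxA l) lPp -!mulmxA.
  have PPl : Pp J *m (Pp J *m (l *m y *m Pm J)) = Pp J *m (l *m y *m Pm J).
    by rewrite (mulmxA (Pp J) (Pp J)) Pp_sq.
  rewrite -wB /B CE -(mulmxA x) PPl !mulmxA.
  by [].
Qed.

End SingularWord.

Lemma frame_rows (R : realType) p q (A B : 'M[R]_(p + q)) :
  (forall i, delta_mx 0 (lshift q i) *m A = delta_mx 0 (lshift q i) *m B :> 'rV_(p + q)) ->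
  (forall j, delta_mx 0 (rshift p j) *m A = delta_mx 0 (rshift p j) *m B :> 'rV_(p + q)) -> A = B.
Proof.
move=> h1 h2; apply/row_matrixP => k; rewrite !rowE; case: (split_ordP k) => j ->; [exact: h1|exact: h2].
Qed.

Lemma trmx_word (R : comPzRingType) n (a b c x y : 'M[R]_n) : x^T = x -> y^T = y ->
  (a *m x *m b *m y *m c)^T = c^T *m y *m b^T *m x *m a^T.
Proof. by move=> xT yT; rewrite !trmx_mul xT yT !mulmxA. Qed.

Lemma sdet_right (R : realType) n (J : 'M[R]_n) kappa g : sdet J false kappa g = sing_det J kappa g^T.
Proof. by []. Qed.

Definition singular_pattern (R : realType) p (X Y : 'rV[R]_p) :=
  exists (P : pred 'I_p) (c : R) (b : bool),
  [/\ forall i, P i -> (expR (X 0 i) + expR (- X 0 i)) / 2 = c,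
      b -> forall i, P i -> expR (X 0 i) - expR (- X 0 i) = 0
    & (#|[pred i | Y 0%R i != 0%R]| + ~~ b * #|[pred i | Y 0%R i != 0%R]| < #|P|)%N].

Lemma card_nonzero (R : realType) p (Y : 'rV[R]_p) :
  (#|[pred i | Y 0%R i == 0%R]| + #|[pred i | Y 0%R i != 0%R]|)%N = p.
Proof.
rewrite -[RHS]card_ord -(cardC [pred i | Y 0%R i == 0%R]); congr (_ + _)%N.
Qed.

Lemma singular_pattern_zeros (R : realType) p (X Y : 'rV[R]_p) :
  (p < #|[pred i | X 0%R i == 0%R]| + #|[pred i | Y 0%R i == 0%R]|)%N -> singular_pattern X Y.
Proof.
move=> h; exists (fun i => X 0 i == 0), 1, true; split=> [i|_ i|].
- move=> /eqP ->; rewrite oppr0 expR0 -[1 + 1]/2%:R divff ?pnatr_eq0//.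
- by move=> /eqP ->; rewrite oppr0 expR0 subrr.
- have := card_nonzero Y; rewrite mul0n addn0 => Yp.
  have h2 : (#|[pred i | Y 0%R i != 0%R]| < #|[pred i | X 0%R i == 0%R]|)%N by lia.
  exact: h2.
Qed.

Lemma singular_pattern_block (R : realType) p (X Y : 'rV[R]_p) (c : R) :
  (2 * p < #|[pred i | X 0%R i ^+ 2 == c]| + 2 * #|[pred i | Y 0%R i == 0%R]|)%N -> singular_pattern X Y.
Proof.
move=> h; have Yp := card_nonzero Y.
have /card_gt0P[i0] : (0 < #|[pred i | X 0%R i ^+ 2 == c]|)%N by lia.
rewrite inE => /eqP i0c; exists (fun i => X 0 i ^+ 2 == c), ((expR (X 0 i0) + expR (- X 0 i0)) / 2), false.
split=> // [i|]; last first.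
  have h2 : (#|[pred i | Y 0%R i != 0%R]| + #|[pred i | Y 0%R i != 0%R]| < #|[pred i | X 0%R i ^+ 2 == c]|)%N by lia.
  rewrite mul1n; exact: h2.
rewrite -i0c eqf_sqr => /orP[/eqP -> //|/eqP ->].
by rewrite opprK addrC.
Qed.

(** Both largest multiplicities are at most p, so their sum cannot exceed 2p. What fails is
    therefore u + v <= p, or one of the two mixed inequalities, which are interchanged by swapping X
    and Y. *)
Lemma noneligible_pattern (R : realType) p (X Y : 'rV[R]_p) s u t v :
  configuration X s u -> configuration Y t v ->
  ~~ (max_config s (2 * u) + max_config t (2 * v) <= 2 * p)%N ->
  singular_pattern X Y \/ singular_pattern Y X.
Proof.
move=> /configP[Xu _ Xs] /configP[Yv _ Yt]; rewrite -ltnNge /max_config.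
have := card_nonzero X; have := card_nonzero Y; rewrite Xu Yv => pY pX.
have bs : (\max_(m <- s) m <= p)%N.
  case: (posnP (\max_(m <- s) m)) => [->//|/Xs[c _ <-]]; by rewrite -[X in (_ <= X)%N]card_ord max_card.
have bt : (\max_(m <- t) m <= p)%N.
  case: (posnP (\max_(m <- t) m)) => [->//|/Yt[c _ <-]]; by rewrite -[X in (_ <= X)%N]card_ord max_card.
move=> h; have [uv|uv] := ltnP p (u + v); first by left; apply: singular_pattern_zeros; rewrite Xu Yv.
have [sv|sv] := ltnP (2 * p) (\max_(m <- s) m + 2 * v).
  have [|c _ cE] := Xs; first by lia.
  by left; apply: (@singular_pattern_block _ _ _ _ c); rewrite cE Yv.
have [tu|tu] := ltnP (2 * p) (\max_(m <- t) m + 2 * u).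
  have [|c _ cE] := Yt; first by lia.
  by right; apply: (@singular_pattern_block _ _ _ _ c); rewrite cE Xu.
exfalso; move: h bs bt sv tu uv; move: (\max_(m <- s) m) (\max_(m <- t) m) => a b; lia.
Qed.

(** * The criterion for real matrix groups *)

(* For SU(p, q), [T] is multiplication by i, which spans the trace-form
   complement of the Lie algebra among the J-skew matrices commuting with [Rs];
   for the other families [T = 0]. A complex Cayley transform need not have
   determinant one: hence the distinguished generators [gens], and the correction
   [c] in [ld_Kcay]. *)
Record lie_data (R : realType) (p q d : nat) (Rs : seq 'M[R]_d) (G K : set 'M[R]_((p + q) * d))
    (T : 'M[R]_((p + q) * d)) (gens : set 'M[R]_((p + q) * d)) : Prop := LieData {
  ld_d : (0 < d)%N;
  ld_irr : forall a b : 'rV[R]_d, a != 0 -> (forall rho, rho \in Rs -> a *m rho *m b^T = 0) -> b = 0;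
  ld_RsT : forall rho, rho \in Rs -> rho^T = rho \/ rho^T = - rho;
  ld_GM : forall g h, G g -> G h -> G (g *m h);
  ld_Ginv : forall g, G g -> G (jinv (Ipq R p q *t 1%:M) g);
  ld_GJ : forall g, G g -> g^T *m (Ipq R p q *t 1%:M) *m g = Ipq R p q *t 1%:M;
  ld_GR : forall g, G g -> commutes Rs g;
  ld_Gcl : closed G;
  ld_Gexp : forall X, G (cexp q X *t 1%:M);
  ld_Kcl : closed K;
  ld_KG : K `<=` G;
  ld_Korth : forall k, K k -> k^T *m k = 1%:M;
  ld_K1 : K 1%:M;
  ld_KM : forall g h, K g -> K h -> K (g *m h);
  ld_Ktr : forall k, K k -> K k^T;
  ld_TT : T^T = - T;
  ld_TJ : T *m (Ipq R p q *t 1%:M) = (Ipq R p q *t 1%:M) *m T;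
  ld_TR : commutes Rs T;
  ld_GT : forall g, G g -> g *m T = T *m g;
  ld_trT : forall eta : R, 0 < eta -> exists2 delta : R, 0 < delta &
    forall g g', G g -> G g' -> `|g - 1%:M| < delta -> `|g' - 1%:M| < delta ->
      `|\tr ((g - g') *m T)| <= eta * `|g - g'|;
  ld_gensT : forall xi, gens xi -> xi^T = - xi;
  ld_gensK : forall xi t, gens xi -> K (cay (t *: xi));
  ld_gens_span : forall Z, commutes Rs Z -> Z *m (Ipq R p q *t 1%:M) = (Ipq R p q *t 1%:M) *m Z ->
    Z^T = - Z -> \tr (Z *m T) = 0 -> (forall xi, gens xi -> \tr (Z *m xi) = 0) -> Z = 0;
  ld_Kcay : forall xi, commutes Rs xi -> xi *m (Ipq R p q *t 1%:M) = (Ipq R p q *t 1%:M) *m xi ->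
    xi^T = - xi -> exists c, [/\ c^T *m c = 1%:M,
      c *m (Ipq R p q *t 1%:M) = (Ipq R p q *t 1%:M) *m c,
      forall X, c *m (cexp q X *t 1%:M) = (cexp q X *t 1%:M) *m c & K (c *m cay xi)] }.

Section LieDataCriterion.
Variables (R : realType) (p q d : nat) (pq : (0 < p < q)%N) (Rs : seq 'M[R]_d).
Local Notation N := ((p + q) * d)%N.
Variables (G K : set 'M[R]_N) (T : 'M[R]_N) (gens : set 'M[R]_N).
Hypothesis ld : lie_data Rs G K T gens.
Local Notation J := (Ipq R p q *t 1%:M : 'M[R]_N).
Variable mG : {measure set (borel 'M[R]_N) -> \bar R}.
Hypothesis mGC : mG (~` G) = 0%E.
Hypothesis mGinv : forall g, G g -> forall A : set (borel 'M[R]_N), measurable A ->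
  mG (mulmx g @^-1` A) = mG A.
Hypothesis mGfin : forall C : set 'M[R]_N, compact C -> C `<=` G -> (mG C < +oo)%E.
Hypothesis mG0 : mG G != 0%E.
Variable mK : probability (borel 'M[R]_N) R.
Hypothesis mKC : mK (~` K) = 0%E.
Hypothesis mKinv : forall g, K g -> forall A : set (borel 'M[R]_N), measurable A ->
  mK (mulmx g @^-1` A) = mK A.
Variables (X Y : 'rV[R]_p).
Variable mu : probability (borel 'M[R]_N) R.
Hypothesis mu_word : forall A : set (borel 'M[R]_N), measurable A ->
  mu A = ((mK \x mK) \x mK)%E ((fun om : borel 'M[R]_N * borel 'M[R]_N * borel 'M[R]_N =>
    om.1.1 *m (cexp q X *t 1%:M) *m om.1.2 *m (cexp q Y *t 1%:M) *m om.2 : borel 'M[R]_N) @^-1` A).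

Let p_lt_q : (p < q)%N. Proof. by case/andP: pq. Qed.

Let JT : J^T = J := tens_J_sym _ _ _ _.
Let JJ : J *m J = 1%:M := tens_J_sq _ _ _ _.

Lemma tens_norm (A : 'M[R]_(p + q)) : `|A *t (1%:M : 'M[R]_d)| <= `|A|.
Proof.
apply: mx_norm_le => // i j; case: (mxtens_indexP i) => a b; case: (mxtens_indexP j) => a' b'.
rewrite tensmxE mxE; case: (b == b'); last by rewrite mulr0 normr0.
by rewrite mulr1; exact: mx_entry_le.
Qed.

Let H : 'M[R]_(p + q) := cartan_mx q (const_mx 1).

(** The one-parameter group is exp (t H) for the Cartan matrix H with all entries 1. On the range of
    [Pm], H^2 = 1, so exp (t H) acts there as cosh t + (sinh t) H, a polynomial in s = e^t after
    multiplication by 2 s. *)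
Lemma flow_null left kappa : mG [set g | sdet J left kappa g = 0] = 0%E.
Proof.
have HT : (H *t 1%:M : 'M[R]_N)^T = H *t 1%:M by rewrite trmx_tens trmx1 trmx_cartan.
have HJ : (H *t 1%:M) *m J = - (J *m (H *t 1%:M)).
  rewrite !tensmx_mul mulmx1 -[RHS]scaleN1r tensZ1 scaleN1r; congr (_ *t _).
  apply: (@frame_ext R p q p_lt_q) => [b i|j pj].
    rewrite mulmxN !mulmxA frame_cartan -scalemxAl !frame_Ipq mulNmx frame_cartan opprK scalerN !mxE !mulr1.
    by case: b; rewrite ?expr0 ?expr1 ?scaleN1r ?scale1r ?opprK.
  by rewrite mulmxN !mulmxA e'_Ipq !col_cartan_ge// mul0mx oppr0.
have PH : Pm (Ipq R p q) *m (H *m H) = Pm (Ipq R p q).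
  apply: frame_rows => [i|j].
    by rewrite !mulmxA mulJ_Pm ?e_Ipq// row_cartan mxE scale1r col_cartan mxE scale1r.
  by rewrite mulmxA (mulJ_Pm0 (e'_Ipq _ _ j)) mul0mx.
have HH : Pm J *m ((H *t 1%:M) *m (H *t 1%:M)) = Pm J.
  by rewrite Pm_tens !tensmx_mul !mulmx1 PH.
pose h t : 'M[R]_N := cexp q (const_mx t) *t 1%:M.
have hE t : let s := expR t in (2 * s) *: (Pm J *m h t) =
    Pm J *m ((s ^+ 2 + 1) *: 1%:M + (s ^+ 2 - 1) *: (H *t 1%:M)).
  move=> s; rewrite Pm_tens -tens11 !tensZ1 tensD1 !tensmx_mul !mulmx1 tensZ1; congr (_ *t _).
  have s0 : s != 0 by rewrite gt_eqF// expR_gt0.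
  apply: frame_rows => [i|j].
    rewrite -scalemxAr !mulmxA mulJ_Pm ?e_Ipq// (row_cexp p_lt_q) mxE expRN -/s.
    rewrite mulmxDr -!scalemxAr mulmx1 row_cartan mxE scale1r scalerDr !scalerA.
    by congr (_ *: _ + _ *: _); field.
  by rewrite -scalemxAr !mulmxA (mulJ_Pm0 (e'_Ipq _ _ j)) !mul0mx scaler0.
have h_bound t : -1 <= t <= 0 -> `|h t| <= 2 * (1 + expR 1); last first.
  exact: (@sing_null R N J JT JJ G (ld_GJ ld) (ld_Gcl ld) mG mGC mGinv mGfin
    (H *t 1%:M) h (2 * (1 + expR 1)) HT HJ HH (fun t => ld_Gexp ld (const_mx t)) hE h_bound left kappa).
move=> /andP[t1 t0]; apply: le_trans (tens_norm _) _.
have a0 : 0 < expR t := expR_gt0 t; have b0 : 0 < expR (- t) := expR_gt0 (- t).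
have a1 : expR t <= 1 by rewrite -expR0 ler_expR.
have b1 : expR (- t) <= expR 1 by rewrite ler_expR lerNl.
have e0 : 0 < expR 1 :> R := expR_gt0 1.
rewrite /cexp mulrDl mul1r; apply: le_trans (ler_normD _ _) _; apply: lerD; (apply: mx_norm_le => [|i j]; first by lra).
- rewrite !mxE; case: (i == j); last by rewrite mulr0n normr0; lra.
  rewrite mulr1n; case: (fintype.split i) => [k|k].
    by rewrite /= !mxE ger0_norm; lra.
  by case: insubP => [k' _ _|_]; rewrite /= ?mxE ger0_norm; lra.
- have hb (A : 'M[R]_(p, q)) : (forall i j, `|A i j| <= 1 + expR 1) ->
      `|(block_mx 0 A A^T 0 : 'M[R]_(p + q)) i j| <= 1 + expR 1.
    move=> hA; case: (split_ordP i) => i' ->; case: (split_ordP j) => j' ->;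
      rewrite ?block_mxEul ?block_mxEur ?block_mxEdl ?block_mxEdr ?mxE ?normr0//; lra.
  apply: hb => i' j'; rewrite !mxE; case: eqP => _; last by rewrite mulr0n normr0; lra.
  by rewrite mulr1n ler_norml; apply/andP; split; lra.
Qed.

Lemma mu_singular (left : bool) kappa :
  (forall k1 l k4, K k1 -> K l -> K k4 -> sdet J left kappa
    (k1 *m (cexp q X *t 1%:M) *m l *m (cexp q Y *t 1%:M) *m k4) = 0) ->
  mu (~` [set g : 'M[R]_N | sdet J left kappa g = 0]) = 0%E.
Proof.
move=> h; have mS : measurable ([set g | sdet J left kappa g = 0] : set (borel 'M[R]_N)).
  apply: borel_closed; rewrite (_ : [set _ | _] = sdet J left kappa @^-1` [set 0])//.
  apply: closed_comp; last exact: closed_eq.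
  by move=> g _; exact: continuous_sdet.
rewrite mu_word; last exact: measurableC.
have mK' : measurable (~` K : set (borel 'M[R]_N)).
  by apply: measurableC; apply: borel_closed; exact: ld_Kcl ld.
have mT : measurable ([set: borel 'M[R]_N]) by exact: measurableT.
pose B1 : set (borel 'M[R]_N * borel 'M[R]_N * borel 'M[R]_N) := (~` K `*` setT) `*` setT.
pose B2 : set (borel 'M[R]_N * borel 'M[R]_N * borel 'M[R]_N) := (setT `*` ~` K) `*` setT.
pose B3 : set (borel 'M[R]_N * borel 'M[R]_N * borel 'M[R]_N) := setT `*` ~` K.
have mB1 : measurable B1 by apply: measurableX => //; exact: measurableX.
have mB2 : measurable B2 by apply: measurableX => //; exact: measurableX.
have mB3 : measurable B3 by apply: measurableX => //; exact: measurableT.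
have h0 : mK (~` (K : set (borel 'M[R]_N))) = 0%E by exact: mKC.
have z1 : ((mK \x mK) \x mK)%E B1 = 0%E.
  by rewrite /B1 product_measure1E//; [rewrite /= product_measure1E//; rewrite [X in (X * _ * _)%E]h0 !mul0e|exact: measurableX].
have z2 : ((mK \x mK) \x mK)%E B2 = 0%E.
  by rewrite /B2 product_measure1E//; [rewrite /= product_measure1E//; rewrite [X in (_ * X * _)%E]h0 mule0 mul0e|exact: measurableX].
have z3 : ((mK \x mK) \x mK)%E B3 = 0%E by rewrite /B3 product_measure1E//; rewrite [X in (_ * X)%E]h0 mule0.
apply/eqP; rewrite eq_le measure_ge0 andbT.
set W := _ @^-1` _; have WB : W `<=` (B1 `|` B2) `|` B3.
  move=> [[k1 l] k4] Wk; apply: contrapT => /not_orP[/not_orP[n1 n2] n3].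
  have [[Kk1 _]|] := pselect (K k1 /\ True); last by move=> nk; apply: n1; split => //; split => // Kk; exact: nk.
  have [[Kl _]|] := pselect (K l /\ True); last by move=> nk; apply: n2; split => //; split => // Kk; exact: nk.
  have [[Kk4 _]|] := pselect (K k4 /\ True); last by move=> nk; apply: n3; split => // Kk; exact: nk.
  by apply: Wk; exact: h.
have mW : measurable W.
  rewrite -[X in measurable X]setTI; apply: measurable_word => //.
  exact: measurableC.
apply: (@le_trans _ _ (((mK \x mK) \x mK)%E ((B1 `|` B2) `|` B3))).
  apply: le_measure => //; rewrite inE//.
  by apply: measurableU => //; exact: measurableU.
apply: le_trans (measureU2 _ _ _) _ => //; first exact: measurableU.
rewrite [X in (_ + X <= _)%E]z3 adde0; apply: le_trans (measureU2 _ _ _) _ => //.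
by rewrite [X in (X + _ <= _)%E]z1 [X in (_ + X <= _)%E]z2 adde0.
Qed.

Let KJ k : K k -> k *m J = J *m k.
Proof.
move=> Kk; have := congr1 (mulmx k) (ld_GJ ld (ld_KG ld Kk)).
by rewrite !mulmxA (mulmx1C (ld_Korth ld Kk)) mul1mx => ->.
Qed.

Let not_ac (left : bool) kappa :
  (forall k1 l k4, K k1 -> K l -> K k4 -> sdet J left kappa
    (k1 *m (cexp q X *t 1%:M) *m l *m (cexp q Y *t 1%:M) *m k4) = 0) ->
  ~ (forall A : set (borel 'M[R]_N), measurable A -> mG A = 0%E -> mu A = 0%E).
Proof.
move=> h ac; pose S : set (borel 'M[R]_N) := [set g | sdet J left kappa g = 0].
have mS : measurable S.
  apply: borel_closed; rewrite (_ : S = sdet J left kappa @^-1` [set 0])//.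
  apply: closed_comp; last exact: closed_eq.
  by move=> g _; exact: continuous_sdet.
have m0 := mu_singular h; have m1 : mu S = 0%E by apply: ac => //; exact: flow_null.
have : mu (S `|` ~` S) = 1%E by rewrite setUv probability_setT.
rewrite measureU//; [|exact: measurableC|by rewrite setICr].
by rewrite [X in (X + _)%E]m1 [X in (_ + X)%E]m0 adde0 => /eqP; rewrite eq_sym onee_eq0.
Qed.

Theorem lie_data_criterion s u t v : configuration X s u -> configuration Y t v ->
  (forall A : set (borel 'M[R]_N), measurable A -> mG A = 0%E -> mu A = 0%E) <->
  (max_config s (2 * u) + max_config t (2 * v) <= 2 * p)%N.
Proof.
move=> hX hY; split=> [ac|el].
  apply/negPn/negP => ne; case: (noneligible_pattern hX hY ne) => -[P [c [b [h1 h2 h3]]]].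
    apply: (@not_ac true (c ^+ 2) _ ac) => k1 l k4 K1 K2 K3.
    by apply: (singular_word p_lt_q (ld_d ld) h1 h2 h3); do ?[exact: KJ|exact: (mulmx1C (ld_Korth ld _))].
  (* For the pattern with X and Y exchanged, the word is transposed, which reverses the order of its
     factors; the eigenvalue is then one of A^T A. *)
  apply: (@not_ac false (c ^+ 2) _ ac) => k1 l k4 K1 K2 K3.
  have -> : sdet J false (c ^+ 2) (k1 *m (cexp q X *t 1%:M) *m l *m (cexp q Y *t 1%:M) *m k4) =
      sing_det J (c ^+ 2) (k4^T *m (cexp q Y *t 1%:M) *m l^T *m (cexp q X *t 1%:M) *m k1^T).
    have xyT Z : (cexp q Z *t 1%:M : 'M[R]_N)^T = cexp q Z *t 1%:M by rewrite trmx_tens trmx1 cexp_tr.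
    by rewrite sdet_right (trmx_word _ _ _ (xyT X) (xyT Y)).
  have L1 := ld_Ktr ld K1; have L2 := ld_Ktr ld K2; have L3 := ld_Ktr ld K3.
  by apply: (singular_word p_lt_q (ld_d ld) h1 h2 h3); do ?[exact: KJ|exact: (mulmx1C (ld_Korth ld _))].
move/configP: hX => [Xu Xs _]; move/configP: hY => [Yv Yt _].
have [k0 [kk kJ tk]] : exists k, [/\ k *m k^T = 1%:M, k *m Ipq R p q = Ipq R p q *m k & transverse X Y k].
  apply: exists_transversal; rewrite ?pq ?Xu ?Yv//.
  - by move: el; rewrite /max_config; lia.
  - move=> c /Yt; move: el; rewrite /max_config; lia.
  - move=> c /Xs; move: el; rewrite /max_config; lia.
move=> A mA A0; have GE := ld_Gexp ld.
apply: (@ac_eligible R p q d pq Rs (ld_irr ld) (ld_RsT ld) X Y (cexp q X) (cexp q Y) _ _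
  (cexp_tr q X) (cexp_tr q Y) (same_pattern_sinh X) (same_pattern_sinh Y)
  (odd_part_cexp p_lt_q X) (odd_part_cexp p_lt_q Y) G K (ld_GM ld) (ld_Ginv ld) (ld_GJ ld) (ld_GR ld)
  (ld_Gcl ld) mG mGC mGinv mGfin mG0 (ld_Kcl ld) (ld_KG ld) (ld_Korth ld) (ld_K1 ld) (ld_KM ld) (ld_Ktr ld)
  mK mKC mKinv (GE X) (GE Y) T (ld_TT ld) (ld_TJ ld) (ld_TR ld) (ld_GT ld) (ld_trT ld) gens (ld_gensT ld)
  (ld_gensK ld) (ld_gens_span ld) _ _ mu mu_word A mA A0); last by exists k0.
move=> xi cxi xiJ xiT; have [c [cc cJ cX Kc]] := ld_Kcay ld cxi xiJ xiT.
by exists c; split.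
Qed.

End LieDataCriterion.

Section ImageMeasure.
Context d d' (T : measurableType d) (T' : measurableType d') (R : realType).
Variables (m : {measure set T -> \bar R}) (f : T -> T') (mf : measurable_fun setT f).

Definition image_measure : {measure set T' -> \bar R} :=
  measure_function_pushforward__canonical__measure_function_Measure m mf.

End ImageMeasure.

(** * From convolutions to words in three Haar elements *)

Section HaarWords.
Local Open Scope ereal_scope.
Context d (T : measurableType d) (R : realType).
Variable op : T -> T -> T.
Hypothesis opA : associative op.
Hypothesis mop : measurable_fun setT (fun z : T * T => op z.1 z.2).

Let mopl g : measurable_fun setT (op g).
Proof.
apply: (measurableT_comp mop (_ : measurable_fun setT (fun h : T => (g, h)))).
by apply/measurable_fun_pairP; split => /=; [exact: measurable_cst|exact: measurable_id].
Qed.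

Let mopr h : measurable_fun setT (op^~ h).
Proof.
apply: (measurableT_comp mop (_ : measurable_fun setT (fun g : T => (g, h)))).
by apply/measurable_fun_pairP; split => /=; [exact: measurable_id|exact: measurable_cst].
Qed.

Let pre (f : T -> T) (A : set T) : measurable_fun setT f -> measurable A -> measurable (f @^-1` A).
Proof. by move=> mf mA; rewrite -[X in measurable X]setTI; exact: mf. Qed.

Definition law_mul (a b : probability T R) : probability T R := distribution (a \x b) (mk_mfun mop).

Lemma law_mulE a b A : law_mul a b A = \int[a]_g b (op g @^-1` A).
Proof.
apply: eq_integral => g _ /=; congr (b _); apply/seteqP; split=> h /=; rewrite /xsection /= inE//.
Qed.

Lemma measurable_section (b : probability T R) A : measurable A ->
  measurable_fun setT (fun g => b (op g @^-1` A)).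
Proof.
move=> mA; have mA' : measurable ((fun z : T * T => op z.1 z.2) @^-1` A).
  by rewrite -[X in measurable X]setTI; exact: mop.
have := @measurable_fun_xsection _ _ _ _ R b _ mA'.
congr (measurable_fun _ _); apply/funext => g /=; congr (b _).
by apply/seteqP; split=> h /=; rewrite /xsection /= inE.
Qed.

Lemma integral_law_dirac (a : probability T R) (x : T) (F : T -> \bar R) :
  measurable_fun setT F -> (forall g, 0 <= F g) ->
  \int[law_mul a \d_x]_g F g = \int[a]_g F (op g x).
Proof.
move=> mF F0; rewrite (@eq_measure_integral _ _ _ _ (distribution a (mk_mfun (mopr x)))); last first.
  move=> A mA _; transitivity (\int[a]_g \d_x (op g @^-1` A)); first exact: law_mulE.
  under eq_integral do rewrite diracE.
  transitivity (a (op^~ x @^-1` A)); last by [].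
  rewrite -[in RHS](setIT (op^~ x @^-1` A)) -integral_indic//; last exact: pre.
by rewrite ge0_integral_pushforward.
Qed.

Lemma law_mul_invariant (a b : probability T R) k :
  (forall A, measurable A -> a (op k @^-1` A) = a A) ->
  forall A, measurable A -> law_mul a b (op k @^-1` A) = law_mul a b A.
Proof.
move=> ak A mA; rewrite !law_mulE.
rewrite -[RHS](@eq_measure_integral _ _ _ _ _ (distribution a (mk_mfun (mopl k)))); last first.
  by move=> B mB _; exact: ak.
rewrite ge0_integral_pushforward//; last exact: measurable_section.
apply: eq_integral => g _ /=; congr (b _); apply/seteqP; split=> h /=; by rewrite opA.
Qed.

Variables (mK : probability T R) (K : set T).
Hypotheses (mKm : measurable K) (mKC : mK (~` K) = 0).
Hypothesis mKinv : forall g, K g -> forall A, measurable A -> mK (op g @^-1` A) = mK A.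

(** The convolution is the law of (k1 x k2)(k3 y k4). The law [ny] of the second factor is invariant
    under left translation by K, so k2 is absorbed into k3. *)
Lemma law_word x y A : measurable A ->
  law_mul (law_mul (law_mul mK \d_x) mK) (law_mul (law_mul mK \d_y) mK) A =
  \int[mK]_k \int[mK]_l mK [set h | A (op (op (op (op k x) l) y) h)].
Proof.
move=> mA; set ny := law_mul (law_mul mK \d_y) mK.
have nyK k : K k -> forall B, measurable B -> ny (op k @^-1` B) = ny B.
  move=> Kk; apply: law_mul_invariant; apply: law_mul_invariant; exact: mKinv.
pose F g := ny (op g @^-1` A).
have mF : measurable_fun setT F by exact: measurable_section.
have F0 g : 0 <= F g by exact: measure_ge0.
rewrite law_mulE -/F.
have mFop : measurable_fun setT (fun z : T * T => F (op z.1 z.2)) by exact: (measurableT_comp mF mop).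
have -> : \int[law_mul (law_mul mK \d_x) mK]_g F g = \int[law_mul mK \d_x]_g F g.
  rewrite ge0_integral_pushforward// fubini_tonelli1//.
  apply: eq_integral => g _; rewrite /fubini_F /=.
  rewrite (@eq_integral_off_null _ _ _ mK K _ (fun=> F g))//.
  - by rewrite integral_cst//; have e := @probability_setT _ _ _ mK; rewrite [X in _ * X]e mule1.
  - by apply: (measurableT_comp mF); exact: mopl.
  move=> k Kk; rewrite /F -[RHS](nyK k Kk); last exact: pre.
  by congr (ny _); apply/seteqP; split=> h /=; rewrite opA.
rewrite integral_law_dirac//; apply: eq_integral => k _; rewrite /F /ny law_mulE integral_law_dirac//.
- by apply: eq_integral => l _; congr (mK _); apply/seteqP; split=> h /=; rewrite !opA.
- by apply: measurable_section; exact: pre.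
Qed.

End HaarWords.

Lemma product_word_image d d' (T : measurableType d) (T' : measurableType d') (R : realType)
    (m : probability T' R) (phi : {mfun T' >-> T}) (W : set (T * T * T)) : measurable W ->
  (let mK := distribution m phi in ((mK \x mK) \x mK) W =
    \int[m]_k \int[m]_l m [set h | W ((phi k, phi l), phi h)])%E.
Proof.
move=> mW mK; have mF : measurable_fun setT (fun z : T * T => mK (xsection W z)).
  exact: measurable_fun_xsection.
have mF0 : measurable_fun setT (fun k => \int[mK]_l mK (xsection W (k, l)))%E.
  exact: (@measurable_fun_fubini_tonelli_F _ _ _ _ R mK (fun z => mK (xsection W z))).
have mphi : measurable_fun setT phi by exact: measurable_funP.
rewrite [LHS]/product_measure1 fubini_tonelli1// /fubini_F ge0_integral_pushforward//; last first.
  by move=> k _; apply: integral_ge0.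
apply: eq_integral => k _ /=; rewrite ge0_integral_pushforward//; last first.
  apply: (measurableT_comp mF (_ : measurable_fun setT (fun l : T => (phi k, l)))).
  by apply/measurable_fun_pairP; split => /=; [exact: measurable_cst|exact: measurable_id].
apply: eq_integral => l _ /=; rewrite /mK /distribution /pushforward; congr (m _).
by apply/seteqP; split=> h /=; rewrite /xsection /= inE.
Qed.

Section Transport.
Variables (R : realType) (p q d : nat) (pq : (0 < p < q)%N) (Rs : seq 'M[R]_d).
Local Notation N := ((p + q) * d)%N.
Variables (M : matrix_pair R (p + q)) (iota : M -> 'M[R]_N) (psi : 'M[R]_N -> M).
Hypotheses (ci : continuous iota) (cpsi : continuous psi) (iotaK : cancel iota psi).
Hypothesis iotaM : forall a b, iota (amul a b) = iota a *m iota b.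
Hypothesis iota_exp : forall X, iota (of_real (cexp q X)) = cexp q X *t 1%:M.
Variables (T : 'M[R]_N) (gens : set 'M[R]_N).
Hypothesis ld : lie_data Rs (iota @` grp M) (iota @` cpt M) T gens.
Variable mK : probability (borel M) R.
Hypothesis mK_haar : is_haar (cpt M) mK.
Variable mG : {measure set (borel M) -> \bar R}.
Hypothesis mG_haar : is_haar (grp M) mG.
Variables (X Y : 'rV[R]_p) (s t : seq nat) (u v : nat).
Hypotheses (X_config : configuration X s u) (Y_config : configuration Y t v).

Let mi : measurable_fun setT (iota : borel M -> borel 'M[R]_N) := borel_continuous ci.
Let mpsi : measurable_fun setT (psi : borel 'M[R]_N -> borel M) := borel_continuous cpsi.

Let mop : measurable_fun setT (fun z : borel M * borel M => amul z.1 z.2 : borel M).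
Proof.
have -> : (fun z : borel M * borel M => amul z.1 z.2 : borel M) =
    psi \o (fun z : borel M * borel M => iota z.1 *m iota z.2).
  by apply/funext => z /=; rewrite -iotaM iotaK.
apply: (measurableT_comp mpsi).
by apply: (@borel_mulmx _ _ _ _ _ _ (fun z : borel M * borel M => iota z.1) (fun z => iota z.2));
  apply: (measurableT_comp mi).
Qed.

Let opA : associative (@amul R (p + q) M).
Proof. by move=> a b c; apply: (can_inj iotaK); rewrite !iotaM mulmxA. Qed.

Let mG' : {measure set (borel 'M[R]_N) -> \bar R} := image_measure mG mi.
Let mK' : probability (borel 'M[R]_N) R := distribution mK (mk_mfun mi).

Let image_pre (A : set M) : iota @^-1` (iota @` A) = A.
Proof.
apply/seteqP; split=> [a [b Ab ib]|a Aa]; last by exists a.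
by have <- : b = a by exact: (can_inj iotaK).
Qed.

Let haar_inv (m : set (borel M) -> \bar R) (H : set M) : is_haar H m ->
  forall g, (iota @` H) g -> forall A : set (borel 'M[R]_N), measurable A ->
  m (iota @^-1` (mulmx g @^-1` A)) = m (iota @^-1` A).
Proof.
move=> [_ h _ _] _ [g Hg <-] A mA.
rewrite -[RHS](h g Hg); last by rewrite -[X in measurable X]setTI; exact: mi.
by congr (m _); apply/seteqP; split=> x /=; rewrite iotaM.
Qed.

Let iota_word k l h : iota (amul (amul (amul (amul k (of_real (cexp q X))) l) (of_real (cexp q Y))) h) =
  iota k *m (cexp q X *t 1%:M) *m iota l *m (cexp q Y *t 1%:M) *m iota h.
Proof. by rewrite 4!iotaM (iota_exp X) (iota_exp Y). Qed.

Let word_mu (A : set (borel 'M[R]_N)) : measurable A ->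
  convolution (natural mK (of_real (expmx (cartan_mx q X))))
              (natural mK (of_real (expmx (cartan_mx q Y)))) (iota @^-1` A) =
  ((mK' \x mK') \x mK')%E ((fun om : borel 'M[R]_N * borel 'M[R]_N * borel 'M[R]_N =>
    om.1.1 *m (cexp q X *t 1%:M) *m om.1.2 *m (cexp q Y *t 1%:M) *m om.2 : borel 'M[R]_N) @^-1` A).
Proof.
move=> mA; have [mKC mKinv _ _] := mK_haar; have pq' : (p < q)%N by case/andP: pq.
have mKm : measurable (cpt M : set (borel M)).
  have : measurable (iota @^-1` (iota @` cpt M) : set (borel M)).
    by rewrite -[X in measurable X]setTI; apply: mi => //; apply: borel_closed; exact: ld_Kcl ld.
  by rewrite image_pre.
rewrite !(expmx_cartan pq').
have := @law_word _ (borel M) R (@amul R (p + q) M) opA mop mK (cpt M) mKm mKC mKinv (of_real (cexp q X)) (of_real (cexp q Y)) (iota @^-1` A).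
move=> h; rewrite [LHS]h; last by rewrite -[X in measurable X]setTI; exact: mi.
rewrite product_word_image; last by rewrite -[X in measurable X]setTI; exact: measurable_word.
apply: eq_integral => k _; apply: eq_integral => l _; congr (mK _).
apply/funext => h0; exact: (congr1 A (iota_word k l h0)).
Qed.

(** Since [psi] is a continuous left inverse of [iota], every Borel set of M is the preimage of a
    Borel set of real matrices, so null sets correspond on both sides. *)
Theorem transport_criterion :
  convolution (natural mK (of_real (expmx (cartan_mx q X))))
              (natural mK (of_real (expmx (cartan_mx q Y)))) `<< mG
  <-> (max_config s (2 * u) + max_config t (2 * v) <= 2 * p)%N.
Proof.
pose mu : probability (borel 'M[R]_N) R := distribution ((mK' \x mK') \x mK')%E
  (mk_mfun (measurable_word (cexp q X *t 1%:M : 'M[R]_N) (cexp q Y *t 1%:M))).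
have [mGC _ mGfin mG0] := mG_haar; have [mKC _ _ _] := mK_haar.
have pre0 (m : set (borel M) -> \bar R) (H : set M) : m (~` H) = 0%E -> m (iota @^-1` (~` (iota @` H))) = 0%E.
  by rewrite -preimage_setC image_pre.
have mi' (A : set (borel 'M[R]_N)) : measurable A -> measurable (iota @^-1` A : set (borel M)).
  by move=> mA; rewrite -[X in measurable X]setTI; exact: mi.
have fin (C : set 'M[R]_N) : compact C -> C `<=` iota @` grp M -> (mG (iota @^-1` C) < +oo)%E.
  move=> Cc CG; have -> : iota @^-1` C = psi @` C.
    apply/seteqP; split=> [a Ca|_ [z Cz <-]]; first by exists (iota a) => //; rewrite iotaK.
    by have [a _ az] := CG _ Cz; rewrite -az iotaK /= az.
  apply: mGfin.
    apply: continuous_compact => //; exact: continuous_subspaceT.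
  by move=> _ [z Cz <-]; have [a Ga <-] := CG _ Cz; rewrite iotaK.
have G0 : mG (iota @^-1` (iota @` grp M)) != 0%E by rewrite image_pre.
rewrite -(@lie_data_criterion R p q d pq Rs _ _ T gens ld mG' (pre0 _ _ mGC) (haar_inv mG_haar) fin G0
  mK' (pre0 _ _ mKC) (haar_inv mK_haar) X Y mu (fun _ _ => erefl) s u t v X_config Y_config).
(* Absolute continuity is phrased with sets all of whose measurable subsets are null; for a
   measurable set this is monotonicity of the measure. *)
split=> [ac A mA A0|ac B B0 A mA AB].
- rewrite -[LHS](word_mu mA); apply: (ac (iota @^-1` A) _ _ (mi' _ mA) (fun _ => id)) => B mB BA.
  apply/eqP; rewrite eq_le measure_ge0 andbT.
  have <- : mG (iota @^-1` A) = 0%E by exact: A0.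
  by apply: le_measure; rewrite ?inE//; exact: mi'.
- have AE : A = iota @^-1` (psi @^-1` A).
    by apply/seteqP; split=> a /=; rewrite iotaK.
  have mA' : measurable (psi @^-1` A : set (borel 'M[R]_N)).
    by rewrite -[X in measurable X]setTI; exact: mpsi.
  rewrite AE word_mu//; apply: (ac _ mA'); change (mG (iota @^-1` (psi @^-1` A)) = 0%E).
  by rewrite -AE; exact: B0.
Qed.

End Transport.

(** * Realification *)

Section Blocks.
Variables (R : realType) (d n : nat).
Implicit Types (A B : 'M[R]_(n * d)).

Definition blk A i j : 'M[R]_d := \matrix_(b, c) A (mxtens_index (i, b)) (mxtens_index (j, c)).

Lemma blk_inj A B : (forall i j, blk A i j = blk B i j) -> A = B.
Proof.
move=> h; apply/matrixP => i j; case: (mxtens_indexP i) => a b; case: (mxtens_indexP j) => a' b'.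
by have /matrixP/(_ b b') := h a a'; rewrite !mxE.
Qed.

Lemma blk_mul A B i j : blk (A *m B) i j = \sum_k blk A i k *m blk B k j.
Proof.
apply/matrixP => b c; rewrite mxE mxE sum_tens summxE; apply: eq_bigr => k _.
by rewrite mxE; apply: eq_bigr => e _; rewrite !mxE.
Qed.

Lemma blk_tr A i j : blk A^T i j = (blk A j i)^T.
Proof. by apply/matrixP => b c; rewrite !mxE. Qed.

Lemma blk_tens (A : 'M[R]_n) (M : 'M[R]_d) i j : blk (A *t M) i j = A i j *: M.
Proof. by apply/matrixP => b c; rewrite !mxE !mxtens_indexK. Qed.

Lemma blk_sum_rho A (M : 'M[R]_d) i j : blk (A *m (1%:M *t M)) i j = blk A i j *m M.
Proof.
rewrite blk_mul (bigD1 j)//= big1 ?addr0 => [|k kj]; rewrite blk_tens mxE ?eqxx ?scale1r//.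
by rewrite (negPf kj) scale0r mulmx0.
Qed.

Lemma blk_rho_sum A (M : 'M[R]_d) i j : blk ((1%:M *t M) *m A) i j = M *m blk A i j.
Proof.
rewrite blk_mul (bigD1 i)//= big1 ?addr0 => [|k kj]; rewrite blk_tens mxE ?eqxx ?scale1r//.
by rewrite eq_sym (negPf kj) scale0r mul0mx.
Qed.

(** Each scalar is replaced by its d x d matrix of left multiplication, so that the image consists
    of the real matrices commuting with the right multiplications 1 (x) rho. *)
Definition realify (T : Type) (phi : T -> 'M[R]_d) (A : 'M[T]_n) : 'M[R]_(n * d) :=
  \matrix_(i, j) phi (A (mxtens_unindex i).1 (mxtens_unindex j).1)
    (mxtens_unindex i).2 (mxtens_unindex j).2.

Definition unrealify (T : Type) (psi : 'M[R]_d -> T) (A : 'M[R]_(n * d)) : 'M[T]_n :=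
  \matrix_(i, j) psi (blk A i j).

Lemma blk_realify T (phi : T -> 'M[R]_d) (A : 'M[T]_n) i j : blk (realify phi A) i j = phi (A i j).
Proof. by apply/matrixP => b c; rewrite !mxE !mxtens_indexK. Qed.

Lemma realifyK T (phi : T -> 'M[R]_d) psi : cancel phi psi -> cancel (realify phi) (unrealify psi).
Proof. by move=> h A; apply/matrixP => i j; rewrite mxE blk_realify h. Qed.

Lemma continuous_realify (T : topologicalType) (phi : T -> 'M[R]_d) :
  continuous phi -> continuous (realify phi).
Proof.
move=> cp; apply: mx_continuous => i j A.
rewrite (_ : (fun u => realify phi u i j) = (fun M => M (mxtens_unindex i).2 (mxtens_unindex j).2) \o
  (phi \o fun u : 'M[T]_n => u (mxtens_unindex i).1 (mxtens_unindex j).1)); last first.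
  by apply/funext => u; rewrite mxE.
have h1 := @mx_entry_continuous T n n (mxtens_unindex i).1 (mxtens_unindex j).1 A.
have h2 := continuous_comp h1 (cp _).
exact: (continuous_comp h2 (@mx_entry_continuous R d d _ _ _)).
Qed.

Lemma continuous_unrealify (T : topologicalType) (psi : 'M[R]_d -> T) :
  continuous psi -> continuous (unrealify psi).
Proof.
move=> cp; apply: mx_continuous => i j A.
rewrite (_ : (fun u => unrealify psi u i j) = psi \o (fun u => blk u i j)); last first.
  by apply/funext => u; rewrite mxE.
suff h : continuous (fun u : 'M[R]_(n * d) => blk u i j) by exact: (continuous_comp (h A) (cp _)).
move=> {}A; move: A; apply: mx_continuous => b c A.
rewrite (_ : (fun u => blk u i j b c) = (fun u : 'M[R]_(n * d) => u (mxtens_index (i, b)) (mxtens_index (j, c)))); last first.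
  by apply/funext => u; rewrite mxE.
exact: mx_entry_continuous.
Qed.

End Blocks.

Section RealifyAlgebra.
Variables (R : realType) (d : nat) (F : nzRingType) (phi : F -> 'M[R]_d) (psi : 'M[R]_d -> F).
Hypotheses (phiD : forall x y, phi (x + y) = phi x + phi y) (phiM : forall x y, phi (x * y) = phi x *m phi y).
Hypotheses (phi1 : phi 1 = 1%:M) (phiK : cancel phi psi).

Lemma phi0 : phi 0 = 0.
Proof. by apply: (addrI (phi 0)); rewrite -phiD !addr0. Qed.

Lemma phiN x : phi (- x) = - phi x.
Proof. by apply: (addrI (phi x)); rewrite -phiD !subrr phi0. Qed.

Lemma phi_sum I (r : seq I) (f : I -> F) : phi (\sum_(i <- r) f i) = \sum_(i <- r) phi (f i).
Proof. exact: (big_morph phi phiD phi0). Qed.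

Lemma realify_mul n (A B : 'M[F]_n) : realify phi (A *m B) = realify phi A *m realify phi B.
Proof.
apply: blk_inj => i j; rewrite blk_realify blk_mul mxE phi_sum; apply: eq_bigr => k _.
by rewrite phiM !blk_realify.
Qed.

Lemma realify1 n : realify phi (1%:M : 'M[F]_n) = 1%:M.
Proof.
apply: blk_inj => i j; rewrite -tens11 blk_realify blk_tens !mxE; case: (i == j) => /=.
  by rewrite phi1 scale1r.
by rewrite phi0 scale0r.
Qed.

Lemma realify_of_real n (ofr : R -> F) (A : 'M[R]_n) : (forall a, phi (ofr a) = a%:M) ->
  realify phi (map_mx ofr A) = A *t 1%:M.
Proof.
by move=> h; apply: blk_inj => i j; rewrite blk_realify blk_tens mxE h scalemx1.
Qed.

Lemma realify_Ipq p q : realify phi (Ipq F p q) = Ipq R p q *t 1%:M.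
Proof.
have e n (i j : 'I_n) : phi ((i == j)%:R) = (i == j)%:R *: 1%:M.
  by case: (i == j); rewrite ?phi1 ?scale1r ?phi0 ?scale0r.
apply: blk_inj => i j; rewrite blk_realify blk_tens /Ipq.
case: (split_ordP i) => i' ->; case: (split_ordP j) => j' ->;
  rewrite ?block_mxEul ?block_mxEur ?block_mxEdl ?block_mxEdr !mxE ?phiN ?phi0 ?scale0r ?e ?scaleNr//.
Qed.

Lemma realify_adjoint n conj (A : 'M[F]_n) : (forall x, phi (conj x) = (phi x)^T) ->
  realify phi (adjoint conj A) = (realify phi A)^T.
Proof. by move=> h; apply: blk_inj => i j; rewrite blk_tr !blk_realify !mxE h. Qed.

Variable Rs : seq 'M[R]_d.
Hypothesis phiR : forall x rho, rho \in Rs -> phi x *m rho = rho *m phi x.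
Hypothesis commutant : forall m, (forall rho, rho \in Rs -> m *m rho = rho *m m) -> phi (psi m) = m.

Lemma commutes_realify n (A : 'M[F]_n) : commutes Rs (realify phi A).
Proof. by move=> rho hr; apply: blk_inj => i j; rewrite blk_sum_rho blk_rho_sum blk_realify phiR. Qed.

Lemma unrealifyK n (g : 'M[R]_(n * d)) : commutes Rs g -> realify phi (unrealify psi g) = g.
Proof.
move=> cg; apply: blk_inj => i j; rewrite blk_realify mxE commutant// => rho hr.
by rewrite -blk_sum_rho cg// blk_rho_sum.
Qed.

Lemma preserves_realify p q conj (g : 'M[F]_(p + q)) : (forall x, phi (conj x) = (phi x)^T) ->
  preserves (adjoint conj) (Ipq F p q) g <->
  (realify phi g)^T *m (Ipq R p q *t 1%:M) *m realify phi g = Ipq R p q *t 1%:M.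
Proof.
move=> hc; rewrite -(realify_adjoint _ hc) -realify_Ipq -!realify_mul; split=> [->//|].
exact: (can_inj (realifyK phiK)).
Qed.

(** Commuting with J makes each off-diagonal block equal to its negative, so block diagonal matrices
    are those that commute with J. *)
Lemma block_diag_realify p q conj (g : 'M[F]_(p + q)) : (forall x, phi (conj x) = (phi x)^T) ->
  conj 0 = 0 ->
  block_diag F p q (preserves (adjoint conj) 1%:M) (preserves (adjoint conj) 1%:M) g <->
  (realify phi g)^T *m realify phi g = 1%:M /\
  realify phi g *m (Ipq R p q *t 1%:M) = (Ipq R p q *t 1%:M) *m realify phi g.
Proof.
move=> hc c0; have inj := can_inj (@realifyK R d (p + q) F phi psi phiK).
have adj_block (a : 'M[F]_p) (b : 'M[F]_q) :
    adjoint conj (block_mx a 0 0 b) *m block_mx a 0 0 b =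
    block_mx (adjoint conj a *m a) 0 0 (adjoint conj b *m b).
  rewrite /adjoint map_block_mx tr_block_mx mulmx_block !mulmx0.
  have z m n : (map_mx conj (0 : 'M[F]_(m, n)))^T = 0 by apply/matrixP => i j; rewrite !mxE c0.
  by rewrite !z !mul0mx !addr0 !add0r.
rewrite -(realify_adjoint _ hc) -realify_Ipq -!realify_mul -(realify1 (p + q)); split.
  move=> [[a b] [/= ha hb] <-]; split.
    have ha' : adjoint conj a *m a = 1%:M by rewrite -[LHS]/(adjoint conj a *m a) -[adjoint conj a]mulmx1; exact: ha.
    have hb' : adjoint conj b *m b = 1%:M by rewrite -[adjoint conj b]mulmx1; exact: hb.
    by rewrite adj_block ha' hb' -scalar_mx_block.
  by rewrite /Ipq !mulmx_block !mulmx0 !mul0mx !addr0 !add0r mulmxN mulNmx !mulmx1 !mul1mx.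
move=> [/inj h1 /inj h2].
have two m n (B : 'M[F]_(m, n)) : B = - B -> B = 0.
  move=> e; apply/matrixP => i j; apply: (can_inj phiK); rewrite [in RHS]mxE phi0.
  have /matrixP/(_ i j)/(congr1 phi) := e; rewrite mxE phiN => h.
  by apply/matrixP => a b; move/matrixP/(_ a b): h; rewrite !mxE; lra.
move: h2; rewrite -[g]submxK /Ipq !mulmx_block !mulmx0 !mul0mx !mulmxN !mulNmx !mulmx1 !mul1mx !addr0 !add0r.
move=> /eq_block_mx[_ e1 e2 _].
have z1 : ursubmx g = 0 by apply: two.
have z2 : dlsubmx g = 0 by apply: two; rewrite -[in RHS]e2 opprK.
move: h1; rewrite -[g]submxK z1 z2 adj_block.
have -> : (1%:M : 'M[F]_(p + q)) = block_mx 1%:M 0 0 1%:M by rewrite scalar_mx_block.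
move=> /eq_block_mx[h1 _ _ h4].
exists (ulsubmx g, drsubmx g); last first.
  by rewrite block_mxKul block_mxKur block_mxKdl block_mxKdr.
by split; rewrite /preserves /= mulmx1.
Qed.

End RealifyAlgebra.

Lemma closed_mx_eq (R : realType) (U : topologicalType) m n (f g : U -> 'M[R]_(m, n)) :
  continuous f -> continuous g -> closed [set x | f x = g x].
Proof.
move=> cf cg; rewrite (_ : [set x | _] = (fun x => f x - g x) @^-1` [set 0]); last first.
  by apply/seteqP; split=> x /= => [->|/eqP]; rewrite ?subrr// subr_eq0 => /eqP.
apply: closed_comp => [x _|]; first by apply: continuousB; [exact: cf|exact: cg].
exact: (accessible_closed_set1 (hausdorff_accessible (@norm_hausdorff _ _))).
Qed.

Section UnitaryGroups.
Variables (R : realType) (p q d : nat) (Rs : seq 'M[R]_d).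
Hypothesis RsT : forall rho, rho \in Rs -> rho^T = rho \/ rho^T = - rho.
Local Notation N := ((p + q) * d)%N.
Local Notation J := (Ipq R p q *t 1%:M : 'M[R]_N).

(** The isometry group before any determinant condition: U(p, q) or Sp(p, q), according to [Rs]. *)
Definition unitary_grp : set 'M[R]_N := [set g | g^T *m J *m g = J /\ commutes Rs g].
Definition unitary_cpt : set 'M[R]_N :=
  [set k | [/\ k^T *m k = 1%:M, k *m J = J *m k & commutes Rs k]].

Let JT : J^T = J := tens_J_sym _ _ _ _.
Let JJ : J *m J = 1%:M := tens_J_sq _ _ _ _.

Lemma unitary_mul g h : unitary_grp g -> unitary_grp h -> unitary_grp (g *m h).
Proof.
move=> [gJ gR] [hJ hR]; split; last exact: commutes_mul.
by rewrite trmx_mul -!mulmxA (mulmxA J g h) (mulmxA g^T) (mulmxA g^T) gJ mulmxA.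
Qed.

Lemma unitary_jinv g : unitary_grp g -> unitary_grp (jinv J g).
Proof.
move=> [gJ gR]; have jT : (jinv J g)^T = J *m g *m J.
  by rewrite /jinv !trmx_mul trmxK JT mulmxA.
have gj : g *m J *m g^T = J.
  have h : J *m g^T *m J *m g = 1%:M by rewrite -!mulmxA (mulmxA g^T) gJ JJ.
  have := congr1 (mulmx^~ J) (mulmx1C h).
  by rewrite /= mul1mx !mulmxA -(mulmxA _ J J) JJ mulmx1.
split.
  rewrite jT /jinv !mulmxA -(mulmxA _ J J) JJ mulmx1.
  by rewrite -(mulmxA _ g J) -(mulmxA J) gj JJ mul1mx.
by apply: commutes_mul; [apply: commutes_mul|]; [exact: commutes_tens|exact: commutes_tr|exact: commutes_tens].
Qed.

Lemma unitary_exp (pq : (p < q)%N) X : unitary_grp (cexp q X *t 1%:M).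
Proof.
split; last exact: commutes_tens.
by rewrite trmx_tens trmx1 cexp_tr !tensmx_mul !mulmx1 cexp_Ipq.
Qed.

Lemma closed_commutes : closed [set g : 'M[R]_N | commutes Rs g].
Proof.
rewrite (_ : [set g | _] = \bigcap_(rho in [set r | r \in Rs])
    [set g : 'M[R]_N | g *m (1%:M *t rho) = (1%:M *t rho) *m g]).
  apply: closed_bigI => rho _; apply: closed_mx_eq.
    by apply: (continuous_mulr (f := id)) => ?; exact: cvg_id.
  by apply: (continuous_mull (f := id)) => ?; exact: cvg_id.
by apply/seteqP; split.
Qed.

Lemma closed_unitary : closed unitary_grp.
Proof.
apply: closedI; last exact: closed_commutes.
apply: closed_mx_eq; last by move=> ?; exact: cst_continuous.
apply: continuous_mulmx; last by move=> ?; exact: cvg_id.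
apply: continuous_mulr; apply: continuous_trmx => ?; exact: cvg_id.
Qed.

Lemma closed_unitary_cpt : closed unitary_cpt.
Proof.
rewrite (_ : unitary_cpt = [set k | k^T *m k = 1%:M] `&` [set k | k *m J = J *m k] `&` [set k | commutes Rs k]).
  apply: closedI; last exact: closed_commutes.
  apply: closedI; apply: closed_mx_eq.
  - by apply: continuous_mulmx; [apply: continuous_trmx|]; move=> ?; exact: cvg_id.
  - by move=> ?; exact: cst_continuous.
  - by apply: (continuous_mulr (f := id)) => ?; exact: cvg_id.
  - by apply: (continuous_mull (f := id)) => ?; exact: cvg_id.
by apply/seteqP; split=> k /= [] => [|[]].
Qed.

Lemma unitary_cpt_sub : unitary_cpt `<=` unitary_grp.
Proof. by move=> k [kk kJ kR]; split => //; rewrite -mulmxA -kJ mulmxA kk mul1mx. Qed.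

Lemma unitary_cpt1 : unitary_cpt 1%:M.
Proof.
by split; rewrite ?trmx1 ?mulmx1 ?mul1mx// -tens11; exact: commutes_tens.
Qed.

Lemma unitary_cpt_mul g h : unitary_cpt g -> unitary_cpt h -> unitary_cpt (g *m h).
Proof.
move=> [gg gJ gR] [hh hJ hR]; split; last exact: commutes_mul.
  by rewrite trmx_mul -mulmxA (mulmxA g^T) gg mul1mx.
by rewrite -mulmxA hJ mulmxA gJ mulmxA.
Qed.

Lemma unitary_cpt_tr k : unitary_cpt k -> unitary_cpt k^T.
Proof.
move=> [kk kJ kR]; split; [by rewrite trmxK; exact: mulmx1C| |exact: commutes_tr].
by have := congr1 trmx kJ; rewrite !trmx_mul JT.
Qed.

Lemma unitary_cay xi : commutes Rs xi -> xi *m J = J *m xi -> xi^T = - xi -> unitary_cpt (cay xi).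
Proof.
move=> cxi xJ xT; split; [exact: cay_orth|exact: cay_comm|].
by move=> rho hr; apply: cay_comm => //; exact: cxi.
Qed.

End UnitaryGroups.

Lemma skew_trace_eq0 (R : realType) n (Z : 'M[R]_n) : Z^T = - Z -> \tr (Z *m Z) = 0 -> Z = 0.
Proof.
move=> ZT t0; have : \tr (Z *m Z^T) = 0 by rewrite ZT mulmxN linearN /= t0 oppr0.
rewrite /mxtrace => /eqP; rewrite psumr_eq0 => [/allP h|i _]; last first.
  by rewrite mxE; apply: sumr_ge0 => j _; rewrite mxE -expr2 sqr_ge0.
apply/row_matrixP => i; rewrite row0; apply: sqr_row_eq0.
rewrite -(eqP (h i (mem_index_enum i))).
by rewrite !mxE; apply: eq_bigr => k _; rewrite !mxE.
Qed.

(** * The quaternionic family *)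

Section QuaternionicCase.
Variable R : realType.
Implicit Types x y : quat R.

Definition mx4 (l : seq (seq R)) : 'M[R]_4 := \matrix_(i, j) nth 0 (nth [::] l i) j.

(** Left multiplication by x in the basis 1, i, j, k; column 0 is x itself. *)
Definition quat_mx x : 'M[R]_4 := let: (a, b, c, d) := x in
  mx4 [:: [:: a; - b; - c; - d]; [:: b; a; - d; c]; [:: c; d; a; - b]; [:: d; - c; b; a]].

Definition mx_quat (m : 'M[R]_4) : quat R := (m 0 0, m 1 0, m 2 0, m 3 0).

(* Right multiplication by 1, i, j and k. *)
Definition quat_right : seq 'M[R]_4 := [:: 1%:M;
  mx4 [:: [:: 0; -1; 0; 0]; [:: 1; 0; 0; 0]; [:: 0; 0; 0; 1]; [:: 0; 0; -1; 0]];
  mx4 [:: [:: 0; 0; -1; 0]; [:: 0; 0; 0; -1]; [:: 1; 0; 0; 0]; [:: 0; 1; 0; 0]];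
  mx4 [:: [:: 0; 0; 0; -1]; [:: 0; 0; 1; 0]; [:: 0; -1; 0; 0]; [:: 1; 0; 0; 0]]].

Lemma quat_mxD x y : quat_mx (x + y) = quat_mx x + quat_mx y.
Proof.
case: x => [[[a b] c] d]; case: y => [[[a' b'] c'] d'].
by apply/matrixP => -[[|[|[|[|//]]]] ?] [[|[|[|[|//]]]] ?]; rewrite !mxE /=; ring.
Qed.

Lemma quat_mxM x y : quat_mx (x * y) = quat_mx x *m quat_mx y.
Proof.
case: x => [[[a b] c] d]; case: y => [[[a' b'] c'] d'].
by apply/matrixP => -[[|[|[|[|//]]]] ?] [[|[|[|[|//]]]] ?]; rewrite !mxE !big_ord_recl big_ord0 /= !mxE /=; ring.
Qed.

Lemma quat_mx_of_real a : quat_mx (quat_of_real a) = a%:M.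
Proof.
by apply/matrixP => -[[|[|[|[|//]]]] ?] [[|[|[|[|//]]]] ?]; rewrite !mxE /= ?oppr0 ?mulr1n ?mulr0n.
Qed.

Lemma quat_mx1 : quat_mx 1 = 1%:M.
Proof. exact: quat_mx_of_real 1. Qed.

Lemma quat_mxK : cancel quat_mx mx_quat.
Proof. by case=> [[[a b] c] d]; rewrite /mx_quat !mxE. Qed.

Lemma quat_mx_conj x : quat_mx (quat_conj x) = (quat_mx x)^T.
Proof.
case: x => [[[a b] c] d].
by apply/matrixP => -[[|[|[|[|//]]]] ?] [[|[|[|[|//]]]] ?]; rewrite !mxE /= ?opprK.
Qed.

Lemma quat_mx_right x rho : rho \in quat_right -> quat_mx x *m rho = rho *m quat_mx x.
Proof.
case: x => [[[a b] c] d]; rewrite !inE => /or4P[] /eqP ->; first by rewrite mulmx1 mul1mx.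
all: by apply/matrixP => -[[|[|[|[|//]]]] ?] [[|[|[|[|//]]]] ?]; rewrite !mxE !big_ord_recl !big_ord0 /= !mxE /=; ring.
Qed.

Lemma quat_right_nth k : (k < 4)%N -> nth 0 quat_right k \in quat_right.
Proof. by move=> k4; rewrite mem_nth. Qed.

(** Column 0 is the image of 1, and commuting with right multiplication by i, j and k determines the
    other columns from it. *)
Lemma quat_commutant (m : 'M[R]_4) : (forall rho, rho \in quat_right -> m *m rho = rho *m m) ->
  quat_mx (mx_quat m) = m.
Proof.
move=> h; pose f (i j : nat) := m (inord i) (inord j).
have mf i j : m i j = f i j by rewrite /f !inord_val.
have c1 : [/\ f 0 1 = - f 1 0, f 1 1 = f 0 0, f 2 1 = f 3 0 & f 3 1 = - f 2 0]%N.
  have /matrixP e := h (nth 0 quat_right 1) (quat_right_nth (isT : (1 < 4)%N)).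
  by split; [move: (e (inord 0) 0)|move: (e (inord 1) 0)|move: (e (inord 2) 0)|move: (e (inord 3) 0)];
    rewrite !mxE !big_ord_recl !big_ord0 /= !mxE !mf /= !inordK//=; lra.
have c2 : [/\ f 0 2 = - f 2 0, f 1 2 = - f 3 0, f 2 2 = f 0 0 & f 3 2 = f 1 0]%N.
  have /matrixP e := h (nth 0 quat_right 2) (quat_right_nth (isT : (2 < 4)%N)).
  by split; [move: (e (inord 0) 0)|move: (e (inord 1) 0)|move: (e (inord 2) 0)|move: (e (inord 3) 0)];
    rewrite !mxE !big_ord_recl !big_ord0 /= !mxE !mf /= !inordK//=; lra.
have c3 : [/\ f 0 3 = - f 3 0, f 1 3 = f 2 0, f 2 3 = - f 1 0 & f 3 3 = f 0 0]%N.
  have /matrixP e := h (nth 0 quat_right 3) (quat_right_nth (isT : (3 < 4)%N)).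
  by split; [move: (e (inord 0) 0)|move: (e (inord 1) 0)|move: (e (inord 2) 0)|move: (e (inord 3) 0)];
    rewrite !mxE !big_ord_recl !big_ord0 /= !mxE !mf /= !inordK//=; lra.
case: c1 c2 c3 => ? ? ? ? [? ? ? ?] [? ? ? ?].
by apply/matrixP => -[[|[|[|[|//]]]] ?] [[|[|[|[|//]]]] ?]; rewrite !mxE /= !mf /=; lra.
Qed.

(* Euler's four-square identity: the rows [a *m rho] are orthogonal, of norm |a|. *)
Lemma quat_irr (a b : 'rV[R]_4) : a != 0 ->
  (forall rho, rho \in quat_right -> a *m rho *m b^T = 0) -> b = 0.
Proof.
move=> a0 h; pose f (u : 'rV[R]_4) (i : nat) := u 0 (inord i).
have uf (u : 'rV[R]_4) (i : 'I_4) : u 0 i = f u i by rewrite /f inord_val.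
have e rho : rho \in quat_right -> (a *m rho *m b^T) 0 0 = 0 by move=> /h ->; rewrite mxE.
have e0 := e (nth 0 quat_right 0) (quat_right_nth (isT : (0 < 4)%N)); have e1 := e (nth 0 quat_right 1) (quat_right_nth (isT : (1 < 4)%N)).
have e2 := e (nth 0 quat_right 2) (quat_right_nth (isT : (2 < 4)%N)); have e3 := e (nth 0 quat_right 3) (quat_right_nth (isT : (3 < 4)%N)).
have id4 : (a *m a^T) 0 0 * (b *m b^T) 0 0 = 0.
  have -> : (a *m a^T) 0 0 * (b *m b^T) 0 0 = (a *m nth 0 quat_right 0 *m b^T) 0 0 ^+ 2 +
      (a *m nth 0 quat_right 1 *m b^T) 0 0 ^+ 2 + (a *m nth 0 quat_right 2 *m b^T) 0 0 ^+ 2 +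
      (a *m nth 0 quat_right 3 *m b^T) 0 0 ^+ 2.
    rewrite !mxE !big_ord_recl !big_ord0 /= !mxE !big_ord_recl !big_ord0 /= !mxE /= !uf /=; ring.
  by rewrite e0 e1 e2 e3 expr0n /= !addr0.
apply: sqr_row_eq0; move/eqP: id4; rewrite mulf_eq0 => /orP[/eqP /sqr_row_eq0 a0'|/eqP //].
by rewrite a0' eqxx in a0.
Qed.

Lemma quat_mx_continuous : continuous quat_mx.
Proof.
apply: mx_continuous => i j.
have -> : (fun x => quat_mx x i j) = (fun x : quat R =>
    x.1.1.1 * quat_mx (1, 0, 0, 0) i j + x.1.1.2 * quat_mx (0, 1, 0, 0) i j +
    x.1.2 * quat_mx (0, 0, 1, 0) i j + x.2 * quat_mx (0, 0, 0, 1) i j).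
  apply/funext => -[[[a b] c] d].
  by case: i => -[|[|[|[|//]]]] ?; case: j => -[|[|[|[|//]]]] ?; rewrite !mxE /=; ring.
have c4 : continuous (fun x : quat R => x.2) by move=> x; exact: cvg_snd.
have c3 : continuous (fun x : quat R => x.1.2).
  by move=> x; apply: (@continuous_comp _ _ _ (fun x : quat R => x.1) snd); [exact: cvg_fst|exact: cvg_snd].
have c12 : continuous (fun x : quat R => x.1.1).
  by move=> x; apply: (@continuous_comp _ _ _ (fun x : quat R => x.1) fst); [exact: cvg_fst|exact: cvg_fst].
have c2 : continuous (fun x : quat R => x.1.1.2).
  by move=> x; apply: (@continuous_comp _ _ _ (fun x : quat R => x.1.1) snd); [exact: c12|exact: cvg_snd].
have c1 : continuous (fun x : quat R => x.1.1.1).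
  by move=> x; apply: (@continuous_comp _ _ _ (fun x : quat R => x.1.1) fst); [exact: c12|exact: cvg_fst].
have m (f : quat R -> R) (a : R) : continuous f -> continuous (fun x => f x * a).
  by move=> cf x; apply: (@continuousM _ _ f (fun=> a)); [exact: cf|exact: cst_continuous].
have ad (f g : quat R -> R) : continuous f -> continuous g -> continuous (fun x => f x + g x).
  by move=> cf cg x; apply: (@continuousD _ _ _ f g); [exact: cf|exact: cg].
by do 3 (apply: (ad _ _); last exact: (m _ _)); exact: m.
Qed.

Lemma mx_quat_continuous : continuous mx_quat.
Proof.
have e (i j : 'I_4) (m : 'M[R]_4) : (fun m : 'M[R]_4 => m i j) @ m --> m i j by exact: mx_entry_continuous.
move=> m; have h1 : (fun x : 'M[R]_4 => (x 0 0, x 1 0)) @ m --> (m 0 0, m 1 0).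
  exact: (@cvg_pair _ _ _ _ _ _ _ _ _ _ _ (e 0 0 m) (e 1 0 m)).
have h2 : (fun x : 'M[R]_4 => (x 0 0, x 1 0, x 2 0)) @ m --> (m 0 0, m 1 0, m 2 0).
  exact: (@cvg_pair _ _ _ _ _ _ _ _ _ _ _ h1 (e 2 0 m)).
have h3 : (fun x : 'M[R]_4 => (x 0 0, x 1 0, x 2 0, x 3 0)) @ m --> (m 0 0, m 1 0, m 2 0, m 3 0).
  exact: (@cvg_pair _ _ _ _ _ _ _ _ _ _ _ h2 (e 3 0 m)).
exact: h3.
Qed.

End QuaternionicCase.

Section QuaternionicPair.
Variables (R : realType) (p q : nat) (pq : (0 < p < q)%N).
Local Notation N := ((p + q) * 4)%N.
Local Notation Rs := (quat_right R).
Local Notation iota := (realify (@quat_mx R)).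

Lemma quat_right_tr rho : rho \in Rs -> rho^T = rho \/ rho^T = - rho.
Proof.
rewrite !inE => /or4P[] /eqP ->; [by left; rewrite trmx1|right..];
  by apply/matrixP => -[[|[|[|[|//]]]] ?] [[|[|[|[|//]]]] ?]; rewrite !mxE /= ?oppr0 ?opprK.
Qed.

Lemma Sppq_image : iota @` Sppq R p q = unitary_grp Rs.
Proof.
have hp := preserves_realify (@quat_mxD R) (@quat_mxM R) (@quat_mx1 R) (@quat_mxK R) _ (@quat_mx_conj R).
apply/seteqP; split=> [_ [g Gg <-]|g [gJ gR]].
  split; last exact: (commutes_realify (@quat_mx_right R)).
  exact/hp.
have e := unrealifyK (@quat_commutant R) gR.
by exists (unrealify (@mx_quat R) g) => //; apply/hp; rewrite e.
Qed.

Lemma Spn_image : iota @` block_diag (quat R) p q (@Spn R p) (@Spn R q) = unitary_cpt Rs.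
Proof.
have c0 : quat_conj (0 : quat R) = 0 by rewrite /quat_conj /= !oppr0.
have hp g := block_diag_realify (@quat_mxD R) (@quat_mxM R) (@quat_mx1 R) (@quat_mxK R) g (@quat_mx_conj R) c0.
apply/seteqP; split=> [_ [g /hp[g1 g2] <-]|g [g1 g2 gR]].
  by split => //; exact: (commutes_realify (@quat_mx_right R)).
have e := unrealifyK (@quat_commutant R) gR.
by exists (unrealify (@mx_quat R) g) => //; apply/hp; rewrite e.
Qed.

(** Every Cayley transform of the Lie algebra of Sp(p) x Sp(q) already lies in the group, so all of
    that Lie algebra serves as generators and the correction is 1. *)
Lemma quaternionic_lie_data : lie_data Rs (iota @` Sppq R p q)
  (iota @` block_diag (quat R) p q (@Spn R p) (@Spn R q)) 0
  [set xi : 'M[R]_N | [/\ commutes Rs xi, xi *m (Ipq R p q *t 1%:M) = (Ipq R p q *t 1%:M) *m xi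
    & xi^T = - xi]].
Proof.
have pq' : (p < q)%N by case/andP: pq.
rewrite Sppq_image Spn_image; split.
- by [].
- exact: quat_irr.
- exact: quat_right_tr.
- by move=> g h; exact: unitary_mul.
- by move=> g; apply: unitary_jinv; exact: quat_right_tr.
- by move=> g [].
- by move=> g [].
- exact: closed_unitary.
- by move=> X; exact: unitary_exp.
- exact: closed_unitary_cpt.
- exact: unitary_cpt_sub.
- by move=> k [].
- exact: unitary_cpt1.
- by move=> g h; exact: unitary_cpt_mul.
- by move=> k; apply: unitary_cpt_tr; exact: quat_right_tr.
- by rewrite trmx0 oppr0.
- by rewrite mul0mx mulmx0.
- by move=> rho _; rewrite mul0mx mulmx0.
- by move=> g _; rewrite mul0mx mulmx0.
- move=> eta eta0; exists 1 => // g g' _ _ _ _; rewrite mulmx0 mxtrace0 normr0 mulr_ge0//; exact: ltW.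
- by move=> xi [].
- move=> xi t [cxi xJ xT]; apply: unitary_cay.
  + by move=> rho hr; rewrite -scalemxAl -scalemxAr cxi.
  + by rewrite -scalemxAl -scalemxAr xJ.
  + by rewrite linearZ /= xT scalerN.
- by move=> Z cZ ZJ ZT _ h; apply: (skew_trace_eq0 ZT); exact: h.
- move=> xi cxi xJ xT; exists 1%:M; rewrite trmx1 !mul1mx mulmx1; split => //.
    by move=> X; rewrite mul1mx mulmx1.
  exact: unitary_cay.
Qed.

End QuaternionicPair.

Lemma quaternionic_family_criterion (R : realType) (p q : nat) (pq : (0 < p < q)%N)
  (M := symmetric_pair R QuaternionicCase p q)
  (mK : probability (borel M) R) (mK_haar : is_haar (cpt M) mK)
  (mG : {measure set (borel M) -> \bar R}) (mG_haar : is_haar (grp M) mG)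
  (X Y : 'rV[R]_p) (s t : seq nat) (u v : nat) :
  configuration X s u -> configuration Y t v ->
  convolution (natural mK (of_real (expmx (cartan_mx q X))))
              (natural mK (of_real (expmx (cartan_mx q Y)))) `<< mG
  <-> (max_config s (2 * u) + max_config t (2 * v) <= 2 * p)%N.
Proof.
move=> hX hY.
apply: (@transport_criterion R p q 4 pq (quat_right R) M (realify (@quat_mx R)) (unrealify (@mx_quat R))
  _ _ _ _ _ 0 _ (quaternionic_lie_data R pq) mK mK_haar mG mG_haar X Y s t u v hX hY).
- by apply: continuous_realify; exact: quat_mx_continuous.
- by apply: continuous_unrealify; exact: mx_quat_continuous.
- by apply: realifyK; exact: quat_mxK.
- by move=> a b; exact: (realify_mul (@quat_mxD R) (@quat_mxM R)).
- by move=> Z; exact: (realify_of_real _ (@quat_mx_of_real R)).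
Qed.

(** * The real family *)

Lemma orth_add_signs (R : realType) n (k : 'M[R]_n) : k *m k^T = 1%:M ->
  exists e, k + signs R e \in unitmx.
Proof.
move=> kk.
have irr1 (a b : 'rV[R]_1) : a != 0 -> (forall rho : 'M[R]_1, rho \in [:: 1%:M] -> a *m rho *m b^T = 0) -> b = 0.
  move=> a0 /(_ 1%:M (mem_head _ _)); rewrite mulmx1 => h.
  have a00 : a 0 0 != 0.
    by apply: contraNneq a0 => e; apply/eqP/matrixP => i j; rewrite !ord1 e mxE.
  have /matrixP/(_ 0 0) := h; rewrite !mxE big_ord1 mxE => /eqP; rewrite mulf_eq0 (negPf a00) /= => /eqP e.
  by apply/matrixP => i j; rewrite !ord1 e mxE.
have [||e u] := @orth_add_signs_unit R n 1 [:: 1%:M] irr1 (k *t 1%:M).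
- by rewrite trmx_tens trmx1 tensmx_mul kk mulmx1 tens11.
- exact: commutes_tens.
exists e; rewrite unitmxE unitfE; apply/negP => /det0P[v v0 ve].
have : (v *t (1%:M : 'M[R]_1)) *m (k *t 1%:M + signs R e *t 1%:M) = 0.
  by rewrite tensD1 tensmx_mul mulmx1 ve tens0mx.
move/(congr1 (mulmx^~ (invmx (k *t 1%:M + signs R e *t 1%:M)))); rewrite mulmxK// mul0mx => w0.
case/eqP: v0; apply/rowP => i; rewrite mxE.
have /matrixP/(_ (mxtens_index (0, 0)) (mxtens_index (i, 0))) := w0.
by rewrite tensmxE !mxE mulr1.
Qed.

Section SpecialOrthogonal.
Variables (R : realType) (n : nat).
Implicit Types (x k : 'M[R]_n) (e : {ffun 'I_n -> bool}).

Lemma det_cay x : x^T = - x -> \det (cay x) = 1.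
Proof.
move=> xT; have := congr1 determinant (mul_cay xT); rewrite det_mulmx -[in RHS]det_tr linearD /= trmx1 xT.
have := skew_unit xT; rewrite unitmxE unitfE => u /(canRL (mulKf u)) ->.
by rewrite mulVf.
Qed.

Lemma signs_mul e e' : signs R e *m signs R e' = signs R [ffun i => e i (+) e' i].
Proof.
by rewrite /signs mulmx_diag; congr diag_mx; apply/rowP => i; rewrite !mxE ffunE signr_addb.
Qed.

(* The rotation by a right angle in the plane (a, b) is a Cayley transform. *)
Lemma cay_sq_pair (a b : 'I_n) : a != b -> exists2 x, x^T = - x &
  cay x *m cay x = signs R [ffun i => (i == a) || (i == b)].
Proof.
move=> ab; pose E : 'M[R]_n := delta_mx a b - delta_mx b a.
pose Q : 'M[R]_n := delta_mx a a + delta_mx b b.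
have ET : E^T = - E by rewrite /E linearB /= !trmx_delta opprB.
have dm (i j k l : 'I_n) : delta_mx i j *m delta_mx k l = (if j == k then delta_mx i l else 0) :> 'M[R]_n.
  by rewrite mul_delta_mx_cond; case: eqP.
have ba : (b == a) = false by rewrite eq_sym (negPf ab).
have EE : E *m E = - Q.
  rewrite /E /Q mulmxBl !mulmxBr !dm !eqxx (negPf ab) ba.
  by apply/matrixP => i j; rewrite !mxE; ring.
have EQ : E *m Q = E.
  rewrite /E /Q mulmxBl !mulmxDr !dm !eqxx (negPf ab) ba.
  by apply/matrixP => i j; rewrite !mxE; ring.
have QQ : Q *m Q = Q.
  rewrite /Q mulmxDl !mulmxDr !dm !eqxx (negPf ab) ba.
  by apply/matrixP => i j; rewrite !mxE; ring.
have PE : signs R [ffun i => (i == a) || (i == b)] = 1%:M - 2 *: Q.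
  apply/matrixP => i j; rewrite !mxE ffunE.
  case: (eqVneq i j) => [<-|ij].
    case: (eqVneq i a) => [->|ia] /=; first by rewrite (negPf ab) /= !mulr1n expr1; ring.
    by case: (eqVneq i b) => _ /=; rewrite ?mulr1n ?expr1 ?expr0; ring.
  have [e1 e2] : (i == a) && (j == a) = false /\ (i == b) && (j == b) = false.
    by split; apply/negP => /andP[/eqP e1 /eqP e2]; rewrite e1 e2 eqxx in ij.
  by rewrite e1 e2 /= !mulr0n; ring.
clearbody E Q; exists E => //; rewrite PE; have u := skew_unit ET; have m := mul_cay ET.
apply: (can_inj (mulKmx u)); apply: (can_inj (mulKmx u)); move: (cay E) m => W m.
have c1 : (1%:M - E) *m (1%:M + E) = (1%:M + E) *m (1%:M - E).
  by rewrite !(mulmxDl, mulmxDr, mulmxN, mulNmx, mul1mx, mulmx1); apply/matrixP => i j; rewrite !mxE; ring.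
rewrite (mulmxA (1%:M - E) W) m (mulmxA _ (1%:M + E)) c1 -(mulmxA (1%:M + E)) m.
rewrite !(mulmxDl, mulmxDr, mulmxN, mulNmx, mul1mx, mulmx1) -!scalemxAr.
rewrite !EQ !EE.
by apply/matrixP => i j; rewrite !mxE; ring.
Qed.

(** For suitable signs e, the product of k and the sign matrix is a Cayley transform, of determinant
    1. Hence the number of signs is even, and they are removed two at a time by squares of Cayley
    transforms. With [B] the preimage of the identity component, this places the compact group
    inside it. *)
Lemma SO_generated (B : set 'M[R]_n) : (forall x, x^T = - x -> B (cay x)) ->
  (forall g h, B g -> B h -> B (g *m h)) ->
  forall k, k *m k^T = 1%:M -> \det k = 1 -> B k.
Proof.
move=> Bc Bm k kk dk; have [e u] := orth_add_signs kk.
have SS := signs_sq R e; have hh : (k *m signs R e) *m (k *m signs R e)^T = 1%:M.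
  by rewrite trmx_mul signs_tr mulmxA -(mulmxA k) SS mulmx1.
have u' : 1%:M + k *m signs R e \in unitmx.
  have -> : 1%:M + k *m signs R e = (k + signs R e) *m signs R e by rewrite mulmxDl SS addrC.
  by rewrite unitmx_mul u; have [] := mulmx1_unit SS.
have [x [xT xk _]] := cay_surj hh u'.
have kE : k = cay x *m signs R e by rewrite xk -mulmxA SS mulmx1.
have dS : \det (signs R e) = 1 by rewrite -dk kE det_mulmx det_cay// mul1r.
rewrite kE; apply: (Bm _ _); first exact: Bc.
move: dS; have [m] := ubnP #|[pred i | e i]|; elim: m {x xT xk kE kk dk k u u' hh SS} e => // m ih e em dS.
case: (pickP [pred i | e i]) => [a /= ea|e0]; last first.
  have -> : signs R e = cay 0; last by apply: Bc; rewrite trmx0 oppr0.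
  rewrite cay0 /signs -diag_const_mx; congr diag_mx; apply/rowP => i; rewrite !mxE.
  by have /= -> := e0 i.
case: (pickP [pred i | e i && (i != a)]) => [b /= /andP[eb ba]|e0]; last first.
  move: dS; rewrite /signs det_diag (bigD1 a)//= big1 => [|i ia]; last first.
    by rewrite mxE; have /= := e0 i; rewrite ia andbT => ->.
  by rewrite mxE ea expr1 mulr1 => /eqP; rewrite eq_sym -subr_eq0 opprK -[1 + 1]/2%:R pnatr_eq0.
have ab : a != b by rewrite eq_sym.
have [x xT xx] := cay_sq_pair ab.
pose P := [ffun i => (i == a) || (i == b)]; pose e' : {ffun 'I_n -> bool} := [ffun i => P i (+) e i].
have SE : signs R e = signs R P *m signs R e'.
  rewrite signs_mul; congr (signs R _); apply/ffunP => i; rewrite !ffunE.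
  by rewrite addbA addbb.
rewrite SE -xx; apply: (Bm _ _); first by apply: (Bm _ _); exact: Bc.
apply: ih; last first.
  by move: dS; rewrite SE det_mulmx -xx (det_mulmx (cay x) (cay x)) det_cay// !mul1r.
rewrite -ltnS; apply: leq_trans em; rewrite ltnS; apply: proper_card; apply/properP; split.
  apply/fintype.subsetP => i; rewrite !inE !ffunE; case: (eqVneq i a) => [->|_] /=; first by rewrite ea.
  by case: (eqVneq i b) => [->|_] /=; rewrite ?eb.
by exists a; rewrite !inE ?ffunE ?eqxx ?ea.
Qed.

End SpecialOrthogonal.

Section RealGroup.
Variables (R : realType) (p q : nat) (pq : (0 < p < q)%N).
Local Notation n := (p + q)%N.
Local Notation J := (Ipq R p q).
Local Notation SO := (SOpq R p q).
Local Notation SO0 := (SO0pq R p q).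
Local Notation K := (block_diag R p q (SOn R p) (SOn R q)).

Lemma SOpq_mul g h : SO g -> SO h -> SO (g *m h).
Proof.
move=> [gJ dg] [hJ dh]; split; rewrite /preserves /=.
  by rewrite trmx_mul -!mulmxA (mulmxA J g h) (mulmxA g^T) (mulmxA g^T) gJ mulmxA.
by rewrite det_mulmx dg dh mulr1.
Qed.

Lemma SOpq_jinv g : SO g -> SO (jinv J g).
Proof.
move=> [gJ dg]; have JJ := Ipq_sq R p q; have JT := trmx_Ipq R p q; split; rewrite /preserves /=.
  have gj : g *m J *m g^T = J.
    have h : J *m g^T *m J *m g = 1%:M by rewrite -!mulmxA (mulmxA g^T) gJ JJ.
    have := congr1 (mulmx^~ J) (mulmx1C h).
    by rewrite /= mul1mx !mulmxA -(mulmxA _ J J) JJ mulmx1.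
  rewrite /jinv !trmx_mul trmxK JT !mulmxA -(mulmxA _ J J) JJ mulmx1.
  by rewrite -(mulmxA _ g J) -(mulmxA J) gj JJ mul1mx.
rewrite /jinv !det_mulmx det_tr dg mulr1; have := congr1 determinant JJ.
by rewrite det_mulmx det1.
Qed.

Lemma closed_SOpq : closed SO.
Proof.
apply: closedI.
  apply: closed_mx_eq; last by move=> ?; exact: cst_continuous.
  apply: continuous_mulmx; last by move=> ?; exact: cvg_id.
  apply: continuous_mulr; apply: continuous_trmx => ?; exact: cvg_id.
rewrite (_ : [set g | _] = (fun g : 'M[R]_n => \det g) @^-1` [set 1])//.
apply: closed_comp; last exact: closed_eq.
by move=> g _; apply: continuous_det => ?; exact: cvg_id.
Qed.

Lemma SO1 : SO 1%:M.
Proof. by split; rewrite /preserves /= ?trmx1 ?mul1mx ?mulmx1 ?det1. Qed.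

Lemma SO0_sub : SO0 `<=` SO.
Proof. exact: connected_component_sub. Qed.

Lemma SO0_image (f : 'M[R]_n -> 'M[R]_n) : continuous f -> (forall g, SO g -> SO (f g)) ->
  forall g, SO0 g -> connected_component SO (f 1%:M) (f g).
Proof.
move=> cf fS g g0; apply: (@connected_component_max _ SO (f @` SO0)); last by exists g.
- by exists 1%:M => //; apply: connected_component_refl; exact: SO1.
- by move=> _ [h /SO0_sub Sh <-]; exact: fS.
- apply: connected_continuous_connected; first exact: component_connected.
  exact: continuous_subspaceT.
Qed.

Lemma SO0_mul g h : SO0 g -> SO0 h -> SO0 (g *m h).
Proof.
move=> g0 h0; apply: (connected_component_trans g0).
rewrite -[X in connected_component _ X]mulmx1.
apply: (@SO0_image (mulmx g)) => //.
  by apply: (continuous_mull (f := id)) => ?; exact: cvg_id.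
by move=> k; apply: SOpq_mul; exact: SO0_sub.
Qed.

Lemma SO0_jinv g : SO0 g -> SO0 (jinv J g).
Proof.
move=> g0; have j1 : jinv J 1%:M = 1%:M by rewrite /jinv trmx1 mulmx1 Ipq_sq.
rewrite /SO0pq -j1; apply: (@SO0_image (jinv J)) => //; last exact: SOpq_jinv.
by apply: continuous_mulr; apply: continuous_mull; apply: continuous_trmx => ?; exact: cvg_id.
Qed.

Lemma SO0_path (f : R -> 'M[R]_n) : continuous f -> (forall t, SO (f t)) -> f 0 = 1%:M -> forall t, SO0 (f t).
Proof.
move=> cf fS f0 t; apply: (@connected_component_max _ SO (range f)); last by exists t.
- by exists 0.
- by move=> _ [s _ <-].
- apply: connected_continuous_connected; first exact/connected_intervalP.
  exact: continuous_subspaceT.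
Qed.

Lemma cexp_half (X : 'rV[R]_p) : cexp q X = cexp q (2^-1 *: X) *m cexp q (2^-1 *: X).
Proof.
have p_lt_q : (p < q)%N by case/andP: pq.
apply: (@frame_ext R p q p_lt_q) => [b i|j pj].
  rewrite mulmxA !frame_cexp -scalemxAl frame_cexp scalerA -expRD; congr (expR _ *: _).
  by rewrite !mxE; field.
by rewrite mulmxA !e'_cexp.
Qed.

(** exp X is the square of exp (X / 2), whose determinant squares to 1 because it preserves J. *)
Lemma cexp_det (X : 'rV[R]_p) : \det (cexp q X) = 1.
Proof.
have p_lt_q : (p < q)%N by case/andP: pq.
have sq (Z : 'rV[R]_p) : \det (cexp q Z) ^+ 2 = 1.
  have := congr1 determinant (cexp_Ipq p_lt_q Z); rewrite !det_mulmx mulrAC -expr2.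
  have : \det J != 0 by have := congr1 determinant (Ipq_sq R p q); rewrite det_mulmx det1 => h; apply: contra_eq_neq h => ->; rewrite mul0r eq_sym oner_eq0.
  by move=> J0 /(canRL (mulfK J0)) ->; rewrite divff.
by rewrite cexp_half det_mulmx -expr2 sq.
Qed.

Lemma continuous_cexp (X : 'rV[R]_p) : continuous (fun t : R => cexp q (t *: X)).
Proof.
have p_lt_q : (p < q)%N by case/andP: pq.
have ad (f g : R -> R) : continuous f -> continuous g -> continuous (fun x => f x + g x).
  by move=> cf cg x; apply: (@continuousD _ _ _ f g); [exact: cf|exact: cg].
have m (f : R -> R) (a : R) : continuous f -> continuous (fun x => f x * a).
  by move=> cf x; apply: (@continuousM _ _ f (fun=> a)); [exact: cf|exact: cst_continuous].
have ce (a : R) : continuous (fun t : R => expR (t * a)).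
  by move=> t; apply: (@continuous_comp _ _ _ (fun t : R => t * a) expR); [apply: m => ?; exact: cvg_id|exact: continuous_expR].
have cf (a c c' : R) : continuous (fun t : R => (expR (t * a) + expR (- (t * a))) / 2 * c +
    (expR (t * a) - expR (- (t * a))) / 2 * c').
  have -> : (fun t : R => (expR (t * a) + expR (- (t * a))) / 2 * c + (expR (t * a) - expR (- (t * a))) / 2 * c') =
      (fun t => expR (t * a) * ((c + c') / 2) + expR (t * - a) * ((c - c') / 2)).
    by apply/funext => t; rewrite mulrN; field.
  by apply: (ad _ _); apply: (m _ _); exact: ce.
apply: mx_continuous => k l.
have rE (M : 'M[R]_n) : M k l = ((delta_mx 0 k : 'rV_n) *m M) 0 l by rewrite -rowE mxE.
have -> : (fun t => cexp q (t *: X) k l) = (fun t => ((delta_mx 0 k : 'rV_n) *m cexp q (t *: X)) 0 l).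
  by apply/funext => t; rewrite rE.
have cf' a (w w' : 'rV[R]_n) (F : R -> R) :
    (forall t, F t = (((expR (t * a) + expR (- (t * a))) / 2) *: w + ((expR (t * a) - expR (- (t * a))) / 2) *: w') 0 l) ->
    continuous F.
  move=> hF; rewrite (_ : F = (fun t : R => (expR (t * a) + expR (- (t * a))) / 2 * w 0 l +
    (expR (t * a) - expR (- (t * a))) / 2 * w' 0 l)); first exact: cf.
  by apply/funext => t; rewrite hF !mxE.
case: (split_ordP k) => j ->.
  apply: (@cf' (X 0 j) (delta_mx 0 (lshift q j)) (delta_mx 0 (rshift p (widen_ord (ltnW p_lt_q) j)))) => t.
  by rewrite (row_cexp p_lt_q) [(t *: X) 0 j]mxE.
case: (wid_case p_lt_q j) => [pj|[i ->]].
  by under eq_fun do rewrite e'_cexp//; move=> ?; exact: cst_continuous.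
apply: (@cf' (X 0 i) (delta_mx 0 (rshift p (widen_ord (ltnW p_lt_q) i))) (delta_mx 0 (lshift q i))) => t.
by rewrite (col_cexp p_lt_q) [(t *: X) 0 i]mxE addrC.
Qed.

Lemma cexp_SO0 (X : 'rV[R]_p) : SO0 (cexp q X).
Proof.
have p_lt_q : (p < q)%N by case/andP: pq.
have := @SO0_path (fun t => cexp q (t *: X)) _ _ _ 1; rewrite scale1r; apply.
- exact: continuous_cexp.
- move=> t; split; last exact: cexp_det.
  by rewrite /preserves /= cexp_tr cexp_Ipq.
- rewrite scale0r; apply: (@frame_ext R p q p_lt_q) => [b i|j pj].
    by rewrite frame_cexp mxE mulr0 expR0 scale1r mulmx1.
  by rewrite e'_cexp// mulmx1.
Qed.

Lemma block_of_comm (g : 'M[R]_n) : g *m J = J *m g -> g = block_mx (ulsubmx g) 0 0 (drsubmx g).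
Proof.
move=> h; have two m m' (B : 'M[R]_(m, m')) : B = - B -> B = 0.
  by move=> /matrixP e; apply/matrixP => i j; have := e i j; rewrite !mxE; lra.
move: h; rewrite -{1 2}[g]submxK /Ipq !mulmx_block !mulmx0 !mul0mx !mulmxN !mulNmx !mulmx1 !mul1mx !addr0 !add0r.
move=> /eq_block_mx[_ e1 e2 _]; rewrite -{1}[g]submxK; congr block_mx; first exact: two.
by apply: two; rewrite -[in RHS]e2 opprK.
Qed.

Lemma cay_block_diag_SO (x : 'M[R]_n) : x^T = - x -> x *m J = J *m x -> K (cay x).
Proof.
move=> xT /block_of_comm xE; have := xT; rewrite {1 2}xE tr_block_mx opp_block_mx => /eq_block_mx[aT _ _ bT].
have hc m (y : 'M[R]_m) : y^T = - y -> SOn R m (cay y).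
  by move=> yT; split; [rewrite /preserves /= mulmx1; exact: cay_orth|exact: det_cay].
exists (cay (ulsubmx x), cay (drsubmx x)); first by split; exact: hc.
apply: (can_inj (mulKmx (skew_unit xT))); rewrite mul_cay//= xE (scalar_mx_block _ _ 1).
rewrite opp_block_mx !add_block_mx !oppr0 !addr0 mulmx_block !mulmx0 !mul0mx !addr0 !add0r.
by rewrite !block_mxKul !block_mxKdr !mul_cay.
Qed.

Lemma cay_SO0 (x : 'M[R]_n) : x^T = - x -> x *m J = J *m x -> SO0 (cay x).
Proof.
move=> xT xJ; have := @SO0_path (fun t => cay (t *: x)) _ _ _ 1; rewrite scale1r; apply.
- exact: cay_continuous.
- move=> t; have tT : (t *: x)^T = - (t *: x) by rewrite linearZ /= xT scalerN.
  split; last exact: det_cay.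
  have cJ : cay (t *: x) *m J = J *m cay (t *: x).
    by apply: cay_comm => //; rewrite -scalemxAl -scalemxAr xJ.
  by rewrite /preserves /= -mulmxA -cJ mulmxA cay_orth// mul1mx.
- by rewrite scale0r cay0.
Qed.

(** A Cayley transform cay x is joined to 1 by the path of the cay (t x), and these transforms
    generate each of the two factors. *)
Lemma block_diag_SO_sub_SO0 : K `<=` SO0.
Proof.
have skew_block (a : 'M[R]_p) (b : 'M[R]_q) : a^T = - a -> b^T = - b -> SO0 (block_mx (cay a) 0 0 (cay b)).
  move=> aT bT; pose x : 'M[R]_n := block_mx a 0 0 b.
  have xT : x^T = - x by rewrite /x tr_block_mx !trmx0 aT bT opp_block_mx !oppr0.
  have -> : block_mx (cay a) 0 0 (cay b) = cay x.
    apply: (can_inj (mulKmx (skew_unit xT))); rewrite mul_cay// /x (scalar_mx_block _ _ 1).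
    rewrite opp_block_mx !add_block_mx !oppr0 !addr0 mulmx_block !mulmx0 !mul0mx !addr0 !add0r.
    by rewrite !mul_cay.
  by apply: cay_SO0 => //; exact: block_diag_Ipq.
have z m : (0 : 'M[R]_m)^T = - 0 by rewrite trmx0 oppr0.
move=> _ [[a b] [/= [ha da] [hb db]] <-].
have blk_mulE (a' : 'M[R]_p) (b' : 'M[R]_q) c' d' : block_mx a' 0 0 b' *m block_mx c' 0 0 d' = block_mx (a' *m c') 0 0 (b' *m d') :> 'M[R]_n.
  by rewrite mulmx_block !mulmx0 !mul0mx !addr0 !add0r.
have h1 : SO0 (block_mx a 0 0 1%:M).
  apply: (@SO_generated R p [set a | SO0 (block_mx a 0 0 1%:M)]) => //=.
  - by move=> x xT; have := skew_block _ _ xT (z q); rewrite cay0.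
  - by move=> g h g0 h0; have := SO0_mul g0 h0; rewrite blk_mulE mulmx1.
  - by apply: mulmx1C; move: ha; rewrite /preserves /= mulmx1.
have h2 : SO0 (block_mx 1%:M 0 0 b).
  apply: (@SO_generated R q [set b | SO0 (block_mx 1%:M 0 0 b)]) => //=.
  - by move=> x xT; have := skew_block _ _ (z p) xT; rewrite cay0.
  - by move=> g h g0 h0; have := SO0_mul g0 h0; rewrite blk_mulE mulmx1.
  - by apply: mulmx1C; move: hb; rewrite /preserves /= mulmx1.
by have := SO0_mul h1 h2; rewrite blk_mulE mulmx1 mul1mx.
Qed.

Lemma block_diag_SOE : K = [set g | [/\ g^T *m g = 1%:M, g *m J = J *m g, \det (ulsubmx g) = 1 & \det (drsubmx g) = 1]].
Proof.
apply/seteqP; split=> [_ [[a b] [/= [ha da] [hb db]] <-]|g [gg gJ da db]].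
  rewrite block_mxKul block_mxKdr; split => //; last exact: block_diag_Ipq.
  move: ha hb; rewrite /preserves /= !mulmx1 => ha hb.
  by rewrite tr_block_mx !trmx0 mulmx_block !mulmx0 !mul0mx !addr0 !add0r ha hb -scalar_mx_block.
have gE := block_of_comm gJ; exists (ulsubmx g, drsubmx g); last by [].
move: gg; rewrite {1 2}gE tr_block_mx !trmx0 mulmx_block !mulmx0 !mul0mx !addr0 !add0r (scalar_mx_block _ _ 1).
by move=> /eq_block_mx[h1 _ _ h2]; split; split => //; rewrite /preserves /= mulmx1.
Qed.

Lemma closed_block_diag_SO : closed K.
Proof.
have cid : continuous (fun g : 'M[R]_n => g) by move=> ?; exact: cvg_id.
rewrite block_diag_SOE (_ : [set g | _] = [set g : 'M[R]_n | g^T *m g = 1%:M] `&` [set g | g *m J = J *m g] `&`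
    ((fun g : 'M[R]_n => \det (ulsubmx g)) @^-1` [set 1]) `&` ((fun g : 'M[R]_n => \det (drsubmx g)) @^-1` [set 1])); last first.
  by apply/seteqP; split=> g /= => [[]|[[[]]]].
have cl m (f : 'M[R]_n -> 'M[R]_m) : continuous f -> closed ((fun g : 'M[R]_n => \det (f g)) @^-1` [set 1]).
  by move=> cf; apply: closed_comp; [move=> g _; exact: continuous_det|exact: closed_eq].
have sub m (f : 'M[R]_n -> 'M[R]_m) i' : (forall g i j, f g i j = g (i' i) (i' j)) -> continuous f.
  move=> hf; apply: mx_continuous => i j.
  by rewrite (_ : (fun u => f u i j) = (fun u : 'M[R]_n => u (i' i) (i' j))); [exact: mx_entry_continuous|apply/funext => u].
apply: closedI; last by apply: cl; apply: (sub _ _ (@rshift p q)) => g i j; rewrite !mxE.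
apply: closedI; last by apply: cl; apply: (sub _ _ (@lshift p q)) => g i j; rewrite !mxE.
apply: closedI; apply: closed_mx_eq.
- by apply: continuous_mulmx => //; exact: continuous_trmx.
- by move=> ?; exact: cst_continuous.
- exact: continuous_mulr.
- exact: continuous_mull.
Qed.

End RealGroup.

Section RealPair.
Variables (R : realType) (p q : nat) (pq : (0 < p < q)%N).
Local Notation n := (p + q)%N.
Local Notation J := (Ipq R p q).
Local Notation K := (block_diag R p q (SOn R p) (SOn R q)).
Let phi (a : R) : 'M[R]_1 := a%:M.
Let psi (m : 'M[R]_1) : R := m 0 0.
Local Notation iota := (realify phi (n := p + q)).
Let Rs : seq 'M[R]_1 := [:: 1%:M].

Let phiD x y : phi (x + y) = phi x + phi y. Proof. exact: raddfD. Qed.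
Let phiM x y : phi (x * y) = phi x *m phi y. Proof. by rewrite /phi -scalar_mxM. Qed.
Let phiK : cancel phi psi. Proof. by move=> a; rewrite /psi mxE mulr1n. Qed.
Let phi_psi m : phi (psi m) = m.
Proof. by apply/matrixP => i j; rewrite !ord1 mxE mulr1n. Qed.
Let phiT x : phi x = (phi x)^T. Proof. by rewrite tr_scalar_mx. Qed.

Let commRs (g : 'M[R]_(n * 1)) : commutes Rs g.
Proof. by move=> rho; rewrite inE => /eqP ->; rewrite tens11 mulmx1 mul1mx. Qed.

Let iotaE (A : 'M[R]_n) : iota A = A *t 1%:M.
Proof.
rewrite -[LHS]/(realify phi A) -[A in LHS](map_mx_id_in (f := id)) //.
by rewrite (@realify_of_real _ _ _ phi _ id).
Qed.

Let iotaK : cancel iota (unrealify psi). Proof. exact: realifyK. Qed.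
Let psiK : cancel (unrealify psi) iota.
Proof. by move=> g; apply: (unrealifyK (Rs := Rs)). Qed.

Let iotaM (A B : 'M[R]_n) : iota (A *m B) = iota A *m iota B.
Proof. exact: realify_mul. Qed.

Let iotaT (A : 'M[R]_n) : iota A^T = (iota A)^T.
Proof. by rewrite !iotaE trmx_tens trmx1. Qed.

Let image_closed (A : set 'M[R]_n) : closed A -> closed (iota @` A).
Proof.
move=> cA; rewrite (_ : iota @` A = unrealify psi @^-1` A).
  apply: closed_comp => // g _; apply: continuous_unrealify; exact: mx_entry_continuous.
by apply/seteqP; split=> [_ [a Aa <-]|g Ag] /=; [rewrite iotaK|exists (unrealify psi g)].
Qed.

Let iota_cay (x : 'M[R]_n) : x^T = - x -> iota (cay x) = cay (iota x).
Proof.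
move=> xT; have xT' : (iota x)^T = - iota x by rewrite -iotaT xT !iotaE -scaleN1r -tensZ1 scaleN1r.
apply: (can_inj (mulKmx (skew_unit xT'))); rewrite mul_cay//.
have -> : 1%:M - iota x = iota (1%:M - x) by rewrite !iotaE -tensB1 tens11.
by rewrite -iotaM mul_cay// !iotaE -tensD1 tens11.
Qed.

Let gens : set 'M[R]_(n * 1) := [set xi | xi *m (J *t 1%:M) = (J *t 1%:M) *m xi /\ xi^T = - xi].

Let Kgens xi : gens xi -> (iota @` K) (cay xi).
Proof.
move=> [xJ xT]; have e := psiK xi; set x := unrealify psi xi in e.
have xT' : x^T = - x.
  by apply: (can_inj iotaK); rewrite iotaT e xT -e !iotaE -[in RHS]scaleN1r -tensZ1 scaleN1r.
have xJ' : x *m J = J *m x by apply: (can_inj iotaK); rewrite !iotaM e (iotaE J).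
by exists (cay x); [exact: cay_block_diag_SO|rewrite iota_cay// e].
Qed.

Lemma real_lie_data : lie_data Rs (iota @` SO0pq R p q) (iota @` K) 0 gens.
Proof.
have J1 : iota 1%:M = 1%:M by rewrite iotaE tens11.
split.
- by [].
- move=> a b a0 /(_ 1%:M (mem_head _ _)); rewrite mulmx1 => h.
  have a00 : a 0 0 != 0.
    by apply: contraNneq a0 => e; apply/eqP/matrixP => i j; rewrite !ord1 e mxE.
  have /matrixP/(_ 0 0) := h; rewrite !mxE big_ord1 mxE => /eqP; rewrite mulf_eq0 (negPf a00) /= => /eqP e.
  by apply/matrixP => i j; rewrite !ord1 e mxE.
- by move=> rho; rewrite inE => /eqP ->; left; rewrite trmx1.
- by move=> _ _ [g Gg <-] [h Gh <-]; exists (g *m h); [exact: SO0_mul|rewrite iotaM].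
- move=> _ [g Gg <-]; exists (jinv J g); first exact: SO0_jinv.
  by rewrite /jinv !iotaM iotaT (iotaE J).
- by move=> _ [g /SO0_sub[gJ _] <-]; rewrite -iotaT -(iotaE J) -!iotaM; congr iota.
- by [].
- by apply: image_closed; apply: component_closed; exact: closed_SOpq.
- by move=> X; exists (cexp q X); [exact: cexp_SO0|rewrite iotaE].
- by apply: image_closed; exact: closed_block_diag_SO.
- by move=> _ [k Kk <-]; exists k => //; exact: block_diag_SO_sub_SO0.
- by move=> _ [k + <-]; rewrite block_diag_SOE => -[kk _ _ _]; rewrite -iotaT -iotaM kk.
- exists 1%:M => //; rewrite -cay0; apply: cay_block_diag_SO; first by rewrite trmx0 oppr0.
  by rewrite mul0mx mulmx0.
- move=> _ _ [g [[a b] [/= [ha da] [hb db]] <-] <-] [h [[c d] [/= [hc dc] [hd dd]] <-] <-].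
  rewrite -iotaM; eexists; last reflexivity; exists (a *m c, b *m d) => /=; last first.
    by rewrite mulmx_block !mulmx0 !mul0mx !addr0 !add0r.
  have SOM m (x y : 'M[R]_m) : preserves trmx 1%:M x -> \det x = 1 -> preserves trmx 1%:M y -> \det y = 1 -> SOn R m (x *m y).
    rewrite /preserves /= !mulmx1 => hx dx hy dy; split; rewrite /preserves /= ?det_mulmx ?dx ?dy ?mulr1//.
    by rewrite mulmx1 trmx_mul -mulmxA (mulmxA x^T) hx mul1mx.
  by split; exact: SOM.
- move=> _ [_ [[a b] [/= [ha da] [hb db]] <-] <-]; rewrite -iotaT; eexists; last reflexivity.
  exists (a^T, b^T) => /=; last by rewrite tr_block_mx !trmx0.
  have SOT m (x : 'M[R]_m) : preserves trmx 1%:M x -> \det x = 1 -> SOn R m x^T.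
    by rewrite /preserves /= !mulmx1 => hx dx; split; rewrite /preserves /= ?det_tr// mulmx1 trmxK; exact: mulmx1C.
  by split; exact: SOT.
- by rewrite trmx0 oppr0.
- by rewrite mul0mx mulmx0.
- by [].
- by move=> g _; rewrite mul0mx mulmx0.
- move=> eta eta0; exists 1 => // g g' _ _ _ _; rewrite mulmx0 mxtrace0 normr0 mulr_ge0//; exact: ltW.
- by move=> xi [].
- move=> xi t [xJ xT]; apply: Kgens; split.
    by rewrite -scalemxAl -scalemxAr xJ.
  by rewrite linearZ /= xT scalerN.
- by move=> Z cZ ZJ ZT _ h; apply: (skew_trace_eq0 ZT); exact: h.
- move=> xi cxi xJ xT; exists 1%:M; rewrite trmx1 !mul1mx mulmx1; split => //; last exact: Kgens.
  by move=> X; rewrite mul1mx mulmx1.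
Qed.

Lemma real_family_criterion
  (M := symmetric_pair R RealCase p q)
  (mK : probability (borel M) R) (mK_haar : is_haar (cpt M) mK)
  (mG : {measure set (borel M) -> \bar R}) (mG_haar : is_haar (grp M) mG)
  (X Y : 'rV[R]_p) (s t : seq nat) (u v : nat) :
  configuration X s u -> configuration Y t v ->
  convolution (natural mK (of_real (expmx (cartan_mx q X))))
              (natural mK (of_real (expmx (cartan_mx q Y)))) `<< mG
  <-> (max_config s (2 * u) + max_config t (2 * v) <= 2 * p)%N.
Proof.
move=> hX hY.
apply: (@transport_criterion R p q 1 pq Rs M iota (unrealify psi)
  _ _ _ _ _ 0 _ real_lie_data mK mK_haar mG mG_haar X Y s t u v hX hY).
- apply: continuous_realify; apply: mx_continuous => i j; rewrite !ord1.
  by rewrite (_ : (fun u => _) = id); [move=> ?; exact: cvg_id|apply/funext => a; rewrite mxE mulr1n].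
- by apply: continuous_unrealify; exact: mx_entry_continuous.
- exact: iotaK.
- exact: iotaM.
- by move=> Z; exact: iotaE.
Qed.

End RealPair.

(** * The complex family *)

Section StrictDeterminant.
Variables (R : realType) (M d : nat).
Implicit Types (F : 'rV[R]_M -> 'M[R]_d).

Lemma strict_eq F F' D D' : strict F D -> (forall w, F w = F' w) -> (forall b, D b = D' b) -> strict F' D'.
Proof. by move=> h /funext <- /funext <-. Qed.

Lemma strict_add F G D D' : strict F D -> strict G D' ->
  strict (fun w => F w + G w) (fun b => D b + D' b).
Proof.
move=> sF sG eta eta0; have e2 : 0 < eta / 2 by rewrite divr_gt0.
have [d1 d10 h1] := sF _ e2; have [d2 d20 h2] := sG _ e2.
exists (Num.min d1 d2); first by rewrite lt_min d10.
move=> w w'; rewrite !lt_min => /andP[w1 w2] /andP[w1' w2'].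
have := lerD (h1 _ _ w1 w1') (h2 _ _ w2 w2'); rewrite -mulrDl -splitr; apply: le_trans.
apply: le_trans (ler_normD _ _); rewrite (_ : \sum_b _ = \sum_b (w 0 b - w' 0 b) *: D b + \sum_b (w 0 b - w' 0 b) *: D' b).
  move: (F w) (F w') (G w) (G w') (\sum_b _ *: D b) (\sum_b _ *: D' b) => a a' b b' c c'.
  by rewrite (_ : a + b - (a' + b') - (c + c') = a - a' - c + (b - b' - c'))//; apply/matrixP => k l; rewrite !mxE; ring.
by rewrite -big_split; apply: eq_bigr => b _; rewrite scalerDr.
Qed.

Lemma strict_sum I (r : seq I) (F : I -> 'rV[R]_M -> 'M[R]_d) D : (forall i, strict (F i) (D i)) ->
  strict (fun w => \sum_(i <- r) F i w) (fun b => \sum_(i <- r) D i b).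
Proof.
move=> sF; elim: r => [|i r ih].
  rewrite (_ : (fun w => _) = fun=> 0); last by apply/funext => w; rewrite big_nil.
  rewrite (_ : (fun b => _) = fun=> 0); last by apply/funext => w; rewrite big_nil.
  exact: strict_cst.
by apply: strict_eq (strict_add (sF i) ih) _ _ => w; rewrite big_cons.
Qed.

Lemma strict_scale (c : R) F D : strict F D -> strict (fun w => c *: F w) (fun b => c *: D b).
Proof.
move=> sF; apply: strict_eq (strict_mul (strict_cst M c%:M) sF) _ _ => w.
  by rewrite mul_scalar_mx.
by rewrite mul0mx add0r mul_scalar_mx.
Qed.

(** In the Leibniz rule each term differentiates one factor and evaluates the others at 0, so two
    factors vanishing at 0 annihilate the derivative. *)
Lemma strict_bigmul_ex I (r : seq I) (F : I -> 'rV[R]_M -> 'M[R]_d) D : (forall i, strict (F i) (D i)) ->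
  exists D', [/\ strict (fun w => \big[mulmx/1%:M]_(i <- r) F i w) D',
    (0 < count (fun i => F i 0%R == 0%R) r)%N -> \big[mulmx/1%:M]_(i <- r) F i 0 = 0
    & (1 < count (fun i => F i 0%R == 0%R) r)%N -> D' = fun=> 0].
Proof.
move=> sF; elim: r => [|i r [D' [sD z1 z2]]].
  exists (fun=> 0); split => //=.
  rewrite (_ : (fun w => _) = fun=> 1%:M); last by apply/funext => w; rewrite big_nil.
  exact: strict_cst.
eexists; split.
- by apply: strict_eq (strict_mul (sF i) sD) _ _ => w; [rewrite big_cons|reflexivity].
- rewrite big_cons /=; case: eqP => [->|_]; first by rewrite mul0mx.
  by rewrite add0n => /z1 ->; rewrite mulmx0.
- move=> /=; case: eqP => [e|_] h; apply/funext => b.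
    by rewrite e mul0mx addr0 z1 ?mulmx0.
  by rewrite z1 ?z2 ?mulmx0 ?addr0// ltnW.
Qed.

Lemma strict_bigmul0 I (r : seq I) (F : I -> 'rV[R]_M -> 'M[R]_d) D : (forall i, strict (F i) (D i)) ->
  (1 < count (fun i => F i 0%R == 0%R) r)%N -> strict (fun w => \big[mulmx/1%:M]_(i <- r) F i w) (fun=> 0).
Proof. by move=> sF c2; have [D' [h _ z]] := strict_bigmul_ex r sF; rewrite -z. Qed.

End StrictDeterminant.

Section BlockDeterminant.
Variables (R : realType) (n d : nat) (d_gt0 : (0 < d)%N).
Local Notation N := (n * d)%N.

(* The Leibniz formula in the blocks; for d = 2 it realizes the complex determinant. *)
Definition blk_det (g : 'M[R]_N) : 'M[R]_d :=
  \sum_(s : 'S_n) (-1) ^+ s *: \big[mulmx/1%:M]_i blk g i (s i).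

(** The derivative of the determinant at 1 is the trace: the identity permutation contributes the
    diagonal blocks, and any other one moves two indices, so that two of its factors vanish at 1. *)
Lemma blk_det_strict (eta : R) : 0 < eta -> exists2 delta : R, 0 < delta &
  forall g g' : 'M[R]_N, `|g - 1%:M| < delta -> `|g' - 1%:M| < delta ->
    `|blk_det g - blk_det g' - \sum_i blk (g - g') i i| <= eta * `|g - g'|.
Proof.
pose F i j (w : 'rV[R]_(N * N)) := blk (1%:M + vec_mx w) i j.
pose D i j (b : 'I_(N * N)) := blk (vec_mx (delta_mx 0 b) : 'M[R]_N) i j.
have FD i j (w w' : 'rV[R]_(N * N)) : \sum_b (w 0 b - w' 0 b) *: D i j b = F i j w - F i j w'.
  have -> : F i j w - F i j w' = blk (vec_mx (w - w')) i j.
    by apply/matrixP => a b; rewrite !mxE; ring.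
  rewrite [w - w' in RHS]row_sum_delta; apply/matrixP => a c; rewrite linear_sum /= mxE !summxE.
  by apply: eq_bigr => b _; rewrite !mxE.
have sF i j : strict (F i j) (D i j).
  by move=> e e0; exists 1 => // w w' _ _; rewrite FD subrr normr0 mulr_ge0// ltW.
have F0 i j : F i j 0 = (i == j)%:R *: 1%:M.
  by rewrite /F linear0 addr0 -tens11 blk_tens mxE.
have sP (s : 'S_n) : strict (fun w => (-1) ^+ s *: \big[mulmx/1%:M]_i F i (s i) w)
    (fun b => (if s == 1%g then \sum_i D i i b else 0)).
  case: eqVneq => [->|s1].
    have h1 i : F i i 0 = 1%:M by rewrite F0 eqxx scale1r.
    have h := @strict_bigmul R (N * N) d _ (index_enum 'I_n) (fun i => F i i) (fun i => D i i) (fun i => sF i i) h1.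
    apply: strict_eq h _ _ => w //; rewrite odd_perm1 expr0 scale1r.
    by apply: eq_bigr => i _; rewrite perm1.
  have h2 : (1 < count (fun i => F i (s i) 0%R == 0%R) (index_enum 'I_n))%N.
    have [i si] : exists i, s i != i.
      apply: contrapT => /forallNP h; case/eqP: s1; apply/permP => i; rewrite perm1.
      by have /negP := h i; rewrite negbK => /eqP.
    have ssi : s (s i) != s i by rewrite (inj_eq perm_inj).
    have z k : s k != k -> F k (s k) 0 == 0 by move=> /negPf; rewrite eq_sym F0 => ->; rewrite scale0r.
    rewrite -sum1_count (bigD1 i) ?z//= (bigD1 (s i)) ?z ?si//=.
  have h := strict_scale ((-1) ^+ s) (@strict_bigmul0 R (N * N) d _ (index_enum 'I_n) (fun i => F i (s i)) (fun i => D i (s i)) (fun i => sF i (s i)) h2).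
  by apply: strict_eq h _ _ => w //; rewrite scaler0.
have sdet : strict (fun w => blk_det (1%:M + vec_mx w)) (fun b => \sum_i D i i b).
  apply: strict_eq (strict_sum (index_enum 'S_n) sP) _ _ => b //.
  by rewrite (bigD1 1%g)//= eqxx [X in _ + X]big1 ?addr0// => s /negPf ->.
move=> eta0; have [delta d0 h] := sdet _ eta0; exists delta => // g g' hg hg'.
have vn (A : 'M[R]_N) : `|mxvec A| <= `|A|.
  apply: mx_norm_le => // i j; rewrite ord1; case: (mxvec_indexP j) => a b; rewrite mxvecE; exact: mx_entry_le.
have := h (mxvec (g - 1%:M)) (mxvec (g' - 1%:M)) (le_lt_trans (vn _) hg) (le_lt_trans (vn _) hg').
have K1 (A : 'M[R]_N) : 1%:M + (A - 1%:M) = A by rewrite addrC subrK.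
rewrite !mxvecK !K1.
have -> : \sum_b (mxvec (g - 1%:M) 0 b - mxvec (g' - 1%:M) 0 b) *: (\sum_i D i i b) = \sum_i blk (g - g') i i.
  under eq_bigr do rewrite scaler_sumr; rewrite exchange_big; apply: eq_bigr => i _.
  by rewrite FD /F !mxvecK; apply/matrixP => a b; rewrite !mxE; ring.
move/le_trans; apply; rewrite ler_wpM2l ?(ltW eta0)// -linearB /=.
by have -> : g - 1%:M - (g' - 1%:M) = g - g' by rewrite opprB addrA subrK.
Qed.

End BlockDeterminant.

Section ComplexScalars.
Variable R : realType.
Implicit Types x y : cplx R.

Definition mx2 (a b c d : R) : 'M[R]_2 :=
  \matrix_(i, j) nth 0 (nth [::] [:: [:: a; b]; [:: c; d]] i) j.

Definition cplx_mx x : 'M[R]_2 := mx2 (complex.Re x) (- complex.Im x) (complex.Im x) (complex.Re x).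
Definition mx_cplx (m : 'M[R]_2) : cplx R := Complex (m 0 0) (m 1 0).
Definition mx_i : 'M[R]_2 := cplx_mx (Complex 0 1).
Definition cplx_right : seq 'M[R]_2 := [:: 1%:M; mx_i].

Lemma cplx_mxD x y : cplx_mx (x + y) = cplx_mx x + cplx_mx y.
Proof.
case: x => a b; case: y => a' b'.
by apply/matrixP => -[[|[|//]] ?] [[|[|//]] ?]; rewrite !mxE /=; ring.
Qed.

Lemma cplx_mxM x y : cplx_mx (x * y) = cplx_mx x *m cplx_mx y.
Proof.
case: x => a b; case: y => a' b'.
by apply/matrixP => -[[|[|//]] ?] [[|[|//]] ?]; rewrite !mxE !big_ord_recl big_ord0 !mxE /=; ring.
Qed.

Lemma cplx_mx_of_real a : cplx_mx (a%:C)%C = a%:M.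
Proof. by apply/matrixP => -[[|[|//]] ?] [[|[|//]] ?]; rewrite !mxE /= ?oppr0 ?mulr1n ?mulr0n. Qed.

Lemma cplx_mx1 : cplx_mx 1 = 1%:M. Proof. exact: cplx_mx_of_real 1. Qed.

Lemma cplx_mxK : cancel cplx_mx mx_cplx.
Proof. by case=> a b; rewrite /mx_cplx !mxE. Qed.

Lemma cplx_mx_conj x : cplx_mx (conjc x) = (cplx_mx x)^T.
Proof.
by case: x => a b; apply/matrixP => -[[|[|//]] ?] [[|[|//]] ?]; rewrite !mxE /= ?opprK.
Qed.

Lemma cplx_mx_right x rho : rho \in cplx_right -> cplx_mx x *m rho = rho *m cplx_mx x.
Proof.
rewrite !inE => /orP[] /eqP ->; first by rewrite mulmx1 mul1mx.
by rewrite -!cplx_mxM mulrC.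
Qed.

Lemma cplx_commutant (m : 'M[R]_2) : (forall rho, rho \in cplx_right -> m *m rho = rho *m m) ->
  cplx_mx (mx_cplx m) = m.
Proof.
move=> h; pose f (i j : nat) := m (inord i) (inord j).
have mf (i j : 'I_2) : m i j = f i j by rewrite /f !inord_val.
have hi : mx_i \in cplx_right by rewrite !inE eqxx orbT.
have /matrixP e := h _ hi.
have [c0 c1] : [/\ f 0 1 = - f 1 0 & f 1 1 = f 0 0]%N.
  by split; [move: (e (inord 0) 0)|move: (e (inord 1) 0)];
    rewrite !mxE !big_ord_recl !big_ord0 /= !mxE !mf /= !inordK//=; lra.
by apply/matrixP => -[[|[|//]] ?] [[|[|//]] ?]; rewrite !mxE /= !mf /=; lra.
Qed.

Lemma cplx_irr (a b : 'rV[R]_2) : a != 0 ->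
  (forall rho, rho \in cplx_right -> a *m rho *m b^T = 0) -> b = 0.
Proof.
move=> a0 h; pose f (u : 'rV[R]_2) (i : nat) := u 0 (inord i).
have uf (u : 'rV[R]_2) (i : 'I_2) : u 0 i = f u i by rewrite /f inord_val.
have hi : mx_i \in cplx_right by rewrite !inE eqxx orbT.
have e rho : rho \in cplx_right -> (a *m rho *m b^T) 0 0 = 0 by move=> /h ->; rewrite mxE.
have e0 := e 1%:M (mem_head _ _); have e1 := e _ hi.
have id2 : (a *m a^T) 0 0 * (b *m b^T) 0 0 = 0.
  have -> : (a *m a^T) 0 0 * (b *m b^T) 0 0 = (a *m 1%:M *m b^T) 0 0 ^+ 2 + (a *m mx_i *m b^T) 0 0 ^+ 2.
    rewrite mulmx1 !mxE !big_ord_recl !big_ord0 /= !mxE !big_ord_recl !big_ord0 /= !mxE /= !uf /=; ring.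
  by rewrite e0 e1 expr0n /= !addr0.
apply: sqr_row_eq0; move/eqP: id2; rewrite mulf_eq0 => /orP[/eqP /sqr_row_eq0 a0'|/eqP //].
by rewrite a0' eqxx in a0.
Qed.

Lemma cplx_right_tr rho : rho \in cplx_right -> rho^T = rho \/ rho^T = - rho.
Proof.
rewrite !inE => /orP[] /eqP ->; [by left; rewrite trmx1|right].
by apply/matrixP => -[[|[|//]] ?] [[|[|//]] ?]; rewrite !mxE /= ?oppr0 ?opprK.
Qed.

(** The modulus as a real number; the norm on [cplx R] takes its values in [cplx R]. *)
Definition cabs x : R := Num.sqrt (complex.Re x ^+ 2 + complex.Im x ^+ 2).

Lemma norm_parts x : cabs x <= `|complex.Re x| + `|complex.Im x| /\
  (`|complex.Re x| <= cabs x /\ `|complex.Im x| <= cabs x).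
Proof.
case: x => a b; rewrite /cabs /=; have ab0 : 0 <= a ^+ 2 + b ^+ 2 by rewrite addr_ge0 ?sqr_ge0.
split; first rewrite -(ger0_norm (addr_ge0 (normr_ge0 a) (normr_ge0 b))) -sqrtr_sqr ler_sqrt ?sqr_ge0//.
  rewrite sqrrD !real_normK ?num_real// addrAC lerDl mulrn_wge0// mulr_ge0//.
by split; rewrite -sqrtr_sqr ler_sqrt// ?lerDl ?lerDr sqr_ge0.
Qed.

Lemma cplx_ballE x y (e : R) : ball x (e%:C)%C y <-> cabs (x - y) < e.
Proof. by rewrite -ball_normE /= normc_def ltcR. Qed.

Lemma cplx_nbhsP x (A : set (cplx R)) : nbhs x A <-> exists2 e : R, 0 < e & forall y, cabs (x - y) < e -> A y.
Proof.
split=> [/nbhs_ballP[e /= e0 h]|[e e0 h]].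
  have eR : e = ((complex.Re e)%:C)%C by move: e0; case: e {h} => a b /=; rewrite ltcE /= => /andP[/eqP -> _].
  exists (complex.Re e); first by rewrite -ltcR -eR.
  by move=> y hy; apply: h; rewrite eR; exact/cplx_ballE.
by apply/nbhs_ballP; exists (e%:C)%C; [rewrite /= ltcR|move=> y /cplx_ballE; exact: h].
Qed.

Lemma Re_continuous : continuous (@complex.Re R : cplx R -> R).
Proof.
move=> x A /nbhs_ballP[e /= e0 h]; apply/cplx_nbhsP; exists e => // y hy; apply: h.
rewrite -ball_normE /=; apply: le_lt_trans hy; have [_ [+ _]] := norm_parts (x - y).
by case: x y => a b [a' b'].
Qed.

Lemma Im_continuous : continuous (@complex.Im R : cplx R -> R).
Proof.
move=> x A /nbhs_ballP[e /= e0 h]; apply/cplx_nbhsP; exists e => // y hy; apply: h.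
rewrite -ball_normE /=; apply: le_lt_trans hy; have [_ [_ +]] := norm_parts (x - y).
by case: x y => a b [a' b'].
Qed.

Lemma cplx_mx_continuous : continuous cplx_mx.
Proof.
apply: mx_continuous => i j; case: i => -[|[|//]] hi; case: j => -[|[|//]] hj.
- by rewrite (_ : (fun x => _) = @complex.Re R); [exact: Re_continuous|apply/funext => x; rewrite mxE].
- rewrite (_ : (fun x => _) = (fun x : cplx R => - complex.Im x)); last by apply/funext => x; rewrite mxE.
  by move=> x; apply: (@continuousN _ _ _ (@complex.Im R : cplx R -> R)); exact: Im_continuous.
- by rewrite (_ : (fun x => _) = @complex.Im R); [exact: Im_continuous|apply/funext => x; rewrite mxE].
- by rewrite (_ : (fun x => _) = @complex.Re R); [exact: Re_continuous|apply/funext => x; rewrite mxE].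
Qed.

Lemma mx_cplx_continuous : continuous mx_cplx.
Proof.
move=> m A /cplx_nbhsP[e e0 h]; have e2 : 0 < e / 2 by rewrite divr_gt0.
apply/nbhs_ballP; exists (e / 2) => // m' hm; apply: h; have [+ _] := norm_parts (mx_cplx m - mx_cplx m').
move/le_lt_trans; apply; rewrite /mx_cplx /=; rewrite -ball_normE /= in hm.
have h0 := le_lt_trans (mx_entry_le (m - m') 0 0) hm; have h1 := le_lt_trans (mx_entry_le (m - m') 1 0) hm.
move: h0 h1; rewrite !mxE; lra.
Qed.

End ComplexScalars.

Section ComplexPair.
Variables (R : realType) (p q : nat) (pq : (0 < p < q)%N).
Local Notation n := (p + q)%N.
Local Notation N := (n * 2)%N.
Local Notation C := (cplx R).
Local Notation Rs := (cplx_right R).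
Local Notation iota := (realify (@cplx_mx R) (n := p + q)).
Local Notation psi := (unrealify (@mx_cplx R) (n := p + q)).
Local Notation J := (Ipq R p q *t 1%:M : 'M[R]_N).
Local Notation JC := (Ipq C p q).
Implicit Types (A X : 'M[C]_n) (g : 'M[R]_N).

Let iM A B : iota (A *m B) = iota A *m iota B := realify_mul (@cplx_mxD R) (@cplx_mxM R) A B.
Let i1 : iota 1%:M = 1%:M := realify1 (@cplx_mxD R) (@cplx_mx1 R) n.
Let iJ : iota JC = J := realify_Ipq (@cplx_mxD R) (@cplx_mx1 R) p q.
Let iT A : iota (adjoint (@conjc R) A) = (iota A)^T := realify_adjoint A (@cplx_mx_conj R).
Let iK : cancel iota psi := realifyK (@cplx_mxK R).
Let iR A : commutes Rs (iota A) := commutes_realify (@cplx_mx_right R) A.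
Let pK g : commutes Rs g -> iota (psi g) = g := unrealifyK (@cplx_commutant R) (g := g).

Let iD A B : iota (A + B) = iota A + iota B.
Proof.
by apply: blk_inj => i j; rewrite blk_realify mxE cplx_mxD; apply/matrixP => a b; rewrite !mxE !mxtens_indexK.
Qed.

Let iN A : iota (- A) = - iota A.
Proof. by apply: (addrI (iota A)); rewrite -iD !subrr; apply: (addrI (iota 0)); rewrite -iD !addr0. Qed.

Let iZ (t : R) A : iota ((t%:C)%C *: A) = t *: iota A.
Proof.
apply: blk_inj => i j; rewrite blk_realify mxE cplx_mxM cplx_mx_of_real mul_scalar_mx.
by apply/matrixP => a b; rewrite !mxE !mxtens_indexK.
Qed.

Let pM g h : commutes Rs g -> commutes Rs h -> psi (g *m h) = psi g *m psi h.
Proof. by move=> cg ch; apply: (can_inj iK); rewrite iM !pK//; exact: commutes_mul. Qed.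

Let p1 : psi 1%:M = 1%:M. Proof. by rewrite -i1 iK. Qed.

Definition su_grp : set 'M[R]_N := unitary_grp Rs `&` [set g | \det (psi g) = 1].
Definition su_cpt : set 'M[R]_N := unitary_cpt Rs `&` [set g | \det (psi g) = 1].

Lemma SUpq_image : iota @` SUpq R p q = su_grp.
Proof.
have hp := preserves_realify (@cplx_mxD R) (@cplx_mxM R) (@cplx_mx1 R) (@cplx_mxK R) _ (@cplx_mx_conj R).
apply/seteqP; split=> [_ [g [Gg dg] <-]|g [[gJ gR] dg]].
  split; last by rewrite /= iK.
  by split; [exact/hp|exact: iR].
have e := pK gR.
by exists (psi g) => //; split => //; apply/hp; rewrite e.
Qed.

Lemma SUpq_cpt_image : iota @` (block_diag C p q (@Un R p) (@Un R q) `&` [set g | \det g = 1]) = su_cpt.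
Proof.
have hp (g : 'M[C]_n) := block_diag_realify (@cplx_mxD R) (@cplx_mxM R) (@cplx_mx1 R) (@cplx_mxK R) g (@cplx_mx_conj R) (conjc0 R).
apply/seteqP; split=> [_ [g [/hp[g1 g2] dg] <-]|g [[g1 g2 gR] dg]].
  by split; [split => //; exact: iR|rewrite /= iK].
have e := pK gR.
by exists (psi g) => //; split => //; apply/hp; rewrite e.
Qed.

Lemma closed_det_psi : closed [set g : 'M[R]_N | \det (psi g) = 1].
Proof.
rewrite (_ : [set g | _] = [set g : 'M[R]_N | cplx_mx (\det (psi g)) = 1%:M]).
  apply: closed_mx_eq; last by move=> ?; exact: cst_continuous.
  have cd : continuous (fun g : 'M[R]_N => \det (psi g) : C).
    by apply: continuous_det; apply: continuous_unrealify; exact: mx_cplx_continuous.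
  by move=> g; apply: (continuous_comp (cd g) (@cplx_mx_continuous R _)).
apply/seteqP; split=> g /= => [->|]; first exact: cplx_mx1.
by rewrite -cplx_mx1; exact: (can_inj (@cplx_mxK R)).
Qed.

Lemma blk_det_realify A : blk_det (iota A) = cplx_mx (\det A).
Proof.
rewrite /determinant (phi_sum (@cplx_mxD R)); apply: eq_bigr => s _.
have e : cplx_mx ((-1) ^+ s : C) = (-1) ^+ s *: 1%:M.
  by case: (odd_perm s); rewrite ?expr0 ?expr1 ?(phiN (@cplx_mxD R)) cplx_mx1 ?scale1r ?scaleN1r.
rewrite cplx_mxM e -scalemxAl mul1mx; congr (_ *: _).
rewrite (big_morph (@cplx_mx R) (@cplx_mxM R) (@cplx_mx1 R)).
by apply: eq_bigr => i _; rewrite blk_realify.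
Qed.

Lemma trace_blk g : \tr g = \sum_i \tr (blk g i i).
Proof. by rewrite /mxtrace sum_tens; apply: eq_bigr => i _; apply: eq_bigr => a _; rewrite mxE. Qed.

Lemma trace_realify A : \tr (iota A) = 2 * complex.Re (\tr A).
Proof.
rewrite trace_blk; have tr2 (x : C) : \tr (cplx_mx x) = 2 * complex.Re x.
  by rewrite /mxtrace !big_ord_recl big_ord0 !mxE /=; ring.
under eq_bigr do rewrite blk_realify tr2; rewrite -mulr_sumr; congr (_ * _).
by rewrite [RHS](big_morph (@complex.Re R) (id1 := 0) (op1 := +%R)) => [//|[a b] [a' b']|//].
Qed.

Let T : 'M[R]_N := 1%:M *t mx_i R.

Let TE : T = iota ((Complex 0 1 : C)%:M).
Proof.
apply: blk_inj => i j; rewrite blk_realify blk_tens !mxE; case: (i == j) => /=.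
  by rewrite scale1r mulr1n.
by rewrite scale0r mulr0n (phi0 (@cplx_mxD R)).
Qed.

(** Both determinants are 1, so their difference is 0 and its linear part at the identity, the sum
    of the diagonal blocks of g - g', is itself of higher order. *)
Lemma su_trace_strict (eta : R) : 0 < eta -> exists2 delta : R, 0 < delta &
  forall g g', su_grp g -> su_grp g' -> `|g - 1%:M| < delta -> `|g' - 1%:M| < delta ->
    `|\tr ((g - g') *m T)| <= eta * `|g - g'|.
Proof.
move=> eta0; have e2 : 0 < eta / 2 by rewrite divr_gt0.
have [delta d0 h] := @blk_det_strict R n 2 (eta / 2) e2; exists delta => // g g' [[gJ gR] dg] [[gJ' gR'] dg'] hg hg'.
have := h g g' hg hg'.
rewrite -{1}(pK gR) -{1}(pK gR') !blk_det_realify dg dg' subrr sub0r normrN => hb.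
rewrite trace_blk (eq_bigr (fun i => \tr (blk (g - g') i i *m mx_i R))); last by move=> i _; rewrite blk_sum_rho.
rewrite -linear_sum /= -mulmx_suml; set m := \sum_i _ in hb *.
have -> : eta * `|g - g'| = eta / 2 * `|g - g'| + eta / 2 * `|g - g'| by field.
apply: le_trans (lerD hb hb).
have -> : \tr (m *m mx_i R) = m 0 1 - m 1 0.
  rewrite /mxtrace !big_ord_recl big_ord0 !mxE !big_ord_recl !big_ord0 !mxE /=.
  rewrite (_ : lift ord0 ord0 = 1); last exact: val_inj.
  ring.
by apply: le_trans (ler_normB _ _) _; apply: lerD; exact: mx_entry_le.
Qed.

(** The condition det (1 + t xi) = det (1 - t xi), in complex terms, is asked for all t; it is
    stronger than trace zero and not linear in xi, so the generators form a mere set. *)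
Definition su_gens : set 'M[R]_N := [set xi | xi^T = - xi /\ forall t : R, su_cpt (cay (t *: xi))].

Let cay_psi X : (iota X)^T = - iota X -> (1%:M - X) *m psi (cay (iota X)) = 1%:M + X /\ \det (1%:M - X) != 0.
Proof.
move=> XT; have cR : commutes Rs (cay (iota X)).
  by move=> rho hr; apply: cay_comm => //; exact: iR.
have e : (1%:M - X) *m psi (cay (iota X)) = 1%:M + X.
  by apply: (can_inj iK); rewrite iM pK// !iD i1 iN mul_cay.
split => //; apply/negP => /det0P[v v0 hv].
(* All rows are v: a square matrix to which the realification applies. *)
pose V : 'M[C]_n := \matrix_(i, j) v 0 j.
have VX : V *m (1%:M - X) = 0.
  apply/row_matrixP => i; rewrite row_mul row0 (_ : row i V = v)//.
  by apply/rowP => j; rewrite !mxE.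
have : iota V *m iota (1%:M - X) = 0.
  rewrite -iM VX; apply: (addrI (iota 0)); by rewrite -iD !addr0.
rewrite iD i1 iN => /(congr1 (mulmx^~ (invmx (1%:M - iota X)))).
rewrite mulmxK ?skew_unit// mul0mx => V0.
have V0' : V = 0 by apply: (can_inj iK); rewrite V0; apply/esym; apply: (addrI (iota 0)); rewrite -iD !addr0.
case/eqP: v0; apply/rowP => j; have i0 : 'I_n by exact: (Ordinal (leq_trans (ltn_ord j) (leqnn _))).
by have /matrixP/(_ j j) := V0'; rewrite !mxE.
Qed.

(* If U conjugates X to -X then det (1 + tX) = det (1 - tX). *)
Lemma su_gens_realify X (U : 'M[C]_n) : adjoint (@conjc R) X = - X -> X *m JC = JC *m X ->
  U *m U = 1%:M -> U *m X = - (X *m U) -> su_gens (iota X).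
Proof.
move=> XT XJ UU UX; have XT' : (iota X)^T = - iota X by rewrite -iT XT iN.
split => // t; have tT : (t *: iota X)^T = - (t *: iota X) by rewrite linearZ /= XT' scalerN.
split.
  apply: unitary_cay => //.
    by move=> rho hr; rewrite -scalemxAl -scalemxAr iR.
  by rewrite -scalemxAl -scalemxAr -iJ -!iM XJ.
set Y := (t%:C)%C *: X; have tE : t *: iota X = iota Y by rewrite iZ.
rewrite /= tE; rewrite tE in tT; have [e d0] := cay_psi tT.
have UY : U *m (1%:M - Y) = (1%:M + Y) *m U.
  by rewrite mulmxBr mulmxDl mulmx1 mul1mx /Y -scalemxAr UX scalerN opprK scalemxAl.
have dU : \det U != 0.
  have := congr1 determinant UU; rewrite det_mulmx det1 => h.
  by apply: contra_eq_neq h => ->; rewrite mul0r eq_sym oner_eq0.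
have := congr1 determinant UY; rewrite !det_mulmx mulrC => /(mulIf dU) h.
by have := congr1 determinant e; rewrite det_mulmx -h => /(canRL (mulKf d0)) ->; rewrite mulVf.
Qed.

Let dm (i j k l : 'I_n) : delta_mx i j *m delta_mx k l = (if j == k then delta_mx i l else 0) :> 'M[C]_n.
Proof. by rewrite mul_delta_mx_cond; case: eqP. Qed.

Let adjE A : adjoint (@conjc R) A = - A -> forall i j, A j i = - conjc (A i j).
Proof. by move=> /matrixP h i j; have := h j i; rewrite !mxE => ->; rewrite opprK. Qed.

Let comm_diag A : A *m JC = JC *m A <-> forall i j, A i j * (row_mx (const_mx (-1)) (const_mx 1) : 'rV[C]_n) 0 j =
  (row_mx (const_mx (-1)) (const_mx 1) : 'rV[C]_n) 0 i * A i j.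
Proof.
rewrite Ipq_diag; split=> [/matrixP h i j|h].
  by have := h i j; rewrite mul_mx_diag mul_diag_mx !mxE.
by apply/matrixP => i j; rewrite mul_mx_diag mul_diag_mx !mxE; have := h i j; rewrite !mxE.
Qed.

Let trace_delta A i j : \tr (A *m delta_mx i j) = A j i.
Proof.
rewrite /mxtrace (bigD1 j)//= big1 ?addr0 => [|k kj]; rewrite mxE (bigD1 i)//= big1 ?addr0 ?mxE ?eqxx ?mulr1//.
- by move=> l li; rewrite !mxE (negPf li) mulr0.
- by rewrite (negPf kj) andbF mulr0.
- by move=> l li; rewrite !mxE (negPf li) mulr0.
Qed.

(** With z = A j k, test against X = z E_jk - conj(z) E_kj, which the sign change at j conjugates to
    -X. Then tr (A X) = -2 |z|^2. *)
Lemma su_offdiag A : adjoint (@conjc R) A = - A -> A *m JC = JC *m A ->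
  (forall xi, su_gens xi -> \tr (iota A *m xi) = 0) -> forall j k, j != k -> A j k = 0.
Proof.
move=> AT AJ h j k jk; have kj : (k == j) = false by rewrite eq_sym (negPf jk).
pose z : C := A j k; pose X : 'M[C]_n := z *: delta_mx j k - conjc z *: delta_mx k j.
pose U : 'M[C]_n := 1%:M - 2 *: delta_mx j j.
have conjB (x y : C) : conjc (x - y) = conjc x - conjc y by exact: rmorphB.
have conjM (x y : C) : conjc (x * y) = conjc x * conjc y by exact: rmorphM.
have conjn (b : bool) : conjc (b%:R : C) = b%:R by exact: conjc_nat.
have gX : su_gens (iota X).
  apply: (@su_gens_realify X U).
  - apply/matrixP => a b; rewrite !mxE conjB !conjM !conjn conjcK.
    by rewrite opprB [(b == j) && _]andbC [(b == k) && _]andbC.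
  - apply/comm_diag => a b; rewrite /X mxE [X in _ + X]mxE [X in X + _]mxE [X in _ - X]mxE [delta_mx j k a b]mxE [delta_mx k j a b]mxE.
    have hA := (comm_diag A).1 AJ; set D := row_mx _ _ in hA *.
    have h1 := hA j k; have h2 := hA k j; rewrite (adjE AT j k) -/z in h2; rewrite -/z in h1.
    case: (eqVneq a j) => [->|aj] /=; case: (eqVneq b k) => [->|bk] /=.
    + by rewrite (negPf jk) /= mulr1 mulr0 subr0.
    + by rewrite (negPf jk) /= !mulr0 subr0 mul0r mulr0.
    + by rewrite kj andbF /= !mulr0 subr0 mul0r mulr0.
    + case: (eqVneq a k) => [->|ak] /=; last by rewrite !mulr0 subr0 mul0r mulr0.
      case: (eqVneq b j) => [->|bj] /=; last by rewrite !mulr0 subr0 mul0r mulr0.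
      by rewrite mulr1 mulr0 sub0r.
  - rewrite /U !(mulmxDl, mulmxDr, mulmxN, mulNmx, mul1mx, mulmx1) -!scalemxAl -!scalemxAr dm eqxx.
    by apply/matrixP => a b; rewrite !mxE; ring.
  - have EX : delta_mx j j *m X = z *: delta_mx j k.
      by rewrite /X mulmxBr -!scalemxAr !dm eqxx (negPf jk) scaler0 subr0.
    have XE : X *m delta_mx j j = - (conjc z *: delta_mx k j).
      by rewrite /X mulmxBl -!scalemxAl !dm eqxx kj scaler0 sub0r.
    rewrite /U; move: (delta_mx j j) EX XE => E EX XE.
    rewrite (mulmxBl 1%:M) (mulmxBr X 1%:M) mul1mx mulmx1 -scalemxAl -scalemxAr EX XE /X.
    move: (conjc z) (z) (delta_mx j k) (delta_mx k j) => w y D D'.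
    by apply/matrixP => a b; rewrite !mxE; ring.
have := h _ gX; rewrite -iM trace_realify.
have -> : \tr (A *m X) = z * - conjc z - conjc z * z.
  rewrite /X (mulmxBr A) -(scalemxAr z) -(scalemxAr (conjc z)).
  by rewrite mxtraceD -scaleN1r !mxtraceZ !trace_delta (adjE AT j k) -/z mulN1r.
rewrite -[A j k]/z; move: (z) => [a b] /= e; have : a ^+ 2 + b ^+ 2 = 0 by move: e; lra.
move/eqP; rewrite paddr_eq0 ?sqr_ge0// !sqrf_eq0 => /andP[/eqP -> /eqP ->].
by [].
Qed.

(** Test against X = i (E_jj - E_kk), which the transposition of j and k conjugates to -X. The real
    part of tr (A X) is the difference of the two imaginary parts. *)
Lemma su_diag A : (forall xi, su_gens xi -> \tr (iota A *m xi) = 0) ->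
  forall j k, complex.Im (A j j) = complex.Im (A k k).
Proof.
move=> h j k; have [->//|jk] := eqVneq j k.
have kj : (k == j) = false by rewrite eq_sym (negPf jk).
pose im : C := Complex 0 1.
pose X : 'M[C]_n := im *: (delta_mx j j - delta_mx k k).
pose U : 'M[C]_n := 1%:M - delta_mx j j - delta_mx k k + delta_mx j k + delta_mx k j.
have conjB (x y : C) : conjc (x - y) = conjc x - conjc y by exact: rmorphB.
have conjM (x y : C) : conjc (x * y) = conjc x * conjc y by exact: rmorphM.
have conjn (b : bool) : conjc (b%:R : C) = b%:R by exact: conjc_nat.
have gX : su_gens (iota X).
  apply: (@su_gens_realify X U).
  - apply/matrixP => a b; rewrite !mxE conjM conjB !conjn.
    have -> : conjc im = - im by rewrite /im /=; congr Complex; rewrite oppr0.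
    by rewrite mulNr [(b == j) && _]andbC [(b == k) && _]andbC.
  - apply/comm_diag => a b; rewrite /X mxE [(delta_mx j j - _) a b]mxE [X in _ + X]mxE !(mxE delta_mx_key).
    set D := row_mx _ _; case: (eqVneq a b) => [->|ab]; first by rewrite mulrC.
    have e i : (a == i) && (b == i) = false by apply/negP => /andP[/eqP e1 /eqP e2]; rewrite e1 e2 eqxx in ab.
    by rewrite !e subrr mulr0 mul0r mulr0.
  - rewrite /U !(mulmxDl, mulmxDr, mulmxN, mulNmx, mul1mx, mulmx1) !dm ?eqxx ?(negPf jk) ?kj.
    by apply/matrixP => a b; rewrite !mxE; ring.
  - rewrite /U /X -!scalemxAl -!scalemxAr !(mulmxDl, mulmxDr, mulmxN, mulNmx, mul1mx, mulmx1) !dm ?eqxx ?(negPf jk) ?kj.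
    by apply/matrixP => a b; rewrite !mxE; ring.
have := h _ gX; rewrite -iM trace_realify.
have -> : \tr (A *m X) = im * (A j j - A k k).
  by rewrite /X -(scalemxAr im) (mulmxBr A) mxtraceZ mxtraceD -scaleN1r mxtraceZ !trace_delta mulN1r.
by case: (A j j) => a b; case: (A k k) => a' b' /=; lra.
Qed.

Let cJ : commutes Rs J. Proof. exact: commutes_tens. Qed.

Let commT : commutes Rs T.
Proof. by rewrite TE; exact: iR. Qed.

Let det_mul g h : commutes Rs g -> commutes Rs h -> \det (psi (g *m h)) = \det (psi g) * \det (psi h).
Proof. by move=> cg ch; rewrite pM// det_mulmx. Qed.

Let det_ofreal (A : 'M[R]_n) : \det (psi (A *t 1%:M)) = (\det A)%:C%C.
Proof.
rewrite -(realify_of_real (phi := @cplx_mx R) (ofr := fun a => (a%:C)%C : C)); last exact: cplx_mx_of_real.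
by rewrite iK -det_map_mx.
Qed.

Let det_tr_psi g : commutes Rs g -> \det (psi g^T) = conjc (\det (psi g)).
Proof.
move=> cg; rewrite -{1}(pK cg) -iT iK /adjoint det_tr.
exact: (det_map_mx (@conjc R)).
Qed.

(** What remains is a diagonal matrix with a common imaginary entry, and the trace condition makes
    that entry 0. *)
Lemma su_scalar A : adjoint (@conjc R) A = - A -> A *m JC = JC *m A -> complex.Im (\tr A) = 0 ->
  (forall xi, su_gens xi -> \tr (iota A *m xi) = 0) -> A = 0.
Proof.
move=> AT AJ t0 h; have dg := su_diag h; have i0 : 'I_n.
  by case/andP: pq => p0 _; exact: (Ordinal (leq_trans p0 (leq_addr q p))).
have im0 j : complex.Im (A j j) = 0.
  move: t0; rewrite /mxtrace (big_morph (@complex.Im R) (id1 := 0) (op1 := +%R)) => [|[a b] [a' b']|]//.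
  rewrite (eq_bigr (fun=> complex.Im (A j j))); last by move=> i _; exact: dg.
  rewrite sumr_const card_ord => /eqP; rewrite mulrn_eq0 => /orP[|/eqP//].
  by case/andP: pq => p0 _; rewrite addn_eq0 -[p == 0]negbK -lt0n p0.
apply/matrixP => i j; have [<-|ij] := eqVneq i j; last by rewrite (su_offdiag AT AJ h ij) mxE.
have := adjE AT i i; have := im0 i; rewrite [X in _ -> _ -> _ = X]mxE; case: (A i i) => a b /= -> [e _].
by congr Complex; lra.
Qed.

Lemma su_gens_span (Z : 'M[R]_N) : commutes Rs Z -> Z *m J = J *m Z -> Z^T = - Z -> \tr (Z *m T) = 0 ->
  (forall xi, su_gens xi -> \tr (Z *m xi) = 0) -> Z = 0.
Proof.
move=> cZ ZJ ZT t0 h; have e := pK cZ; rewrite -e.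
have -> : psi Z = 0; last by apply: (addrI (iota 0)); rewrite -iD !addr0.
apply: su_scalar.
- by apply: (can_inj iK); rewrite iT iN e ZT.
- by apply: (can_inj iK); rewrite !iM iJ e ZJ.
- move: t0; rewrite -{1}e TE -iM trace_realify mul_mx_scalar mxtraceZ.
  by case: (\tr (psi Z)) => a b /=; lra.
- by rewrite e.
Qed.

(* The diagonal matrix with a single phase in the last coordinate, which the Cartan subspace
   does not see because p < q, corrects the determinant. *)
Lemma su_phase (xi : 'M[R]_N) : commutes Rs xi -> xi *m J = J *m xi -> xi^T = - xi ->
  exists c, [/\ c^T *m c = 1%:M, c *m J = J *m c,
    forall X : 'rV[R]_p, c *m (cexp q X *t 1%:M) = (cexp q X *t 1%:M) *m c & su_cpt (c *m cay xi)].
Proof.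
move=> cxi xJ xT; have p_lt_q : (p < q)%N by case/andP: pq.
have [oc cJc cc] := unitary_cay cxi xJ xT.
pose u := \det (psi (cay xi)).
have uu : conjc u * u = 1.
  have cT := commutes_tr (@cplx_right_tr R) cc.
  by rewrite /u -(det_tr_psi cc) -(det_mul cT cc) oc p1 det1.
have l0 : (q.-1 < q)%N by case/andP: pq; lia.
pose l : 'I_n := rshift p (Ordinal l0).
pose D : 'M[C]_n := diag_mx (\row_k (if k == l then conjc u else 1)).
have DD : adjoint (@conjc R) D *m D = 1%:M.
  rewrite /adjoint /D map_diag_mx tr_diag_mx mulmx_diag -diag_const_mx; congr diag_mx.
  apply/rowP => k; rewrite !mxE; case: (k == l).
    transitivity (u * conjc u); last by rewrite mulrC.
    by congr (_ * _); exact: conjcK.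
  by rewrite mulr1; exact: conjc1.
have DJ : D *m JC = JC *m D by rewrite Ipq_diag /D; exact: diag_mxC.
have Dc (X : 'rV[R]_p) : D *m map_mx (fun a : R => (a%:C)%C : C) (cexp q X) =
    map_mx (fun a : R => (a%:C)%C : C) (cexp q X) *m D.
  have el j : cexp q X l j = (l == j)%:R.
    have pl : (p <= Ordinal l0)%N by move: p_lt_q => /=; lia.
    have /matrixP/(_ 0 j) := e'_cexp X pl; rewrite -rowE !mxE eqxx /= eq_sym => ->.
    by [].
  have er j : cexp q X j l = (l == j)%:R by rewrite -(cexp_tr q X) mxE el.
  move: (cexp q X) el er => E el er.
  apply/matrixP => i j; rewrite mul_mx_diag mul_diag_mx !mxE.
  case: (eqVneq i l) => [->|il]; case: (eqVneq j l) => [->|jl]; rewrite ?mulr1 ?mul1r//.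
  - by rewrite mulrC.
  - by rewrite el eq_sym (negPf jl) mulr0.
  - by rewrite er eq_sym (negPf il) mul0r.
have of_realE (A : 'M[R]_n) : iota (map_mx (fun a : R => (a%:C)%C : C) A) = A *t 1%:M.
  by apply: realify_of_real; exact: cplx_mx_of_real.
have cD : commutes Rs (iota D) by exact: iR.
exists (iota D); split.
- by rewrite -iT -iM DD i1.
- by rewrite -iJ -!iM DJ.
- by move=> X; rewrite -of_realE -!iM Dc.
split.
  apply: unitary_cpt_mul => //; split => //; first by rewrite -iT -iM DD i1.
  by rewrite -iJ -!iM DJ.
rewrite /= det_mul// iK -/u /D det_diag (bigD1 l)//= big1 ?mulr1 => [|k kl]; rewrite mxE ?eqxx//.
by rewrite (negPf kl).
Qed.

Lemma complex_lie_data : lie_data Rs (iota @` SUpq R p q)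
  (iota @` (block_diag C p q (@Un R p) (@Un R q) `&` [set g | \det g = 1])) T su_gens.
Proof.
have pq' : (p < q)%N by case/andP: pq.
have RsT := @cplx_right_tr R.
rewrite SUpq_image SUpq_cpt_image; split.
- by [].
- exact: cplx_irr.
- exact: RsT.
- move=> g h [Gg dg] [Gh dh]; split; first exact: unitary_mul.
  by rewrite /= det_mul ?dg ?dh ?mulr1//; [case: Gg|case: Gh].
- move=> g [Gg dg]; split; first exact: unitary_jinv.
  have [_ cg] := Gg; have cT := commutes_tr RsT cg.
  rewrite /= /jinv (det_mul (commutes_mul cJ cT) cJ) (det_mul cJ cT) (det_tr_psi cg) dg.
  by rewrite (conjc1 R) mulr1 -(det_mul cJ cJ) tens_J_sq p1 det1.
- by move=> g [[]].
- by move=> g [[]].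
- by apply: closedI; [exact: closed_unitary|exact: closed_det_psi].
- by move=> X; split; [exact: unitary_exp|rewrite /= det_ofreal cexp_det].
- by apply: closedI; [exact: closed_unitary_cpt|exact: closed_det_psi].
- by move=> k [Kk dk]; split => //; exact: unitary_cpt_sub.
- by move=> k [[]].
- by split; [exact: unitary_cpt1|rewrite /= p1 det1].
- move=> g h [Kg dg] [Kh dh]; split; first exact: unitary_cpt_mul.
  by rewrite /= det_mul ?dg ?dh ?mulr1//; [case: Kg|case: Kh].
- move=> k [Kk dk]; split; first exact: unitary_cpt_tr.
  by rewrite /= det_tr_psi ?dk ?(conjc1 R)//; case: Kk.
- rewrite TE -iT -iN; congr iota; apply/matrixP => i j; rewrite !mxE eq_sym.
  by case: (i == j); rewrite ?mulr1n ?mulr0n ?conjc0 ?oppr0//=; congr Complex; rewrite oppr0.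
- by rewrite TE -iJ -!iM scalar_mxC.
- exact: commT.
- by move=> g [[_ cg] _]; apply: cg; rewrite !inE eqxx orbT.
- exact: su_trace_strict.
- by move=> xi [].
- by move=> xi t [_ ].
- exact: su_gens_span.
- exact: su_phase.
Qed.

End ComplexPair.

Lemma complex_family_criterion (R : realType) (p q : nat) (pq : (0 < p < q)%N)
  (M := symmetric_pair R ComplexCase p q)
  (mK : probability (borel M) R) (mK_haar : is_haar (cpt M) mK)
  (mG : {measure set (borel M) -> \bar R}) (mG_haar : is_haar (grp M) mG)
  (X Y : 'rV[R]_p) (s t : seq nat) (u v : nat) :
  configuration X s u -> configuration Y t v ->
  convolution (natural mK (of_real (expmx (cartan_mx q X))))
              (natural mK (of_real (expmx (cartan_mx q Y)))) `<< mG
  <-> (max_config s (2 * u) + max_config t (2 * v) <= 2 * p)%N.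
Proof.
move=> hX hY.
apply: (@transport_criterion R p q 2 pq (cplx_right R) M (realify (@cplx_mx R)) (unrealify (@mx_cplx R))
  _ _ _ _ _ (1%:M *t mx_i R) _ (complex_lie_data R pq) mK mK_haar mG mG_haar X Y s t u v hX hY).
- by apply: continuous_realify; exact: cplx_mx_continuous.
- by apply: continuous_unrealify; exact: mx_cplx_continuous.
- by apply: realifyK; exact: cplx_mxK.
- by move=> a b; exact: (realify_mul (@cplx_mxD R) (@cplx_mxM R)).
- by move=> Z; exact: (realify_of_real _ (@cplx_mx_of_real R)).
Qed.

Theorem corollary15 (R : realType) (p q : nat) (k : symmetric_family)
  (p_ge1 : (1 <= p)%N) (p_lt_q : (p < q)%N)
  (mK : probability (borel (symmetric_pair R k p q)) R)
  (mK_haar : is_haar (cpt (symmetric_pair R k p q)) mK)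
  (mG : {measure set (borel (symmetric_pair R k p q)) -> \bar R})
  (mG_haar : is_haar (grp (symmetric_pair R k p q)) mG)
  (X Y : 'rV[R]_p) (s t : seq nat) (u v : nat)
  (X_config : configuration X s u) (Y_config : configuration Y t v) :
  convolution (natural mK (of_real (expmx (cartan_mx q X))))
              (natural mK (of_real (expmx (cartan_mx q Y)))) `<< mG
  <-> (max_config s (2 * u) + max_config t (2 * v) <= 2 * p)%N.
Proof.
have pq : (0 < p < q)%N by rewrite p_ge1.
case: k mK mK_haar mG mG_haar => mK mK_haar mG mG_haar.
- exact: (real_family_criterion pq mK_haar mG_haar X_config Y_config).
- exact: (complex_family_criterion pq mK_haar mG_haar X_config Y_config).
- exact: (quaternionic_family_criterion pq mK_haar mG_haar X_config Y_config).
Qed.
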